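(* Let $(M^3,J,\theta,f,\mu)$ be a closed three-dimensional CR Yamabe soliton with $P_0f=0$, where $P_0$ is the CR Paneitz operator of $(M,J,\theta)$. Suppose that the contact class $[\theta]$ of $\theta$ contains a contact form $\widetilde\theta$ whose CR $Q$-curvature $\widetilde Q$ vanishes identically, and that $f$ is nowhere vanishing. Then the pseudohermitian torsion of $(M,J,\theta)$ vanishes, i.e. $A_{11}=0$ on $M$.
   Context: A pseudohermitian $3$-manifold $(M^3,J,\theta)$ is a smooth $3$-manifold with a global contact form $\theta$, oriented contact structure $\xi=\ker\theta$, and a smooth endomorphism $J:\xi\to\xi$ with $J^2=-\mathrm{Id}$. The Reeb field $\mathbf{T}$ is defined by $\theta(\mathbf{T})=1$, $d\theta(\mathbf{T},\cdot)=0$. Let $T_{1,0},T_{0,1}$ be the $\pm i$-eigenbundles of $J$ on $\mathbb{C}\otimes\xi$. Take a local frame $\{\mathbf{T},Z_1,Z_{\bar1}\}$ with $Z_1\in T_{1,0}$, $Z_{\bar1}=\overline{Z_1}$, dual coframe $\{\theta,\theta^1,\theta^{\bar1}\}$, normalized so that $d\theta=i\theta^1\wedge\theta^{\bar1}$. There is a unique purely imaginary $1$-form $\theta_1{}^1$ with $d\theta^1=\theta^1\wedge\theta_1{}^1+\theta\wedge A^1{}_{\bar1}\theta^{\bar1}$; the pseudohermitian torsion components are $A_{\bar1\bar1}=A^1{}_{\bar1}$ and $A_{11}=\overline{A_{\bar1\bar1}}$. The pseudohermitian connection is given by $\nabla Z_1=\theta_1{}^1\otimes Z_1$, $\nabla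 Z_{\bar1}=\overline{\theta_1{}^1}\otimes Z_{\bar1}$, $\nabla\mathbf{T}=0$. The Tanaka-Webster scalar curvature $W$ is the real function defined by $d\theta_1{}^1=W\theta^1\wedge\theta^{\bar1}+2i\,\mathrm{Im}(A_{11,\bar1}\theta^1\wedge\theta)$. Indices $0,1,\bar1$ on functions and tensor components denote covariant derivatives along $\mathbf{T},Z_1,Z_{\bar1}$ (e.g. $f_0=\mathbf{T}f$, $f_1=Z_1f$, $f_{11}=Z_1Z_1f-\theta_1{}^1(Z_1)Z_1f$); the sub-Laplacian is $\Delta_b\varphi=\varphi_{1\bar1}+\varphi_{\bar11}$. A CR Yamabe soliton $(M^3,J,\theta,f,\mu)$ is a pseudohermitian $3$-manifold with a smooth real function $f$ and a constant $\mu\in\mathbb{R}$ such that $W+\frac12 f_0=\mu$ and $f_{11}+iA_{11}f=0$. It is closed if $M$ is compact without boundary. CR Paneitz operator: put $P_1\varphi=\varphi_{\bar111}+iA_{11}\varphi_{\bar1}$ (that is, $\varphi_{\bar1}{}^{\bar1}{}_1+iA_{11}\varphi^1$ in the normalized frame); for real $\varphi$, $P_0\varphi=(P_1\varphi)_{,\bar1}+\overline{(P_1\varphi)_{,\bar1}}$. CR $Q$-curvature: put $R_1=W_1-iA_{11,\bar1}$; then $Q=-cR_{1,\bar1}=-\frac c2(\Delta_bW+2\,\mathrm{Im}\,A_{11,\bar1\bar1})$ for a fixed nonzero constant $c$. The contact class $[\theta]$ is the set of contact forms $e^{2g}\theta$, $g$ a smooth real function on $M$; $\widetilde Q$ denotes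 the CR $Q$-curvature computed for $(M,J,\widetilde\theta)$. *)

(* Defs.v *)
From HB Require Import structures.
From mathcomp Require Import all_boot all_order all_algebra.
From mathcomp Require Import all_classical all_reals all_analysis.
From mathcomp Require Import complex.

Set Implicit Arguments.
Unset Strict Implicit.
Unset Printing Implicit Defensive.
Import Order.TTheory GRing.Theory Num.Theory.
Import numFieldNormedType.Exports.
Local Open Scope classical_set_scope.
Local Open Scope ring_scope.
Local Open Scope complex_scope.

(** * Smooth 3-manifolds *)

(* For an open set W this is the usual C^k: all iterated partial derivatives up
   to order k exist and are continuous on W. *)
Fixpoint Ck_on (R : realType) (k : nat) (W : set 'rV[R]_3) (h : 'rV[R]_3 -> R)
    : Prop :=
  (forall x, W x -> {for x, continuous h}) /\
  if k is k'.+1 then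
    forall i : 'I_3,
      (forall x, W x -> derivable h x (delta_mx ord0 i)) /\
      Ck_on k' W (fun x => 'D_(delta_mx ord0 i) h x)
  else True.

Definition Cinf_on (R : realType) (W : set 'rV[R]_3) (h : 'rV[R]_3 -> R) :=
  forall k, Ck_on k W h.

Record chart (R : realType) (M : topologicalType) := Chart {
  chart_dom : set M;
  chart_map : M -> 'rV[R]_3;
  chart_inv : 'rV[R]_3 -> M;
  chart_dom_open : open chart_dom;
  chart_img_open : open (chart_map @` chart_dom);
  chart_mapK : {in chart_dom, cancel chart_map chart_inv};
  chart_map_cont : {in chart_dom, continuous chart_map};
  chart_inv_cont : {in chart_map @` chart_dom, continuous chart_inv} }.

(* Charts take values in open subsets of R^3, so there is no boundary. *)
Record manifold3 (R : realType) := Manifold3 {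
  mpoint :> topologicalType;
  atlas : set (chart R mpoint);
  mhausdorff : hausdorff_space mpoint;
  msecond_countable : @second_countable mpoint;
  atlas_cover : forall p : mpoint, exists2 c, atlas c & chart_dom c p;
  atlas_compat : forall c d, atlas c -> atlas d -> forall j : 'I_3,
    Cinf_on (chart_map c @` (chart_dom c `&` chart_dom d))
            (fun x => chart_map d (chart_inv c x) ord0 j) }.

Section Geometry.
Variables (R : realType) (M : manifold3 R).
Local Notation C := R[i].

(* Meaningful for open U. *)
Definition smooth_on (U : set M) (f : M -> R) :=
  forall c, atlas c ->
    Cinf_on (chart_map c @` (chart_dom c `&` U)) (f \o chart_inv c).

Definition csmooth_on (U : set M) (f : M -> C) :=
  smooth_on U (fun p => complex.Re (f p)) /\
  smooth_on U (fun p => complex.Im (f p)).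

Definition csmooth_near (p : M) (f : M -> C) :=
  exists U : set M, [/\ open U, U p & csmooth_on U f].

Definition cfun_of (f : M -> R) : M -> C := fun p => (f p)%:C.

(** * Complexified tangent vectors, vector fields and forms *)

(* An element of C (x) T_p M is a C-linear derivation at p of the complex-valued
   functions that are smooth near p.  Locality follows from the Leibniz rule:
   if f = 0 near p then f = f * k for some k vanishing near p.  The value on
   the other functions is fixed to 0, so that equality of vectors is equality
   of functions. *)
Definition cvector := (M -> C) -> C.

Definition is_tangent (p : M) (v : cvector) :=
  [/\ forall (a : C) f g, csmooth_near p f -> csmooth_near p g ->
        v (fun q => a * f q + g q) = a * v f + v g,
      forall f g, csmooth_near p f -> csmooth_near p g ->
        v (fun q => f q * g q) = v f * g p + f p * v g
    & forall f, ~ csmooth_near p f -> v f = 0].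

Definition lincombv (a : C) (v w : cvector) : cvector := fun f => a * v f + w f.

Definition scalev (a : C) (v : cvector) : cvector := fun f => a * v f.

Definition conjv (v : cvector) : cvector := fun f => (v (fun q => (f q)^*))^*.

Definition vfield := M -> cvector.

Definition conjvf (X : vfield) : vfield := fun p => conjv (X p).

Definition vderiv (X : vfield) (f : M -> C) : M -> C := fun p => X p f.

Definition smooth_vfield (U : set M) (X : vfield) :=
  (forall p, U p -> is_tangent p (X p)) /\
  forall V f, open V -> V `<=` U -> csmooth_on V f -> csmooth_on V (vderiv X f).

Definition real_vfield (U : set M) (X : vfield) :=
  forall p, U p -> conjv (X p) = X p.

(* The test gives the bracket the value 0 on functions that are not smooth
   near p, as required by [is_tangent]. *)
Definition bracket (X Y : vfield) : vfield := fun p f =>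
  if `[< csmooth_near p f >]
  then X p (vderiv Y f) - Y p (vderiv X f) else 0.

Definition form1 := M -> cvector -> C.

Definition form2 := M -> cvector -> cvector -> C.

Definition contract (al : form1) (X : vfield) : M -> C := fun p => al p (X p).

Definition smooth_form1 (U : set M) (al : form1) :=
  (forall p, U p -> forall a v w, is_tangent p v -> is_tangent p w ->
     al p (lincombv a v w) = a * al p v + al p w) /\
  forall V X, open V -> V `<=` U -> smooth_vfield V X -> csmooth_on V (contract al X).

Definition conj1 (al : form1) : form1 := fun p v => (al p (conjv v))^*.

Definition conj2 (be : form2) : form2 :=
  fun p v w => (be p (conjv v) (conjv w))^*.

Definition real_form1 (U : set M) (al : form1) :=
  forall p v, U p -> is_tangent p v -> conj1 al p v = al p v.

Definition imaginary_form1 (U : set M) (al : form1) :=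
  forall p v, U p -> is_tangent p v -> conj1 al p v = - al p v.

Definition wedge (al be : form1) : form2 :=
  fun p v w => al p v * be p w - al p w * be p v.

(* 2i Im(be) is be minus its conjugate. *)
Definition two_i_im (be : form2) : form2 :=
  fun p v w => be p v w - conj2 be p v w.

(* The value of d al on the vector fields X, Y. *)
Definition extd (al : form1) (X Y : vfield) : M -> C := fun p =>
  vderiv X (contract al Y) p - vderiv Y (contract al X) p - contract al (bracket X Y) p.

Definition extd_eq (U : set M) (al : form1) (be : form2) :=
  forall V X Y, open V -> V `<=` U -> smooth_vfield V X -> smooth_vfield V Y ->
    forall p, V p -> extd al X Y p = be p (X p) (Y p).

(** * Pseudohermitian structures *)

Definition wedge_extd (th : form1) (X Y Z : vfield) : M -> C := fun p =>
  th p (X p) * extd th Y Z p + th p (Y p) * extd th Z X p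
  + th p (Z p) * extd th X Y p.

Definition contact_form (th : form1) :=
  [/\ smooth_form1 setT th, real_form1 setT th
    & forall p, exists U X Y Z,
        [/\ open U, U p,
            [/\ smooth_vfield U X, smooth_vfield U Y & smooth_vfield U Z]
          & wedge_extd th X Y Z p != 0]].

(* The complexification of ker th at p. *)
Definition horizontal (th : form1) (p : M) (v : cvector) :=
  is_tangent p v /\ th p v = 0.

(* A bundle endomorphism of ker th is represented by its C-linear extension,
   i.e. by an endomorphism of the complexification that commutes with
   conjugation.  Values of J off ker th are irrelevant. *)
Definition bundle_endo := M -> cvector -> cvector.

Definition almost_complex (th : form1) (J : bundle_endo) :=
  [/\ forall p v, horizontal th p v -> horizontal th p (J p v),
      forall p a v w, horizontal th p v -> horizontal th p w ->
        J p (lincombv a v w) = lincombv a (J p v) (J p w),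
      forall p v, horizontal th p v -> J p (conjv v) = conjv (J p v),
      forall p v, horizontal th p v -> J p (J p v) = scalev (-1) v
    & forall U X, open U -> smooth_vfield U X ->
        (forall p, U p -> th p (X p) = 0) -> smooth_vfield U (fun p => J p (X p))].

(* J induces on ker th the orientation given by d th.  This is what makes the
   normalization d th = i th^1 /\ conj th^1 possible; for the opposite
   orientation the sign would be reversed. *)
Definition oriented (th : form1) (J : bundle_endo) :=
  forall U X, open U -> smooth_vfield U X -> real_vfield U X ->
    (forall p, U p -> th p (X p) = 0) ->
    forall p, U p -> X p <> (fun=> 0) ->
      0 < extd th X (fun q => J q (X q)) p.

Definition pseudohermitian (th : form1) (J : bundle_endo) :=
  [/\ contact_form th, almost_complex th J & oriented th J].

Definition reeb_on (U : set M) (th : form1) (T : vfield) :=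
  [/\ smooth_vfield U T, real_vfield U T,
      forall p, U p -> th p (T p) = 1
    & forall V X, open V -> V `<=` U -> smooth_vfield V X ->
        forall p, V p -> extd th T X p = 0].

(* The derivative along X of the component with a lower indices 1 and b lower
   indices \bar 1 of a tensor; om is the connection form th_1^1. *)
Definition covderiv (om : form1) (X : vfield) (a b : nat) (s : M -> C) : M -> C :=
  fun p => vderiv X s p - (om p (X p) *+ a + conj1 om p (X p) *+ b) * s p.

(* A normalized local frame on U, together with the connection form, torsion
   and curvature that it determines through the structure equations. *)
Record local_frame (th : form1) (J : bundle_endo) (U : set M) := LocalFrame {
  fr_open : open U;
  fr_T : vfield;
  fr_Z1 : vfield;
  fr_th1 : form1;
  fr_om : form1;
  (* A^1_{\bar 1} = A_{\bar 1 \bar 1} *)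
  fr_tors : M -> C;
  fr_W : M -> R;
  fr_reeb : reeb_on U th fr_T;
  fr_Z1_smooth : smooth_vfield U fr_Z1;
  fr_Z1_horizontal : forall p, U p -> th p (fr_Z1 p) = 0;
  fr_Z1_type10 : forall p, U p -> J p (fr_Z1 p) = scalev 'i (fr_Z1 p);
  fr_th1_smooth : smooth_form1 U fr_th1;
  fr_th1_dual : forall p, U p ->
    [/\ fr_th1 p (fr_T p) = 0, fr_th1 p (fr_Z1 p) = 1
      & fr_th1 p (conjvf fr_Z1 p) = 0];
  fr_normalized :
    extd_eq U th (fun p v w => 'i * wedge fr_th1 (conj1 fr_th1) p v w);
  fr_om_smooth : smooth_form1 U fr_om;
  fr_om_imaginary : imaginary_form1 U fr_om;
  fr_structure : extd_eq U fr_th1 (fun p v w =>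
    wedge fr_th1 fr_om p v w + fr_tors p * wedge th (conj1 fr_th1) p v w);
  (* d th_1^1 = W th^1 /\ conj th^1 + 2i Im(A_{11,\bar 1} th^1 /\ th) *)
  fr_curvature : extd_eq U fr_om (fun p v w =>
    (fr_W p)%:C * wedge fr_th1 (conj1 fr_th1) p v w
    + two_i_im (fun q v' w' =>
        covderiv fr_om (conjvf fr_Z1) 2 0 (fun q' => (fr_tors q')^*) q
        * wedge fr_th1 th q v' w') p v w) }.

Section Frame.
Variables (th : form1) (J : bundle_endo) (U : set M) (F : local_frame th J U).
Local Notation Z1 := (fr_Z1 F).
Local Notation Zb1 := (conjvf (fr_Z1 F)).
Local Notation nabla := (covderiv (fr_om F)).

Definition A11 : M -> C := fun p => (fr_tors F p)^*.

(* A_{11, \bar 1} *)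
Definition A11_b : M -> C := nabla Zb1 2 0 A11.

(* phi_0 *)
Definition d_0 (phi : M -> C) : M -> C := vderiv (fr_T F) phi.

(* phi_{11} *)
Definition d_11 (phi : M -> C) : M -> C := nabla Z1 1 0 (vderiv Z1 phi).

(* phi_{\bar 1 1 1} *)
Definition d_b11 (phi : M -> C) : M -> C :=
  nabla Z1 1 1 (nabla Z1 0 1 (vderiv Zb1 phi)).

Definition P1 (phi : M -> C) : M -> C :=
  fun p => d_b11 phi p + 'i * A11 p * vderiv Zb1 phi p.

Definition P0 (phi : M -> R) : M -> C :=
  let D := nabla Zb1 1 0 (P1 (cfun_of phi)) in fun p => D p + (D p)^*.

Definition R1 : M -> C :=
  fun p => vderiv Z1 (cfun_of (fr_W F)) p - 'i * A11_b p.

Definition Qcurv (c : R) : M -> C := fun p => - c%:C * nabla Zb1 1 0 R1 p.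

End Frame.

(* The equations below do not depend on the choice of local frame, and every
   point lies in the domain of one; they are required in all local frames. *)

Definition cr_yamabe_soliton (th : form1) (J : bundle_endo) (f : M -> R) (mu : R) :=
  [/\ pseudohermitian th J, smooth_on setT f
    & forall U (F : local_frame th J U) p, U p ->
        (fr_W F p)%:C + 2%:R^-1 * d_0 F (cfun_of f) p = mu%:C /\
        d_11 F (cfun_of f) p + 'i * A11 F p * (f p)%:C = 0].

Definition paneitz_null (th : form1) (J : bundle_endo) (phi : M -> R) :=
  forall U (F : local_frame th J U) p, U p -> P0 F phi p = 0.

Definition Qcurv_vanishes (c : R) (th : form1) (J : bundle_endo) :=
  forall U (F : local_frame th J U) p, U p -> Qcurv F c p = 0.

Definition torsion_vanishes (th : form1) (J : bundle_endo) :=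
  forall U (F : local_frame th J U) p, U p -> A11 F p = 0.

(* th' belongs to the contact class of th *)
Definition in_contact_class (th th' : form1) :=
  exists2 g : M -> R, smooth_on setT g &
    th' = fun p v => (expR (2 * g p))%:C * th p v.

End Geometry.

(* Main.v *)
Require Import Defs.
From HB Require Import structures.
From mathcomp Require Import all_boot all_order all_algebra fingroup perm.
From mathcomp Require Import all_classical all_reals all_analysis.
From mathcomp Require Import complex ring lra zify.
Set Implicit Arguments.
Unset Strict Implicit.
Unset Printing Implicit Defensive.
Import Order.TTheory GRing.Theory Num.Theory.
Import numFieldNormedType.Exports.
Local Open Scope classical_set_scope.
Local Open Scope ring_scope.
Local Open Scope complex_scope.
Local Notation contract := Defs.contract.
Local Notation "x ^c" := (conjc x) (at level 1, format "x ^c") : ring_scope.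


(** A closed soliton is treated with two integrations over the manifold.

    Let [f_0] be the derivative of [f] along the Reeb field. Differentiating
    [f_11 + i A_11 f = 0], commuting derivatives and using the contracted Bianchi
    identity gives an evolution equation for the scalar curvature
    ([soliton_evolution]); together with [W + f_0 / 2 = mu] it says that [f_0 ^ 2] is
    the divergence of a vector field ([soliton_divergence]). Hence [f_0 = 0] on a
    closed manifold, and [W = mu] ([soliton_constant_curvature]).

    Let [e^(2g) theta] have vanishing Q-curvature. In a conformal change [R_1]
    becomes [e^(-3g) (R_1 - 6 P_1 g)] ([conf_R1]), so the divergence of [R_1] is [6]
    times the divergence of [P_1 g]. Multiply by [f] and integrate by parts. As [W]
    is constant, the soliton equation turns the first divergence into [|A_11|^2 f]
    ([curvature_pairing]). The operator [P_0] is formally self-adjoint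
    ([paneitz_symmetric]) and [P_0 f = 0], so the real part of the second one
    disappears. Thus [|A_11|^2 f] is a divergence ([torsion_divergence]); as [f] has
    no zeros, its sign is locally constant, [|A_11|^2 |f|] is a divergence as well,
    and it vanishes.

    The local identities are proved in the ring of smooth functions on an open
    set, on which the frame fields act as derivations. The commutators of the frame
    and the components of the structure equations ([frame_eqs]) turn every
    statement about tensors into a ring identity. That they hold in every frame, that
    frames exist, and how they change with the frame and with the contact form
    follows from the brackets of the frame fields.

    Integration enters through one fact: a nonnegative function that is the
    divergence of a vector field on a closed manifold is zero ([nonneg_div_eq0]).
    Integrals are replaced by sums over finer and finer grids in space. Sums of a partial derivative telescope, hence
    tend to zero ([S_der]), and the sums of a nonzero nonnegative continuous function
    do not ([S_pos]). On a manifold the sums depend on charts, and one has to know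
    that a change of charts alters them by a null sequence ([chart_change]). The
    argument is that of P. Lax: if two maps agree outside a compact set then
    [k (psi x) Jac psi x] and [k (phi x) Jac phi x] differ by a divergence
    ([lax]). A transition map, cut off near a point, is deformed first to its
    derivative and then, through an LU decomposition, to a signed permutation of the
    coordinates, which preserves the grids ([local_change]). *)

(** * Calculus of smooth functions on open subsets of R^3 *)

Definition i0 : 'I_3 := @Ordinal 3 0 isT.
Definition i1 : 'I_3 := @Ordinal 3 1 isT.
Definition i2 : 'I_3 := @Ordinal 3 2 isT.

Lemma ord3P (i : 'I_3) : [\/ i = i0, i = i1 | i = i2].
Proof.
case: i => -[|[|[|//]]] ?; [constructor 1|constructor 2|constructor 3]; exact/val_inj.
Qed.

Lemma sum3 (G : nmodType) (F : 'I_3 -> G) : \sum_i F i = F i0 + F i1 + F i2.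
Proof.
rewrite !big_ord_recr/= big_ord0 add0r.
by congr (F _ + F _ + F _); exact/val_inj.
Qed.

Definition bvec (R : realType) (i : 'I_3) : 'rV[R]_3 := delta_mx ord0 i.

(* Locked, so that partial derivatives are compared through the rules of calculus
   and not as limits of difference quotients. *)
HB.lock Definition pder (R : realType) (i : 'I_3) (h : 'rV[R]_3 -> R) : 'rV[R]_3 -> R :=
  fun x => 'D_(bvec R i) h x.

Lemma pderE (R : realType) (h : 'rV[R]_3 -> R) i x : pder i h x = 'D_(bvec R i) h x.
Proof. by rewrite pder.unlock. Qed.

Section Calculus.
Variable R : realType.
Local Notation V := 'rV[R]_3.
Implicit Types (h : V -> R) (W : set V) (x y v : V).

Lemma rV_expand v : v = \sum_i v ord0 i *: bvec R i.
Proof. exact: row_sum_delta. Qed.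

Lemma comb3E (a b c : R) i : (a *: bvec R i0 + b *: bvec R i1 + c *: bvec R i2) ord0 i =
  if i == i0 then a else if i == i1 then b else c.
Proof.
rewrite !mxE; case: (ord3P i) => ->; rewrite !eqE /= ?(mulr1, mulr0, addr0, add0r) //.
Qed.

Lemma norm_bvec i : `|bvec R i| = 1.
Proof.
rewrite /Num.Def.normr/= mx_normrE /bvec; apply/eqP; rewrite eq_le; apply/andP; split.
  apply/bigmax_leP; split => // -[a b] _ /=; rewrite !mxE.
  by case: eqP => _ /=; [case: eqP => _ /=|]; rewrite ?normr1 ?normr0.
have := le_bigmax (0 : R) (fun k : 'I_1 * 'I_3 => `|bvec R i k.1 k.2|) (ord0, i).
by rewrite /bvec !mxE !eqxx /= normr1.
Qed.

Lemma coord_le_norm v i : `|v ord0 i| <= `|v|.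
Proof.
rewrite [leRHS]/Num.Def.normr/= mx_normrE.
exact: (le_bigmax (0 : R) (fun k : 'I_1 * 'I_3 => `|v k.1 k.2|) (ord0, i)).
Qed.

Lemma normrV_le v (r : R) : 0 <= r -> (forall i, `|v ord0 i| <= r) -> `|v| <= r.
Proof.
move=> r0 hv; rewrite [leLHS]/Num.Def.normr/= mx_normrE.
by apply/bigmax_leP; split => // -[a b] _; rewrite (ord1 a).
Qed.

Lemma is_derive_line h y v (t : R) :
  derivable h (y + t *: v) v ->
  is_derive t (1:R) (fun s : R => h (y + s *: v)) ('D_v h (y + t *: v)).
Proof.
move=> hd; have E : (fun s : R => s^-1 *: (((fun s : R => h (y + s *: v)) \o shift t) (s *: (1:R)) - h (y + t *: v)))
   = (fun s : R => s^-1 *: ((h \o shift (y + t *: v)) (s *: v) - h (y + t *: v))).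
  apply/funext => s; congr (_ *: (h _ - _)) => /=.
  by rewrite [s *: 1]mulr1 scalerDl addrCA.
by split; rewrite /derivable /derive E.
Qed.

Lemma line_MVT h y v (s : R) :
  (forall t : R, `|t| <= `|s| -> derivable h (y + t *: v) v) ->
  exists2 t : R, `|t| <= `|s| & h (y + s *: v) - h y = s * 'D_v h (y + t *: v).
Proof.
move=> hd; pose g (t : R) := h (y + t *: v).
have dg (t : R) : `|t| <= `|s| -> is_derive t (1 : R) g ('D_v h (y + t *: v)).
  by move=> /hd; exact: is_derive_line.
have cg (a b : R) : (forall t, t \in `[a, b] -> `|t| <= `|s|) ->
    {within `[a, b], continuous g}.
  move=> hab; apply: derivable_within_continuous => t /hab ht.
  exact: (@ex_derive _ _ _ _ _ _ _ (dg t ht)).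
have g0 : g 0 = h y by rewrite /g scale0r addr0.
have [s0|s0] := leP 0 s.
  have hin t : t \in `[0, s] -> `|t| <= `|s|.
    by rewrite in_itv/= => /andP[t0 ts]; rewrite !ger0_norm.
  have [|t ts E] := @MVT_segment _ g (fun t => 'D_v h (y + t *: v)) 0 s s0 _ (cg _ _ hin).
    by move=> t /subset_itv_oo_cc/hin/dg.
  exists t; first exact: hin.
  by move: E; rewrite g0 subr0 mulrC.
have hin t : t \in `[s, 0] -> `|t| <= `|s|.
  by rewrite in_itv/= => /andP[st t0]; rewrite !ler0_norm ?lerN2// ltW.
have [|t ts E] := @MVT_segment _ g (fun t => 'D_v h (y + t *: v)) s 0 (ltW s0) _ (cg _ _ hin).
  by move=> t /subset_itv_oo_cc/hin/dg.
exists t; first exact: hin.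
by apply/eqP; rewrite -eqr_opp opprB -g0 E sub0r mulrN mulrC.
Qed.

Lemma Ck_cont k W h x : Ck_on k W h -> W x -> {for x, continuous h}.
Proof. by case: k => [|k] [c _] /c. Qed.

Lemma Ck_onS k W h : Ck_on k.+1 W h <-> (forall x, W x -> {for x, continuous h}) /\
  forall i, (forall x, W x -> derivable h x (bvec R i)) /\ Ck_on k W (pder i h).
Proof. by rewrite pder.unlock. Qed.

Lemma Ck_der k W h i x : Ck_on k.+1 W h -> W x -> derivable h x (bvec R i).
Proof. by move=> [_ /(_ i) [d _]] /d. Qed.

Lemma Ck_pder k W h i : Ck_on k.+1 W h -> Ck_on k W (pder i h).
Proof. by rewrite pder.unlock; move=> [_ /(_ i) []]. Qed.

Lemma Ck_pred k W h : Ck_on k.+1 W h -> Ck_on k W h.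
Proof.
elim: k h => [|k IH] h [c d]; split=> // i; have [d1 d2] := d i.
by split=> //; apply: IH.
Qed.

Lemma Ck_le k l W h : (l <= k)%N -> Ck_on k W h -> Ck_on l W h.
Proof.
move=> /subnKC <-; elim: (k - l)%N => [|n IH]; first by rewrite addn0.
by rewrite addnS => /Ck_pred.
Qed.

Lemma Ck_sub k W W' h : W' `<=` W -> Ck_on k W h -> Ck_on k W' h.
Proof.
move=> s; elim: k h => [|k IH] h [c d]; (split=> [x /s/c//|]) => // i.
by have [d1 d2] := d i; split=> [x /s/d1//|]; apply: IH.
Qed.

Lemma near_open (T : topologicalType) (W : set T) (x : T) (P : T -> Prop) :
  open W -> W x -> (forall y : T, W y -> P y) -> \forall y \near x, P y.
Proof. by move=> oW Wx WP; apply: filterS WP _; exact: open_nbhs_nbhs. Qed.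

Lemma Ck_eq k W h h' : open W -> (forall x, W x -> h x = h' x) ->
  Ck_on k W h -> Ck_on k W h'.
Proof.
move=> oW; elim: k h h' => [|k IH] h h' E [c d].
  split=> // x Wx; have n : {near x, h =1 h'} by apply: near_open Wx _.
  rewrite /prop_for /continuous_at -(E x Wx); apply: cvg_trans (c x Wx).
  by exact: (near_eq_cvg n).
split=> [x Wx|i].
  have n : {near x, h =1 h'} by apply: near_open Wx _.
  rewrite /prop_for /continuous_at -(E x Wx); apply: cvg_trans (c x Wx).
  by exact: (near_eq_cvg n).
have [d1 d2] := d i; split=> [x Wx|].
  by apply: near_eq_derivable (d1 x Wx); apply: near_open Wx _.
apply: IH d2 => x Wx.
by apply: near_eq_derive; apply: near_open Wx _.
Unshelve. all: end_near. Qed.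

Lemma Ck_local k W h :
  (forall x, W x -> exists2 B : set V, open B /\ B x & Ck_on k B h) -> Ck_on k W h.
Proof.
elim: k h => [|k IH] h H.
  by split=> // x /H[B [_ Ox] /Ck_cont]; apply.
apply/Ck_onS; split; first by move=> x /H[B [_ Ox] /Ck_cont]; apply.
move=> i; split=> [x /H[B [_ Ox] hO]|]; first exact: Ck_der hO Ox.
apply: IH => x /H[B oO hO]; exists B => //; exact: (Ck_pder i hO).
Qed.

Lemma pder_cst (c : R) i : pder i (fun=> c) = fun=> 0.
Proof. by apply/funext => x; rewrite pderE derive_cst. Qed.

Lemma Ck_cst k W (c : R) : Ck_on k W (fun=> c).
Proof.
elim: k c => [|k IH] c; split; try (by move=> x _; exact: cst_continuous); first by [].
move=> i; split=> [x _|]; first exact: derivable_cst.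
by have := pder_cst c i; rewrite pder.unlock => ->.
Qed.

Lemma pderM h g i x : derivable h x (bvec R i) -> derivable g x (bvec R i) ->
  pder i (fun x => h x * g x) x = h x * pder i g x + g x * pder i h x.
Proof. by move=> hd gd; rewrite !pderE; exact: deriveM. Qed.

Lemma pderD h g i x : derivable h x (bvec R i) -> derivable g x (bvec R i) ->
  pder i (fun x => h x + g x) x = pder i h x + pder i g x.
Proof. by move=> hd gd; rewrite !pderE; exact: deriveD. Qed.

Lemma Ck_add k W h g : open W ->
  Ck_on k W h -> Ck_on k W g -> Ck_on k W (fun x => h x + g x).
Proof.
move=> oW; elim: k h g => [|k IH] h g Hh Hg.
  by split=> // x Wx; exact: (continuousD (Ck_cont Hh Wx) (Ck_cont Hg Wx)).
apply/Ck_onS; split=> [x Wx|i].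
  exact: (continuousD (Ck_cont Hh Wx) (Ck_cont Hg Wx)).
split=> [x Wx|]; first by apply: derivableD; [exact: Ck_der Hh Wx|exact: Ck_der Hg Wx].
apply: (@Ck_eq _ _ (fun x => pder i h x + pder i g x)) => //.
  by move=> x Wx; rewrite pderD//; [exact: Ck_der Hh Wx|exact: Ck_der Hg Wx].
by apply: IH; exact: Ck_pder.
Qed.

Lemma Ck_mul k W h g : open W ->
  Ck_on k W h -> Ck_on k W g -> Ck_on k W (fun x => h x * g x).
Proof.
move=> oW; elim: k h g => [|k IH] h g Hh Hg.
  by split=> // x Wx; exact: (continuousM (Ck_cont Hh Wx) (Ck_cont Hg Wx)).
apply/Ck_onS; split=> [x Wx|i].
  exact: (continuousM (Ck_cont Hh Wx) (Ck_cont Hg Wx)).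
split=> [x Wx|]; first by apply: derivableM; [exact: Ck_der Hh Wx|exact: Ck_der Hg Wx].
apply: (@Ck_eq _ _ (fun x => h x * pder i g x + g x * pder i h x)) => //.
  by move=> x Wx; rewrite pderM//; [exact: Ck_der Hh Wx|exact: Ck_der Hg Wx].
by apply: Ck_add => //; apply: IH; (exact: Ck_pred || exact: Ck_pder).
Qed.

Lemma derivable_coord (i : 'I_3) x v : is_derive x v (fun y : V => y ord0 i) (v ord0 i).
Proof.
have E : (fun h : R => h^-1 *: (((fun y : V => y ord0 i) \o shift x) (h *: v) - x ord0 i)) @ 0^'
   --> (v ord0 i : R).
  apply/cvgrPdist_le => e e0; near=> h.
  rewrite /= !mxE addrK [_ *: (_ * _)]mulKf ?subrr ?normr0 ?ltW//.
  by near: h; exact: nbhs_dnbhs_neq.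
by split; [apply/cvg_ex; exists (v ord0 i)|exact/cvg_lim].
Unshelve. all: end_near. Qed.

Lemma pder_coord i j : pder i (fun y => y ord0 j) = fun=> (i == j)%:R.
Proof.
apply/funext => x; rewrite pderE; have d := derivable_coord j x (bvec R i).
by rewrite derive_val /bvec mxE eqxx /= eq_sym.
Qed.

Lemma Ck_coord k W i : Ck_on k W (fun x : V => x ord0 i).
Proof.
case: k => [|k]; split => //; try by move=> x _; exact: coord_continuous.
move=> j; split=> [x _|].
  have d := derivable_coord i x (bvec R j); exact: ex_derive.
by have := pder_coord j i; rewrite pder.unlock => ->; exact: Ck_cst.
Qed.

Lemma Ck_sum k W (I : Type) (r : seq I) (F : I -> V -> R) : open W ->
  (forall i, Ck_on k W (F i)) -> Ck_on k W (fun x => \sum_(i <- r) F i x).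
Proof.
move=> oW HF; elim: r => [|i r IH].
  by apply: (@Ck_eq _ _ (fun=> 0)) (Ck_cst _ _ _) => // x _; rewrite big_nil.
apply: (@Ck_eq _ _ (fun x => F i x + \sum_(j <- r) F j x)).
- by [].
- by move=> x _; rewrite big_cons.
- exact: Ck_add.
Qed.

Lemma Ck_opp k W h : open W -> Ck_on k W h -> Ck_on k W (fun x => - h x).
Proof.
move=> oW Hh; apply: (@Ck_eq _ _ (fun x => -1 * h x)) => //.
  by move=> x _; rewrite mulN1r.
exact: Ck_mul (Ck_cst _ _ _) Hh.
Qed.

(** ** Differentiability and the chain rule *)

Definition lin3 (c : 'I_3 -> R) (v : V) : R := \sum_i v ord0 i * c i.

Lemma lin3_is_linear c : linear (lin3 c).
Proof.
move=> a u v; rewrite /lin3 scaler_sumr -big_split /=; apply: eq_bigr => i _.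
by rewrite !mxE mulrDl -mulrA.
Qed.
HB.instance Definition _ c := GRing.isLinear.Build R V R _ (lin3 c) (lin3_is_linear c).

Lemma lin3_continuous c : continuous (lin3 c).
Proof.
move=> x; apply: (@Ck_cont 0 setT) => //; apply: Ck_sum => [|i]; first exact: openT.
by apply: Ck_mul; [exact: openT|exact: Ck_coord|exact: Ck_cst].
Qed.

(** Move from [x] to [x + v] one coordinate at a time; on each of the three
    segments the mean value theorem turns the increment into a partial
    derivative taken near [x]. *)
Lemma C1_differentiable W h x : open W -> W x -> Ck_on 1 W h ->
  differentiable h x /\ ('d h x : V -> R) = lin3 (fun i => pder i h x).
Proof.
move=> oW Wx H; set L := lin3 _.
suff E : h \o shift x = cst (h x) + (L : V -> R) +o_ (0 : V) id.
  have dE : ('d h x : V -> R) = L.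
    by apply: diff_unique E; exact: lin3_continuous.
  split=> //; apply/diff_locallyP; rewrite dE; split=> //; exact: lin3_continuous.
apply/eqaddoP => _/posnumP[eps].
have e3 : 0 < eps%:num / 3 by rewrite divr_gt0.
have [r r0 rW] : exists2 r : R, 0 < r & forall y, `|y - x| < r -> W y /\
    forall i, `|pder i h y - pder i h x| <= eps%:num / 3.
  have : \forall y \near x, W y /\ forall i, `|pder i h y - pder i h x| <= eps%:num / 3.
    apply: filterI; first by exact: open_nbhs_nbhs.
    apply: (@filter_forall _ _ (fun i y => `|pder i h y - pder i h x| <= eps%:num / 3) _ (nbhs_filter x)) => i.
    have /cvgrPdist_le/(_ _ e3) := @Ck_cont _ _ _ _ (Ck_pder i H) Wx.
    by apply: filterS => y; rewrite distrC.
  move=> /nbhs_ballP[r /= r0 hr]; exists r => // y yx; apply: hr.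
  by rewrite mx_norm_ball /ball_/= distrC.
have n0 : \forall v \near (0 : V), `|v| < r by exact: nbhs0_lt.
rewrite /=; apply: filterS n0 => v vr.
have vi i : `|v ord0 i| <= `|v| by exact: coord_le_norm.
have key (y : V) i : (forall t : R, `|t| <= `|v ord0 i| -> `|y + t *: bvec R i - x| < r) ->
    `|h (y + v ord0 i *: bvec R i) - h y - v ord0 i * pder i h x| <= eps%:num / 3 * `|v|.
  move=> hy; have [t /hy/rW[_ /(_ i) ht]] :=
    @line_MVT h y (bvec R i) (v ord0 i) (fun t ht => Ck_der H (proj1 (rW _ (hy t ht)))).
  rewrite -pderE => ->; rewrite -mulrBr normrM mulrC; apply: ler_pM => //.
have Ev : v = v ord0 i0 *: bvec R i0 + v ord0 i1 *: bvec R i1 + v ord0 i2 *: bvec R i2.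
  by rewrite {1}(rV_expand v) sum3.
have LE : L v = v ord0 i0 * pder i0 h x + v ord0 i1 * pder i1 h x + v ord0 i2 * pder i2 h x.
  by rewrite /L /lin3 sum3.
have nb (a b c : R) : `|a| <= `|v ord0 i0| -> `|b| <= `|v ord0 i1| -> `|c| <= `|v ord0 i2| ->
    `|a *: bvec R i0 + b *: bvec R i1 + c *: bvec R i2| < r.
  move=> ha hb hc; apply: le_lt_trans vr; apply: normrV_le => // i.
  rewrite comb3E; have [->|->|->] := ord3P i;
    [exact: le_trans ha (vi _)|exact: le_trans hb (vi _)|exact: le_trans hc (vi _)].
have k0 := key x i0.
have k1 := key (x + v ord0 i0 *: bvec R i0) i1.
have k2 := key (x + v ord0 i0 *: bvec R i0 + v ord0 i1 *: bvec R i1) i2.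
have Exv : v + x = x + v ord0 i0 *: bvec R i0 + v ord0 i1 *: bvec R i1 + v ord0 i2 *: bvec R i2.
  by rewrite {1}Ev addrC !addrA.
have -> : (h \o shift x - (cst (h x) + (L : V -> R))) v =
   (h (x + v ord0 i0 *: bvec R i0) - h x - v ord0 i0 * pder i0 h x) +
   (h (x + v ord0 i0 *: bvec R i0 + v ord0 i1 *: bvec R i1) - h (x + v ord0 i0 *: bvec R i0)
     - v ord0 i1 * pder i1 h x) +
   (h (x + v ord0 i0 *: bvec R i0 + v ord0 i1 *: bvec R i1 + v ord0 i2 *: bvec R i2)
     - h (x + v ord0 i0 *: bvec R i0 + v ord0 i1 *: bvec R i1) - v ord0 i2 * pder i2 h x).
  rewrite -[LHS]/(h (v + x) - (h x + L v)) LE Exv; ring.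
have -> : eps%:num * `|v| = eps%:num/3 * `|v| + eps%:num/3 * `|v| + eps%:num/3 * `|v| by field.
have cancel (u : V) : x + u - x = u by rewrite addrC addKr.
apply: (le_trans (ler_normD _ _)); apply: lerD; first
 (apply: (le_trans (ler_normD _ _)); apply: lerD).
- apply: k0 => t ht; rewrite addrAC subrr add0r.
  have := nb t 0 0 ht; rewrite !scale0r !addr0 !normr0; apply; exact: normr_ge0.
- apply: k1 => t ht.
  have := nb (v ord0 i0) t 0 (lexx _) ht; rewrite scale0r addr0 normr0 => /(_ (normr_ge0 _)).
  by rewrite -[x + _ + _]addrA cancel.
- apply: k2 => t ht; have := nb _ _ t (lexx _) (lexx _) ht.
  by rewrite -[x + _ + _]addrA -[x + _ + _]addrA cancel.
Qed.

End Calculus.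

Section Chain.
Variable R : realType.
Local Notation V := 'rV[R]_3.
Implicit Types (h : V -> R) (W : set V) (x y v : V) (phi : V -> V).

Lemma derive_line (g : V -> R) x v : 'D_v g x = 'D_1 (fun t : R => g (t *: v + x)) 0.
Proof.
have E : (fun s : R => s^-1 *: ((g \o shift x) (s *: v) - g x)) =
  (fun s : R => s^-1 *: (((fun t : R => g (t *: v + x)) \o shift 0) (s *: (1:R)) - g (0 *: v + x))).
  by apply/funext => t /=; rewrite [t *: 1]mulr1 addr0 scale0r add0r.
by rewrite /derive E.
Qed.

(** The composite is seen along the line [t |-> x + t v], where [phi] is a path
    and [h] has a total differential by [C1_differentiable]. *)
Lemma chain_rule W h phi x v : open W -> W (phi x) -> Ck_on 1 W h ->
  (forall j, derivable (fun y => phi y ord0 j) x v) ->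
  derivable (h \o phi) x v /\
  'D_v (h \o phi) x = \sum_j pder j h (phi x) * 'D_v (fun y => phi y ord0 j) x.
Proof.
move=> oW Wx Hh dphi.
have [dh dhE] := C1_differentiable oW Wx Hh.
pose c (t : R) : V := phi (t *: v + x).
have dc j : derivable (fun t => c t ord0 j) 0 1.
  by have := dphi j; rewrite derivable1P.
have dcm : derivable c 0 (1 : R).
  by apply/derivable_mxP => i j; rewrite (ord1 i).
have c0 : c 0 = phi x by rewrite /c scale0r add0r.
have dcd : differentiable c (0 : R) by apply/derivable1_diffP.
have dh' : differentiable h (c 0) by rewrite c0.
have dcomp : differentiable (h \o c) (0 : R) by exact: differentiable_comp.
have dd : derivable (h \o phi) x v by rewrite derivable1P; apply/derivable1_diffP.
split=> //.
rewrite derive_line -/(h \o c) deriveE// diff_comp//= c0 dhE /lin3; apply: eq_bigr => j _.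
rewrite mulrC; congr (_ * _).
by rewrite -deriveE// derive_mx// mxE derive_line.
Qed.

Lemma pder_comp W h phi x i : open W -> W (phi x) -> Ck_on 1 W h ->
  (forall j, derivable (fun y => phi y ord0 j) x (bvec R i)) ->
  pder i (h \o phi) x = \sum_j pder j h (phi x) * pder i (fun y => phi y ord0 j) x.
Proof.
move=> oW Wx Hh dphi; have [_] := chain_rule oW Wx Hh dphi; rewrite pderE => ->.
by apply: eq_bigr => j _; rewrite (pderE (fun y => phi y ord0 j)).
Qed.

Lemma cont_rV phi x : (forall j, {for x, continuous (fun y => phi y ord0 j)}) ->
  {for x, continuous phi}.
Proof.
move=> H; apply/(@cvgrPdist_le _ _ _ _ (nbhs_filter x)) => e e0.
suff : \forall y \near x, forall i, `|phi x ord0 i - phi y ord0 i| <= e.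
  by apply: filterS => y hy; apply: normrV_le => [|i]; [exact: ltW|rewrite !mxE].
apply: (@filter_forall _ _ (fun (i : 'I_3) y => `|phi x ord0 i - phi y ord0 i| <= e) _ (nbhs_filter x)) => i.
by have /cvgrPdist_le/(_ _ e0) := H i.
Qed.

Lemma Ck_comp k W W' h phi : open W -> open W' ->
  (forall x, W' x -> W (phi x)) -> Ck_on k W h ->
  (forall j, Ck_on k W' (fun y => phi y ord0 j)) -> Ck_on k W' (h \o phi).
Proof.
move=> oW oW' sub; elim: k h => [|k IH] h Hh Hphi.
  split=> // x W'x; apply: continuous_comp.
    by apply: cont_rV => j; exact: Ck_cont (Hphi j) W'x.
  exact: Ck_cont Hh (sub _ W'x).
have Hphi' j : Ck_on k W' (fun y => phi y ord0 j) by exact: Ck_pred.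
have H1 : Ck_on 1 W h by exact: Ck_le Hh.
have dphi x j i : W' x -> derivable (fun y => phi y ord0 j) x (bvec R i).
  by move=> W'x; exact: Ck_der (Hphi j) W'x.
apply/Ck_onS; split=> [x W'x|i].
  apply: continuous_comp; last exact: Ck_cont Hh (sub _ W'x).
  by apply: cont_rV => j; exact: Ck_cont (Hphi j) W'x.
split=> [x W'x|].
  by have [] := chain_rule oW (sub _ W'x) H1 (fun j => dphi x j i W'x).
apply: (@Ck_eq _ _ _ (fun x => \sum_j pder j h (phi x) * pder i (fun y => phi y ord0 j) x)) => //.
  by move=> x W'x; rewrite -(pder_comp oW) //; [exact: sub|move=> j; exact: dphi].
apply: Ck_sum => // j; apply: Ck_mul => //; last exact: Ck_pder.
by apply: (IH (pder j h)) => //; exact: Ck_pder.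
Qed.

(** ** Functions of one variable

    A family of functions of one real variable closed under differentiation
    consists of smooth functions; stating this for a family rather than for a
    single function keeps the induction on the order of differentiability
    free of any calculus in several variables. *)
Definition der_closed (D : set R) (F : (R -> R) -> Prop) :=
  forall g, F g -> exists2 g', F g' & forall t, D t -> is_derive t (1:R) g (g' t).

Lemma chain1 (g : R -> R) h x v d :
  is_derive (h x) (1:R) g d -> derivable h x v ->
  derivable (g \o h) x v /\ 'D_v (g \o h) x = d * 'D_v h x.
Proof.
move=> gd dh.
pose c (t : R) : R := h (t *: v + x).
have dc : derivable c 0 1 by move: dh; rewrite derivable1P.
have c0 : c 0 = h x by rewrite /c scale0r add0r.
have dcd : differentiable c (0 : R) by apply/derivable1_diffP.
have dg' : differentiable g (c 0) by rewrite c0; apply/derivable1_diffP; exact: ex_derive.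
have dcomp : differentiable (g \o c) (0 : R) by exact: differentiable_comp.
have dd : derivable (g \o h) x v by rewrite derivable1P; apply/derivable1_diffP.
split=> //.
rewrite !derive_line -/(g \o c) -/c -!derive1E derive1_comp; last 2 first.
- exact: dc.
- by rewrite c0; exact: ex_derive.
by rewrite c0 [in LHS]derive1E derive_val.
Qed.

Lemma Ck_comp1 k (D : set R) F g W h : open W -> der_closed D F -> F g ->
  (forall x, W x -> D (h x)) -> Ck_on k W h -> Ck_on k W (g \o h).
Proof.
move=> oW cl; elim: k g => [|k IH] g Fg sub Hh; have [g' Fg' dg] := cl _ Fg.
  split=> // x Wx; apply: continuous_comp; first exact: Ck_cont Hh Wx.
  have := dg _ (sub _ Wx) => -[d _]; apply: differentiable_continuous.
  exact/derivable1_diffP.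
apply/Ck_onS; split=> [x Wx|i].
  apply: continuous_comp; first exact: Ck_cont Hh Wx.
  have := dg _ (sub _ Wx) => -[d _]; apply: differentiable_continuous.
  exact/derivable1_diffP.
have dh x : W x -> derivable h x (bvec R i) by move=> Wx; exact: Ck_der Hh Wx.
split=> [x Wx|]; first by have [] := chain1 (dg _ (sub _ Wx)) (dh x Wx).
apply: (@Ck_eq _ _ _ (fun x => (g' \o h) x * pder i h x)) => //.
  by move=> x Wx; have [_] := chain1 (dg _ (sub _ Wx)) (dh x Wx); rewrite -!pderE => ->.
by apply: Ck_mul => //; [apply: IH => //; exact: Ck_pred|exact: Ck_pder].
Qed.

Lemma exp_der_closed : der_closed setT (fun g => g = @expR R).
Proof. by move=> _ ->; exists (@expR R) => // t _; exact: is_derive_expR. Qed.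

Lemma inv_der_closed : der_closed [set t : R | t != 0]
  (fun g => exists (c : R) n, g = fun t => c * (t^-1) ^+ n).
Proof.
move=> _ [c [n ->]]; exists (fun t => (- n%:R * c) * (t^-1) ^+ n.+1); first by exists (- n%:R * c), n.+1.
move=> t /= t0.
have d1 : is_derive t (1:R) (fun t : R => t^-1) (- t ^- 2).
  split; first by apply: derivableV => //; exact: derivable_id.
  by have := deriveV t0 (@derivable_id _ _ t (1:R)); rewrite derive_id [_ *: _]mulr1.
have d2 := @is_deriveX _ _ (fun t : R => t^-1) n t (1:R) _ d1.
have d3 := @is_deriveZ _ _ _ _ c t (1:R) _ d2.
have -> : (fun t : R => c * t^-1 ^+ n) = c *: (fun t : R => t^-1) ^+ n.
  by apply/funext => s; rewrite /= exprfctE.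
apply: (is_derive_eq d3); rewrite /GRing.scale /=.
case: n {d2 d3} => [|n]; first by rewrite !(mul0r, mulr0, oppr0).
by rewrite /= -exprVn !exprS expr0; ring.
Qed.

Lemma ln_der_closed : der_closed [set t : R | 0 < t]
  (fun g => g = @ln R \/ exists (c : R) n, g = fun t => c * (t^-1) ^+ n).
Proof.
move=> g [->|Fg].
  exists (fun t => 1 * t^-1 ^+ 1); first by right; exists 1, 1%N.
  by move=> t /= t0; rewrite mul1r expr1; exact: is_derive1_ln.
have [g' Fg' dg] := inv_der_closed Fg; exists g'; first by right.
by move=> t /= t0; apply: dg; rewrite /= gt_eqF.
Qed.

Lemma Ck_inv k W h : open W -> (forall x, W x -> h x != 0) ->
  Ck_on k W h -> Ck_on k W (fun x => (h x)^-1).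
Proof.
move=> oW h0 Hh.
apply: (@Ck_eq _ _ _ ((fun t => 1 * t^-1 ^+ 1) \o h)) => //.
  by move=> x _; rewrite /= mul1r expr1.
by apply: (Ck_comp1 oW inv_der_closed) => //; exists 1, 1%N.
Qed.

Lemma Ck_exp k W h : open W -> Ck_on k W h -> Ck_on k W (fun x => expR (h x)).
Proof. by move=> oW; apply: (Ck_comp1 oW exp_der_closed). Qed.

Lemma Ck_ln k W h : open W -> (forall x, W x -> 0 < h x) ->
  Ck_on k W h -> Ck_on k W (fun x => ln (h x)).
Proof. by move=> oW h0; apply: (Ck_comp1 oW ln_der_closed) => //; left. Qed.

Lemma derive_shift_eq h w x v :
  (fun s : R => s^-1 *: (((fun y => h (y + w)) \o shift x) (s *: v) - h (x + w))) =
  (fun s : R => s^-1 *: ((h \o shift (x + w)) (s *: v) - h (x + w))).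
Proof. by apply/funext => s; rewrite /= addrA. Qed.

Lemma derivable_shift h w x v : derivable h (x + w) v -> derivable (fun y => h (y + w)) x v.
Proof. by rewrite /derivable derive_shift_eq. Qed.

Lemma pder_shift h w x i : pder i (fun y => h (y + w)) x = pder i h (x + w).
Proof. by rewrite !pderE /derive derive_shift_eq. Qed.

Lemma pderB h g i x : derivable h x (bvec R i) -> derivable g x (bvec R i) ->
  pder i (fun x => h x - g x) x = pder i h x - pder i g x.
Proof. by move=> hd gd; rewrite !pderE; exact: deriveB. Qed.

Lemma pder_val h i x d : is_derive x (bvec R i) h d -> pder i h x = d.
Proof. by rewrite pderE; case. Qed.

Lemma pder_near_eq h g i x : (\near x, h x = g x) -> pder i h x = pder i g x.
Proof. by rewrite !pderE; exact: near_eq_derive. Qed.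

End Chain.

Lemma addxK (G : zmodType) (x u : G) : x + u - x = u.
Proof. by rewrite addrAC subrr add0r. Qed.

Section SchwarzHadamard.
Variable R : realType.
Local Notation V := 'rV[R]_3.
Implicit Types (h : V -> R) (W : set V) (x y v w : V).

Lemma cvg_dist h x : {for x, continuous h} ->
  forall e : R, 0 < e -> exists2 d : R, 0 < d & forall y, `|y - x| < d -> `|h y - h x| <= e.
Proof.
move=> /cvgrPdist_le ch e e0; have := ch e e0.
rewrite /= => /nbhs_ballP[d /= d0 hd]; exists d => // y yx.
by rewrite distrC; apply: hd; rewrite mx_norm_ball /ball_ /= distrC.
Qed.

Lemma open_dist W x : open W -> W x -> exists2 d : R, 0 < d & forall y, `|y - x| < d -> W y.
Proof.
move=> oW Wx; have /nbhs_ballP[d /= d0 hd] := open_nbhs_nbhs (conj oW Wx).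
by exists d => // y yx; apply: hd; rewrite mx_norm_ball /ball_ /= distrC.
Qed.

Lemma normBvec (a : R) i : `|a *: bvec R i| = `|a|.
Proof. by rewrite mx_normZ norm_bvec mulr1. Qed.

(** The second difference of [h] over a small square, written as a mixed
    second derivative at some point of the square by two uses of the mean value
    theorem; the two orders of use give the two mixed derivatives. *)
Lemma second_difference W h x i j (r s : R) : (forall y, `|y - x| < r -> W y) ->
  Ck_on 2 W h -> 0 < s -> s + s < r ->
  exists2 z, `|z - x| <= s + s &
    h (x + s *: bvec R i + s *: bvec R j) - h (x + s *: bvec R i)
    - (h (x + s *: bvec R j) - h x) = s * (s * pder j (pder i h) z).
Proof.
move=> rW Hh s0 sr.
have inb (a b : R) : `|a| <= `|s| -> `|b| <= `|s| ->
    `|x + a *: bvec R i + b *: bvec R j - x| <= s + s.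
  rewrite (gtr0_norm s0) -[x + _ + _]addrA addxK => ha hb.
  by rewrite (le_trans (ler_normD _ _))// !normBvec lerD.
have inW (a b : R) : `|a| <= `|s| -> `|b| <= `|s| -> W (x + a *: bvec R i + b *: bvec R j).
  by move=> ha hb; exact: rW (le_lt_trans (inb a b ha hb) sr).
have z0 : `|0 : R| <= `|s| by rewrite normr0.
have inW0 (a : R) : `|a| <= `|s| -> W (x + a *: bvec R i).
  by move=> /inW/(_ z0); rewrite scale0r addr0.
pose k y := h (y + s *: bvec R j) - h y.
have dk (a : R) : `|a| <= `|s| -> derivable k (x + a *: bvec R i) (bvec R i).
  move=> ha; apply: derivableB; last exact: Ck_der Hh (inW0 a ha).
  by apply: derivable_shift; exact: Ck_der Hh (inW a s ha (lexx _)).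
have [t ts Et] := line_MVT dk.
have Hp : Ck_on 1 W (pder i h) by exact: Ck_pder.
have [u us Eu] : exists2 u : R, `|u| <= `|s| &
    pder i h (x + t *: bvec R i + s *: bvec R j) - pder i h (x + t *: bvec R i) =
    s * pder j (pder i h) (x + t *: bvec R i + u *: bvec R j).
  have [u us Eu] := line_MVT (fun u hu => Ck_der Hp (inW t u ts hu)).
  by exists u => //; rewrite Eu pderE.
exists (x + t *: bvec R i + u *: bvec R j); first exact: inb.
rewrite -/(k (x + s *: bvec R i)) -/(k x) Et -Eu -pderE; congr (_ * _).
rewrite /k pderB; last 2 first.
- by apply: derivable_shift; exact: Ck_der Hh (inW t s ts (lexx _)).
- exact: Ck_der Hh (inW0 t ts).
by rewrite pder_shift.
Qed.

Lemma schwarz W h x i j : open W -> W x -> Ck_on 2 W h ->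
  pder i (pder j h) x = pder j (pder i h) x.
Proof.
move=> oW Wx Hh; apply/eqP; rewrite -subr_eq0 -normr_eq0; apply/eqP/le_anti.
rewrite normr_ge0 andbT; apply/ler_addgt0Pl => e e0; rewrite addr0.
have e2 : 0 < e / 2 by rewrite divr_gt0.
have [r r0 rW] := open_dist oW Wx.
have cont a b := @Ck_cont _ _ _ _ _ (Ck_pder b (Ck_pder a Hh)) Wx.
have [d1 d10 h1] := cvg_dist (cont j i) e2.
have [d2 d20 h2] := cvg_dist (cont i j) e2.
have [s s0 s3] : exists2 s : R, 0 < s & s + s < Num.min r (Num.min d1 d2).
  have m0 : 0 < Num.min r (Num.min d1 d2) by rewrite !lt_min r0 d10 d20.
  by exists (Num.min r (Num.min d1 d2) / 3); lra.
move: s3; rewrite !lt_min => /and3P[sr sd1 sd2].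
have [z1 hz1 E1] := second_difference i j rW Hh s0 sr.
have [z2 hz2 E2] := second_difference j i rW Hh s0 sr.
have aux (A B C D : R) : A - B - (C - D) = A - C - (B - D) by ring.
have EE : pder j (pder i h) z1 = pder i (pder j h) z2.
  have : s * (s * pder j (pder i h) z1) = s * (s * pder i (pder j h) z2).
    apply: etrans (esym E1) _; apply: etrans _ E2.
    have EA : h (x + s *: bvec R j + s *: bvec R i) = h (x + s *: bvec R i + s *: bvec R j).
      by congr h; exact: addrAC.
    by apply: etrans (aux _ _ _ _) _; congr (_ - _ - _).
  by move=> /(mulfI (lt0r_neq0 s0)) /(mulfI (lt0r_neq0 s0)).
have b1 := h2 z1 (le_lt_trans hz1 sd2).
have b2 := h1 z2 (le_lt_trans hz2 sd1).
rewrite (_ : _ - _ = (pder j (pder i h) z1 - pder j (pder i h) x)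
   - (pder i (pder j h) z2 - pder i (pder j h) x)); last by rewrite EE; ring.
by rewrite (le_trans (ler_normB _ _))// (splitr e) lerD.
Qed.

(** ** Hadamard's lemma *)

Variables (c : V) (r : R).
Definition cball : set V := [set y | `|y - c| < r].
Definition seg (t : R) (y : V) : V := c + t *: (y - c).

Lemma open_cball : open cball.
Proof.
rewrite (_ : cball = ball c r); first exact: ball_open.
by rewrite mx_norm_ball; apply/seteqP; split=> y; rewrite /cball/ball_/= distrC.
Qed.

Lemma seg_in t y : 0 <= t <= 1 -> cball y -> cball (seg t y).
Proof.
move=> /andP[t0 t1]; rewrite /cball /seg /= addxK mx_normZ ger0_norm// => hy.
by apply: le_lt_trans hy; rewrite ler_piMl.
Qed.

Lemma seg_dist t y t' y' : `|seg t' y' - seg t y| <= `|t'| * `|y' - y| + `|t' - t| * `|y - c|.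
Proof.
rewrite (_ : _ - _ = t' *: (y' - y) + (t' - t) *: (y - c)).
  by rewrite (le_trans (ler_normD _ _))// !mx_normZ.
rewrite /seg opprD addrACA subrr add0r scalerBl addrA; congr (_ - _).
by rewrite -scalerDr addrA subrK.
Qed.

Lemma seg_near h t y (e : R) : {for seg t y, continuous h} -> 0 < e ->
  \forall t' \near t & y' \near y, `|h (seg t' y') - h (seg t y)| <= e.
Proof.
move=> ch e0; have [d d0 hd] := cvg_dist ch e0.
have K0 : 0 < `|t| + 1 + `|y - c| by rewrite ltr_wpDr// ltr_wpDl.
pose a := Num.min 1 (d / (2 * (`|t| + 1 + `|y - c|))).
have a0 : 0 < a by rewrite lt_min ltr01 divr_gt0// mulr_gt0.
exists ([set t' | `|t - t'| < a], [set y' | `|y - y'| < a]).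
  split; first by apply/nbhs_ballP; exists a.
  by apply/nbhs_ballP; exists a => //=; rewrite mx_norm_ball.
move=> [t' y'] /= [ht hy]; apply: hd; apply: le_lt_trans (seg_dist _ _ _ _) _.
rewrite distrC in ht; rewrite distrC in hy.
have a1 : a <= 1 by rewrite ge_min lexx.
have ad : a * (2 * (`|t| + 1 + `|y - c|)) <= d.
  by rewrite -ler_pdivlMr ?mulr_gt0// ge_min lexx orbT.
have t'b : `|t'| <= `|t| + 1.
  rewrite -(subrK t t') addrC (le_trans (ler_normD _ _))// lerD2l.
  exact: le_trans (ltW ht) a1.
apply: (@le_lt_trans _ _ ((`|t| + 1) * a + a * `|y - c|)).
  by apply: lerD; apply: ler_pM => //; exact: ltW.
by nra.
Qed.

Local Notation mu := (@lebesgue_measure R).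
Local Notation I01 := (`[0%R, 1%R]%classic : set R).

Lemma seg_tube h y (e : R) : cball y -> (forall x, cball x -> {for x, continuous h}) ->
  0 < e -> \forall y' \near y, forall t, 0 <= t <= 1 -> `|h (seg t y') - h (seg t y)| <= e.
Proof.
move=> By ch e0.
have /compact_near_coveringP/(_ _ (nbhs y) (fun y' t => `|h (seg t y') - h (seg t y)| <= e)
   (nbhs_filter y)) := @segment_compact R 0 1.
move=> H; apply: filterS (H _) => [y' hy' t t01|]; first by apply: hy'; rewrite /= in_itv.
move=> t; rewrite /= in_itv /= => t01.
have e2 : 0 < e / 2 by rewrite divr_gt0.
have [[A B] /= [nA nB] hAB] := seg_near (ch _ (seg_in t01 By)) e2.
exists (A, B) => // -[t' y'] /= [At' By'].
have h1 := hAB (t', y') (conj At' By').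
have h2 := hAB (t', y) (conj At' (nbhs_singleton nB)).
rewrite (_ : _ - _ = (h (seg t' y') - h (seg t y)) - (h (seg t' y) - h (seg t y))); last by ring.
by rewrite (le_trans (ler_normB _ _))// (splitr e) lerD.
Qed.

Lemma path_cont_at k h y t : 0 <= t <= 1 -> cball y ->
  (forall x, cball x -> {for x, continuous h}) ->
  {for t, continuous (fun t : R => t ^+ k * h (seg t y))}.
Proof.
move=> t01 By ch; apply: (@continuousM _ _ (fun t : R => t ^+ k) (fun t : R => h (seg t y))).
  exact: exprn_continuous.
apply/cvgrPdist_le => e e0.
have [[A B] /= [nA nB] hAB] := seg_near (ch _ (seg_in t01 By)) e0.
apply: filterS nA => t' At'; rewrite distrC.
exact: (hAB (t', y) (conj At' (nbhs_singleton nB))).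
Qed.

Lemma cont_path k h y : cball y -> (forall x, cball x -> {for x, continuous h}) ->
  {within I01, continuous (fun t : R => t ^+ k * h (seg t y))}.
Proof.
move=> By ch; apply: continuous_in_subspaceT => t; rewrite inE /= in_itv /= => t01.
exact: path_cont_at.
Qed.

Lemma path_integrable k h y : cball y -> (forall x, cball x -> {for x, continuous h}) ->
  mu.-integrable I01 (EFin \o (fun t : R => t ^+ k * h (seg t y))).
Proof.
by move=> By ch; apply: continuous_compact_integrable; [exact: segment_compact|exact: cont_path].
Qed.

Definition radial k h : V -> R := fun y => (\int[mu]_(t in I01) (t ^+ k * h (seg t y)))%R.

Lemma mu01 : fine (mu I01) = 1.
Proof. by rewrite lebesgue_measure_itv /= lte_fin ltr01 -EFinB /= subr0. Qed.

Lemma radial_cont k h x : cball x -> (forall x, cball x -> {for x, continuous h}) ->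
  {for x, continuous (radial k h)}.
Proof.
move=> Bx ch; apply/(@cvgrPdist_le _ _ _ _ (nbhs_filter x)) => e e0.
have nB : \forall y \near x, cball y by apply: open_nbhs_nbhs; split => //; exact: open_cball.
apply: filterS2 nB (seg_tube Bx ch e0) => y By hy.
rewrite /radial -RintegralB//; last 2 first.
- exact: path_integrable.
- exact: path_integrable.
have ib : mu.-integrable I01 (EFin \o (fun t : R => t ^+ k * h (seg t x) - t ^+ k * h (seg t y))).
  have := @integrableB _ _ _ mu I01 (measurable_itv _) _ _ (path_integrable k Bx ch) (path_integrable k By ch).
  by apply: eq_integrable => // t _; rewrite /= EFinB.
apply: le_trans (le_normr_Rintegral _ ib) _ => //.
apply: (@le_trans _ _ (\int[mu]_(t in I01) e)%R); last by rewrite Rintegral_cst// mu01 mulr1.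
apply: le_Rintegral => //.
- exact: integrable_norm ib.
- apply: continuous_compact_integrable; first exact: segment_compact.
  by apply: continuous_subspaceT => t; exact: cvg_cst.
move=> t; rewrite /= in_itv /= => t01; have /andP[t0 t1] := t01.
rewrite -mulrBr normrM ger0_norm ?exprn_ge0// distrC.
by rewrite -[leRHS]mul1r ler_pM// ?exprn_ge0//; [exact: exprn_ile1|exact: hy].
Qed.

Lemma radial_der k h x i : cball x -> Ck_on 1 cball h ->
  is_derive x (bvec R i) (radial k h) (radial k.+1 (pder i h) x).
Proof.
move=> Bx Hh.
have ch y : cball y -> {for y, continuous h} by exact: (Ck_cont Hh).
have cph y : cball y -> {for y, continuous (pder i h)} by exact: (Ck_cont (Ck_pder i Hh)).
pose f (s : R) (t : R) := t ^+ k * h (seg t (x + s *: bvec R i)).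
have nB : \forall y \near x, cball y by apply: open_nbhs_nbhs; split => //; exact: open_cball.
have [d d0 hd] : exists2 d : R, 0 < d & forall y, `|y - x| < d -> cball y /\
    forall t, 0 <= t <= 1 -> `|pder i h (seg t y) - pder i h (seg t x)| <= 1.
  have nT : \forall y \near x, cball y /\
      forall t, 0 <= t <= 1 -> `|pder i h (seg t y) - pder i h (seg t x)| <= 1.
    by apply: filterI => //; exact: seg_tube.
  have /nbhs_ballP[d /= d0 hd] := nT.
  by exists d => // y yx; apply: hd; rewrite mx_norm_ball /ball_ /= distrC.
have inB (s : R) : s \in `]-d, d[ -> `|x + s *: bvec R i - x| < d.
  by rewrite in_itv /= -ltr_norml (addrC x) addrK normBvec.
have dseg s t : s \in `]-d, d[ -> 0 <= t <= 1 ->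
    is_derive s (1:R) (f ^~ t) (t ^+ k.+1 * pder i h (seg t (x + s *: bvec R i))).
  move=> /inB/hd[By _] t01.
  have -> : f ^~ t = t ^+ k *: (fun s : R => h (seg t x + s *: (t *: bvec R i))).
    apply/funext => s'; rewrite /f /GRing.scale /=; congr (_ * h _).
    by rewrite /seg addrAC scalerDr addrA scalerA mulrC -scalerA.
  have E : seg t (x + s *: bvec R i) = seg t x + s *: (t *: bvec R i).
    by rewrite /seg addrAC scalerDr addrA !scalerA mulrC.
  have D := C1_differentiable open_cball (seg_in t01 By) Hh.
  have D2 : is_derive s (1:R) (fun s : R => h (seg t x + s *: (t *: bvec R i)))
      ('D_(t *: bvec R i) h (seg t x + s *: (t *: bvec R i))).
    by apply: is_derive_line; rewrite -E; apply: diff_derivable; have [] := D.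
  have := @is_deriveZ _ _ _ _ (t ^+ k) s (1:R) _ D2.
  move=> D3; apply: (is_derive_eq D3).
  rewrite -E deriveE; last by have [] := D.
  rewrite linearZ /= -deriveE; last by have [] := D.
  by rewrite -pderE /GRing.scale /= exprSr mulrA.
have s0 : (0 : R) \in `]-d, d[ by rewrite in_itv /= oppr_lt0 d0.
have [M M0 hM] : exists2 M : R, 0 <= M & forall t, 0 <= t <= 1 -> `|pder i h (seg t x)| <= M.
  have /(_ _)[|t _ ht] := @EVT_max R (fun t => `|t ^+ 0 * pder i h (seg t x)|) 0 1 ler01.
    apply: continuous_in_subspaceT => t; rewrite inE /= in_itv /= => t01.
    apply: (@continuous_comp _ _ _ (fun t : R => t ^+ 0 * pder i h (seg t x)) (fun u : R => `|u|)).
      exact: path_cont_at.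
    exact: norm_continuous.
  exists `|t ^+ 0 * pder i h (seg t x)| => // t' t'01.
  by have := ht t'; rewrite in_itv /= t'01 !expr0 !mul1r; apply.
have G_ub s t : s \in `]-d, d[ -> 0 <= t <= 1 -> `|partial1of2 f s t| <= M + 1.
  move=> hs t01; rewrite partial1of2E.
  have Ds := dseg s t hs t01; rewrite derive_val normrM.
  have [_ /(_ t t01) hh] := hd _ (inB _ hs).
  have /andP[t0 t1] := t01.
  rewrite -[M + 1]mul1r ler_pM//.
    by rewrite normrX ger0_norm// exprn_ile1.
  rewrite -(subrK (pder i h (seg t x)) (pder i h (seg t (x + _)))) addrC.
  by rewrite (le_trans (ler_normD _ _))// lerD// hM.
have int01c (a : R) : mu.-integrable I01 (EFin \o (fun=> a)).
  apply: continuous_compact_integrable; first exact: segment_compact.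
  by apply: continuous_subspaceT => t; exact: cvg_cst.
have m01 : measurable I01 by exact: measurable_itv.
have If s : `]-d, d[%classic s -> mu.-integrable I01 (EFin \o f s).
  by move=> /= hs; apply: path_integrable => //; have [] := hd _ (inB _ hs).
have If0 : `]-d, d[%classic (0 : R) by [].
have dif s t : `]-d, d[%classic s -> I01 t -> derivable (f ^~ t) s (1:R).
  move=> hs; rewrite /= in_itv /= => t01; have := dseg s t hs t01 => ?; exact: ex_derive.
have G0 (t : R) : 0 <= M + 1 by rewrite addr_ge0.
have Gub s t : `]-d, d[%classic s -> I01 t -> `|partial1of2 f s t| <= M + 1.
  by move=> hs; rewrite /= in_itv /= => t01; exact: G_ub.
have E1 := @differentiation_under_integral R _ _ mu f I01 m01 0 (-d) d If0 If dif
  (fun=> M + 1) G0 (int01c _) Gub.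
have E2 := @derivable_under_integral R _ _ mu f I01 m01 0 (-d) d If0 If dif
  (fun=> M + 1) G0 (int01c _) Gub.
have EF : (fun s : R => (\int[mu]_(y in I01) f s y)%R) = (fun s => radial k h (s *: bvec R i + x)).
  by apply/funext => s; rewrite addrC.
rewrite EF in E1 E2.
split; first by rewrite derivable1P.
rewrite derive_line -derive1E E1; apply: eq_Rintegral => t; rewrite inE /= in_itv /= => t01.
have Ds := dseg 0 t s0 t01.
by rewrite partial1of2E derive_val scale0r addr0.
Qed.

Lemma radial_Ck m k h : Ck_on m.+1 cball h -> Ck_on m cball (radial k h).
Proof.
elim: m k h => [|m IH] k h Hh.
  by split=> // x Bx; apply: radial_cont => // y; exact: (Ck_cont Hh).
have H1 : Ck_on 1 cball h by exact: Ck_le Hh.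
apply/Ck_onS; split=> [x Bx|i]; first by apply: radial_cont => // y; exact: (Ck_cont Hh).
split=> [x Bx|]; first by have := radial_der k i Bx H1 => ?; exact: ex_derive.
apply: (@Ck_eq _ _ _ (radial k.+1 (pder i h))).
- exact: open_cball.
- by move=> x Bx; rewrite -(pder_val (radial_der k i Bx H1)) pderE.
- by apply: IH; exact: Ck_pder.
Qed.

Lemma hadamard h x : cball x -> Ck_on 2 cball h ->
  h x = h c + \sum_i (x ord0 i - c ord0 i) * radial 0 (pder i h) x.
Proof.
move=> Bx H2; have H1 : Ck_on 1 cball h by exact: Ck_le H2.
pose F (t : R) := h (seg t x).
have dF (t : R) : 0 <= t <= 1 -> is_derive t (1:R) F (\sum_i (x ord0 i - c ord0 i) * pder i h (seg t x)).
  move=> t01; have [D DE] := C1_differentiable open_cball (seg_in t01 Bx) H1.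
  have := @is_derive_line R h c (x - c) t (@diff_derivable _ _ _ h (seg t x) (x - c) D).
  by move=> D3; apply: (is_derive_eq D3); rewrite deriveE// DE /lin3;
    apply: eq_bigr => i _; rewrite !mxE.
have cp i y : cball y -> {for y, continuous (pder i h)} by exact: (Ck_cont (Ck_pder i H1)).
have ci i (t : R) : 0 <= t <= 1 ->
    {for t, continuous (fun t : R => (x ord0 i - c ord0 i) * pder i h (seg t x))}.
  move=> t01; apply: (@continuousM _ _ (fun=> x ord0 i - c ord0 i)); first exact: cst_continuous.
  have -> : (fun t : R => pder i h (seg t x)) = (fun t => t ^+ 0 * pder i h (seg t x)).
    by apply/funext => u; rewrite expr0 mul1r.
  exact: (@path_cont_at 0 (pder i h) x t t01 Bx (cp i)).
have cf : {within I01, continuous (fun t => \sum_i (x ord0 i - c ord0 i) * pder i h (seg t x))}.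
  apply: continuous_in_subspaceT => t; rewrite inE /= in_itv /= => t01.
  under eq_fun do rewrite sum3.
  exact: (continuousD (continuousD (ci i0 t t01) (ci i1 t t01)) (ci i2 t t01)).
have cF : {within I01, continuous F}.
  have -> : F = (fun t => t ^+ 0 * h (seg t x)).
    by apply/funext => u; rewrite expr0 mul1r.
  exact: (@cont_path 0 h x Bx (fun y By => Ck_cont H1 By)).
have F1 : F 1 = h x by rewrite /F /seg scale1r addrC subrK.
have F0 : F 0 = h c by rewrite /F /seg scale0r addr0.
have [_ cF0 cF1] := (continuous_within_itvP F (@ltr01 R)).1 cF.
have := @continuous_FTC2 R _ F 0 1 ltr01 cf; rewrite F1 F0 => E.
have {}E : (\int[mu]_(t in I01) (\sum_i (x ord0 i - c ord0 i) * pder i h (seg t x)))%R = h x - h c.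
  rewrite /Rintegral E//; last 2 first.
  - split=> // t /subset_itv_oo_cc; rewrite in_itv /= => /dF d; exact: ex_derive.
  - by move=> t /subset_itv_oo_cc; rewrite in_itv /= => /dF d; rewrite derive1E derive_val.
apply/eqP; rewrite addrC -subr_eq -E; apply/eqP.
have ii i : mu.-integrable I01 (EFin \o (fun t => (x ord0 i - c ord0 i) * pder i h (seg t x))).
  apply: continuous_compact_integrable; first exact: segment_compact.
  by apply: continuous_in_subspaceT => t; rewrite inE /= in_itv /= => t01; exact: ci.
under eq_Rintegral do rewrite sum3.
have ii2 : mu.-integrable I01 (EFin \o (fun t => (x ord0 i0 - c ord0 i0) * pder i0 h (seg t x) +
    (x ord0 i1 - c ord0 i1) * pder i1 h (seg t x))).
  apply: continuous_compact_integrable; first exact: segment_compact.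
  apply: continuous_in_subspaceT => t; rewrite inE /= in_itv /= => t01.
  exact: (continuousD (ci i0 t t01) (ci i1 t t01)).
rewrite !RintegralD//.
have rz i : (x ord0 i - c ord0 i) * radial 0 (pder i h) x =
    (\int[mu]_(t in I01) ((x ord0 i - c ord0 i) * pder i h (seg t x)))%R.
  have pint := path_integrable 0 Bx (cp i).
  rewrite /radial -RintegralZl//.
  by apply: eq_Rintegral => t _; rewrite expr0 mul1r.
by rewrite sum3 !rz.
Qed.

Lemma radial0_center h : cball c -> radial 0 h c = h c.
Proof.
move=> Bc; rewrite /radial; under eq_Rintegral do rewrite expr0 mul1r /seg subrr scaler0 addr0.
by rewrite Rintegral_cst// mu01 mulr1.
Qed.

End SchwarzHadamard.

(** * Smooth functions on a 3-manifold *)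

Section ComplexParts.
Variable R : realType.
Implicit Types x y : R[i].

Lemma ReD x y : complex.Re (x + y) = complex.Re x + complex.Re y.
Proof. by case: x; case: y. Qed.
Lemma ImD x y : complex.Im (x + y) = complex.Im x + complex.Im y.
Proof. by case: x; case: y. Qed.
Lemma ReM x y : complex.Re (x * y) = complex.Re x * complex.Re y - complex.Im x * complex.Im y.
Proof. by case: x; case: y. Qed.
Lemma ImM x y : complex.Im (x * y) = complex.Re x * complex.Im y + complex.Im x * complex.Re y.
Proof. by case: x; case: y => * /=; ring. Qed.
Lemma ReJ x : complex.Re (x^c) = complex.Re x.
Proof. by case: x. Qed.
Lemma ImJ x : complex.Im (x^c) = - complex.Im x.
Proof. by case: x. Qed.
Lemma complex_eq x y : complex.Re x = complex.Re y -> complex.Im x = complex.Im y -> x = y.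
Proof. by case: x => a b; case: y => c d /= -> ->. Qed.
Lemma conjcM x y : (x * y)^c = x^c * y^c.
Proof. exact: rmorphM. Qed.
Lemma conjcD x y : (x + y)^c = x^c + y^c.
Proof. exact: rmorphD. Qed.
Lemma conjcN x : (- x)^c = - x^c.
Proof. exact: rmorphN. Qed.
Lemma conjcB x y : (x - y)^c = x^c - y^c.
Proof. exact: rmorphB. Qed.
Lemma conjci : ('i : R[i])^c = - 'i.
Proof. by apply: complex_eq; rewrite /= ?oppr0. Qed.
Lemma mulii : ('i : R[i]) * 'i = -1.
Proof. by rewrite -expr2 sqr_i. Qed.
End ComplexParts.

Section SmoothFunctions.
Variables (R : realType) (M : manifold3 R).
Local Notation C := R[i].
Local Notation V := 'rV[R]_3.
Implicit Types (c d : chart R M) (U W : set M) (p q : M) (f g : M -> R) (u w : M -> C).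

Definition img c U : set V := chart_map c @` (chart_dom c `&` U).

Lemma invK c q : chart_dom c q -> chart_inv c (chart_map c q) = q.
Proof. by move=> dq; apply: chart_mapK; rewrite inE. Qed.

Lemma img_mem c U q : chart_dom c q -> U q -> img c U (chart_map c q).
Proof. by move=> dq Uq; exists q. Qed.

Lemma imgP c U x : img c U x ->
  [/\ chart_dom c (chart_inv c x), U (chart_inv c x) & chart_map c (chart_inv c x) = x].
Proof. by move=> [q [dq Uq] <-]; rewrite invK. Qed.

Lemma img_sub c U W : U `<=` W -> img c U `<=` img c W.
Proof. by move=> UW _ [q [dq Uq] <-]; apply: img_mem => //; exact: UW. Qed.

Lemma open_img c U : open U -> open (img c U).
Proof.
move=> oU; rewrite openE => x /imgP[dx Ux Ex].
have Ix : (chart_map c @` chart_dom c) x by exists (chart_inv c x).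
have n1 : nbhs x (chart_map c @` chart_dom c).
  by apply: open_nbhs_nbhs; split => //; exact: chart_img_open.
have n2 : nbhs x (chart_inv c @^-1` (chart_dom c `&` U)).
  apply: (@chart_inv_cont _ _ c x); first by rewrite inE.
  by apply: open_nbhs_nbhs; split => //; apply: openI => //; exact: chart_dom_open.
apply: filterS2 n1 n2 => y [q dq <-] /=; rewrite invK// => -[_ Uq].
exact: img_mem.
Qed.

Lemma map_cont c q : chart_dom c q -> {for q, continuous (chart_map c)}.
Proof. by move=> dq; apply: chart_map_cont; rewrite inE. Qed.

Lemma smooth_sub U W f : W `<=` U -> smooth_on U f -> smooth_on W f.
Proof. by move=> WU Hf c ac k; apply: Ck_sub (Hf c ac k); exact: img_sub. Qed.

Lemma smooth_local U f :
  (forall p, U p -> exists2 W, open W /\ W p & smooth_on W f) -> smooth_on U f.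
Proof.
move=> H c ac k; apply: Ck_local => x /imgP[dx Ux Ex].
have [W [oW Wx] HW] := H _ Ux; exists (img c W); last exact: HW.
by split; [exact: open_img|rewrite -Ex; exact: img_mem].
Qed.

Lemma smooth_chart c U f : atlas c -> open U -> U `<=` chart_dom c ->
  Cinf_on (img c U) (f \o chart_inv c) -> smooth_on U f.
Proof.
move=> ac oU Uc Hf d ad k.
pose phi (x : V) := chart_map c (chart_inv d x).
apply: (@Ck_eq _ _ _ ((f \o chart_inv c) \o phi)).
- exact: open_img.
- by move=> x /imgP[dx /Uc cx Ex] /=; rewrite /phi invK.
- apply: (@Ck_comp _ k (img c U)); [exact: open_img|exact: open_img| |exact: Hf|].
    by move=> x /imgP[dx Ux Ex]; apply: img_mem => //; exact: Uc.
  by move=> j; apply: Ck_sub (atlas_compat ad ac j k); exact: img_sub.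
Qed.

Lemma smooth_eq U f g : open U -> (forall p, U p -> f p = g p) -> smooth_on U f -> smooth_on U g.
Proof.
move=> oU E Hf c ac k; apply: (@Ck_eq _ _ _ (f \o chart_inv c)); first exact: open_img.
  by move=> x /imgP[_ Ux _] /=; exact: E.
exact: Hf.
Qed.

Lemma smooth_cst U (a : R) : smooth_on U (fun=> a).
Proof. by move=> c ac k; exact: Ck_cst. Qed.

Lemma smoothD U f g : open U -> smooth_on U f -> smooth_on U g -> smooth_on U (fun p => f p + g p).
Proof. by move=> oU Hf Hg c ac k; apply: Ck_add; [exact: open_img|exact: Hf|exact: Hg]. Qed.

Lemma smoothM U f g : open U -> smooth_on U f -> smooth_on U g -> smooth_on U (fun p => f p * g p).
Proof. by move=> oU Hf Hg c ac k; apply: Ck_mul; [exact: open_img|exact: Hf|exact: Hg]. Qed.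

Lemma smoothN U f : open U -> smooth_on U f -> smooth_on U (fun p => - f p).
Proof. by move=> oU Hf c ac k; apply: Ck_opp; [exact: open_img|exact: Hf]. Qed.

Lemma smoothV U f : open U -> (forall p, U p -> f p != 0) ->
  smooth_on U f -> smooth_on U (fun p => (f p)^-1).
Proof.
move=> oU f0 Hf c ac k; apply: (@Ck_inv _ k _ (f \o chart_inv c)); [exact: open_img| |exact: Hf].
by move=> x /imgP[_ Ux _]; exact: f0.
Qed.

Lemma smooth_exp U f : open U -> smooth_on U f -> smooth_on U (fun p => expR (f p)).
Proof. by move=> oU Hf c ac k; apply: (@Ck_exp _ k _ (f \o chart_inv c)); [exact: open_img|exact: Hf]. Qed.

Lemma smooth_ln U f : open U -> (forall p, U p -> 0 < f p) ->
  smooth_on U f -> smooth_on U (fun p => ln (f p)).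
Proof.
move=> oU f0 Hf c ac k; apply: (@Ck_ln _ k _ (f \o chart_inv c)); [exact: open_img| |exact: Hf].
by move=> x /imgP[_ Ux _]; exact: f0.
Qed.

Lemma smooth_cont U f p : open U -> U p -> smooth_on U f -> {for p, continuous f}.
Proof.
move=> oU Up Hf; have [c ac cp] := atlas_cover p.
have E : \near p, ((f \o chart_inv c) \o chart_map c) p = f p.
  apply: (@near_open _ (chart_dom c)) => //; first exact: chart_dom_open.
  by move=> q cq /=; rewrite invK.
have cc : {for p, continuous ((f \o chart_inv c) \o chart_map c)}.
  apply: continuous_comp; first exact: map_cont.
  by apply: (Ck_cont (Hf c ac 0%N)); exact: img_mem.
rewrite /prop_for /continuous_at -[f p]/(f p).
have -> : f p = ((f \o chart_inv c) \o chart_map c) p by rewrite /= invK.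
apply: cvg_trans cc; apply: near_eq_cvg.
exact: E.
Qed.

(** ** Complex-valued functions *)

Lemma csmooth_sub U W u : W `<=` U -> csmooth_on U u -> csmooth_on W u.
Proof. by move=> WU [h1 h2]; split; exact: smooth_sub WU _. Qed.

Lemma csmooth_local U u :
  (forall p, U p -> exists2 W, open W /\ W p & csmooth_on W u) -> csmooth_on U u.
Proof. by move=> H; split; apply: smooth_local => p /H[W oW []]; exists W. Qed.

Lemma csmooth_eq U u w : open U -> (forall p, U p -> u p = w p) -> csmooth_on U u -> csmooth_on U w.
Proof. by move=> oU E [h1 h2]; split; [apply: smooth_eq h1|apply: smooth_eq h2] => // p /E ->. Qed.

Lemma csmooth_cst U (a : C) : csmooth_on U (fun=> a).
Proof. by split; exact: smooth_cst. Qed.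

Lemma csmoothD U u w : open U -> csmooth_on U u -> csmooth_on U w ->
  csmooth_on U (fun p => u p + w p).
Proof.
move=> oU [u1 u2] [w1 w2]; split; [apply: smooth_eq (smoothD oU u1 w1)|
 apply: smooth_eq (smoothD oU u2 w2)] => // p _; by rewrite (ReD, ImD).
Qed.

Lemma csmoothM U u w : open U -> csmooth_on U u -> csmooth_on U w ->
  csmooth_on U (fun p => u p * w p).
Proof.
move=> oU [u1 u2] [w1 w2]; split.
  have h := smoothD oU (smoothM oU u1 w1) (smoothN oU (smoothM oU u2 w2)).
  by apply: smooth_eq h => // p _; rewrite ReM.
have h := smoothD oU (smoothM oU u1 w2) (smoothM oU u2 w1).
by apply: smooth_eq h => // p _; rewrite ImM.
Qed.

Lemma csmoothN U u : open U -> csmooth_on U u -> csmooth_on U (fun p => - u p).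
Proof.
move=> oU Hu; apply: csmooth_eq (csmoothM oU (csmooth_cst U (-1)) Hu) => // p _.
by rewrite mulN1r.
Qed.

Lemma csmoothB U u w : open U -> csmooth_on U u -> csmooth_on U w ->
  csmooth_on U (fun p => u p - w p).
Proof. by move=> oU Hu Hw; apply: csmoothD => //; exact: csmoothN. Qed.

Lemma csmoothJ U u : open U -> csmooth_on U u -> csmooth_on U (fun p => (u p)^c).
Proof.
move=> oU [u1 u2]; split; first by apply: smooth_eq u1 => // p _; rewrite ReJ.
by apply: smooth_eq (smoothN oU u2) => // p _; rewrite ImJ.
Qed.

Lemma csmooth_real U f : smooth_on U f -> csmooth_on U (cfun_of f).
Proof. by move=> Hf; split => //; exact: smooth_cst. Qed.

Lemma csmoothV U u : open U -> (forall p, U p -> u p != 0) ->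
  csmooth_on U u -> csmooth_on U (fun p => (u p)^-1).
Proof.
move=> oU u0 Hu; have [u1 u2] := Hu.
pose n p := complex.Re (u p) * complex.Re (u p) + complex.Im (u p) * complex.Im (u p).
have Hn : smooth_on U n by apply: smoothD => //; apply: smoothM.
have n0 p : U p -> n p != 0.
  move=> /u0; apply: contraNneq; rewrite /n -!expr2 => /eqP.
  rewrite paddr_eq0 ?sqr_ge0// !sqrf_eq0 => /andP[/eqP a /eqP b].
  by apply/eqP; exact: complex_eq.
have h := csmoothM oU (csmooth_real (smoothV oU n0 Hn)) (csmoothJ oU Hu).
apply: csmooth_eq h => // p Up; apply: (mulfI (u0 p Up)); rewrite mulfV ?u0//.
rewrite mulrCA (_ : u p * (u p)^c = (n p)%:C); last first.
  by rewrite /n; case: (u p) => a b /=; apply: complex_eq => /=; ring.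
by rewrite /cfun_of -rmorphM /= mulVf ?n0.
Qed.

Lemma csmooth_nearW U u p : open U -> U p -> csmooth_on U u -> csmooth_near p u.
Proof. by move=> oU Up Hu; exists U. Qed.

Lemma csmooth_near_eq u w p : (\near p, u p = w p) -> csmooth_near p u -> csmooth_near p w.
Proof.
move=> /nbhs_interior; rewrite /= => E [U [oU Up Hu]].
pose W : set M := U `&` [set q | u q = w q]^°.
have oW : open W by apply: openI => //; exact: open_interior.
exists W; split => //; first by split=> //; exact: nbhs_singleton E.
by apply: csmooth_eq (csmooth_sub _ Hu) => // [q [_ /interior_subset]|q []].
Qed.

Lemma csmooth_nearD u w p : csmooth_near p u -> csmooth_near p w -> csmooth_near p (fun q => u q + w q).
Proof.
move=> [U [oU Up Hu]] [W [oW Wp Hw]]; exists (U `&` W); split=> //; first exact: openI.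
by apply: csmoothD; [exact: openI|apply: csmooth_sub Hu => q []|apply: csmooth_sub Hw => q []].
Qed.

Lemma csmooth_nearM u w p : csmooth_near p u -> csmooth_near p w -> csmooth_near p (fun q => u q * w q).
Proof.
move=> [U [oU Up Hu]] [W [oW Wp Hw]]; exists (U `&` W); split=> //; first exact: openI.
by apply: csmoothM; [exact: openI|apply: csmooth_sub Hu => q []|apply: csmooth_sub Hw => q []].
Qed.

Lemma csmooth_near_cst (a : C) p : csmooth_near p (fun=> a).
Proof. by exists setT; split=> //; [exact: openT|exact: csmooth_cst]. Qed.

Lemma csmooth_nearJ u p : csmooth_near p u -> csmooth_near p (fun q => (u q)^c).
Proof. by move=> [U [oU Up Hu]]; exists U; split=> //; exact: csmoothJ. Qed.

(** ** Partial derivatives in a chart *)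

Definition xcoord c (i : 'I_3) : M -> R := fun q => chart_map c q ord0 i.
Definition ccoord c (i : 'I_3) : M -> C := cfun_of (xcoord c i).

Lemma smooth_xcoord c i : atlas c -> smooth_on (chart_dom c) (xcoord c i).
Proof. by move=> ac d ad k; exact: (atlas_compat ad ac i k). Qed.

Lemma csmooth_ccoord c i : atlas c -> csmooth_on (chart_dom c) (ccoord c i).
Proof. by move=> ac; apply: csmooth_real; exact: smooth_xcoord. Qed.

Definition dM c i f : M -> R := fun p => pder i (f \o chart_inv c) (chart_map c p).
Definition dC c i u : M -> C := fun p =>
  dM c i (fun q => complex.Re (u q)) p +i* dM c i (fun q => complex.Im (u q)) p.

Lemma smooth_dM c i U f : atlas c -> open U -> U `<=` chart_dom c ->
  smooth_on U f -> smooth_on U (dM c i f).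
Proof.
move=> ac oU Uc Hf; apply: (@smooth_chart c) => // k.
apply: (@Ck_eq _ _ _ (pder i (f \o chart_inv c))); first exact: open_img.
  by move=> x /imgP[_ _ Ex]; rewrite /= /dM Ex.
by apply: Ck_pder; exact: (Hf c ac k.+1).
Qed.

Lemma csmooth_dC c i U u : atlas c -> open U -> U `<=` chart_dom c ->
  csmooth_on U u -> csmooth_on U (dC c i u).
Proof. by move=> ac oU Uc [h1 h2]; split; exact: smooth_dM. Qed.

Lemma smooth_derivable c i U f p : atlas c -> chart_dom c p -> U p -> smooth_on U f ->
  derivable (f \o chart_inv c) (chart_map c p) (bvec R i).
Proof. by move=> ac cp Up Hf; apply: (Ck_der (Hf c ac 1%N)); exact: img_mem. Qed.

Lemma near_inv c p (P : M -> Prop) : chart_dom c p -> (\near p, P p) ->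
  \forall x \near chart_map c p, P (chart_inv c x).
Proof.
move=> cp H; have Ix : (chart_map c @` chart_dom c) (chart_map c p) by exists p.
apply: (@chart_inv_cont _ _ c (chart_map c p)); first by rewrite inE.
by rewrite invK.
Qed.

Lemma dM_near c i f g p : chart_dom c p -> (\near p, f p = g p) -> dM c i f p = dM c i g p.
Proof. by move=> cp E; apply: pder_near_eq; exact: (near_inv cp E). Qed.

Lemma dC_near c i u w p : chart_dom c p -> (\near p, u p = w p) -> dC c i u p = dC c i w p.
Proof.
move=> cp E; congr (_ +i* _); apply: dM_near => //; by apply: filterS E => q ->.
Qed.

Lemma dM_coord c i j p : atlas c -> chart_dom c p -> dM c i (xcoord c j) p = (i == j)%:R.
Proof.
move=> ac cp; rewrite /dM.
rewrite (@pder_near_eq _ _ (fun x => x ord0 j)); first by rewrite pder_coord.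
have oI : open (img c setT) by apply: open_img; exact: openT.
apply: (@near_open _ (img c setT)) => //; first exact: img_mem.
by move=> x /imgP[_ _ Ex]; rewrite /xcoord /= Ex.
Qed.

Lemma dC_coord c i j p : atlas c -> chart_dom c p -> dC c i (ccoord c j) p = (i == j)%:R.
Proof.
move=> ac cp; rewrite /dC /ccoord /cfun_of /= dM_coord// /dM pder_cst.
by case: (i == j).
Qed.

Lemma dM_sum c i U f g p : atlas c -> chart_dom c p -> U p -> smooth_on U f -> smooth_on U g ->
  dM c i (fun q => f q + g q) p = dM c i f p + dM c i g p.
Proof.
move=> ac cp Up Hf Hg; rewrite /dM.
by apply: pderD; [exact: smooth_derivable Hf|exact: smooth_derivable Hg].
Qed.

Lemma dM_mul c i U f g p : atlas c -> chart_dom c p -> U p -> smooth_on U f -> smooth_on U g ->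
  dM c i (fun q => f q * g q) p = dM c i f p * g p + f p * dM c i g p.
Proof.
move=> ac cp Up Hf Hg; rewrite /dM.
rewrite (@pderM _ (f \o chart_inv c) (g \o chart_inv c)); last 2 first.
- exact: smooth_derivable Hf.
- exact: smooth_derivable Hg.
by rewrite /= !invK// addrC mulrC.
Qed.

Lemma dM_opp c i U f p : atlas c -> chart_dom c p -> U p -> smooth_on U f ->
  dM c i (fun q => - f q) p = - dM c i f p.
Proof.
move=> ac cp Up Hf.
have := @dM_mul c i U (fun=> -1) f p ac cp Up (smooth_cst _ _) Hf.
rewrite (_ : (fun q => -1 * f q) = (fun q => - f q)); last by apply/funext => q; rewrite mulN1r.
by move=> ->; rewrite /dM pder_cst mul0r add0r mulN1r.
Qed.

Lemma dC_cst c i (a : C) p : dC c i (fun=> a) p = 0.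
Proof. by rewrite /dC /dM !pder_cst. Qed.

Lemma dC_add c i u w p : atlas c -> chart_dom c p -> csmooth_near p u -> csmooth_near p w ->
  dC c i (fun q => u q + w q) p = dC c i u p + dC c i w p.
Proof.
move=> ac cp [U [oU Up Hu]] [W [oW Wp Hw]].
have [[u1 u2] [w1 w2]] : csmooth_on (U `&` W) u /\ csmooth_on (U `&` W) w.
  by split; [apply: csmooth_sub Hu => q []|apply: csmooth_sub Hw => q []].
have UWp : (U `&` W) p by [].
rewrite {1}/dC.
under [X in dM _ _ X]eq_fun do rewrite ReD.
under [X in _ +i* dM _ _ X _]eq_fun do rewrite ImD.
by rewrite (dM_sum i ac cp UWp u1 w1) (dM_sum i ac cp UWp u2 w2).
Qed.

Lemma dC_mul c i u w p : atlas c -> chart_dom c p -> csmooth_near p u -> csmooth_near p w ->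
  dC c i (fun q => u q * w q) p = dC c i u p * w p + u p * dC c i w p.
Proof.
move=> ac cp [U [oU Up Hu]] [W [oW Wp Hw]].
have oUW : open (U `&` W) by exact: openI.
have [[u1 u2] [w1 w2]] : csmooth_on (U `&` W) u /\ csmooth_on (U `&` W) w.
  by split; [apply: csmooth_sub Hu => q []|apply: csmooth_sub Hw => q []].
have UWp : (U `&` W) p by [].
rewrite {1}/dC.
under [X in dM _ _ X]eq_fun do rewrite ReM.
under [X in _ +i* dM _ _ X _]eq_fun do rewrite ImM.
rewrite (dM_sum i ac cp UWp (smoothM oUW u1 w1) (smoothN oUW (smoothM oUW u2 w2))).
rewrite (dM_opp i ac cp UWp (smoothM oUW u2 w2)).
rewrite (dM_sum i ac cp UWp (smoothM oUW u1 w2) (smoothM oUW u2 w1)).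
rewrite (dM_mul i ac cp UWp u1 w1) (dM_mul i ac cp UWp u2 w2).
rewrite (dM_mul i ac cp UWp u1 w2) (dM_mul i ac cp UWp u2 w1).
apply: complex_eq; rewrite (ReD, ImD) !(ReM, ImM) /=; ring.
Qed.

End SmoothFunctions.

(** * Tangent vectors, vector fields and exterior derivatives *)

Section Tangent.
Variables (R : realType) (M : manifold3 R).
Local Notation C := R[i].
Local Notation V := 'rV[R]_3.
Implicit Types (c d : chart R M) (U W : set M) (p q : M) (u w : M -> C) (v : cvector M).
Implicit Types (X Y Z : vfield M) (al : form1 M).

Lemma tangentD p v u w : is_tangent p v -> csmooth_near p u -> csmooth_near p w ->
  v (fun q => u q + w q) = v u + v w.
Proof.
move=> [lin _ _] hu hw; have := lin 1 u w hu hw; rewrite mul1r => <-.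
by congr v; apply/funext => q; rewrite mul1r.
Qed.

Lemma tangentM p v u w : is_tangent p v -> csmooth_near p u -> csmooth_near p w ->
  v (fun q => u q * w q) = v u * w p + u p * v w.
Proof. by move=> [_ leib _]; exact: leib. Qed.

Lemma tangent_cst p v (a : C) : is_tangent p v -> v (fun=> a) = 0.
Proof.
move=> tv; have s1 (b : C) := csmooth_near_cst b p.
have v0 : v (fun=> 0) = 0.
  have := tangentM tv (s1 0) (s1 0); by rewrite !mulr0 mul0r addr0.
have v1 : v (fun=> 1) = 0.
  have := tangentM tv (s1 1) (s1 1); rewrite !mulr1 mul1r.
  by move=> /eqP; rewrite -subr_eq subrr eq_sym => /eqP.
have [lin _ _] := tv; have := lin a _ _ (s1 1) (s1 0); rewrite v1 v0 mulr0 !addr0.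
by rewrite mulr1.
Qed.

(** Multiplying [u - w] by a function that is [0] near [p] and [1] where
    [u] and [w] differ does not change it, so the Leibniz rule kills it. *)
Lemma tangent_near p v u w : is_tangent p v -> (\near p, u p = w p) -> v u = v w.
Proof.
move=> tv E; have [su|nsu] := pselect (csmooth_near p u); last first.
  have nsw : ~ csmooth_near p w.
    move=> sw; apply: nsu; apply: csmooth_near_eq sw.
    by apply: filterS E => q ->.
  by have [_ _ z] := tv; rewrite !z.
have sw := csmooth_near_eq E su.
pose k q : C := if `[< u q = w q >] then 0 else 1.
have kE : \near p, k p = 0 by apply: filterS E => q e; rewrite /k asboolT.
have sk : csmooth_near p k.
  apply: csmooth_near_eq (csmooth_near_cst 0 p); by apply: filterS kE => q ->.
have kp : k p = 0 by exact: (nbhs_singleton kE).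
pose z q := u q + (-1) * w q.
have sm : csmooth_near p (fun q => (-1) * w q).
  by apply: csmooth_nearM => //; exact: csmooth_near_cst.
have sz : csmooth_near p z by exact: csmooth_nearD.
have zk : (fun q => z q * k q) = z.
  apply/funext => q; rewrite /k; case: asboolP => [e|_]; last by rewrite mulr1.
  by rewrite mulr0 /z e mulN1r subrr.
have zp : z p = 0 by rewrite /z (nbhs_singleton E) mulN1r subrr.
have : v z = 0 by rewrite -zk (tangentM tv sz sk) kp zp mulr0 mul0r addr0.
rewrite /z (tangentD tv su sm) (tangentM tv (csmooth_near_cst (-1) p) sw).
rewrite (tangent_cst _ tv) mul0r add0r mulN1r => /eqP.
by rewrite subr_eq0 => /eqP.
Qed.

Lemma tangent_sum p v (I : Type) (r : seq I) (F : I -> M -> C) : is_tangent p v ->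
  (forall i, csmooth_near p (F i)) ->
  csmooth_near p (fun q => \sum_(i <- r) F i q) /\
  v (fun q => \sum_(i <- r) F i q) = \sum_(i <- r) v (F i).
Proof.
move=> tv sF; elim: r => [|i r [IH1 IH2]].
  have -> : (fun q : M => \sum_(i <- [::]) F i q) = (fun=> 0).
    by apply/funext => q; rewrite big_nil.
  by split; [exact: csmooth_near_cst|rewrite big_nil; exact: tangent_cst tv].
have -> : (fun q : M => \sum_(j <- i :: r) F j q) = (fun q => F i q + \sum_(j <- r) F j q).
  by apply/funext => q; rewrite big_cons.
split; first exact: csmooth_nearD.
by rewrite (tangentD tv) // IH2 big_cons.
Qed.

(** A tangent vector acts on real functions through their differential:
    Hadamard's lemma writes [f - f p] as a combination of products of
    functions that vanish at [p]. *)
Lemma tangent_coord_real c p v U (f : M -> R) : atlas c -> chart_dom c p ->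
  is_tangent p v -> open U -> U p -> smooth_on U f ->
  v (cfun_of f) = \sum_i v (ccoord c i) * (dM c i f p)%:C.
Proof.
move=> ac cp tv oU Up Hf.
pose h := f \o chart_inv c; pose x0 := chart_map c p.
have [r r0 rU] := open_dist (@open_img _ _ c U oU) (img_mem cp Up).
have Bs : cball x0 r `<=` img c U by [].
have Hh k : Ck_on k (cball x0 r) h by apply: Ck_sub (Hf c ac k).
have Bx0 : cball x0 r x0 by rewrite /cball /= subrr normr0.
pose G i : M -> R := fun q => radial x0 0 (pder i h) (chart_map c q).
pose B : set M := chart_dom c `&` chart_map c @^-1` cball x0 r.
have nB : nbhs p B.
  apply: filterI; first by apply: open_nbhs_nbhs; split => //; exact: chart_dom_open.
  apply: (map_cont cp); apply: open_nbhs_nbhs; split => //; exact: open_cball.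
have imgB : img c (B^°) `<=` cball x0 r.
  by move=> _ [q [_ /interior_subset[_ Bq]] <-].
have sG i : csmooth_near p (cfun_of (G i)).
  exists (B^°); split => //; first exact: open_interior.
  apply: csmooth_real; apply: (@smooth_chart _ _ c) => //.
  - exact: open_interior.
  - by move=> q /interior_subset[].
  move=> k; apply: (@Ck_eq _ _ _ (radial x0 0 (pder i h))).
  - by apply: open_img; exact: open_interior.
  - by move=> x /imgP[_ _ Ex]; rewrite /= /G Ex.
  - apply: (Ck_sub imgB); apply: radial_Ck; exact: Ck_pder.
have sx i : csmooth_near p (ccoord c i).
  by exists (chart_dom c); split=> //; [exact: chart_dom_open|exact: csmooth_ccoord].
pose F i q := (ccoord c i q + - ccoord c i p) * cfun_of (G i) q.
have sF' i : csmooth_near p (fun q => ccoord c i q + - ccoord c i p).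
  by apply: csmooth_nearD => //; exact: csmooth_near_cst.
have sF i : csmooth_near p (F i) by exact: csmooth_nearM.
pose fp : C := (f p)%:C.
have E : \near p, (cfun_of f) p = (fun q => fp + \sum_i F i q) p.
  apply: filterS nB => q [cq Bq].
  have := hadamard Bq (Hh 2); rewrite /h /= !invK// => e.
  apply: etrans (congr1 (fun z => z%:C) e) _; rewrite rmorphD /= rmorph_sum /=.
  congr (_ + _); apply: eq_bigr => i _.
  by rewrite /F /ccoord /cfun_of /xcoord rmorphM rmorphB.
rewrite (tangent_near tv E).
have [sS vS] := tangent_sum (index_enum 'I_3) tv sF.
rewrite (tangentD tv (csmooth_near_cst _ p) sS) vS (tangent_cst _ tv) add0r.
apply: eq_bigr => i _; rewrite (tangentM tv (sF' i) (sG i)) subrr mul0r addr0.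
rewrite (tangentD tv (sx i) (csmooth_near_cst _ p)) (tangent_cst _ tv) addr0.
by congr (_ * _); rewrite /cfun_of /G (radial0_center _ Bx0).
Qed.

Lemma tangent_coord c p v u : atlas c -> chart_dom c p -> is_tangent p v -> csmooth_near p u ->
  v u = \sum_i v (ccoord c i) * dC c i u p.
Proof.
move=> ac cp tv [U [oU Up [u1 u2]]].
have s1 : csmooth_near p (cfun_of (fun q => complex.Re (u q))).
  by exists U; split => //; exact: csmooth_real.
have s2 : csmooth_near p (cfun_of (fun q => complex.Im (u q))).
  by exists U; split => //; exact: csmooth_real.
have -> : u = (fun q => cfun_of (fun q => complex.Re (u q)) q + 'i * cfun_of (fun q => complex.Im (u q)) q).
  by apply/funext => q; rewrite [LHS]complexE.
have si := csmooth_near_cst ('i : C) p.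
rewrite (tangentD tv s1 (csmooth_nearM si s2)) (tangentM tv si s2) (tangent_cst _ tv) mul0r add0r.
rewrite (tangent_coord_real ac cp tv oU Up u1) (tangent_coord_real ac cp tv oU Up u2).
rewrite mulr_sumr -big_split /=; apply: eq_bigr => i _.
rewrite mulrCA -mulrDr; congr (_ * _).
rewrite (dC_add i ac cp s1 (csmooth_nearM si s2)) (dC_mul i ac cp si s2) dC_cst mul0r add0r.
by rewrite /dC /dM !pder_cst.
Qed.

Lemma tangent_ext c p v v' : atlas c -> chart_dom c p -> is_tangent p v -> is_tangent p v' ->
  (forall i, v (ccoord c i) = v' (ccoord c i)) -> v = v'.
Proof.
move=> ac cp tv tv' E; apply/funext => u.
have [su|nsu] := pselect (csmooth_near p u); last first.
  by have [_ _ z] := tv; have [_ _ z'] := tv'; rewrite z// z'.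
rewrite (tangent_coord ac cp tv su) (tangent_coord ac cp tv' su).
by apply: eq_bigr => i _; rewrite E.
Qed.

Lemma tangent_lin p a v v' : is_tangent p v -> is_tangent p v' -> is_tangent p (lincombv a v v').
Proof.
move=> [l1 m1 z1] [l2 m2 z2]; split.
- by move=> b f g sf sg; rewrite /lincombv l1// l2//; ring.
- by move=> f g sf sg; rewrite /lincombv m1// m2//; ring.
- by move=> f nf; rewrite /lincombv z1// z2// mulr0 addr0.
Qed.

Lemma tangent_zero p : is_tangent p (fun=> 0 : C).
Proof.
by split=> [a f g _ _|f g _ _|//]; rewrite ?mulr0 ?mul0r ?addr0.
Qed.

Lemma scalev_lin (a : C) v : scalev a v = lincombv a v (fun=> 0).
Proof. by apply/funext => f; rewrite /lincombv /scalev addr0. Qed.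

Lemma tangent_scale p a v : is_tangent p v -> is_tangent p (scalev a v).
Proof. by move=> tv; rewrite scalev_lin; apply: tangent_lin => //; exact: tangent_zero. Qed.

Lemma csmooth_nearJP p u : csmooth_near p (fun q => (u q)^c) <-> csmooth_near p u.
Proof.
split=> [H|]; last exact: csmooth_nearJ.
have := csmooth_nearJ H; congr csmooth_near; apply/funext => q; exact: conjcK.
Qed.

Lemma tangent_conj p v : is_tangent p v -> is_tangent p (conjv v).
Proof.
move=> tv; have [l m z] := tv; split.
- move=> a f g /csmooth_nearJP sf /csmooth_nearJP sg; rewrite /conjv.
  have -> : (fun q => (a * f q + g q)^c) = (fun q => a^c * (f q)^c + (g q)^c).
    by apply/funext => q; rewrite conjcD conjcM.
  by rewrite l// conjcD conjcM conjcK.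
- move=> f g /csmooth_nearJP sf /csmooth_nearJP sg; rewrite /conjv.
  have -> : (fun q => (f q * g q)^c) = (fun q => (f q)^c * (g q)^c).
    by apply/funext => q; rewrite conjcM.
  by rewrite m// conjcD !conjcM !conjcK.
- by move=> f nf; rewrite /conjv z ?conjc0 // => /csmooth_nearJP.
Qed.

Lemma conjvK v : conjv (conjv v) = v.
Proof.
apply/funext => f; rewrite /conjv conjcK; congr v; apply/funext => q; exact: conjcK.
Qed.

Lemma conjv_lin a v v' : conjv (lincombv a v v') = lincombv a^c (conjv v) (conjv v').
Proof. by apply/funext => f; rewrite /conjv /lincombv conjcD conjcM. Qed.

Lemma conjv_scale a v : conjv (scalev a v) = scalev a^c (conjv v).
Proof. by apply/funext => f; rewrite /conjv /scalev conjcM. Qed.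

(** ** Vector fields *)

Lemma vf_tangent U X p : smooth_vfield U X -> U p -> is_tangent p (X p).
Proof. by move=> [t _]; exact: t. Qed.

Lemma vf_smooth U W X u : smooth_vfield U X -> open W -> W `<=` U -> csmooth_on W u ->
  csmooth_on W (vderiv X u).
Proof. by move=> [_ s]; exact: s. Qed.

Lemma vf_sub U W X : W `<=` U -> smooth_vfield U X -> smooth_vfield W X.
Proof.
move=> WU [t s]; split=> [p /WU/t//|V' f oV V'W]; apply: s => //.
exact: subset_trans WU.
Qed.

Lemma vf_near p U X u : open U -> U p -> smooth_vfield U X -> csmooth_near p u ->
  csmooth_near p (vderiv X u).
Proof.
move=> oU Up sX [W [oW Wp su]]; exists (U `&` W); split=> //; first exact: openI.
apply: (vf_smooth sX); [exact: openI|by move=> q []|].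
by apply: csmooth_sub su => q [].
Qed.

Lemma vf_eq U X Y : (forall p, U p -> X p = Y p) -> smooth_vfield U X -> smooth_vfield U Y.
Proof.
move=> E [t s]; split=> [p Up|W f oW WU sf]; first by rewrite -E//; exact: t.
by apply: csmooth_eq (s W f oW WU sf) => // p /WU Up; rewrite /vderiv E.
Qed.

Definition linf (a : M -> C) X Y : vfield M := fun p => lincombv (a p) (X p) (Y p).
Definition zerof : vfield M := fun _ _ => 0.
Definition scalef (a : M -> C) X : vfield M := fun p => scalev (a p) (X p).

Lemma vf_lin U a X Y : open U -> csmooth_on U a -> smooth_vfield U X -> smooth_vfield U Y ->
  smooth_vfield U (linf a X Y).
Proof.
move=> oU sa [tX sX] [tY sY]; split=> [p Up|W f oW WU sf].
  by apply: tangent_lin; [exact: tX|exact: tY].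
apply: csmoothD => //; last exact: sY.
by apply: csmoothM => //; [exact: csmooth_sub sa|exact: sX].
Qed.

Lemma vf_zero U : smooth_vfield U zerof.
Proof. by split=> [p _|W f _ _ _]; [exact: tangent_zero|exact: csmooth_cst]. Qed.

Lemma scalef_lin a X : scalef a X = linf a X zerof.
Proof. by apply/funext => p; exact: scalev_lin. Qed.

Lemma vf_scale U a X : open U -> csmooth_on U a -> smooth_vfield U X ->
  smooth_vfield U (scalef a X).
Proof. by move=> oU sa sX; rewrite scalef_lin; apply: vf_lin => //; exact: vf_zero. Qed.

Lemma vf_conj U X : open U -> smooth_vfield U X -> smooth_vfield U (conjvf X).
Proof.
move=> oU [tX sX]; split=> [p Up|W f oW WU sf]; first by apply: tangent_conj; exact: tX.
by apply: csmoothJ => //; apply: sX => //; exact: csmoothJ.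
Qed.

Lemma bracketE X Y p u : csmooth_near p u ->
  bracket X Y p u = X p (vderiv Y u) - Y p (vderiv X u).
Proof. by move=> su; rewrite /bracket asboolT. Qed.

Lemma bracket_out X Y p u : ~ csmooth_near p u -> bracket X Y p u = 0.
Proof. by move=> su; rewrite /bracket asboolF. Qed.

Lemma vderivM_near U X p u w : open U -> U p -> smooth_vfield U X ->
  csmooth_near p u -> csmooth_near p w ->
  \near p, vderiv X (fun q => u q * w q) p = vderiv X u p * w p + u p * vderiv X w p.
Proof.
move=> oU Up sX [W1 [wo1 p1 s1]] [W2 [wo2 p2 s2]].
apply: (@near_open _ (U `&` (W1 `&` W2))); [by do 2 apply: openI => //|by []|].
move=> q [Uq [q1 q2]]; apply: (tangentM (vf_tangent sX Uq)); by [exists W1|exists W2].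
Qed.

Lemma vderivL_near U X p (a : C) u w : open U -> U p -> smooth_vfield U X ->
  csmooth_near p u -> csmooth_near p w ->
  \near p, vderiv X (fun q => a * u q + w q) p = a * vderiv X u p + vderiv X w p.
Proof.
move=> oU Up sX [W1 [wo1 p1 s1]] [W2 [wo2 p2 s2]].
apply: (@near_open _ (U `&` (W1 `&` W2))); [by do 2 apply: openI => //|by []|].
move=> q [Uq [q1 q2]]; have [l _ _] := vf_tangent sX Uq.
by apply: l; [exists W1|exists W2].
Qed.

Lemma tangent_bracket U X Y p : open U -> U p -> smooth_vfield U X -> smooth_vfield U Y ->
  is_tangent p (bracket X Y p).
Proof.
move=> oU Up sX sY; have tX := vf_tangent sX Up; have tY := vf_tangent sY Up.
split.
- move=> a f g sf sg.
  have sfg : csmooth_near p (fun q => a * f q + g q).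
    by apply: csmooth_nearD => //; apply: csmooth_nearM => //; exact: csmooth_near_cst.
  rewrite !bracketE//.
  rewrite (tangent_near tX (vderivL_near a oU Up sY sf sg)).
  rewrite (tangent_near tY (vderivL_near a oU Up sX sf sg)).
  have [lX _ _] := tX; have [lY _ _] := tY.
  rewrite lX; [|exact: vf_near sY sf|exact: vf_near sY sg].
  rewrite lY; [|exact: vf_near sX sf|exact: vf_near sX sg].
  by ring.
- move=> f g sf sg.
  have sfg : csmooth_near p (fun q => f q * g q) by exact: csmooth_nearM.
  rewrite !bracketE//.
  rewrite (tangent_near tX (vderivM_near oU Up sY sf sg)).
  rewrite (tangent_near tY (vderivM_near oU Up sX sf sg)).
  have sYf := vf_near oU Up sY sf; have sYg := vf_near oU Up sY sg.
  have sXf := vf_near oU Up sX sf; have sXg := vf_near oU Up sX sg.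
  rewrite (tangentD tX); [|exact: csmooth_nearM|exact: csmooth_nearM].
  rewrite (tangentD tY); [|exact: csmooth_nearM|exact: csmooth_nearM].
  rewrite !(tangentM tX)// !(tangentM tY)//.
  by rewrite /vderiv; ring.
- by move=> f nf; exact: bracket_out.
Qed.

Lemma vf_bracket U X Y : open U -> smooth_vfield U X -> smooth_vfield U Y ->
  smooth_vfield U (bracket X Y).
Proof.
move=> oU sX sY; split=> [p Up|W f oW WU sf]; first exact: tangent_bracket sX sY.
have h : csmooth_on W (fun p => vderiv X (vderiv Y f) p - vderiv Y (vderiv X f) p).
  by apply: csmoothB => //; [apply: (vf_smooth sX) => //; exact: (vf_smooth sY)|
    apply: (vf_smooth sY) => //; exact: (vf_smooth sX)].
apply: csmooth_eq h => // p Wp; rewrite /vderiv bracketE//.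
exact: (csmooth_nearW oW Wp).
Qed.

(** ** One-forms and their exterior derivatives *)

Lemma form_lin U al p a v v' : smooth_form1 U al -> U p -> is_tangent p v -> is_tangent p v' ->
  al p (lincombv a v v') = a * al p v + al p v'.
Proof. by move=> [l _] Up; exact: l. Qed.

Lemma form_smooth U W X al : smooth_form1 U al -> open W -> W `<=` U -> smooth_vfield W X ->
  csmooth_on W (contract al X).
Proof. by move=> [_ s]; exact: s. Qed.

Lemma form_zero U al p : smooth_form1 U al -> U p -> al p (fun=> 0) = 0.
Proof.
move=> sal Up; have := form_lin (-1) sal Up (tangent_zero p) (tangent_zero p).
have -> : lincombv (-1) (fun=> 0) (fun=> 0) = (fun=> 0) :> cvector M.
  by apply/funext => f; rewrite /lincombv mulr0 addr0.
by rewrite mulN1r addNr.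
Qed.

Lemma form_scale U al p a v : smooth_form1 U al -> U p -> is_tangent p v ->
  al p (scalev a v) = a * al p v.
Proof.
move=> sal Up tv; rewrite scalev_lin (form_lin _ sal Up tv (tangent_zero p)).
by rewrite (form_zero sal Up) addr0.
Qed.

Lemma form_sub U W al : W `<=` U -> smooth_form1 U al -> smooth_form1 W al.
Proof.
move=> WU [l s]; split=> [p /WU Up|V' X oV V'W]; first exact: l.
by apply: s => //; exact: subset_trans WU.
Qed.

Lemma extd_local al X Y X' Y' U p : open U -> U p ->
  smooth_vfield U X -> smooth_vfield U Y ->
  (forall q, U q -> X q = X' q) -> (forall q, U q -> Y q = Y' q) ->
  extd al X Y p = extd al X' Y' p.
Proof.
move=> oU Up sX sY EX EY; have tX := vf_tangent sX Up; have tY := vf_tangent sY Up.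
have n (Q : M -> Prop) : (forall q, U q -> Q q) -> \near p, Q p by exact: near_open.
rewrite /extd /vderiv -(EX p Up) -(EY p Up).
have -> : X p (contract al Y') = X p (contract al Y).
  by apply: (tangent_near tX); apply: n => q Uq; rewrite /contract EY.
have -> : Y p (contract al X') = Y p (contract al X).
  by apply: (tangent_near tY); apply: n => q Uq; rewrite /contract EX.
congr (_ - al p _); apply/funext => f.
have [sf|nsf] := pselect (csmooth_near p f); last by rewrite !bracket_out.
rewrite !bracketE// -(EX p Up) -(EY p Up).
rewrite (@tangent_near p (X p) (vderiv Y f) (vderiv Y' f))//; last first.
  by apply: n => q Uq; rewrite /vderiv EY.
rewrite (@tangent_near p (Y p) (vderiv X f) (vderiv X' f))//.
by apply: n => q Uq; rewrite /vderiv EX.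
Qed.

Lemma bracket_lin U a X X' Y p : open U -> U p -> csmooth_on U a ->
  smooth_vfield U X -> smooth_vfield U X' -> smooth_vfield U Y ->
  bracket (linf a X X') Y p =
  lincombv (a p) (bracket X Y p) (lincombv (- Y p a) (X p) (bracket X' Y p)).
Proof.
move=> oU Up sa sX sX' sY; apply/funext => f.
have [sf|nsf] := pselect (csmooth_near p f); last first.
  rewrite /lincombv !bracket_out// !(mulr0, addr0).
  by have [_ _ z] := vf_tangent sX Up; rewrite z// mulr0 addr0.
rewrite /lincombv !bracketE// /linf /lincombv.
have tY := vf_tangent sY Up.
have sX'f := vf_near oU Up sX' sf; have sXf := vf_near oU Up sX sf.
have sa' := csmooth_nearW oU Up sa.
have -> : Y p (vderiv (fun p0 => fun f0 => a p0 * X p0 f0 + X' p0 f0) f) =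
    Y p a * X p f + a p * Y p (vderiv X f) + Y p (vderiv X' f).
  have := tangentD tY (csmooth_nearM sa' sXf) sX'f.
  by rewrite (tangentM tY sa' sXf) => <-.
by ring.
Qed.

Lemma extd_lin U al a X X' Y p : open U -> U p -> smooth_form1 U al -> csmooth_on U a ->
  smooth_vfield U X -> smooth_vfield U X' -> smooth_vfield U Y ->
  extd al (linf a X X') Y p = a p * extd al X Y p + extd al X' Y p.
Proof.
move=> oU Up sal sa sX sX' sY.
have tX := vf_tangent sX Up; have tX' := vf_tangent sX' Up; have tY := vf_tangent sY Up.
have cX := csmooth_nearW oU Up (form_smooth sal oU (@subset_refl _ U) sX).
have cX' := csmooth_nearW oU Up (form_smooth sal oU (@subset_refl _ U) sX').
have sa' := csmooth_nearW oU Up sa.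
have tb := tangent_bracket oU Up sX sY; have tb' := tangent_bracket oU Up sX' sY.
rewrite /extd /vderiv (@tangent_near p (Y p) _ (fun q => a q * contract al X q + contract al X' q) tY); last first.
  apply: (@near_open _ U) => // q Uq.
  by rewrite /contract (form_lin _ sal Uq (vf_tangent sX Uq) (vf_tangent sX' Uq)).
rewrite (tangentD tY (csmooth_nearM sa' cX) cX') (tangentM tY sa' cX).
rewrite /contract (bracket_lin oU Up sa sX sX' sY).
rewrite (form_lin _ sal Up tb (tangent_lin _ tX tb')) (form_lin _ sal Up tX tb').
rewrite /vderiv /linf /lincombv /contract; ring.
Qed.

Lemma bracketC X Y p : bracket X Y p = scalev (-1) (bracket Y X p).
Proof.
apply/funext => f; rewrite /scalev; have [sf|nsf] := pselect (csmooth_near p f).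
  by rewrite !bracketE// mulN1r opprB.
by rewrite !bracket_out// mulr0.
Qed.

Lemma extdC U al X Y p : open U -> U p -> smooth_form1 U al ->
  smooth_vfield U X -> smooth_vfield U Y -> extd al X Y p = - extd al Y X p.
Proof.
move=> oU Up sal sX sY; rewrite /extd {3}/contract bracketC.
rewrite (form_scale _ sal Up (tangent_bracket oU Up sY sX)) /contract; ring.
Qed.

(** ** Coordinate vector fields *)

Definition pd c i : vfield M := fun p f => if `[< csmooth_near p f >] then dC c i f p else 0.

Lemma pdE c i p u : csmooth_near p u -> pd c i p u = dC c i u p.
Proof. by move=> su; rewrite /pd asboolT. Qed.

Lemma vf_pd c i : atlas c -> smooth_vfield (chart_dom c) (pd c i).
Proof.
move=> ac; split=> [p cp|W f oW Wc sf]; last first.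
  apply: csmooth_eq (csmooth_dC i ac oW Wc sf) => // p Wp.
  by rewrite /vderiv pdE//; exact: (csmooth_nearW oW Wp).
split.
- move=> a f g sf sg; have sa := csmooth_near_cst a p.
  have saf := csmooth_nearM sa sf.
  rewrite !pdE//; last exact: csmooth_nearD.
  by rewrite (dC_add i ac cp saf sg) (dC_mul i ac cp sa sf) dC_cst mul0r add0r.
- by move=> f g sf sg; rewrite !pdE//; [exact: dC_mul|exact: csmooth_nearM].
- by move=> f nf; rewrite /pd asboolF.
Qed.

(** The value at [p] of the exterior derivative of [al], as a bilinear form in
    the components of two tangent vectors with respect to a chart. *)
Definition dd c al p v v' : C :=
  \sum_i \sum_j v (ccoord c i) * v' (ccoord c j) * extd al (pd c i) (pd c j) p.

Lemma vf_expand c U X p : atlas c -> open U -> smooth_vfield U X -> U p -> chart_dom c p ->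
  X p = linf (vderiv X (ccoord c i0)) (pd c i0)
       (linf (vderiv X (ccoord c i1)) (pd c i1)
       (linf (vderiv X (ccoord c i2)) (pd c i2) zerof)) p.
Proof.
move=> ac oU sX Up cp; have tX := vf_tangent sX Up.
have tp i := vf_tangent (vf_pd i ac) cp.
apply: (tangent_ext ac cp tX).
  by do 3 (apply: tangent_lin => //); exact: tangent_zero.
move=> i; rewrite /linf /lincombv /zerof /vderiv.
have sx : csmooth_near p (ccoord c i).
  by exists (chart_dom c); split=> //; [exact: chart_dom_open|exact: csmooth_ccoord].
rewrite !pdE// !dC_coord//.
by have [->|->|->] := ord3P i; rewrite !eqE /= !(mulr0, mulr1, addr0, add0r).
Qed.

Lemma extd_tensor c U al X Y p : atlas c -> chart_dom c p -> open U -> U p ->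
  smooth_form1 U al -> smooth_vfield U X -> smooth_vfield U Y ->
  extd al X Y p = dd c al p (X p) (Y p).
Proof.
move=> ac cp oU Up sal sX sY.
pose W := U `&` chart_dom c.
have oW : open W by apply: openI => //; exact: chart_dom_open.
have Wp : W p by [].
have sal' : smooth_form1 W al by apply: form_sub sal => q [].
have sX' : smooth_vfield W X by apply: vf_sub sX => q [].
have sY' : smooth_vfield W Y by apply: vf_sub sY => q [].
have sp i : smooth_vfield W (pd c i) by apply: vf_sub (vf_pd i ac) => q [].
have sx i : csmooth_on W (ccoord c i) by apply: csmooth_sub (csmooth_ccoord i ac) => q [].
have cX i : csmooth_on W (vderiv X (ccoord c i)) by exact: (vf_smooth sX').
have cY i : csmooth_on W (vderiv Y (ccoord c i)) by exact: (vf_smooth sY').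
have sz := vf_zero W.
have expand1 (A B : vfield M) : smooth_vfield W A -> smooth_vfield W B ->
    extd al A B p = \sum_i A p (ccoord c i) * extd al (pd c i) B p.
  move=> sA sB.
  have cA i : csmooth_on W (vderiv A (ccoord c i)) by exact: (vf_smooth sA).
  have ez : extd al zerof B p = 0.
    rewrite (extdC oW Wp sal' sz sB) /extd /vderiv.
    have tB := vf_tangent sB Wp.
    rewrite (@tangent_near p (B p) (contract al zerof) (fun=> 0) tB); last first.
      by apply: (@near_open _ W) => // q Wq; rewrite /contract /zerof (form_zero sal' Wq).
    have -> : contract al (bracket B zerof) p = al p (fun=> 0).
      congr (al p _); apply/funext => f; have [sf|nsf] := pselect (csmooth_near p f); last first.
        by rewrite bracket_out.
      by rewrite bracketE// /zerof (tangent_cst _ tB) subrr.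
    by rewrite (form_zero sal' Wp) (tangent_cst _ tB) /vderiv /zerof !subr0 oppr0.
  rewrite (@extd_local al A B _ B W p oW Wp sA sB
     (fun q Wq => vf_expand ac oW sA Wq (proj2 Wq)) (fun q _ => erefl)).
  have L2 := vf_lin oW (cA i2) (sp i2) sz.
  have L1 := vf_lin oW (cA i1) (sp i1) L2.
  rewrite (extd_lin oW Wp sal' (cA i0) (sp i0) L1 sB) (extd_lin oW Wp sal' (cA i1) (sp i1) L2 sB).
  by rewrite (extd_lin oW Wp sal' (cA i2) (sp i2) sz sB) ez addr0 sum3 addrA.
rewrite (expand1 _ _ sX' sY') /dd; apply: eq_bigr => i _.
rewrite (extdC oW Wp sal' (sp i) sY') (expand1 _ _ sY' (sp i)) -sumrN mulr_sumr.
apply: eq_bigr => j _; rewrite -mulrN -(extdC oW Wp sal' (sp i) (sp j)) mulrA.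
by [].
Qed.

End Tangent.

(** * Tensor calculus in a pseudohermitian frame *)

Section FrameAlgebra.
Variables (A : comPzRingType) (I : A) (conj T Z Zb : A -> A).
Hypothesis II : I * I = -1.

Record is_der (D : A -> A) : Prop := IsDer {
  derD : forall x y, D (x + y) = D x + D y;
  derM : forall x y, D (x * y) = D x * y + x * D y;
  derI : D I = 0 }.
Hypotheses (dT : is_der T) (dZ : is_der Z) (dZb : is_der Zb).

Record is_conj : Prop := IsConj {
  conjD : forall x y, conj (x + y) = conj x + conj y;
  conjM : forall x y, conj (x * y) = conj x * conj y;
  conjIn : forall x, conj (conj x) = x;
  conjI : conj I = - I;
  conjZ : forall x, conj (Z x) = Zb (conj x);
  conjZb : forall x, conj (Zb x) = Z (conj x);
  conjT : forall x, conj (T x) = T (conj x) }.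
Hypothesis cj : is_conj.

Lemma der0 D : is_der D -> D 0 = 0.
Proof. by move=> d; have := derD d 0 0; rewrite addr0 => /eqP; rewrite -subr_eq subrr eq_sym => /eqP. Qed.
Lemma derN D x : is_der D -> D (- x) = - D x.
Proof.
by move=> d; apply/eqP; rewrite -subr_eq0 opprK addrC -derD// subrr der0.
Qed.
Lemma der1 D : is_der D -> D 1 = 0.
Proof.
move=> d; have := derM d 1 1; rewrite !mulr1 mul1r => /eqP.
by rewrite -subr_eq subrr eq_sym => /eqP.
Qed.
Lemma der_nat D n : is_der D -> D n%:R = 0.
Proof.
by move=> d; elim: n => [|n IH]; rewrite ?mulr0n ?der0// -[n.+1]addn1 natrD derD// IH der1// addr0.
Qed.
Lemma conj0 : conj 0 = 0.
Proof. by have := conjD cj 0 0; rewrite addr0 => /eqP; rewrite -subr_eq subrr eq_sym => /eqP. Qed.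
Lemma conjN x : conj (- x) = - conj x.
Proof.
by apply/eqP; rewrite -subr_eq0 opprK addrC -(conjD cj) subrr conj0.
Qed.
Lemma conj1r : conj 1 = 1.
Proof. by rewrite -[LHS]mul1r -[X in X * _](conjIn cj) -(conjM cj) mulr1 (conjIn cj). Qed.
Lemma conj_nat n : conj n%:R = n%:R.
Proof.
elim: n => [|n IH]; first by rewrite mulr0n conj0.
by rewrite -[n.+1]addn1 natrD (conjD cj) IH conj1r.
Qed.

Definition cE := (conj0, conj_nat, conj1r, conjD cj, conjM cj, conjN, conjZ cj, conjZb cj, conjT cj,
  conjIn cj, conjI cj).
Definition dTE := (der0 dT, fun n => der_nat n dT, der1 dT, derD dT, derM dT, fun x => derN x dT, derI dT).
Definition dZE := (der0 dZ, fun n => der_nat n dZ, der1 dZ, derD dZ, derM dZ, fun x => derN x dZ, derI dZ).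
Definition dZbE := (der0 dZb, fun n => der_nat n dZb, der1 dZb, derD dZb, derM dZb, fun x => derN x dZb, derI dZb).

(** Proves an identity that is a linear combination of known ones: each
    application subtracts the multiple [c] of a known identity, and what is left
    holds in the polynomial ring. *)
Lemma lc (c : A) l r x y : l = r -> x = y + c * (l - r) -> x = y.
Proof. by move=> -> ->; rewrite subrr mulr0 addr0. Qed.
Arguments lc c {l r x y} _ _.

Variables (w0 w1 wb a ac W : A).

(** The commutators of the frame, and the components of the structure
    equations of the connection form [w0 theta + w1 theta^1 + wb theta^1bar]. *)
Record frame_eqs : Prop := FrameEqs {
  cw1 : conj w1 = - wb;
  cw0 : conj w0 = - w0;
  ca : conj a = ac;
  cW : conj W = W;
  comZZb : forall x, Z (Zb x) = Zb (Z x) - I * T x - wb * Z x - w1 * Zb x;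
  comZT : forall x, Z (T x) = T (Z x) - w0 * Z x + a * Zb x;
  curvW : W = Z wb - Zb w1 + I * w0 + 2%:R * (w1 * wb);
  curvA : Z w0 - T w1 + w0 * w1 - a * wb = Zb a - 2%:R * (wb * a) }.
Hypothesis fe : frame_eqs.

Lemma cwb : conj wb = - w1.
Proof. by have := congr1 conj (cw1 fe); rewrite (conjIn cj) conjN => ->; rewrite opprK. Qed.
Lemma comZbT x : Zb (T x) = T (Zb x) + w0 * Zb x + ac * Z x.
Proof.
have := congr1 conj (comZT fe (conj x)).
rewrite !cE (cw0 fe) (ca fe) => ->.
by ring.
Qed.

Lemma curvAc : Zb w0 - T wb - w0 * wb - ac * w1 = - Z ac - 2%:R * (w1 * ac).
Proof.
have := congr1 conj (curvA fe).
rewrite !cE.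
rewrite (cw0 fe) (cw1 fe) (ca fe) cwb !(dTE, dZE, dZbE) => H.
by apply: (lc (-1) H); ring.
Qed.

Definition ndb x := Zb x - wb * x.
Definition nd1 x := Z x + w1 * x.
Definition frame_div x0 x1 xb := T x0 + nd1 x1 + ndb xb.

Definition a_b := Zb a - 2%:R * (wb * a).
Definition a_bb := ndb a_b.
Definition R1c := Z W - I * a_b.
Definition P1c x := Z (nd1 (Zb x)) + I * a * Zb x.

(** The contracted second Bianchi identity [A_{11,bb} + conj = W_0]: the
    exterior derivative of the curvature form vanishes. *)
Lemma bianchi : a_bb + conj a_bb = T W.
Proof.
have Twb : T wb = Zb w0 + Z ac + w1 * ac - w0 * wb.
  by apply: (lc (-1) curvAc); ring.
have Tw1 : T w1 = Z w0 - Zb a + w0 * w1 + wb * a.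
  by apply: (lc (-1) (curvA fe)); ring.
have TZ x : T (Z x) = Z (T x) + w0 * Z x - a * Zb x by rewrite (comZT fe); ring.
have TZb x : T (Zb x) = Zb (T x) - w0 * Zb x - ac * Z x by rewrite comZbT; ring.
rewrite /a_bb /a_b /ndb (curvW fe).
rewrite !cE.
rewrite cwb (ca fe).
rewrite !(dTE, TZ, TZb) Twb Tw1 !(dZE, dZbE, comZZb fe).
ring: II.
Qed.

(** ** Solitons: the square of [T f] is a divergence *)

Section SolitonIdentity.
Variable f : A.
Hypotheses (cf : conj f = f) (sol : Z (Z f) - w1 * Z f + I * a * f = 0).
Hypothesis WZ : Z (T f) = - 2%:R * Z W.
Hypothesis WT : T (T f) = - 2%:R * T W.

Lemma sol_c : Zb (Zb f) + wb * Zb f - I * ac * f = 0.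
Proof.
have := congr1 conj sol; rewrite conj0 !cE (ca fe) (cw1 fe) cf => <-; ring.
Qed.

Lemma WZb : Zb (T f) = - 2%:R * Zb W.
Proof. by have := congr1 conj WZ; rewrite !cE cf (cW fe) => ->. Qed.

Let h := ndb (Z f).

Lemma hE : nd1 (Zb f) = h - I * T f.
Proof. by rewrite /h /ndb /nd1 (comZZb fe); ring. Qed.

(** The derivative along [Zb] of [f_11 + i A_11 f = 0], with the third
    derivatives commuted. *)
Lemma soliton_first : - I * a_b * f = Z h + I * Z (T f) + W * Z f.
Proof.
have E := congr1 Zb sol.
rewrite (der0 dZb) !dZbE in E.
have ZbZZ : Zb (Z (Z f)) = Z (Zb (Z f)) + I * T (Z f) + wb * Z (Z f) + w1 * Zb (Z f).
  by rewrite (comZZb fe); ring.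
have TZ : T (Z f) = Z (T f) + w0 * Z f - a * Zb f by rewrite (comZT fe); ring.
rewrite ZbZZ TZ in E.
rewrite /a_b /h /ndb !dZE (curvW fe).
by apply: (lc (-1) E); apply: (lc (2%:R * wb) sol); ring: II.
Qed.

(** Commuting [T] with the two derivatives of [f] produces the torsion times
    [f_11] and [f_bb]; by the soliton equation and its conjugate these terms are
    opposite multiples of [|A|^2 f]. *)
Lemma soliton_T : T h = ndb (Z (T f)) - a_b * Zb f - conj a_b * Z f.
Proof.
have TZb x : T (Zb x) = Zb (T x) - w0 * Zb x - ac * Z x by rewrite comZbT; ring.
have TZ : T (Z f) = Z (T f) + w0 * Z f - a * Zb f by rewrite (comZT fe); ring.
have Twb : T wb = Zb w0 + Z ac + w1 * ac - w0 * wb.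
  by apply: (lc (-1) curvAc); ring.
rewrite /h /ndb /a_b !cE cwb (ca fe) !(dTE, TZb, TZ) Twb !dZbE.
by apply: (lc (- a) sol_c); apply: (lc (- ac) sol); ring: II.
Qed.

(** The imaginary part of the divergence of [soliton_first]: the evolution
    equation of the scalar curvature along the soliton flow. *)
Lemma soliton_evolution :
  4%:R * (ndb (Z (T f)) + nd1 (Zb (T f))) =
  f * T (T f) - 2%:R * (W * T f) + I * (Z (T f) * Zb f - Zb (T f) * Z f).
Proof.
have [h' [E0 Th hE' hd]] : exists h', [/\ - I * a_b * f = Z h' + I * Z (T f) + W * Z f,
    T h' = ndb (Z (T f)) - a_b * Zb f - conj a_b * Z f,
    nd1 (Zb f) = h' - I * T f & h' = ndb (Z f)].
  by exists h; split; [exact: soliton_first|exact: soliton_T|exact: hE|].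
have E := congr1 ndb E0.
have Ec := congr1 conj E.
have hc : conj h' = h' - I * T f.
  by rewrite hd /ndb !cE cf cwb -[RHS]/(h - I * T f) -hE /nd1; ring.
have comh : Zb (Z h') = Z (Zb h') + I * T h' + wb * Z h' + w1 * Zb h' by rewrite (comZZb fe); ring.
have comF : Zb (Z (T f)) = Z (Zb (T f)) + I * T (T f) + wb * Z (T f) + w1 * Zb (T f).
  by rewrite (comZZb fe); ring.
rewrite /ndb !(cE, cf, cW fe, cwb, hc) in E Ec; rewrite !dZbE in E; rewrite !dZE in Ec.
have B := bianchi; rewrite /a_bb /ndb !cE cwb in B.
rewrite /ndb in Th.
have ZbF : Zb (Z f) = h' + wb * Z f by rewrite hd /ndb; ring.
have ZFb : Z (Zb f) = h' - I * T f - w1 * Zb f by rewrite -hE' /nd1; ring.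
rewrite ZbF comh comF in E; rewrite ZFb in Ec.
pose k : A := 2%:R * I.
apply: (lc k E); apply: (lc (- k) Ec); apply: (lc (k * I * f) B); apply: (lc (k * I) Th).
apply: (lc (- f) WT); apply: (lc (- I * Zb f) WZ); apply: (lc (I * Z f) WZb).
rewrite /ndb /nd1 /a_b /k !cE ?cwb !(dZE, dZbE) ?comF; ring: II.
Qed.

(** In [soliton_evolution] the terms [f T T f] and [2 W T f] differ from
    divergences by [T f * T f] and by terms in [Z W = - Z (T f) / 2], which
    cancel the last summand. *)
Lemma soliton_divergence :
  T f * T f = frame_div (f * T f) (- 2%:R * I * W * Zb f - 4%:R * Zb (T f))
                        (2%:R * I * W * Z f - 4%:R * Z (T f)).
Proof.
have H := hE; rewrite /h /nd1 /ndb in H.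
rewrite /frame_div /nd1 /ndb !(dTE, dZE, dZbE).
apply: (lc 1 soliton_evolution); apply: (lc (2%:R * I * W) H).
apply: (lc (I * Zb f) WZ); apply: (lc (- I * Z f) WZb).
rewrite /ndb /nd1; ring: II.
Qed.

End SolitonIdentity.

(** ** The Paneitz operator is formally self-adjoint *)

(** [P_1] is a second order operator applied to [Zb]; two integrations by
    parts move it across, and the torsion term is symmetric. *)
Lemma paneitz_symmetric x y :
  x * ndb (P1c y) - y * ndb (P1c x) =
  frame_div 0 (Zb y * nd1 (Zb x) - Zb x * nd1 (Zb y)) (x * P1c y - y * P1c x).
Proof.
by rewrite /frame_div (der0 dT) /P1c /nd1 /ndb !(dZE, dZbE); ring.
Qed.

(** Two integrations by parts move both derivatives of [a] to [f], where the
    soliton equation turns [f_bb] into [I * ac * f]. *)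
Lemma curvature_pairing f : conj f = f -> Z (Z f) - w1 * Z f + I * a * f = 0 -> Z W = 0 ->
  f * ndb R1c = a * ac * f + ndb (I * (Zb f * a - f * a_b)).
Proof.
move=> cf sol ZW; have S := sol_c cf sol; rewrite /R1c ZW.
rewrite /ndb /a_b !(der0 dZb, dZbE).
by apply: (lc (- I * a) S); ring: II.
Qed.

(** ** Conformal change of the contact form *)

Section Conformal.
Variables (g e : A).
Hypotheses (cg : conj g = g) (ce : conj e = e).
Hypotheses (Ze : Z e = - e * Z g) (Zbe : Zb e = - e * Zb g) (Te : T e = - e * T g).

Let Z' x := e * Z x.
Let Zb' x := e * Zb x.
Let T' x := e * e * (T x - 2%:R * I * Zb g * Z x + 2%:R * I * Z g * Zb x).
Let w1' := e * (w1 + 3%:R * Z g).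
Let wb' := e * (wb - 3%:R * Zb g).
Let w0' := e * e * (w0 - 4%:R * I * Z g * Zb g + 2%:R * I * Z (Zb g) + 2%:R * I * Z g * wb - T g).
Let a' := e * e * (a + 2%:R * I * (Z (Z g) - w1 * Z g) - 4%:R * I * Z g * Z g).
Let W' := e * e * (W - 4%:R * (ndb (Z g) + nd1 (Zb g)) - 8%:R * Z g * Zb g).

(** The primed quantities are the data of the frame of [e^(2g) theta] with
    [e = e^(-g)]: by uniqueness of the connection it suffices that they satisfy the
    commutator relations. *)
Lemma conf_comZZb x : Z' (Zb' x) - Zb' (Z' x) = - I * T' x - wb' * Z' x - w1' * Zb' x.
Proof.
rewrite /Z' /Zb' /T' /wb' /w1' !(dZE, dZbE) Ze Zbe (comZZb fe); ring: II.
Qed.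

Lemma conf_comZT x : Z' (T' x) - T' (Z' x) = - w0' * Z' x + a' * Zb' x.
Proof.
rewrite /Z' /Zb' /T' /w0' /a' !(dTE, dZE, dZbE) Ze Zbe Te (comZT fe) !(comZZb fe); ring: II.
Qed.

Lemma conf_curvature : Z' wb' - Zb' w1' + I * w0' + 2%:R * (w1' * wb') = W'.
Proof.
rewrite /Z' /Zb' /w0' /w1' /wb' /W' /ndb /nd1 (curvW fe) !(dTE, dZE, dZbE) Ze Zbe !(comZZb fe).
ring: II.
Qed.

(** The conformal weight of [R_1] is [-3], and the operator [P_1] measures its
    failure to be invariant; this is why [P_0] governs the change of [Q]. *)
Lemma conf_R1 :
  Z' W' - I * (Zb' a' - 2%:R * (wb' * a')) = e * e * e * (R1c - 6%:R * P1c g).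
Proof.
have ZbZZ : Zb (Z (Z g)) = Z (Zb (Z g)) + I * T (Z g) + wb * Z (Z g) + w1 * Zb (Z g).
  by rewrite (comZZb fe); ring.
have ZbZ : Zb (Z g) = Z (Zb g) + I * T g + wb * Z g + w1 * Zb g by rewrite (comZZb fe); ring.
have TZ : T (Z g) = Z (T g) + w0 * Z g - a * Zb g by rewrite (comZT fe); ring.
rewrite /Z' /Zb' /W' /a' /wb' /R1c /P1c /a_b /ndb /nd1.
rewrite !dZbE ZbZZ !dZE TZ ZbZ !dZE Ze Zbe (curvW fe) !dZE; ring: II.
Qed.

Lemma conf_Q x : Zb' (e * e * e * x) - wb' * (e * e * e * x) = e * e * e * e * ndb x.
Proof. rewrite /Zb' /wb' /ndb !dZbE Zbe; ring: II. Qed.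

End Conformal.

End FrameAlgebra.

Arguments lc {A} c {l r x y} _ _.

(** * The ring of smooth functions on an open set *)

Section SmoothRing.
Variables (R : realType) (M : manifold3 R) (U : set M).
Local Notation C := R[i].

(** Functions are made zero outside [U], so that equality on [U] is equality
    of functions and the ring axioms hold on the nose. *)
Record sfun := Sfun {
  sval_fun :> M -> C;
  sfun_smooth : csmooth_on U sval_fun;
  sfun_out : forall p, ~ U p -> sval_fun p = 0 }.

Lemma sfun_ext (f g : sfun) : (forall p, U p -> f p = g p) -> f = g.
Proof.
case: f g => [f sf zf] [g sg zg] /= E.
have {}E : f = g.
  apply/funext => p; have [Up|nUp] := pselect (U p); first exact: E.
  by rewrite zf// zg.
by subst g; congr Sfun; exact: Prop_irrelevance.
Qed.

HB.instance Definition _ := gen_eqMixin sfun.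
HB.instance Definition _ := gen_choiceMixin sfun.

Hypothesis oU : open U.

Definition cutoff (f : M -> C) : M -> C := fun p => if `[< U p >] then f p else 0.

Lemma cutoff_in f p : U p -> cutoff f p = f p.
Proof. by move=> Up; rewrite /cutoff asboolT. Qed.

Lemma cutoff_out f p : ~ U p -> cutoff f p = 0.
Proof. by move=> Up; rewrite /cutoff asboolF. Qed.

Lemma cutoff_smooth f : csmooth_on U f -> csmooth_on U (cutoff f).
Proof. by apply: csmooth_eq => // p Up; rewrite cutoff_in. Qed.

Definition mks f (sf : csmooth_on U f) : sfun := Sfun (cutoff_smooth sf) (@cutoff_out f).

Lemma mksE f (sf : csmooth_on U f) p : U p -> mks sf p = f p.
Proof. exact: cutoff_in. Qed.

End SmoothRing.

Section SmoothRingOps.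
Variables (R : realType) (M : manifold3 R) (U : set M) (oU : open U).
Local Notation C := R[i].

(** The carrier remembers that [U] is open, which the operations need. *)
Definition oring of open U := sfun U.
Local Notation A := (oring oU).

Definition sadd (f g : A) : A := mks oU (csmoothD oU (sfun_smooth f) (sfun_smooth g)).
Definition sopp (f : A) : A := mks oU (csmoothN oU (sfun_smooth f)).
Definition smul (f g : A) : A := mks oU (csmoothM oU (sfun_smooth f) (sfun_smooth g)).
Definition scst (a : C) : A := mks oU (@csmooth_cst _ _ U a).

HB.instance Definition _ := gen_eqMixin A.
HB.instance Definition _ := gen_choiceMixin A.

Lemma saddA : associative sadd.
Proof. by move=> f g h; apply: sfun_ext => p Up; rewrite !mksE// addrA. Qed.
Lemma saddC : commutative sadd.
Proof. by move=> f g; apply: sfun_ext => p Up; rewrite !mksE// addrC. Qed.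
Lemma sadd0 : left_id (scst 0) sadd.
Proof. by move=> f; apply: sfun_ext => p Up; rewrite !mksE// add0r. Qed.
Lemma saddN : left_inverse (scst 0) sopp sadd.
Proof. by move=> f; apply: sfun_ext => p Up; rewrite !mksE// addNr. Qed.
HB.instance Definition _ := GRing.isZmodule.Build A saddA saddC sadd0 saddN.

Lemma smulA : associative smul.
Proof. by move=> f g h; apply: sfun_ext => p Up; rewrite !mksE// mulrA. Qed.
Lemma smulC : commutative smul.
Proof. by move=> f g; apply: sfun_ext => p Up; rewrite !mksE// mulrC. Qed.
Lemma smul1 : left_id (scst 1) smul.
Proof. by move=> f; apply: sfun_ext => p Up; rewrite !mksE// mul1r. Qed.
Lemma smulD : left_distributive smul sadd.
Proof. by move=> f g h; apply: sfun_ext => p Up; rewrite !mksE// mulrDl. Qed.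
HB.instance Definition _ := GRing.Zmodule_isComPzRing.Build A smulA smulC smul1 smulD.

Lemma sE p (Up : U p) :
  ((forall f g : A, (f + g)%R p = (f p + g p)%R) *
   (forall f g : A, (f * g)%R p = (f p * g p)%R) *
   (forall f : A, (- f)%R p = (- f p)%R) * ((0 : A)%R p = 0%R) * ((1 : A)%R p = 1%R) *
   (forall a, scst a p = a) * (forall n, (n%:R : A)%R p = n%:R%R))%type.
Proof.
have H1 f g : (f + g : A) p = f p + g p by rewrite mksE.
have H2 : (0 : A) p = 0 by rewrite mksE.
have H3 : (1 : A) p = 1 by rewrite mksE.
do ![split] => //.
- by move=> f g; rewrite mksE.
- by move=> f; rewrite mksE.
- by move=> a; rewrite mksE.
- by elim=> [|n IH]; rewrite ?mulr0n// -[n.+1]addn1 !natrD H1 IH H3.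
Qed.

Definition sconj (f : A) : A := mks oU (csmoothJ oU (sfun_smooth f)).
Lemma sconjE f p : U p -> sconj f p = (f p)^c.
Proof. by move=> Up; rewrite mksE. Qed.

Section Derivation.
Variables (X : vfield M) (sX : smooth_vfield U X).

Definition sder (f : A) : A := mks oU (vf_smooth sX oU (@subset_refl _ U) (sfun_smooth f)).

(** Identities are proved between elements of the ring and read off as identities
    between the functions that they represent. *)
Definition rep (f : A) (u : M -> C) := forall p, U p -> f p = u p.

Lemma rep_near f u p : rep f u -> U p -> \near p, f p = u p.
Proof. by move=> fu Up; apply: (@near_open _ U). Qed.

Lemma rep_der f u : rep f u -> rep (sder f) (vderiv X u).
Proof.
move=> fu p Up; rewrite mksE// /vderiv; apply: tangent_near (vf_tangent sX Up) _.
exact: rep_near.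
Qed.

Lemma sfun_near (f : A) p : U p -> csmooth_near p f.
Proof. by move=> Up; exact: (csmooth_nearW oU Up (sfun_smooth f)). Qed.

Lemma is_der_sder : is_der (scst 'i) sder.
Proof.
split.
- move=> f g; apply: sfun_ext => p Up; rewrite !(sE Up) !mksE//.
  have tX := vf_tangent sX Up; rewrite /vderiv.
  rewrite -(tangentD tX (sfun_near f Up) (sfun_near g Up)).
  by apply: tangent_near tX _; apply: (@near_open _ U) => // q Uq; rewrite !(sE Uq).
- move=> f g; apply: sfun_ext => p Up; rewrite !(sE Up) !mksE//.
  have tX := vf_tangent sX Up; rewrite /vderiv.
  rewrite -(tangentM tX (sfun_near f Up) (sfun_near g Up)).
  by apply: tangent_near tX _; apply: (@near_open _ U) => // q Uq; rewrite !(sE Uq).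
- apply: sfun_ext => p Up; rewrite (sE Up) mksE//.
  have tX := vf_tangent sX Up; rewrite /vderiv -(tangent_cst 'i tX).
  by apply: tangent_near tX _; apply: (@near_open _ U) => // q Uq; rewrite !(sE Uq).
Qed.

End Derivation.

Lemma rep_add f g u w : rep f u -> rep g w -> rep (f + g) (fun p => u p + w p).
Proof. by move=> fu gw p Up; rewrite (sE Up) fu// gw. Qed.
Lemma rep_mul f g u w : rep f u -> rep g w -> rep (f * g) (fun p => u p * w p).
Proof. by move=> fu gw p Up; rewrite (sE Up) fu// gw. Qed.
Lemma rep_opp f u : rep f u -> rep (- f) (fun p => - u p).
Proof. by move=> fu p Up; rewrite (sE Up) fu. Qed.
Lemma rep_sub f g u w : rep f u -> rep g w -> rep (f - g) (fun p => u p - w p).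
Proof. by move=> fu gw p Up; rewrite !(sE Up) fu// gw. Qed.
Lemma rep_cst a : rep (scst a) (fun=> a).
Proof. by move=> p Up; rewrite (sE Up). Qed.
Lemma rep_nat n : rep n%:R (fun=> n%:R).
Proof. by move=> p Up; rewrite (sE Up). Qed.
Lemma rep_mks u (su : csmooth_on U u) : rep (mks oU su : A) u.
Proof. by move=> p Up; rewrite mksE. Qed.

Lemma sconj_der X (sX : smooth_vfield U X) (sX' : smooth_vfield U (conjvf X)) (f : A) :
  sconj (sder sX f) = sder sX' (sconj f).
Proof.
apply: sfun_ext => p Up; rewrite sconjE// !mksE// /vderiv /conjvf /conjv.
congr (_^c); apply: tangent_near (vf_tangent sX Up) _.
by apply: (@near_open _ U) => // q Uq; rewrite sconjE// conjcK.
Qed.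

Lemma is_conj_sconj T Z (sT : smooth_vfield U T) (sZ : smooth_vfield U Z)
    (sZb : smooth_vfield U (conjvf Z)) :
  (forall p, U p -> conjv (T p) = T p) ->
  is_conj (scst 'i) sconj (sder sT) (sder sZ) (sder sZb).
Proof.
move=> rT; split.
- by move=> f g; apply: sfun_ext => p Up; rewrite sconjE// !(sE Up) !sconjE// conjcD.
- by move=> f g; apply: sfun_ext => p Up; rewrite sconjE// !(sE Up) !sconjE// conjcM.
- by move=> f; apply: sfun_ext => p Up; rewrite !sconjE// conjcK.
- by apply: sfun_ext => p Up; rewrite sconjE// !(sE Up) conjci.
- exact: sconj_der.
- move=> f; apply: sfun_ext => p Up; rewrite sconjE// !mksE// /vderiv /conjvf /conjv conjcK.
  apply: tangent_near (vf_tangent sZ Up) _.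
  by apply: (@near_open _ U) => // q Uq; rewrite sconjE.
- move=> f; apply: sfun_ext => p Up; rewrite sconjE// !mksE// /vderiv.
  have := congr1 (fun v => v (sconj f : M -> C)) (rT p Up); rewrite /conjv => <-; congr (_^c).
  apply: tangent_near (vf_tangent sT Up) _.
  by apply: (@near_open _ U) => // q Uq; rewrite sconjE// conjcK.
Qed.

End SmoothRingOps.

(** * Local frames *)

Section Jacobi.
Variables (A : comPzRingType) (I : A) (conj T Z Zb : A -> A).
Hypotheses (II : I * I = -1) (dT : is_der I T) (dZ : is_der I Z) (dZb : is_der I Zb).
Hypothesis cj : is_conj I conj T Z Zb.
Variables (w0 w1 wb a : A).
Hypotheses
  (comZZb : forall x, Z (Zb x) = Zb (Z x) - I * T x - wb * Z x - w1 * Zb x)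
  (comZT : forall x, Z (T x) = T (Z x) - w0 * Z x + a * Zb x)
  (indep : forall x y t, (forall f, x * Z f + y * Zb f + t * T f = 0) ->
     [/\ x = 0, y = 0 & t = 0]).

(** The Jacobi identity for the three frame fields contains both the
    reality of the connection form and one component of its exterior
    derivative. *)
Lemma jacobi_frame : conj w0 = - w0 /\
  Z w0 - T w1 + w0 * w1 - a * wb = Zb a - 2%:R * (wb * a).
Proof.
have comZbT x : Zb (T x) = T (Zb x) - conj w0 * Zb x + conj a * Z x.
  have := congr1 conj (comZT (conj x)); rewrite !(cE cj) => ->; ring.
have [_ Y t] : [/\ wb * w0 - w1 * conj a + T wb - Z (conj a) - Zb w0 - (w0 + conj w0) * wb = 0,
   - wb * a + w1 * conj w0 + T w1 + Z (conj w0) + Zb a - (w0 + conj w0) * w1 = 0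
   & - I * (w0 + conj w0) = 0].
  apply: indep => x; have E := comZZb (T x).
  rewrite comZbT comZT !(dZE dZ) !(dZbE dZb) !comZT !comZbT !comZZb !(dTE dT) in E.
  apply: (lc (-1) E); ring: II.
have c0 : conj w0 = - w0.
  have : (- I * (w0 + conj w0)) * I = 0 by rewrite t mul0r.
  by move=> E; apply: (lc 1 E); ring: II.
split=> //; rewrite c0 (derN _ dZ) in Y; by apply: (lc (-1) Y); ring.
Qed.

End Jacobi.

Section DualBasis.
Variables (R : realType) (M : manifold3 R).
Local Notation C := R[i].
Implicit Types (c : chart R M) (U V W : set M) (p q : M) (v x : cvector M).
Implicit Types (X Y Z T : vfield M) (al th : form1 M).

Definition linear_at p (l : cvector M -> C) := forall a x y, is_tangent p x -> is_tangent p y ->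
  l (lincombv a x y) = a * l x + l y.

Lemma tangent_pd c p i : atlas c -> chart_dom c p -> is_tangent p (pd c i p).
Proof. by move=> ac cp; exact: (vf_tangent (vf_pd i ac) cp). Qed.

Lemma pd_coord c p i j : atlas c -> chart_dom c p -> pd c i p (ccoord c j) = (i == j)%:R.
Proof.
move=> ac cp; rewrite pdE ?dC_coord//.
by exists (chart_dom c); split=> //; [exact: chart_dom_open|exact: csmooth_ccoord].
Qed.

Lemma tangent_expand c p x : atlas c -> chart_dom c p -> is_tangent p x ->
  x = lincombv (x (ccoord c i0)) (pd c i0 p) (lincombv (x (ccoord c i1)) (pd c i1 p)
        (scalev (x (ccoord c i2)) (pd c i2 p))).
Proof.
move=> ac cp tx; have tp i := tangent_pd i ac cp.
apply: (tangent_ext ac cp tx).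
  by do 2 (apply: tangent_lin => //); exact: tangent_scale.
move=> i; rewrite /lincombv /scalev !pd_coord//.
by have [->|->|->] := ord3P i; rewrite !eqE /= !(mulr0, mulr1, addr0, add0r).
Qed.

Lemma linear_scale p l a x : linear_at p l -> is_tangent p x -> l (scalev a x) = a * l x.
Proof.
move=> L tx; have t0 := tangent_zero p; rewrite scalev_lin L//.
have := L (-1) _ _ t0 t0.
have -> : lincombv (-1) (fun=> 0) (fun=> 0) = (fun=> 0) :> cvector M.
  by apply/funext => f; rewrite /lincombv mulr0 addr0.
by rewrite mulN1r addNr => ->; rewrite addr0.
Qed.

Lemma linear_coord c p l x : atlas c -> chart_dom c p -> is_tangent p x -> linear_at p l ->
  l x = \sum_i x (ccoord c i) * l (pd c i p).
Proof.
move=> ac cp tx L; have tp i := tangent_pd i ac cp.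
rewrite {1}(tangent_expand ac cp tx) !L//; last 2 first.
- exact: tangent_scale.
- by apply: tangent_lin => //; exact: tangent_scale.
by rewrite (linear_scale _ L (tp i2)) sum3 addrA.
Qed.

Lemma dual_basis c p (v : 'I_3 -> cvector M) (l : 'I_3 -> cvector M -> C) :
  atlas c -> chart_dom c p -> (forall i, is_tangent p (v i)) -> (forall i, linear_at p (l i)) ->
  (forall i j, l i (v j) = (i == j)%:R) ->
  forall x, is_tangent p x ->
    x = lincombv (l i0 x) (v i0) (lincombv (l i1 x) (v i1) (scalev (l i2 x) (v i2))).
Proof.
move=> ac cp tv L D x tx; apply: (tangent_ext ac cp tx).
  by do 2 (apply: tangent_lin => //); exact: tangent_scale.
pose E := \matrix_(i < 3, k < 3) v i (ccoord c k).
pose K := \matrix_(k < 3, i < 3) l i (pd c k p).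
have EK : E *m K = 1%:M.
  apply/matrixP => i j; rewrite !mxE -[RHS]/((i == j)%:R) eq_sym -D.
  by rewrite (linear_coord ac cp (tv i) (L j)); apply: eq_bigr => k _; rewrite !mxE.
have KE := mulmx1C EK.
have S k : \sum_i l i x * v i (ccoord c k) = x (ccoord c k).
  transitivity (((\row_j x (ccoord c j)) *m (K *m E)) ord0 k); last by rewrite KE mulmx1 mxE.
  rewrite mulmxA mxE; apply: eq_bigr => i _; rewrite !mxE; congr (_ * _).
  by rewrite (linear_coord ac cp tx (L i)); apply: eq_bigr => j _; rewrite !mxE.
by move=> k; rewrite -S sum3 /lincombv /scalev addrA.
Qed.

Lemma linear_form U al p : smooth_form1 U al -> U p -> linear_at p (al p).
Proof. by move=> sal Up a x y tx ty; exact: (form_lin a sal Up tx ty). Qed.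

Lemma linear_conj p (l : cvector M -> C) : linear_at p l -> linear_at p (fun x => (l (conjv x))^c).
Proof.
move=> L a x y tx ty; rewrite conjv_lin L; [|exact: tangent_conj|exact: tangent_conj].
by rewrite conjcD conjcM conjcK.
Qed.

Lemma conjvf_invol X : conjvf (conjvf X) = X.
Proof. by apply/funext => p; exact: conjvK. Qed.

Lemma conj1_smooth U al : open U -> smooth_form1 U al -> smooth_form1 U (conj1 al).
Proof.
move=> oU sal; split=> [p Up a x y tx ty|W X oW WU sX].
  exact: (linear_conj (linear_form sal Up) a tx ty).
have h := form_smooth sal oW WU (vf_conj oW sX).
exact: csmoothJ oW h.
Qed.

Lemma bracket_conj X Y p : bracket (conjvf X) (conjvf Y) p = conjv (bracket X Y p).
Proof.
apply/funext => f; have [sf|nsf] := pselect (csmooth_near p f); last first.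
  by rewrite /conjv !bracket_out ?conjc0// => /csmooth_nearJP.
have cv Q P : vderiv (conjvf Q) (vderiv (conjvf P) f) p =
    (Q p (vderiv P (fun q => (f q)^c)))^c.
  rewrite /vderiv /conjvf /conjv; congr ((Q p _)^c).
  by apply/funext => q; rewrite /vderiv /conjvf /conjv conjcK.
rewrite /conjv !bracketE//; last by apply/csmooth_nearJP.
by rewrite conjcB -!cv.
Qed.

Lemma extd_conj al X Y p : extd (conj1 al) (conjvf X) (conjvf Y) p = (extd al X Y p)^c.
Proof.
have cc Q : contract (conj1 al) (conjvf Q) = (fun q => (contract al Q q)^c).
  by apply/funext => q; rewrite /contract /conj1 /conjvf conjvK.
rewrite /extd /contract bracket_conj /conj1 conjvK -/(contract _ _) -!/(contract _ _).
have cv Q P : vderiv (conjvf Q) (contract (conj1 al) (conjvf P)) p = (vderiv Q (contract al P) p)^c.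
  rewrite cc /vderiv /conjvf /conjv; congr ((Q p _)^c).
  by apply/funext => q; rewrite conjcK.
by rewrite !conjcB -!cv.
Qed.

Lemma extd_form_eq U al be X Y p : open U -> U p -> smooth_vfield U X -> smooth_vfield U Y ->
  (forall q x, U q -> is_tangent q x -> al q x = be q x) -> extd al X Y p = extd be X Y p.
Proof.
move=> oU Up sX sY E; rewrite /extd.
have h Q P : smooth_vfield U Q -> smooth_vfield U P ->
    vderiv Q (contract al P) p = vderiv Q (contract be P) p.
  move=> sQ sP; apply: (tangent_near (vf_tangent sQ Up)); apply: (@near_open _ U) => // q Uq.
  by rewrite /contract E//; exact: vf_tangent sP Uq.
by rewrite !h// /contract E//; exact: tangent_bracket sX sY.
Qed.

Lemma extd_real U th X Y p : open U -> U p -> smooth_vfield U X -> smooth_vfield U Y ->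
  real_form1 U th -> extd th (conjvf X) (conjvf Y) p = (extd th X Y p)^c.
Proof.
move=> oU Up sX sY rth; rewrite -extd_conj.
apply: (@extd_form_eq U) => //; [exact: vf_conj|exact: vf_conj|].
by move=> q x Uq tx; rewrite rth.
Qed.

Lemma extd_smooth U al X Y : open U -> smooth_form1 U al ->
  smooth_vfield U X -> smooth_vfield U Y -> csmooth_on U (extd al X Y).
Proof.
move=> oU sal sX sY; have UU := @subset_refl _ U.
apply: csmoothB => //; last by apply: (form_smooth sal) => //; exact: vf_bracket.
by apply: csmoothB => //; [apply: (vf_smooth sX) => //|apply: (vf_smooth sY) => //];
  exact: (form_smooth sal).
Qed.

Lemma dd_linl c al p y : linear_at p (fun x => dd c al p x y).
Proof.
move=> a x x' tx tx'; rewrite /dd mulr_sumr -big_split; apply: eq_bigr => i _ /=.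
rewrite mulr_sumr -big_split; apply: eq_bigr => j _ /=.
by rewrite /lincombv; ring.
Qed.

Lemma dd_linr c al p x : linear_at p (dd c al p x).
Proof.
move=> a y y' ty ty'; rewrite /dd mulr_sumr -big_split; apply: eq_bigr => i _ /=.
rewrite mulr_sumr -big_split; apply: eq_bigr => j _ /=.
by rewrite /lincombv; ring.
Qed.

End DualBasis.

(** ** Coframes *)

Section Uniqueness.
Variables (A : comPzRingType) (I : A) (T Z Zb : A -> A).
Hypothesis indep : forall x y t, (forall f, x * Z f + y * Zb f + t * T f = 0) ->
     [/\ x = 0, y = 0 & t = 0].

Lemma coef_unique x y t x' y' t' :
  (forall f, x * Z f + y * Zb f + t * T f = x' * Z f + y' * Zb f + t' * T f) ->
  [/\ x = x', y = y' & t = t'].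
Proof.
move=> E.
have [|X Y S] := @indep (x - x') (y - y') (t - t').
  by move=> f; apply: (lc 1 (E f)); ring.
by split; apply/eqP; rewrite -subr_eq0; apply/eqP.
Qed.
End Uniqueness.

Section Coframe.
Variables (R : realType) (M : manifold3 R).
Local Notation C := R[i].
Implicit Types (c : chart R M) (U V W : set M) (p q : M) (v x : cvector M).
Implicit Types (X Y Z T : vfield M) (al th : form1 M).

Lemma extd_const V al X Y p (a b : C) : open V -> V p ->
  smooth_vfield V X -> smooth_vfield V Y ->
  (forall q, V q -> al q (X q) = a) -> (forall q, V q -> al q (Y q) = b) ->
  extd al X Y p = - al p (bracket X Y p).
Proof.
move=> oV Vp sX sY Ea Eb; have tX := vf_tangent sX Vp; have tY := vf_tangent sY Vp.
rewrite /extd /vderiv (@tangent_near _ _ p (X p) (contract al Y) (fun=> b))//; last first.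
  by apply: (@near_open _ V) => // q Vq; rewrite /contract Eb.
rewrite (@tangent_near _ _ p (Y p) (contract al X) (fun=> a))//; last first.
  by apply: (@near_open _ V) => // q Vq; rewrite /contract Ea.
by rewrite (tangent_cst _ tX) (tangent_cst _ tY) subrr sub0r.
Qed.

(** A normalized frame without connection form, torsion or curvature: these
    are functions of the brackets of the frame fields. *)
Record coframe c V (oV : open V) T Z th (th1 : form1 M) : Prop := Coframe {
  cf_atlas : atlas c;
  cf_dom : V `<=` chart_dom c;
  cf_T : smooth_vfield V T;
  cf_Z : smooth_vfield V Z;
  cf_th : smooth_form1 V th;
  cf_th1 : smooth_form1 V th1;
  cf_Treal : forall p, V p -> conjv (T p) = T p;
  cf_threal : real_form1 V th;
  cf_dual : forall p, V p -> [/\ th p (T p) = 1, th p (Z p) = 0, th1 p (T p) = 0,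
     th1 p (Z p) = 1 & th1 p (conjvf Z p) = 0];
  cf_dTZ : forall p, V p -> extd th T Z p = 0;
  cf_dZZb : forall p, V p -> extd th Z (conjvf Z) p = 'i }.

Section Consequences.
Variables (c : chart R M) (V : set M) (oV : open V) (T Z : vfield M) (th th1 : form1 M).
Hypothesis cf : coframe c oV T Z th th1.
Let sT := cf_T cf.
Let sZ := cf_Z cf.
Let sth := cf_th cf.
Let sth1 := cf_th1 cf.
Local Notation Zb := (conjvf Z).

Lemma cf_Zb : smooth_vfield V Zb. Proof. exact: vf_conj. Qed.
Lemma cf_th1b : smooth_form1 V (conj1 th1). Proof. exact: conj1_smooth. Qed.

Lemma cf_vals p : V p ->
  [/\ th p (T p) = 1, th p (Z p) = 0 & th p (Zb p) = 0] /\
  [/\ th1 p (T p) = 0, th1 p (Z p) = 1 & th1 p (Zb p) = 0] /\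
  [/\ conj1 th1 p (T p) = 0, conj1 th1 p (Z p) = 0 & conj1 th1 p (Zb p) = 1].
Proof.
move=> Vp; have [d1 d2 d3 d4 d5] := cf_dual cf Vp; split; [|split]; split=> //.
- rewrite -(cf_threal cf Vp (vf_tangent cf_Zb Vp)) /conj1 /conjvf conjvK d2; exact: conjc0.
- by rewrite /conj1 (cf_Treal cf Vp) d3; exact: conjc0.
- by rewrite /conj1 d5; exact: conjc0.
- by rewrite /conj1 /conjvf conjvK d4; exact: conjc1.
Qed.

Lemma cf_expand p x : V p -> is_tangent p x ->
  x = lincombv (th p x) (T p) (lincombv (th1 p x) (Z p) (scalev (conj1 th1 p x) (Zb p))).
Proof.
move=> Vp tx; have [[a1 a2 a3] [[b1 b2 b3] [c1 c2 c3]]] := cf_vals Vp.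
pose v (i : 'I_3) := nth (T p) [:: T p; Z p; Zb p] i.
pose l (i : 'I_3) := nth (th p) [:: th p; th1 p; conj1 th1 p] i.
apply: (@dual_basis _ _ c p v l) => //; first exact: (cf_atlas cf).
- exact: (cf_dom cf).
- by move=> i; have [->|->|->] := ord3P i; [exact: vf_tangent sT Vp|exact: vf_tangent sZ Vp|
    exact: vf_tangent cf_Zb Vp].
- by move=> i; have [->|->|->] := ord3P i; [exact: linear_form sth Vp|exact: linear_form sth1 Vp|
    exact: linear_form cf_th1b Vp].
- by move=> i j; have [->|->|->] := ord3P i; have [->|->|->] := ord3P j; rewrite /v /l.
Qed.

Local Notation A := (oring oV).
Let DT : A -> A := sder (oU := oV) sT.
Let DZ : A -> A := sder (oU := oV) sZ.
Let DZb : A -> A := sder (oU := oV) cf_Zb.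
Local Notation I := (scst oV 'i%C : A).
Local Notation conjA := (sconj (oU := oV)).

Lemma cf_II : I * I = -1.
Proof. by apply: sfun_ext => p Vp; rewrite !(sE oV Vp) mulii. Qed.

Lemma cf_conj : is_conj I conjA DT DZ DZb.
Proof. exact: is_conj_sconj (cf_Treal cf). Qed.

Definition con al (sal : smooth_form1 V al) X (sX : smooth_vfield V X) : A :=
  mks oV (form_smooth sal oV (@subset_refl _ V) sX).

Lemma conE al (sal : smooth_form1 V al) X (sX : smooth_vfield V X) p : V p ->
  con sal sX p = al p (X p).
Proof. by move=> Vp; rewrite mksE. Qed.

Definition cf_wb : A := - con sth1 (vf_bracket oV sZ cf_Zb).
Definition cf_w1 : A := - conjA cf_wb.
Definition cf_w0 : A := - con sth1 (vf_bracket oV sZ sT).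
Definition cf_a : A := con cf_th1b (vf_bracket oV sZ sT).

Lemma bracket_ZZb p : V p -> bracket Z Zb p =
  lincombv (- 'i%C) (T p) (lincombv (- cf_wb p) (Z p) (scalev (- cf_w1 p) (Zb p))).
Proof.
move=> Vp; have tb := tangent_bracket oV Vp sZ cf_Zb.
rewrite [LHS](cf_expand Vp tb) /cf_w1 /cf_wb !(sE oV Vp) sconjE// !(sE oV Vp) conE// !opprK.
have <- : th p (bracket Z Zb p) = - 'i%C.
  rewrite -(cf_dZZb cf Vp) (@extd_const V th Z Zb p 0 0)// ?opprK//; first exact: cf_Zb.
    by move=> q Vq; have [[]] := cf_vals Vq.
  by move=> q Vq; have [[]] := cf_vals Vq.
have -> : conj1 th1 p (bracket Z Zb p) = (- th1 p (bracket Z Zb p))^c; last by [].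
by rewrite /conj1 -bracket_conj conjvf_invol bracketC (form_scale _ sth1 Vp tb) mulN1r.
Qed.

Lemma bracket_ZT p : V p -> bracket Z T p =
  lincombv (- cf_w0 p) (Z p) (scalev (cf_a p) (Zb p)).
Proof.
move=> Vp; have tb := tangent_bracket oV Vp sZ sT.
rewrite [LHS](cf_expand Vp tb) /cf_w0 /cf_a !(sE oV Vp) !conE// !opprK.
have -> : th p (bracket Z T p) = 0.
  have E : extd th T Z p = - th p (bracket T Z p).
    apply: (@extd_const V th T Z p 1 0) => // q Vq; by have [[]] := cf_vals Vq.
  have := cf_dTZ cf Vp; rewrite E bracketC (form_scale _ sth Vp tb) mulN1r opprK.
  by [].
by apply/funext => f; rewrite /lincombv mul0r add0r.
Qed.

Lemma cf_comZZb f : DZ (DZb f) = DZb (DZ f) - I * DT f - cf_wb * DZ f - cf_w1 * DZb f.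
Proof.
apply: sfun_ext => p Vp; have sf := sfun_near f Vp.
have := congr1 (fun v => v (f : M -> C)) (bracket_ZZb Vp).
rewrite bracketE// /lincombv /scalev; move: cf_wb cf_w1 => wb w1 E.
have e1 : DZ (DZb f) p = Z p (vderiv Zb f).
  by rewrite (rep_der sZ (rep_der cf_Zb (fun=> fun=> erefl)) Vp).
have e2 : DZb (DZ f) p = Zb p (vderiv Z f).
  by rewrite (rep_der cf_Zb (rep_der sZ (fun=> fun=> erefl)) Vp).
have e3 : DT f p = T p f by rewrite mksE.
have e4 : DZ f p = Z p f by rewrite mksE.
have e5 : DZb f p = Zb p f by rewrite mksE.
rewrite !(sE oV Vp) e1 e2 e3 e4 e5.
by apply: (lc 1 E); ring.
Qed.

Lemma cf_comZT f : DZ (DT f) = DT (DZ f) - cf_w0 * DZ f + cf_a * DZb f.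
Proof.
apply: sfun_ext => p Vp; have sf := sfun_near f Vp.
have := congr1 (fun v => v (f : M -> C)) (bracket_ZT Vp).
rewrite bracketE// /lincombv /scalev; move: cf_w0 cf_a => w0 a E.
have e1 : DZ (DT f) p = Z p (vderiv T f).
  by rewrite (rep_der sZ (rep_der sT (fun=> fun=> erefl)) Vp).
have e2 : DT (DZ f) p = T p (vderiv Z f).
  by rewrite (rep_der sT (rep_der sZ (fun=> fun=> erefl)) Vp).
have e4 : DZ f p = Z p f by rewrite mksE.
have e5 : DZb f p = Zb p f by rewrite mksE.
rewrite !(sE oV Vp) e1 e2 e4 e5.
by apply: (lc 1 E); ring.
Qed.

(** Testing on coordinate functions and contracting with the dual forms gives
    the coefficients back. *)
Lemma cf_indep (x y t : A) : (forall f, x * DZ f + y * DZb f + t * DT f = 0) ->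
  [/\ x = 0, y = 0 & t = 0].
Proof.
move=> H.
have E p : V p -> lincombv (t p) (T p) (lincombv (x p) (Z p) (scalev (y p) (Zb p))) = (fun=> 0).
  move=> Vp; have [tT tZ tZb] := And3 (vf_tangent sT Vp) (vf_tangent sZ Vp) (vf_tangent cf_Zb Vp).
  apply: (tangent_ext (cf_atlas cf) (cf_dom cf Vp)).
  - by do 2 (apply: tangent_lin => //); exact: tangent_scale.
  - exact: tangent_zero.
  move=> i; have sc : csmooth_on V (ccoord c i).
    by apply: csmooth_sub (csmooth_ccoord i (cf_atlas cf)); exact: (cf_dom cf).
  have := congr1 (fun g : A => g p) (H (mks oV sc : A)).
  rewrite !(sE oV Vp) (rep_der sT (rep_mks oV sc) Vp) (rep_der sZ (rep_mks oV sc) Vp).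
  rewrite (rep_der cf_Zb (rep_mks oV sc) Vp) /vderiv /lincombv /scalev => <-.
  by ring.
have get al : smooth_form1 V al -> forall p, V p ->
    t p * al p (T p) + (x p * al p (Z p) + y p * al p (Zb p)) = 0.
  move=> sal p Vp; have [tT tZ tZb] := And3 (vf_tangent sT Vp) (vf_tangent sZ Vp) (vf_tangent cf_Zb Vp).
  rewrite -(form_zero sal Vp) -(E p Vp) (form_lin _ sal Vp tT); last first.
    by apply: tangent_lin => //; exact: tangent_scale.
  by rewrite (form_lin _ sal Vp tZ (tangent_scale _ tZb)) (form_scale _ sal Vp tZb).
split; apply: sfun_ext => p Vp; rewrite (sE oV Vp); have [[a1 a2 a3] [[b1 b2 b3] [c1 c2 c3]]] := cf_vals Vp.
- by have := get th1 sth1 p Vp; rewrite b1 b2 b3 !(mulr0, mulr1, add0r, addr0).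
- by have := get _ cf_th1b p Vp; rewrite c1 c2 c3 !(mulr0, mulr1, add0r, addr0).
- by have := get th sth p Vp; rewrite a1 a2 a3 !(mulr0, mulr1, add0r, addr0).
Qed.

Definition cf_W : A := DZ cf_wb - DZb cf_w1 + I * cf_w0 + 2%:R * (cf_w1 * cf_wb).

(** Only the commutators and the Jacobi identity enter, so every coframe gives
    a model of the tensor calculus in a frame. *)
Lemma cf_frame_eqs :
  frame_eqs I conjA DT DZ DZb cf_w0 cf_w1 cf_wb cf_a (conjA cf_a) cf_W.
Proof.
have cj := cf_conj.
have dT : is_der I DT := is_der_sder oV sT; have dZ : is_der I DZ := is_der_sder oV sZ.
have dZb : is_der I DZb := is_der_sder oV cf_Zb.
have e1 : conjA cf_w1 = - cf_wb by rewrite /cf_w1 (conjN cj) (conjIn cj).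
have [e0 eA] := jacobi_frame cf_II dT dZ dZb cj cf_comZZb cf_comZT cf_indep.
have eb : conjA cf_wb = - cf_w1 by rewrite /cf_w1 opprK.
split=> //; [|exact: cf_comZZb|exact: cf_comZT].
rewrite /cf_W; move: cf_w0 cf_w1 cf_wb e0 e1 eb {eA} => w0 w1 wb e0 e1 eb.
by rewrite !(cE cj) e0 e1 eb (derN _ dZb) (derN _ dZ); ring.
Qed.

End Consequences.
End Coframe.

(** ** Local frames and coframes *)

Section FrameCoframe.
Variables (R : realType) (M : manifold3 R).
Local Notation C := R[i].
Implicit Types (c : chart R M) (U V W : set M) (p q : M) (v x : cvector M).
Implicit Types (X Y Z T : vfield M) (al th : form1 M).

Lemma imE : ('i%R : C) = 'i%C. Proof. by []. Qed.
Lemma mulCii : ('i%C : C) * 'i%C = -1. Proof. by rewrite -imE mulii. Qed.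
Lemma mulNii : - ('i%C : C) * 'i%C = 1. Proof. by rewrite mulNr -imE mulii opprK. Qed.

Lemma extd_bracket al X Y p : extd al X Y p =
  vderiv X (contract al Y) p - vderiv Y (contract al X) p - al p (bracket X Y p).
Proof. by []. Qed.

Lemma two_i_imE (k : M -> C) al be p v w :
  two_i_im (fun q v' w' => k q * wedge al be q v' w') p v w =
  k p * (al p v * be p w - al p w * be p v)
  - (k p)^c * (conj1 al p v * conj1 be p w - conj1 al p w * conj1 be p v).
Proof. by rewrite /two_i_im /conj2 /wedge !(conjcM, conjcB). Qed.

Lemma extd_eq_on U W al be X Y p : extd_eq U al be -> open W -> W `<=` U ->
  smooth_vfield W X -> smooth_vfield W Y -> W p -> extd al X Y p = be p (X p) (Y p).
Proof. by move=> E oW WU sX sY Wp; exact: (E W). Qed.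

Section FromFrame.
Variables (th : form1 M) (J : bundle_endo M) (U : set M) (F : local_frame th J U).
Hypotheses (sth : smooth_form1 setT th) (rth : real_form1 setT th).
Variables (c : chart R M) (V : set M).
Hypotheses (ac : atlas c) (oV : open V) (VU : V `<=` U) (Vc : V `<=` chart_dom c).
Local Notation T := (fr_T F).
Local Notation Z := (fr_Z1 F).
Local Notation Zb := (conjvf (fr_Z1 F)).
Local Notation th1 := (fr_th1 F).
Local Notation om := (fr_om F).

Lemma frame_coframe : coframe c oV T Z th th1.
Proof.
have [sT rT T1 dT] := fr_reeb F.
have sZ : smooth_vfield V Z by apply: vf_sub VU (fr_Z1_smooth F).
have sZb : smooth_vfield V Zb by exact: vf_conj.
have real q x : V q -> is_tangent q x -> conj1 th q x = th q x by move=> _ tx; exact: rth.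
have thZb q : V q -> th q (Zb q) = 0.
  move=> Vq; rewrite -(real q _ Vq (vf_tangent sZb Vq)) /conj1 /conjvf conjvK.
  by rewrite (fr_Z1_horizontal F (VU Vq)) conjc0.
split => //.
- exact: vf_sub sT.
- exact: form_sub sth.
- exact: form_sub VU (fr_th1_smooth F).
- by move=> p Vp; apply: rT; exact: VU.
- move=> p Vp; have [d1 d2 d3] := fr_th1_dual F (VU Vp); split=> //.
    by apply: T1; exact: VU.
  exact: (fr_Z1_horizontal F (VU Vp)).
- by move=> p Vp; apply: (dT V Z oV VU sZ).
- move=> p Vp; rewrite (extd_eq_on (@fr_normalized _ _ _ _ _ F) oV VU sZ sZb Vp).
  have [d1 d2 d3] := fr_th1_dual F (VU Vp).
  rewrite /wedge d2 d3 /conj1 /conjvf conjvK -/(conjvf Z p) d2 conjc1 mul0r subr0.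
  by rewrite !mulr1.
Qed.

Let cf := frame_coframe.

Lemma frame_wb : rep (cf_wb cf) (contract om Zb).
Proof.
move=> p Vp; rewrite (sE oV Vp) conE//.
have [_ [[b1 b2 b3] [c1 c2 c3]]] := cf_vals cf Vp.
have [sZ sZb] := conj (cf_Z cf) (cf_Zb cf).
rewrite -(@extd_const _ _ V th1 Z Zb p 1 0)//; last 2 first.
- by move=> q Vq; have [_ [[]]] := cf_vals cf Vq.
- by move=> q Vq; have [_ [[]]] := cf_vals cf Vq.
rewrite (extd_eq_on (@fr_structure _ _ _ _ _ F) oV VU sZ sZb Vp) /wedge b2 b3 c2 c3.
have [[_ a2 a3] _] := cf_vals cf Vp.
by rewrite a2 a3 mul1r !mul0r !subr0 mulr0 addr0.
Qed.

Lemma frame_w1 : rep (cf_w1 cf) (contract om Z).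
Proof.
move=> p Vp; rewrite (sE oV Vp) sconjE// frame_wb//.
have := fr_om_imaginary F (VU Vp) (vf_tangent (cf_Z cf) Vp).
by rewrite /conj1 /contract => /(congr1 (fun z => - z)); rewrite opprK.
Qed.

Lemma frame_w0 : rep (cf_w0 cf) (contract om T).
Proof.
move=> p Vp; rewrite (sE oV Vp) conE//.
have [[a1 a2 a3] [[b1 b2 b3] [c1 c2 c3]]] := cf_vals cf Vp.
have [sZ sT] := conj (cf_Z cf) (cf_T cf).
rewrite -(@extd_const _ _ V th1 Z T p 1 0)//; last 2 first.
- by move=> q Vq; have [_ [[]]] := cf_vals cf Vq.
- by move=> q Vq; have [_ [[]]] := cf_vals cf Vq.
rewrite (extd_eq_on (@fr_structure _ _ _ _ _ F) oV VU sZ sT Vp) /wedge b1 b2 a1 a2 c1 c2.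
by rewrite mul1r !(mulr0, mul0r) !subr0 mulr0 addr0.
Qed.

Lemma frame_a : rep (cf_a cf) (A11 F).
Proof.
move=> p Vp; rewrite conE//.
have [[a1 a2 a3] [[b1 b2 b3] [c1 c2 c3]]] := cf_vals cf Vp.
have [sZb sT] := conj (cf_Zb cf) (cf_T cf).
have rT : bracket Z T p = conjv (bracket Zb T p).
  rewrite -bracket_conj conjvf_invol; apply/funext => f.
  have [sf|nsf] := pselect (csmooth_near p f); last by rewrite !bracket_out.
  rewrite !bracketE// /conjvf (cf_Treal cf Vp); congr (_ - _).
  apply: (tangent_near (vf_tangent (cf_Z cf) Vp)); apply: (@near_open _ V) => // q Vq.
  by rewrite /vderiv (cf_Treal cf Vq).
rewrite rT /conj1 conjvK /A11; congr (_^c); apply: oppr_inj.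
rewrite -(@extd_const _ _ V th1 Zb T p 0 0)//; last 2 first.
- by move=> q Vq; have [_ [[]]] := cf_vals cf Vq.
- by move=> q Vq; have [_ [[]]] := cf_vals cf Vq.
rewrite (extd_eq_on (@fr_structure _ _ _ _ _ F) oV VU sZb sT Vp) /wedge b1 b3 a1 a3 c1 c3.
by rewrite !(mulr0, mul0r, mul1r) subr0 sub0r mulrN1 add0r.
Qed.

Lemma frame_W : rep (cf_W cf) (cfun_of (fr_W F)).
Proof.
move=> p Vp.
have [[a1 a2 a3] [[b1 b2 b3] [c1 c2 c3]]] := cf_vals cf Vp.
have [sZ sZb] := conj (cf_Z cf) (cf_Zb cf).
have som : smooth_form1 V om by apply: form_sub VU (fr_om_smooth F).
have tZ := vf_tangent sZ Vp; have tZb := vf_tangent sZb Vp; have tT := vf_tangent (cf_T cf) Vp.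
have := extd_eq_on (@fr_curvature _ _ _ _ _ F) oV VU sZ sZb Vp.
rewrite two_i_imE /wedge b2 b3 c2 c3 a2 a3 !(rth _ tZ, rth _ tZb)// a2 a3.
move=> E; have {}E : extd om Z Zb p = (fr_W F p)%:C by rewrite E; ring.
apply: etrans E; rewrite extd_bracket (bracket_ZZb cf Vp).
rewrite (form_lin _ som Vp tT (tangent_lin _ tZ (tangent_scale _ tZb))).
rewrite (form_lin _ som Vp tZ (tangent_scale _ tZb)) (form_scale _ som Vp tZb).
rewrite -[om p (T p)]/(contract om T p) -(frame_w0 Vp) -[om p (Z p)]/(contract om Z p) -(frame_w1 Vp).
rewrite -[om p (Zb p)]/(contract om Zb p) -(frame_wb Vp).
rewrite -(rep_der sZ frame_wb Vp) -(rep_der sZb frame_w1 Vp) /cf_W.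
move: (cf_w0 _) (cf_w1 _) (cf_wb _) => w0 w1 wb.
by rewrite !(sE oV Vp); ring.
Qed.

End FromFrame.

(** ** Construction of frames *)

Section CoframeExtd.
Variables (c : chart R M) (V : set M) (oV : open V) (T Z : vfield M) (th th1 : form1 M).
Hypothesis cf : coframe c oV T Z th th1.
Local Notation Zb := (conjvf Z).

(** Two-forms are determined by their values on pairs of frame fields. *)
Lemma cf_extd W al X Y p : open W -> W `<=` V -> smooth_form1 V al ->
  smooth_vfield W X -> smooth_vfield W Y -> W p ->
  extd al X Y p =
  (th p (X p) * th1 p (Y p) - th1 p (X p) * th p (Y p)) * extd al T Z p
  + (th p (X p) * conj1 th1 p (Y p) - conj1 th1 p (X p) * th p (Y p)) * extd al T Zb p
  + (th1 p (X p) * conj1 th1 p (Y p) - conj1 th1 p (X p) * th1 p (Y p)) * extd al Z Zb p.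
Proof.
move=> oW WV sal sX sY Wp; have Vp := WV p Wp.
have [tX tY] := conj (vf_tangent sX Wp) (vf_tangent sY Wp).
have [sT sZ sZb] := And3 (cf_T cf) (cf_Z cf) (cf_Zb cf).
have [tT tZ tZb] := And3 (vf_tangent sT Vp) (vf_tangent sZ Vp) (vf_tangent sZb Vp).
have ac := cf_atlas cf; have cp := cf_dom cf Vp.
rewrite (extd_tensor ac cp oW Wp (form_sub WV sal) sX sY).
rewrite {1}(cf_expand cf Vp tX) {1}(cf_expand cf Vp tY).
have tl := (tangent_lin, tangent_scale).
have L x y : is_tangent p x -> is_tangent p y -> forall a b d a' b' d',
   dd c al p (lincombv a (T p) (lincombv b (Z p) (scalev d (Zb p))))
             (lincombv a' (T p) (lincombv b' (Z p) (scalev d' (Zb p)))) =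
   a * (a' * dd c al p (T p) (T p) + b' * dd c al p (T p) (Z p) + d' * dd c al p (T p) (Zb p)) +
   b * (a' * dd c al p (Z p) (T p) + b' * dd c al p (Z p) (Z p) + d' * dd c al p (Z p) (Zb p)) +
   d * (a' * dd c al p (Zb p) (T p) + b' * dd c al p (Zb p) (Z p) + d' * dd c al p (Zb p) (Zb p)).
  move=> tx ty a b d a' b' d'.
  have r z : dd c al p z (lincombv a' (T p) (lincombv b' (Z p) (scalev d' (Zb p)))) =
     a' * dd c al p z (T p) + b' * dd c al p z (Z p) + d' * dd c al p z (Zb p).
    have Lr := @dd_linr _ _ c al p z.
    rewrite Lr//; last by apply: tangent_lin => //; exact: tangent_scale.
    rewrite Lr//; last exact: tangent_scale.
    by rewrite (linear_scale _ Lr tZb) addrA.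
  set y' := lincombv a' _ _ in r *.
  have Ll := @dd_linl _ _ c al p y'.
  rewrite Ll//; last by apply: tangent_lin => //; exact: tangent_scale.
  rewrite Ll//; last exact: tangent_scale.
  by rewrite (linear_scale _ Ll tZb) !r addrA.
rewrite (L _ _ tX tY).
have e P Q : smooth_vfield V P -> smooth_vfield V Q -> dd c al p (P p) (Q p) = extd al P Q p.
  by move=> sP sQ; rewrite (extd_tensor ac cp oV Vp sal sP sQ).
have z P : smooth_vfield V P -> extd al P P p = 0.
  move=> sP; have H := extdC oV Vp sal sP sP.
  have : extd al P P p *+ 2 = 0 by rewrite mulr2n {1}H addNr.
  by move/eqP; rewrite mulrn_eq0 => /eqP.
rewrite !e// !z// (extdC oV Vp sal sZ sT) (extdC oV Vp sal sZb sT) (extdC oV Vp sal sZb sZ).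
by ring.
Qed.
End CoframeExtd.

Section Builder.
Variables (c : chart R M) (V : set M) (T Z : vfield M) (th : form1 M) (J : bundle_endo M).
Hypotheses (ac : atlas c) (Vc : V `<=` chart_dom c) (oV : open V).
Hypotheses (sT : smooth_vfield V T) (sZ : smooth_vfield V Z) (sth : smooth_form1 V th).
Hypotheses (rT : forall p, V p -> conjv (T p) = T p) (rth : real_form1 V th).
Hypotheses (T1 : forall p, V p -> th p (T p) = 1) (Z0 : forall p, V p -> th p (Z p) = 0).
Hypotheses (dTZ : forall p, V p -> extd th T Z p = 0)
  (dZZb : forall p, V p -> extd th Z (conjvf Z) p = 'i).
Local Notation Zb := (conjvf Z).

(** Contracting the exterior derivative of [th] with [conj Z] gives the form
    dual to [Z]. *)
Definition dual10 : form1 M := fun p v => - 'i%C * dd c th p v (Zb p).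

Lemma extdXX U al X p : open U -> U p -> smooth_form1 U al -> smooth_vfield U X ->
  extd al X X p = 0.
Proof.
move=> oU Up sal sX; have H := extdC oU Up sal sX sX.
have : extd al X X p *+ 2 = 0 by rewrite mulr2n {1}H addNr.
by move/eqP; rewrite mulrn_eq0 => /eqP.
Qed.

Lemma dual10_coframe : coframe c oV T Z th dual10.
Proof.
have sZb : smooth_vfield V Zb by exact: vf_conj.
have E W X p : open W -> W `<=` V -> smooth_vfield W X -> W p ->
    dual10 p (X p) = - 'i%C * extd th X Zb p.
  move=> oW WV sX Wp; have Vp := WV p Wp.
  by rewrite (extd_tensor ac (Vc Vp) oW Wp (form_sub WV sth) sX (vf_sub WV sZb)).
split=> //.
- split=> [p Vp a v w tv tw|W X oW WV sX].
    by rewrite /dual10 (@dd_linl _ _ c th p (Zb p) a v w tv tw); ring.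
  have h : csmooth_on W (fun p => - 'i%C * extd th X Zb p).
    apply: csmoothM => //; first exact: csmooth_cst.
    apply: (extd_smooth oW (form_sub WV sth) sX); exact: vf_sub sZb.
  by apply: csmooth_eq h => // p Wp; rewrite /contract (E W X p).
- move=> p Vp; have VV := @subset_refl _ V.
  rewrite T1// Z0// !(E V _ p)// dZZb// (extdXX oV Vp sth sZb) mulr0 mulNii.
  split=> //; have := extd_real oV Vp sT sZ rth.
  rewrite dTZ// conjc0 => H; rewrite (_ : extd th T Zb p = 0) ?mulr0//.
  rewrite -H; apply: (@extd_local _ _ th T Zb _ _ V p oV Vp sT sZb) => // q Vq.
  by rewrite /conjvf rT.
Qed.

Let cf := dual10_coframe.
Let w0 := cf_w0 cf.
Let w1 := cf_w1 cf.
Let wb := cf_wb cf.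
Let a := cf_a cf.
Let th1 := dual10.

Definition conn : form1 M := fun p v => w0 p * th p v + w1 p * th1 p v + wb p * conj1 th1 p v.

Lemma conn_smooth : smooth_form1 V conn.
Proof.
have s1 := cf_th1 cf; have s2 := cf_th1b cf.
split=> [p Vp b v w tv tw|W X oW WV sX].
  rewrite /conn /th1 (form_lin _ sth Vp tv tw) (form_lin _ s1 Vp tv tw) (form_lin _ s2 Vp tv tw).
  by ring.
have h (f : oring oV) : csmooth_on W f by apply: csmooth_sub (sfun_smooth f).
do 2?[apply: csmoothD => //]; apply: csmoothM => //; exact: (form_smooth _ oW WV sX).
Qed.

Lemma conn_vals p : V p -> [/\ conn p (T p) = w0 p, conn p (Z p) = w1 p & conn p (Zb p) = wb p].
Proof.
move=> Vp; have [[a1 a2 a3] [[b1 b2 b3] [c1 c2 c3]]] := cf_vals cf Vp.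
rewrite /conn a1 a2 a3 /th1 b1 b2 b3 c1 c2 c3.
by split; rewrite !(mulr0, mulr1, add0r, addr0).
Qed.

Lemma conj_w p : V p -> [/\ (w0 p)^c = - w0 p, (w1 p)^c = - wb p & (wb p)^c = - w1 p].
Proof.
move=> Vp; have fe := cf_frame_eqs cf; have cj := cf_conj cf.
have e0 : sconj w0 p = (- w0 : oring oV) p by rewrite (cw0 fe).
have e1 : sconj w1 p = (- wb : oring oV) p by rewrite (cw1 fe).
have eb : sconj wb p = (- w1 : oring oV) p by rewrite (cwb cj fe).
by rewrite sconjE// (sE _ Vp) in e0; rewrite sconjE// (sE _ Vp) in e1; rewrite sconjE// (sE _ Vp) in eb.
Qed.

Lemma conn_imaginary : imaginary_form1 V conn.
Proof.
move=> p v Vp tv; rewrite /conj1 /conn !conjcD (conjcM (w0 p)) (conjcM (w1 p)) (conjcM (wb p)).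
have [-> -> ->] := conj_w Vp.
have -> : (th p (conjv v))^c = th p v by rewrite -[RHS](rth Vp tv).
rewrite /conj1 conjvK (conjcK (th1 p v)); move: (th1 _ _) (th1 _ _) (w0 p) (w1 p) (wb p) => *; ring.
Qed.

Definition tors : M -> C := fun p => (a p)^c.
Definition webster : M -> R := fun p => complex.Re (cf_W cf p).

Lemma websterE p : V p -> (webster p)%:C = cf_W cf p.
Proof.
move=> Vp; have : sconj (cf_W cf) p = cf_W cf p by rewrite (cW (cf_frame_eqs cf)).
rewrite sconjE// /webster; case: (cf_W cf p) => x y /= [E].
by apply: complex_eq => //=; lra.
Qed.


Lemma builder_structure : extd_eq V th1 (fun p v w =>
    wedge th1 conn p v w + tors p * wedge th (conj1 th1) p v w).
Proof.
move=> W X Y oW WV sX sY p Wp; have Vp := WV p Wp.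
rewrite (cf_extd cf oW WV (cf_th1 cf) sX sY Wp).
have sZb := cf_Zb cf; have v1 := cf_vals cf.
have eTZ : extd th1 T Z p = - w0 p.
  rewrite (extdC oV Vp (cf_th1 cf) sT sZ) (@extd_const _ _ V _ Z T p 1 0)//; last 2 first.
  - by move=> q Vq; have [_ [[]]] := v1 q Vq.
  - by move=> q Vq; have [_ [[]]] := v1 q Vq.
  by rewrite /w0 /cf_w0 (sE _ Vp) conE.
have eZZb : extd th1 Z Zb p = wb p.
  rewrite (@extd_const _ _ V _ Z Zb p 1 0)//; last 2 first.
  - by move=> q Vq; have [_ [[]]] := v1 q Vq.
  - by move=> q Vq; have [_ [[]]] := v1 q Vq.
  by rewrite /wb /cf_wb (sE _ Vp) conE.
have eTZb : extd th1 T Zb p = tors p.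
  rewrite (extdC oV Vp (cf_th1 cf) sT sZb) (@extd_const _ _ V _ Zb T p 0 0)//; last 2 first.
  - by move=> q Vq; have [_ [[]]] := v1 q Vq.
  - by move=> q Vq; have [_ [[]]] := v1 q Vq.
  rewrite opprK /tors /a /cf_a conE// /conj1 conjcK -bracket_conj; congr (th1 p _).
  apply/funext => f; have [sf|nsf] := pselect (csmooth_near p f); last by rewrite !bracket_out.
  rewrite !bracketE// /conjvf (rT Vp); congr (_ - _).
  apply: (tangent_near (vf_tangent sZb Vp)); apply: (@near_open _ V) => // q Vq.
  by rewrite /vderiv rT.
rewrite eTZ eZZb eTZb /wedge /conn -/th1; ring.
Qed.

Lemma builder_curvature : extd_eq V conn (fun p v w =>
    (webster p)%:C * wedge th1 (conj1 th1) p v w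
    + two_i_im (fun q v' w' =>
        covderiv conn Zb 2 0 (fun q' => (tors q')^*) q
        * wedge th1 th q v' w') p v w).
Proof.
move=> W X Y oW WV sX sY p Wp; have Vp := WV p Wp.
have sZb := cf_Zb cf; have sc := conn_smooth; have [k0 k1 kb] := conn_vals Vp.
have [tT tZ tZb] := And3 (vf_tangent sT Vp) (vf_tangent sZ Vp) (vf_tangent sZb Vp).
have fe := cf_frame_eqs cf.
rewrite (cf_extd cf oW WV sc sX sY Wp).
have r0 : rep w0 (contract conn T) by move=> q Vq; rewrite /contract; have [-> _ _] := conn_vals Vq.
have r1 : rep w1 (contract conn Z) by move=> q Vq; rewrite /contract; have [_ -> _] := conn_vals Vq.
have rb : rep wb (contract conn Zb) by move=> q Vq; rewrite /contract; have [_ _ ->] := conn_vals Vq.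
pose ab := covderiv conn Zb 2 0 (fun q' => (tors q')^*) p.
have abE : ab = (sder (oU := oV) sZb a - 2%:R * (wb * a)) p.
  rewrite /ab /covderiv mulr0n addr0 [conn p (Zb p)]kb.
  have d : sder (oU := oV) sZb a p = vderiv Zb a p by rewrite mksE.
  have -> : (fun q' => (tors q')^*) = (a : M -> C) by apply/funext => q; rewrite /tors conjcK.
  rewrite /tors conjcK; move: d; move: (vderiv Zb a p) => x; move: (sder _ a) => y d.
  by move: y wb a d => y b a' d; rewrite !(sE _ Vp) d; ring.
have eZT : extd conn Z T p = ab.
  rewrite extd_bracket (bracket_ZT cf Vp) (form_lin _ sc Vp tZ (tangent_scale _ tZb)).
  rewrite (form_scale _ sc Vp tZb) k1 kb -(rep_der sZ r0 Vp) -(rep_der sT r1 Vp) abE.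
  have := congr1 (fun g : oring _ => g p) (curvA fe); rewrite -/w0 -/w1 -/wb -/a => <-.
  by move: w0 w1 wb a => w0' w1' wb' a'; rewrite !(sE _ Vp); ring.
have eTZ : extd conn T Z p = - ab by rewrite (extdC oV Vp sc sT sZ) eZT.
have eTZb : extd conn T Zb p = ab^c.
  have H : extd (conj1 conn) (conjvf T) Zb p = - ab^c by rewrite extd_conj eTZ conjcN.
  rewrite -[RHS]opprK -H -(@extd_local _ _ (conj1 conn) T Zb _ _ V p oV Vp sT sZb)//; last first.
    by move=> q Vq; rewrite /conjvf rT.
  have sm : smooth_form1 V (conj1 conn) by exact: conj1_smooth.
  rewrite (@extd_form_eq _ _ V (conj1 conn) (fun q v => - conn q v) T Zb p)//; last first.
    by move=> q x Vq tx; exact: conn_imaginary.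
  have n P : (contract (fun q v => - conn q v) P) = (fun q => -1 * contract conn P q).
    by apply/funext => q; rewrite mulN1r.
  rewrite !extd_bracket !n /vderiv.
  have cs P : smooth_vfield V P -> csmooth_near p (contract conn P).
    by move=> sP; exact: (csmooth_nearW oV Vp (form_smooth sc oV (@subset_refl _ V) sP)).
  have s1 := csmooth_near_cst (-1 : C) p.
  rewrite (tangentM tT s1 (cs _ sZb)) (tangentM tZb s1 (cs _ sT)) (tangent_cst _ tT) (tangent_cst _ tZb).
  by ring.
have eZZb : extd conn Z Zb p = (webster p)%:C.
  rewrite websterE// extd_bracket (bracket_ZZb cf Vp).
  rewrite (form_lin _ sc Vp tT (tangent_lin _ tZ (tangent_scale _ tZb))).
  rewrite (form_lin _ sc Vp tZ (tangent_scale _ tZb)) (form_scale _ sc Vp tZb) k0 k1 kb.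
  rewrite -(rep_der sZ rb Vp) -(rep_der sZb r1 Vp) /cf_W -/w0 -/w1 -/wb.
  by move: w0 w1 wb => w0' w1' wb'; rewrite !(sE _ Vp); ring.
rewrite two_i_imE -/ab eTZ eTZb eZZb /wedge.
have tX := vf_tangent sX Wp; have tY := vf_tangent sY Wp.
rewrite !(rth Vp tX, rth Vp tY) -/th1.
by ring.
Qed.

(** The connection, the torsion and the curvature are read off the commutators
    of [T], [Z] and [conj Z]; the structure equations are then checked on the frame. *)
Lemma frame_builder : (forall p, V p -> J p (Z p) = scalev 'i%C (Z p)) ->
  exists F : local_frame th J V, fr_T F = T /\ fr_Z1 F = Z.
Proof.
move=> JZ.
have sZb := cf_Zb cf.
have dTZb p : V p -> extd th T Zb p = 0.
  move=> Vp; have := extd_real oV Vp sT sZ rth; rewrite dTZ// conjc0 => <-.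
  by apply: (@extd_local _ _ th T Zb _ _ V p oV Vp sT sZb) => // q Vq; rewrite /conjvf rT.
have hr : reeb_on V th T.
  split=> // W X oW WV sX p Wp; have Vp := WV p Wp.
  rewrite (cf_extd cf oW WV sth (vf_sub WV sT) sX Wp) dTZ// dTZb//.
  by have [_ [[-> _ _] [-> _ _]]] := cf_vals cf Vp; rewrite !(mul0r, mulr0, subrr, addr0).
have hd p : V p -> [/\ th1 p (T p) = 0, th1 p (Z p) = 1 & th1 p (Zb p) = 0].
  by move=> Vp; have [_ []] := cf_vals cf Vp.
have hn : extd_eq V th (fun p v w => 'i * wedge th1 (conj1 th1) p v w).
  move=> W X Y oW WV sX sY p Wp; have Vp := WV p Wp.
  by rewrite (cf_extd cf oW WV sth sX sY Wp) dTZ// dTZb// dZZb// /wedge imE -/th1; ring.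
by exists (LocalFrame oV hr sZ Z0 JZ (cf_th1 cf) hd hn conn_smooth conn_imaginary
  builder_structure builder_curvature).
Qed.

End Builder.
End FrameCoframe.

(** ** Existence of local frames *)

Section Existence.
Variables (R : realType) (M : manifold3 R).
Local Notation C := R[i].
Implicit Types (c : chart R M) (U V W : set M) (p q : M) (v x : cvector M).
Implicit Types (X Y Z T : vfield M) (al th : form1 M) (u : M -> C).

Lemma open_pos U (f : M -> R) : open U -> smooth_on U f -> open [set p | U p /\ 0 < f p].
Proof.
move=> oU sf; rewrite openE => p [Up fp].
have c := smooth_cont oU Up sf.
have n : \near p, 0 < f p by apply: (cvgr_gt (f p)).
have nU : \near p, U p by exact: open_nbhs_nbhs.
by apply: filterS2 n nU.
Qed.

Lemma open_neq0 U u : open U -> csmooth_on U u -> open [set p | U p /\ u p != 0].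
Proof.
move=> oU [s1 s2].
pose f p := complex.Re (u p) * complex.Re (u p) + complex.Im (u p) * complex.Im (u p).
have sf : smooth_on U f by apply: smoothD => //; exact: smoothM.
have := open_pos oU sf; congr open; apply/seteqP; split=> p /= [Up h]; split=> //.
  by apply: contraTneq h => u0; rewrite /f u0 /= mulr0 addr0 ltxx.
rewrite /f lt_def -!expr2 addr_ge0 ?sqr_ge0// andbT; apply: contra h.
rewrite paddr_eq0 ?sqr_ge0// !sqrf_eq0 => /andP[/eqP a /eqP b].
by apply/eqP; apply: complex_eq.
Qed.

Lemma J_scale th (J : bundle_endo M) a p v : almost_complex th J -> horizontal th p v ->
  J p (scalev a v) = scalev a (J p v).
Proof.
move=> [_ lin _ _ _] hv.
have E (w : cvector M) : scalev a w = lincombv (a - 1) w w.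
  by apply/funext => f; rewrite /scalev /lincombv; ring.
by rewrite !E lin.
Qed.

Section Point.
Variables (th : form1 M) (J : bundle_endo M).
Hypothesis ps : pseudohermitian th J.

Let sth : smooth_form1 setT th. Proof. by have [[]] := ps. Qed.
Let rth : real_form1 setT th. Proof. by have [[]] := ps. Qed.
Let acJ : almost_complex th J. Proof. by have [] := ps. Qed.

Lemma th_conj p v : is_tangent p v -> th p (conjv v) = (th p v)^c.
Proof.
by move=> tv; rewrite -[RHS](congr1 (@conjc R) (rth (I : setT p) tv)) /conj1 conjcK.
Qed.

Lemma horizontal_conj p v : horizontal th p v -> horizontal th p (conjv v).
Proof.
by move=> [tv v0]; split; [exact: tangent_conj|rewrite th_conj// v0 conjc0].
Qed.

Lemma horizontal_lin p a v w : horizontal th p v -> horizontal th p w ->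
  horizontal th p (lincombv a v w).
Proof.
move=> [tv v0] [tw w0]; split; first exact: tangent_lin.
by rewrite (form_lin a sth I tv tw) v0 w0 mulr0 addr0.
Qed.

(** Among [Y - iJY] and its analogue for [conj Y], one does not vanish. *)
Lemma exists_type10 W Y p : open W -> W p -> smooth_vfield W Y ->
  (forall q, W q -> th q (Y q) = 0) -> Y p <> (fun=> 0) ->
  exists Z, [/\ smooth_vfield W Z, forall q, W q -> th q (Z q) = 0,
    forall q, W q -> J q (Z q) = scalev 'i%C (Z q) & Z p <> (fun=> 0)].
Proof.
move=> oW Wp sY Y0 Yp; have [Jh Jl Jc JJ Js] := acJ.
have mk Y' : smooth_vfield W Y' -> (forall q, W q -> th q (Y' q) = 0) ->
    let Z' := linf (fun=> - 'i%C) (fun q => J q (Y' q)) Y' in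
    [/\ smooth_vfield W Z', forall q, W q -> th q (Z' q) = 0 &
    forall q, W q -> J q (Z' q) = scalev 'i%C (Z' q)].
  move=> sY' Y'0 Z'; have sJ := Js W Y' oW sY' Y'0.
  have h q : W q -> horizontal th q (Y' q) by move=> Wq; split; [exact: vf_tangent sY' Wq|exact: Y'0].
  split.
  - by apply: vf_lin => //; exact: csmooth_cst.
  - by move=> q Wq; have [] := horizontal_lin (- 'i%C) (Jh _ _ (h q Wq)) (h q Wq).
  - move=> q Wq; rewrite /Z' /linf Jl//; [|exact: Jh (h q Wq)|exact: h].
    rewrite JJ; last exact: h.
    by apply/funext => f; rewrite /lincombv /scalev; ring: (mulCii R).
have [s1 h1 t1] := mk Y sY Y0.
have [Zp|Zp] := pselect (linf (fun=> - 'i%C) (fun q => J q (Y q)) Y p = (fun=> 0)); last first.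
  by exists (linf (fun=> - 'i%C) (fun q => J q (Y q)) Y).
have sYb := vf_conj oW sY.
have [|s2 h2 t2] := mk _ sYb.
  by move=> q Wq; rewrite /conjvf th_conj ?Y0 ?conjc0//; exact: vf_tangent sY Wq.
exists (linf (fun=> - 'i%C) (fun q => J q (conjvf Y q)) (conjvf Y)); split=> // Z2.
apply: Yp; have hp : horizontal th p (Y p) by split; [exact: vf_tangent sY Wp|exact: Y0].
apply/funext => f; have := congr1 (fun v => (v (fun q => (f q)^c))^c) Z2.
have := congr1 (fun v => v f) Zp.
rewrite /linf /conjvf Jc// /lincombv /conjv; cbv beta.
have -> : (fun q => ((f q)^c)^c) = f by apply/funext => q; rewrite conjcK.
rewrite !conjcD !conjcM !conjcN conjcK conjc0 => E1.
have -> : ('i%C : C)^c = - 'i%C by rewrite -imE conjci.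
rewrite !conjcK => E2.
have : Y p f *+ 2 = 0 by rewrite mulr2n -[RHS](addr0 0) -{1}E1 -E2; ring.
by move/eqP; rewrite mulrn_eq0 => /eqP.
Qed.

Lemma exists_horizontal p : exists c W T0 Y, [/\ atlas c, open W, W p & W `<=` chart_dom c] /\
  [/\ smooth_vfield W T0, forall q, W q -> th q (T0 q) = 1, smooth_vfield W Y,
     forall q, W q -> th q (Y q) = 0 & Y p <> (fun=> 0)].
Proof.
have [[_ _ /(_ p)[U [X [Y [Z [oU Up [sX sY sZ] wXYZ]]]]]] _ _] := ps.
have [c ac cp] := atlas_cover p.
have [X' [Y' [Z' [sX' sY' sZ' w' X'0]]]] : exists X Y Z, [/\ smooth_vfield U X, smooth_vfield U Y,
    smooth_vfield U Z, wedge_extd th X Y Z p != 0 & th p (X p) != 0].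
  have [E1|] := eqVneq (th p (X p)) 0; last by exists X, Y, Z.
  have [E2|] := eqVneq (th p (Y p)) 0; last first.
    by exists Y, Z, X; split=> //; apply: contra wXYZ => /eqP <-; rewrite /wedge_extd; apply/eqP; ring.
  exists Z, X, Y; split=> //; first by apply: contra wXYZ => /eqP <-; rewrite /wedge_extd; apply/eqP; ring.
  by apply: contra wXYZ => /eqP E3; rewrite /wedge_extd E1 E2 E3 !mul0r !addr0.
clear X Y Z sX sY sZ wXYZ; move: X' Y' Z' sX' sY' sZ' w' X'0 => X Y Z sX sY sZ w X0.
have sU := form_sub (@subsetT _ U) sth.
have ct := form_smooth sU oU (@subset_refl _ U) sX.
pose W : set M := [set q | U q /\ contract th X q != 0] `&` chart_dom c.
have oW : open W by apply: openI; [exact: open_neq0|exact: chart_dom_open].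
have Wp : W p by [].
have WU : W `<=` U by move=> q [[]].
have sW := form_sub WU sU.
pose t' q := (th q (X q))^-1.
have st' : csmooth_on W t'.
  by apply: csmoothV => //; [move=> q [[]]|exact: csmooth_sub ct].
pose T0 := scalef t' X.
have sT0 : smooth_vfield W T0 by apply: vf_scale => //; exact: vf_sub sX.
have tX q : W q -> is_tangent q (X q) by move=> /WU Uq; exact: vf_tangent sX Uq.
have T01 q : W q -> th q (T0 q) = 1.
  move=> Wq; rewrite /T0 /scalef (form_scale _ sW Wq (tX q Wq)) mulVf//.
  by case: Wq => -[].
pose hp Q := linf (fun q => - th q (Q q)) T0 Q.
have hpP Q : smooth_vfield U Q -> smooth_vfield W (hp Q) /\ forall q, W q -> th q (hp Q q) = 0.
  move=> sQ; have sQW := vf_sub WU sQ; split.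
    apply: vf_lin => //; apply: csmoothN => //.
    exact: (form_smooth sW oW (@subset_refl _ W) sQW).
  move=> q Wq; have tQ := vf_tangent sQW Wq.
  by rewrite /hp /linf (form_lin _ sW Wq (vf_tangent sT0 Wq) tQ) T01// mulr1 addNr.
exists c, W, T0.
have [Yp|Yp] := pselect (hp Y p = (fun=> 0)); last first.
  have [s1 s2] := hpP Y sY; exists (hp Y); split=> //; first by split=> // q [].
have [Zp|Zp] := pselect (hp Z p = (fun=> 0)); last first.
  have [s1 s2] := hpP Z sZ; exists (hp Z); split=> //; first by split=> // q [].
exfalso; move/eqP: w; apply.
have comp Q : hp Q p = (fun=> 0) -> Q p = scalev (th p (Q p) * t' p) (X p).
  move=> /(congr1 (fun v => fun f => v f)) E; apply/funext => f.
  have := congr1 (fun v => v f) E; rewrite /hp /linf /lincombv /T0 /scalef /scalev => /eqP.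
  by rewrite addrC mulNr subr_eq0 mulrA => /eqP.
have e P Q : smooth_vfield U P -> smooth_vfield U Q -> extd th P Q p = dd c th p (P p) (Q p).
  by move=> sP sQ; rewrite (extd_tensor ac cp oU Up sU sP sQ).
have xx := extdXX oU Up sU sX; rewrite e// in xx.
have tXp := vf_tangent sX Up.
have sl a b : dd c th p (scalev a (X p)) (scalev b (X p)) = 0.
  rewrite (linear_scale a (@dd_linl _ _ c th p _) tXp) (linear_scale b (@dd_linr _ _ c th p _) tXp).
  by rewrite xx !mulr0.
have sl1 a : dd c th p (scalev a (X p)) (X p) = 0.
  by rewrite (linear_scale a (@dd_linl _ _ c th p _) tXp) xx mulr0.
have sl2 a : dd c th p (X p) (scalev a (X p)) = 0.
  by rewrite (linear_scale a (@dd_linr _ _ c th p _) tXp) xx mulr0.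
have Yc := comp Y Yp; have Zc := comp Z Zp.
by rewrite /wedge_extd !e// Yc Zc sl sl1 sl2 !mulr0 !addr0.
Qed.

(** A horizontal field of type (1,0) can be divided by the square root of
    [- i dtheta (Z, conj Z)], positive by the orientation of [J], and the Reeb field
    is a transverse field corrected by horizontal terms. *)
Lemma exists_frame p : exists c V (F : local_frame th J V),
  [/\ atlas c, V p & V `<=` chart_dom c].
Proof.
have [c [W [T0 [Y [[ac oW Wp Wc] [sT0 T01 sY Y0 Yp]]]]]] := exists_horizontal p.
have [Z [sZ Z0 JZ Zp]] := exists_type10 oW Wp sY Y0 Yp.
have sZb := vf_conj oW sZ.
have sW := form_sub (@subsetT _ W) sth.
have rW : real_form1 W th by move=> q v _; exact: rth.
have [Jh Jl Jc JJ Js] := acJ.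
have hZ q : W q -> horizontal th q (Z q) by move=> Wq; split; [exact: vf_tangent sZ Wq|exact: Z0].
have hZb q : W q -> horizontal th q (conjvf Z q) by move=> Wq; apply: horizontal_conj; exact: hZ.
have JZb q : W q -> J q (conjvf Z q) = scalev (- 'i%C) (conjvf Z q).
  by move=> Wq; rewrite /conjvf Jc ?JZ ?conjv_scale//; [rewrite -imE conjci imE|exact: hZ].
have Wt q : W q -> [/\ is_tangent q (T0 q), is_tangent q (Z q) & is_tangent q (conjvf Z q)].
  by move=> Wq; split; [exact: vf_tangent sT0 Wq|exact: vf_tangent sZ Wq|exact: vf_tangent sZb Wq].
have E q P Q : W q -> smooth_vfield W P -> smooth_vfield W Q ->
   extd th P Q q = dd c th q (P q) (Q q).
  by move=> Wq sP sQ; rewrite (extd_tensor ac (Wc q Wq) oW Wq sW sP sQ).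
pose D q := - 'i%C * extd th Z (conjvf Z) q.
have DC q : W q -> (D q)^c = D q.
  move=> Wq; rewrite /D conjcM conjcN -imE conjci imE -(extd_real oW Wq sZ sZb rW) conjvf_invol.
  by rewrite (extdC oW Wq sW sZb sZ); ring.
have Dp : 0 < D p.
  pose X := linf (fun=> 1) Z (conjvf Z).
  have sX : smooth_vfield W X by apply: vf_lin => //; exact: csmooth_cst.
  have JX q : W q -> linf (fun=> 'i%C) Z (scalef (fun=> - 'i%C) (conjvf Z)) q = J q (X q).
    move=> Wq; rewrite /X /linf Jl; [|exact: hZ|exact: hZb]; rewrite JZ// JZb//.
    by apply/funext => f; rewrite /lincombv /scalef /scalev mul1r.
  have sJX : smooth_vfield W (linf (fun=> 'i%C) Z (scalef (fun=> - 'i%C) (conjvf Z))).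
    by apply: vf_lin => //; [exact: csmooth_cst|apply: vf_scale => //; exact: csmooth_cst].
  have Eor : extd th X (fun q => J q (X q)) p = 2%:R * D p.
    rewrite -(@extd_local _ _ th X _ X _ W p oW Wp sX sJX)// E//.
    have [tT tZ tZb] := Wt p Wp.
    rewrite /X {1}/linf (@dd_linl _ _ c th p _ 1 _ _ tZ tZb).
    rewrite /linf !(@dd_linr _ _ c th p _ 'i%C _ _ tZ (tangent_scale _ tZb)).
    rewrite !(linear_scale _ (@dd_linr _ _ c th p _) tZb) -!E//.
    rewrite (extdXX oW Wp sW sZ) (extdXX oW Wp sW sZb) (extdC oW Wp sW sZb sZ) /D.
    by ring.
  have real : real_vfield W X.
    move=> q Wq; rewrite /X /linf conjv_lin conjc1 /conjvf conjvK.
    by apply/funext => f; rewrite /lincombv; ring.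
  have h0 q : W q -> th q (X q) = 0.
    by move=> Wq; have [_] := horizontal_lin 1 (hZ q Wq) (hZb q Wq).
  have nz : X p <> (fun=> 0).
    move=> X0; apply: Zp; have J0 := JX p Wp.
    have : J p (X p) = (fun=> 0).
      have -> : X p = scalev 0 (X p) by rewrite X0; apply/funext => f; rewrite /scalev mulr0.
      rewrite (J_scale _ acJ); last by split; [exact: vf_tangent sX Wp|exact: h0].
      by apply/funext => f; rewrite /scalev mul0r.
    rewrite -J0 => J1; apply/funext => f.
    have := congr1 (fun v => v f) X0; have := congr1 (fun v => v f) J1.
    rewrite /X /linf /lincombv /scalef /scalev mul1r => E1 E2.
    have : (Z p f *+ 2) = 0.
      by rewrite mulr2n; apply: (lc 1 E2); apply: (lc (- 'i%C) E1); ring: (mulCii R).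
    by move/eqP; rewrite mulrn_eq0 => /eqP.
  by have [_ _ or] := ps; have := or W X oW sX real h0 p Wp nz; rewrite Eor pmulr_rgt0.
have sD : csmooth_on W D.
  apply: csmoothM => //; first exact: csmooth_cst.
  exact: (extd_smooth oW sW sZ sZb).
pose d q := complex.Re (D q).
have dE q : W q -> D q = (d q)%:C.
  move=> Wq; have := DC q Wq; rewrite /d; case: (D q) => x y /= [H].
  by apply: complex_eq => //=; lra.
have dp : 0 < d p by have := Dp; rewrite dE// ltcR.
have [sd _] := sD.
pose V : set M := [set q | W q /\ 0 < d q].
have oV : open V by exact: open_pos.
have Vp : V p by [].
have VW : V `<=` W by move=> q [].
have [sT0' sZ' sZb'] := And3 (vf_sub VW sT0) (vf_sub VW sZ) (vf_sub VW sZb).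
pose e q := expR (- (2%:R^-1) * ln (d q)).
have se : csmooth_on V (cfun_of e).
  apply: csmooth_real; apply: smooth_exp => //; apply: smoothM => //; first exact: smooth_cst.
  by apply: smooth_ln => //; [move=> q []|exact: smooth_sub sd].
have eE q : V q -> (e q)%:C * (e q)%:C * D q = 1.
  move=> [Wq dq]; rewrite dE// -!rmorphM /= /e -expRD -mulrDl -opprD.
  have -> : - (2%:R^-1 + 2%:R^-1) = - 1 :> R by lra.
  by rewrite mulN1r expRN lnK ?posrE// mulVf ?gt_eqF.
pose Z1 := scalef (cfun_of e) Z.
have sZ1 : smooth_vfield V Z1 by exact: vf_scale.
have cZ1 : conjvf Z1 = scalef (cfun_of e) (conjvf Z).
  by apply/funext => q; rewrite /conjvf /Z1 /scalef conjv_scale conjc_real.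
have sZ1b : smooth_vfield V (conjvf Z1) by exact: vf_conj.
have sV := form_sub VW sW.
have EV q P Q : V q -> smooth_vfield V P -> smooth_vfield V Q ->
   extd th P Q q = dd c th q (P q) (Q q).
  by move=> Vq sP sQ; rewrite (extd_tensor ac (Wc q (VW q Vq)) oV Vq sV sP sQ).
have dZZb q : V q -> extd th Z1 (conjvf Z1) q = 'i%C.
  move=> Vq; have [tT tZ tZb] := Wt q (VW q Vq).
  rewrite EV// cZ1 /Z1 /scalef (linear_scale _ (@dd_linl _ _ c th q _) tZ).
  rewrite (linear_scale _ (@dd_linr _ _ c th q _) tZb) -E//; last exact: VW.
  have := eE q Vq; rewrite /D /cfun_of => H; apply: (lc 'i%C H); ring: (mulCii R).
pose b q := 'i%C * extd th T0 (conjvf Z1) q.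
pose b' q := - 'i%C * extd th T0 Z1 q.
have sb : csmooth_on V b.
  by apply: csmoothM => //; [exact: csmooth_cst|exact: extd_smooth].
have sb' : csmooth_on V b'.
  by apply: csmoothM => //; [exact: csmooth_cst|exact: extd_smooth].
pose T := linf b Z1 (linf b' (conjvf Z1) T0).
have sT : smooth_vfield V T by do 2!apply: vf_lin => //.
have tV q : V q -> [/\ is_tangent q (T0 q), is_tangent q (Z1 q) & is_tangent q (conjvf Z1 q)].
  by move=> Vq; split; [exact: vf_tangent sT0' Vq|exact: vf_tangent sZ1 Vq|exact: vf_tangent sZ1b Vq].
have hZ1 q : V q -> th q (Z1 q) = 0.
  move=> Vq; have [_ tZ _] := Wt q (VW q Vq).
  by rewrite /Z1 /scalef (form_scale _ sV Vq tZ) Z0 ?mulr0//; exact: VW.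
have hZ1b q : V q -> th q (conjvf Z1 q) = 0.
  by move=> Vq; have [_ tZ _] := tV q Vq; rewrite /conjvf th_conj// hZ1// conjc0.
have T1 q : V q -> th q (T q) = 1.
  move=> Vq; have [tT tZ tZb] := tV q Vq.
  rewrite /T /linf (form_lin _ sV Vq tZ (tangent_lin _ tZb tT)) (form_lin _ sV Vq tZb tT).
  by rewrite hZ1// hZ1b// T01 ?mulr0 ?add0r//; exact: VW.
have ddT q y : V q -> is_tangent q y -> dd c th q (T q) y =
    b q * dd c th q (Z1 q) y + (b' q * dd c th q (conjvf Z1 q) y + dd c th q (T0 q) y).
  move=> Vq ty; have [tT tZ tZb] := tV q Vq.
  by rewrite /T /linf !(@dd_linl _ _ c th q y)//; exact: tangent_lin.
have dTZ q : V q -> extd th T Z1 q = 0.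
  move=> Vq; have [tT tZ tZb] := tV q Vq.
  rewrite EV// ddT// -!EV// (extdXX oV Vq sV sZ1) (extdC oV Vq sV sZ1b sZ1) dZZb// /b'.
  by ring: (mulCii R).
have dTZb q : V q -> extd th T (conjvf Z1) q = 0.
  move=> Vq; have [tT tZ tZb] := tV q Vq.
  rewrite EV// ddT// -!EV// (extdXX oV Vq sV sZ1b) dZZb// /b.
  by ring: (mulCii R).
have rV : real_form1 V th by move=> q v _; exact: rth.
have rT q : V q -> conjv (T q) = T q.
  move=> Vq; have [tT tZ tZb] := tV q Vq; have tTT := vf_tangent sT Vq.
  pose vv (i : 'I_3) := nth (T q) [:: T q; Z1 q; conjvf Z1 q] i.
  pose l (i : 'I_3) := nth (th q) [:: th q; fun x => - 'i%C * dd c th q x (conjvf Z1 q);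
     fun x => 'i%C * dd c th q x (Z1 q)] i.
  have lin y k : linear_at q (fun x => k * dd c th q x y).
    by move=> a x x' tx tx'; rewrite (@dd_linl _ _ c th q y a x x' tx tx'); ring.
  have Ll i : linear_at q (l i).
    by have [->|->|->] := ord3P i; rewrite /l /=; [exact: linear_form sV Vq|exact: lin|exact: lin].
  have tv i : is_tangent q (vv i) by have [->|->|->] := ord3P i.
  have z1 := dTZ q Vq; have z2 := dTZb q Vq; have z3 := dZZb q Vq.
  have z4 := extdC oV Vq sV sZ1b sZ1; have z5 := extdXX oV Vq sV sZ1; have z6 := extdXX oV Vq sV sZ1b.
  rewrite z3 in z4; rewrite !EV// in z1 z2 z3 z4 z5 z6.
  have dual i j : l i (vv j) = (i == j)%:R.
    have [->|->|->] := ord3P i; have [->|->|->] := ord3P j; rewrite /l /vv /= ?T1 ?hZ1 ?hZ1b ?z1 ?z2 ?z3 ?z4 ?z5 ?z6 //= ?mulr0 ?mulNii//.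
    by rewrite mulrN -imE mulii opprK.
  rewrite (dual_basis ac (Wc _ (VW _ Vq)) tv Ll dual (tangent_conj tTT)).
  have -> : l i0 (conjv (T q)) = 1 by rewrite /l /= th_conj// T1// conjc1.
  have -> : l i1 (conjv (T q)) = 0.
    rewrite /l /= -[conjv (T q)]/(conjvf T q) -EV//; last exact: vf_conj.
    by rewrite (extd_real oV Vq sT sZ1 rV) dTZ// conjc0 mulr0.
  have -> : l i2 (conjv (T q)) = 0.
    rewrite /l /= -[conjv (T q)]/(conjvf T q) -{1}(conjvf_invol Z1) -EV//; [|exact: vf_conj|exact: vf_conj].
    by rewrite (extd_real oV Vq sT sZ1b rV) dTZb// conjc0 mulr0.
  by apply/funext => f; rewrite /lincombv /scalev !mul0r mul1r !addr0.
have Vc : V `<=` chart_dom c by apply: subset_trans Wc.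
have [|F [FT FZ]] := @frame_builder _ _ c V T Z1 th J ac Vc oV sT sZ1 sV rT rV T1 hZ1 dTZ dZZb.
  move=> q Vq; rewrite /Z1 /scalef (J_scale _ acJ); last exact: hZ (VW q Vq).
  by rewrite JZ ?VW//; [apply/funext => f; rewrite /scalev mulrCA|exact: VW].
by exists c, V, F.
Qed.

End Point.
End Existence.

(** * Changes of frame *)

Section FrameChange.
Variables (A : comPzRingType) (I : A) (conj T Z Zb : A -> A).
Hypotheses (II : I * I = -1) (dT : is_der I T) (dZ : is_der I Z) (dZb : is_der I Zb).
Variables (w0 w1 wb a ac W : A).
Hypothesis fe : frame_eqs I conj T Z Zb w0 w1 wb a ac W.
Variables (conj' T' Z' Zb' : A -> A) (v0 v1 vb b bc W' : A).
Hypothesis fe' : frame_eqs I conj' T' Z' Zb' v0 v1 vb b bc W'.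
Hypothesis indep : forall x y t, (forall f, x * Z' f + y * Zb' f + t * T' f = 0) ->
     [/\ x = 0, y = 0 & t = 0].

(** Subtract two expansions of each bracket in the frame and use [indep]. *)
Lemma conn_unique u0 u1 ub b' : 
  (forall x, Z' (Zb' x) - Zb' (Z' x) = - I * T' x - ub * Z' x - u1 * Zb' x) ->
  (forall x, Z' (T' x) - T' (Z' x) = - u0 * Z' x + b' * Zb' x) ->
  [/\ v0 = u0, v1 = u1, vb = ub & b = b'].
Proof.
move=> C1 C2.
have [|E1 E2 _] := @coef_unique _ T' Z' Zb' indep (- ub) (- u1) (- I) (- vb) (- v1) (- I).
  move=> x; have E := comZZb fe' x; have E' := C1 x.
  by apply: (lc 1 E); apply: (lc (-1) E'); ring.
have [|E3 E4 _] := @coef_unique _ T' Z' Zb' indep (- u0) b' 0 (- v0) b 0.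
  move=> x; have E := comZT fe' x; have E' := C2 x.
  by apply: (lc 1 E); apply: (lc (-1) E'); ring.
by split=> //; apply: oppr_inj.
Qed.

Section Conformal.
Variables g e : A.
Hypotheses (Ze : Z e = - e * Z g) (Zbe : Zb e = - e * Zb g) (Te : T e = - e * T g).
Hypotheses (Z'E : forall x, Z' x = e * Z x) (Zb'E : forall x, Zb' x = e * Zb x)
 (T'E : forall x, T' x = e * e * (T x - 2%:R * I * Zb g * Z x + 2%:R * I * Z g * Zb x)).

(** The Q-curvature operator of the new frame, by [conf_R1] and the uniqueness
    of the connection. *)
Lemma conformal_Q :
  ndb Zb' vb (R1c I Z' Zb' vb b W') =
  e * e * e * e * ndb Zb wb (R1c I Z Zb wb a W - 6%:R * P1c I Z Zb w1 a g).
Proof.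
have C1 x := conf_comZZb II dZ dZb fe Ze Zbe x.
have C2 x := conf_comZT II dT dZ dZb fe Ze Zbe Te x.
have C3 := conf_curvature II dZ dZb fe Ze Zbe.
cbv beta in C1, C2, C3.
have [||E0 E1 Eb Ea] := @conn_unique
  (e * e * (w0 - 4 * I * Z g * Zb g + 2 * I * Z (Zb g) + 2 * I * Z g * wb - T g))
  (e * (w1 + 3 * Z g)) (e * (wb - 3 * Zb g))
  (e * e * (a + 2 * I * (Z (Z g) - w1 * Z g) - 4 * I * Z g * Z g)).
- by move=> x; rewrite !T'E !Z'E !Zb'E C1.
- by move=> x; rewrite !(T'E, Z'E, Zb'E) C2.
have EW := curvW fe'; rewrite !(Z'E, Zb'E) E0 E1 Eb C3 in EW.
have := conf_R1 II dZ dZb fe Ze Zbe; cbv beta => CR.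
rewrite {1}/ndb /R1c /a_b !(Z'E, Zb'E) Eb Ea EW CR.
by have := conf_Q II dZb wb Zbe; cbv beta => ->.
Qed.
End Conformal.

Section Rotation.
Variables u uc : A.
Hypothesis uu : u * uc = 1.
Hypotheses (T'E : forall x, T' x = T x) (Z'E : forall x, Z' x = u * Z x)
  (Zb'E : forall x, Zb' x = uc * Zb x).

(** Two frames of the same contact form differ by a factor [u] of modulus one;
    each lower index 1 contributes a factor [u], and each lower index of the
    conjugate type a factor [u^-1]. *)
Lemma rotation : [/\ forall x, nd1 Z' v1 (Zb' x) = nd1 Z w1 (Zb x), b = u * u * a,
  forall x, P1c I Z' Zb' v1 b x = u * P1c I Z Zb w1 a x & a_b Zb' vb b = u * a_b Zb wb a].
Proof.
have ucu D (dD : is_der I D) : u * D uc = - (uc * D u).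
  have := congr1 D uu; rewrite (derM dD) (der1 dD) => E; apply: (lc 1 E); ring.
have [||E0 E1 Eb Ea] := @conn_unique (w0 + uc * T u) (u * w1 - u * u * Z uc)
   (uc * wb + uc * uc * Zb u) (u * u * a).
- move=> x; rewrite !(T'E, Z'E, Zb'E) (derM dZ) (derM dZb) (comZZb fe).
  apply: (lc (- I * T x - wb * Z x - w1 * Zb x) uu).
  by apply: (lc (w1 * Zb x + wb * Z x + uc * Zb u * Z x - u * Z uc * Zb x) uu); ring.
- move=> x; rewrite !(T'E, Z'E, Zb'E) (derM dT) (comZT fe).
  by apply: (lc (T u * Z x - u * a * Zb x) uu); ring.
have H x : nd1 Z' v1 (Zb' x) = nd1 Z w1 (Zb x).
  rewrite /nd1 !(Z'E, Zb'E) E1 (derM dZ).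
  by apply: (lc (Z (Zb x) + w1 * Zb x - u * Z uc * Zb x) uu); ring.
split=> //.
- by move=> x; rewrite /P1c H Z'E Zb'E Ea; apply: (lc (I * u * a * Zb x) uu); ring.
- rewrite /a_b Zb'E Ea Eb !(derM dZb).
  apply: (lc (u * Zb a + 2%:R * Zb u * a - 2%:R * wb * u * a - 2%:R * (1 + u * uc) * Zb u * a) uu).
  by ring.
Qed.
End Rotation.
End FrameChange.

Section ConformalFrame.
Variables (R : realType) (M : manifold3 R).
Local Notation C := R[i].
Implicit Types (c : chart R M) (U V W : set M) (p q : M) (v x : cvector M).
Implicit Types (X Y Z T : vfield M) (al th : form1 M).

Lemma tangent_exp p v U (f : M -> R) : is_tangent p v -> open U -> U p -> smooth_on U f ->
  v (cfun_of (fun q => expR (f q))) = (expR (f p))%:C * v (cfun_of f).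
Proof.
move=> tv oU Up sf; have [c ac cp] := atlas_cover p.
rewrite (tangent_coord_real ac cp tv oU Up (smooth_exp oU sf)) (tangent_coord_real ac cp tv oU Up sf).
rewrite mulr_sumr; apply: eq_bigr => i _; rewrite mulrCA; congr (_ * _).
rewrite -rmorphM; congr (_%:C); rewrite /dM !pderE.
have d := @smooth_derivable _ _ c i U f p ac cp Up sf.
have [_ ->] := chain1 (is_derive_expR ((f \o chart_inv c) (chart_map c p))) d.
by rewrite /= invK.
Qed.

Lemma extd_mul U al (s : M -> C) X Y p : open U -> U p -> smooth_form1 U al -> csmooth_on U s ->
  smooth_vfield U X -> smooth_vfield U Y ->
  extd (fun q v => s q * al q v) X Y p =
  X p s * al p (Y p) - Y p s * al p (X p) + s p * extd al X Y p.
Proof.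
move=> oU Up sal ss sX sY; rewrite !extd_bracket /vderiv.
have ns := csmooth_nearW oU Up ss.
have n P : smooth_vfield U P -> csmooth_near p (contract al P).
  by move=> sP; exact: (csmooth_nearW oU Up (form_smooth sal oU (@subset_refl _ U) sP)).
have e P : contract (fun q v => s q * al q v) P = (fun q => s q * contract al P q) by [].
rewrite !e (tangentM (vf_tangent sX Up) ns (n _ sY)) (tangentM (vf_tangent sY Up) ns (n _ sX)).
by rewrite /contract; ring.
Qed.

Section Conf.
Variables (th : form1 M) (J : bundle_endo M) (g : M -> R).
Hypotheses (ps : pseudohermitian th J) (sg : smooth_on setT g).
Variables (c : chart R M) (V : set M) (oV : open V) (F : local_frame th J V).
Hypotheses (ac : atlas c) (Vc : V `<=` chart_dom c).
Local Notation th' := (fun p v => (expR (2 * g p))%:C * th p v).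
Let sth : smooth_form1 setT th. Proof. by have [[]] := ps. Qed.
Let rth : real_form1 setT th. Proof. by have [[]] := ps. Qed.
Let VV := @subset_refl _ V.
Let cf := frame_coframe F sth rth ac oV VV Vc.
Local Notation T := (fr_T F).
Local Notation Z := (fr_Z1 F).
Local Notation Zb := (conjvf (fr_Z1 F)).
Let sT := cf_T cf.
Let sZ := cf_Z cf.
Let sZb := cf_Zb cf.

Let cg : M -> C := cfun_of g.
Let e : M -> C := cfun_of (fun q => expR (- g q)).
Let scg : csmooth_on V cg.
Proof. by apply: csmooth_real; apply: smooth_sub sg. Qed.
Let se : csmooth_on V e.
Proof.
apply: csmooth_real; apply: smooth_exp => //; apply: smoothN => //.
exact: smooth_sub sg.
Qed.
Let b q : C := - 2%:R * 'i%C * vderiv Zb cg q.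
Let b' q : C := 2%:R * 'i%C * vderiv Z cg q.
Let sb : csmooth_on V b.
Proof. by apply: csmoothM => //; [exact: csmooth_cst|exact: vf_smooth sZb oV VV scg]. Qed.
Let sb' : csmooth_on V b'.
Proof. by apply: csmoothM => //; [exact: csmooth_cst|exact: vf_smooth sZ oV VV scg]. Qed.
Let Z' := scalef e Z.
Let T' := scalef (fun q => e q * e q) (linf b Z (linf b' Zb T)).

Let sZ' : smooth_vfield V Z'. Proof. exact: vf_scale. Qed.
Let see : csmooth_on V (fun q => e q * e q). Proof. exact: csmoothM. Qed.
Let sT0 : smooth_vfield V (linf b Z (linf b' Zb T)).
Proof. by do 2!apply: vf_lin => //. Qed.
Let sT' : smooth_vfield V T'. Proof. exact: vf_scale. Qed.

Let E : M -> C := cfun_of (fun q => expR (2 * g q)).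
Let sE' : csmooth_on V E.
Proof.
apply: csmooth_real; apply: smooth_exp => //; apply: smoothM => //; first exact: smooth_cst.
exact: smooth_sub sg.
Qed.
Let Eee p : E p * (e p * e p) = 1.
Proof.
rewrite /E /e /cfun_of -!rmorphM /= -!expRD (_ : 2 * g p + _ = 0) ?expR0//; ring.
Qed.

Let der_e p v : V p -> is_tangent p v -> v e = - e p * v cg.
Proof.
move=> Vp tv; rewrite (tangent_exp tv oV Vp (smoothN oV (smooth_sub (@subsetT _ V) sg))).
have -> : cfun_of (fun q => - g q) = (fun q => -1 * cg q).
  by apply/funext => q; rewrite mulN1r /cg /cfun_of rmorphN.
rewrite (tangentM tv (csmooth_near_cst _ p) (csmooth_nearW oV Vp scg)) (tangent_cst _ tv).
by rewrite /e /cfun_of; ring.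
Qed.

Let der_E p v : V p -> is_tangent p v -> v E = 2%:R * E p * v cg.
Proof.
move=> Vp tv; have s2 : smooth_on V (fun q => 2 * g q).
  by apply: smoothM => //; [exact: smooth_cst|exact: smooth_sub sg].
rewrite (tangent_exp tv oV Vp s2).
have -> : cfun_of (fun q => 2 * g q) = (fun q => 2%:R * cg q).
  by apply/funext => q; rewrite /cg /cfun_of rmorphM rmorph_nat.
rewrite (tangentM tv (csmooth_near_cst _ p) (csmooth_nearW oV Vp scg)) (tangent_cst _ tv).
by rewrite /E /cfun_of; ring.
Qed.

Let cgJ : (fun q => (cg q)^c) = cg.
Proof. by apply/funext => q; exact: conjc_real. Qed.

(** The fields [e^(-g) Z] and [T'] satisfy the normalization for [e^(2g) theta],
    so they extend to a local frame. *)
Lemma conformal_frame : exists F' : local_frame th' J V, fr_T F' = T' /\ fr_Z1 F' = Z'.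
Proof.
have sthV := form_sub (@subsetT _ V) sth.
have st' : smooth_form1 V th'.
  split=> [p Vp k v w tv tw|W X oW WV sX].
    by rewrite (form_lin _ sthV Vp tv tw); ring.
  apply: csmoothM => //; first exact: csmooth_sub sE'.
  exact: (form_smooth sthV oW WV sX).
have rt' : real_form1 V th'.
  move=> p v Vp tv; rewrite /conj1 conjcM conjc_real; congr (_ * _).
  exact: rth.
have vals p (Vp : V p) := cf_vals cf Vp.
have tt p (Vp : V p) := And3 (vf_tangent sT Vp) (vf_tangent sZ Vp) (vf_tangent sZb Vp).
have thT0 p : V p -> th p (linf b Z (linf b' Zb T) p) = 1.
  move=> Vp; have [tT tZ tZb] := tt p Vp; have [[a1 a2 a3] _] := vals p Vp.
  rewrite /linf (form_lin _ sthV Vp tZ (tangent_lin _ tZb tT)) (form_lin _ sthV Vp tZb tT).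
  by rewrite a1 a2 a3 !mulr0 !add0r.
have thT' p : V p -> th p (T' p) = e p * e p.
  move=> Vp; rewrite /T' /scalef (form_scale _ sthV Vp (vf_tangent sT0 Vp)) thT0//.
  by rewrite mulr1.
have thZ' p : V p -> th p (Z' p) = 0.
  move=> Vp; have [tT tZ tZb] := tt p Vp; have [[a1 a2 a3] _] := vals p Vp.
  by rewrite /Z' /scalef (form_scale _ sthV Vp tZ) a2 mulr0.
have eJ p : (e p)^c = e p by exact: conjc_real.
have cZ' : conjvf Z' = scalef e Zb.
  by apply/funext => p; rewrite /conjvf /Z' /scalef conjv_scale eJ.
have sZb' : smooth_vfield V (conjvf Z') by exact: vf_conj.
have dE P Q p : V p -> smooth_vfield V P -> smooth_vfield V Q ->
   extd th P Q p = dd c th p (P p) (Q p).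
  by move=> Vp sP sQ; rewrite (extd_tensor ac (Vc Vp) oV Vp sthV sP sQ).
have dTZ p (Vp : V p) := cf_dTZ cf Vp.
have dZZb p (Vp : V p) := cf_dZZb cf Vp.
apply: (@frame_builder _ _ c V T' Z' th' J ac Vc oV sT' sZ' st').
- move=> p Vp; rewrite /T' /scalef conjv_scale conjcM eJ /linf !conjv_lin (cf_Treal cf Vp).
  rewrite /conjvf conjvK; apply/funext => f; rewrite /scalev /lincombv.
  have -> : (b p)^c = b' p.
    rewrite /b /b' !conjcM -imE conjci /vderiv /conjvf /conjv conjcK cgJ imE.
    by rewrite rmorphN rmorph_nat; ring.
  have -> : (b' p)^c = b p.
    rewrite /b /b' !conjcM -imE conjci /vderiv /conjvf /conjv cgJ imE.
    by rewrite rmorph_nat; ring.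
  by ring.
- exact: rt'.
- by move=> p Vp; rewrite thT'// Eee.
- by move=> p Vp; rewrite thZ'// mulr0.
- move=> p Vp; have [tT tZ tZb] := tt p Vp.
  rewrite (extd_mul oV Vp sthV sE' sT' sZ') thZ'// thT'// mulr0 sub0r.
  rewrite (der_E Vp (vf_tangent sZ' Vp)) dE// /Z' /T' /scalef.
  rewrite (linear_scale _ (@dd_linl _ _ c th p _) (vf_tangent sT0 Vp)).
  rewrite (linear_scale _ (@dd_linr _ _ c th p _) tZ) /linf.
  rewrite (@dd_linl _ _ c th p (Z p) _ _ _ tZ (tangent_lin _ tZb tT)).
  rewrite (@dd_linl _ _ c th p (Z p) _ _ _ tZb tT) -!dE// dTZ// (extdXX oV Vp sthV sZ).
  rewrite (extdC oV Vp sthV sZb sZ) dZZb// /b' /scalev /vderiv.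
  by have H := Eee p; apply: (lc 0 H); ring: (mulCii R).
- move=> p Vp; have [tT tZ tZb] := tt p Vp.
  rewrite (extd_mul oV Vp sthV sE' sZ' sZb') thZ'//.
  have -> : th p (conjvf Z' p) = 0.
    rewrite cZ' /scalef (form_scale _ sthV Vp tZb).
    by have [[_ _ ->] _] := vals p Vp; rewrite mulr0.
  rewrite !mulr0 subrr add0r dE// cZ' /Z' /scalef.
  rewrite (linear_scale _ (@dd_linl _ _ c th p _) tZ) (linear_scale _ (@dd_linr _ _ c th p _) tZb).
  by rewrite -dE// dZZb//; have H := Eee p; apply: (lc 'i%C H); ring.
- move=> p Vp; have [_ acJ _] := ps; have [tT tZ tZb] := tt p Vp.
  have hZ : horizontal th p (Z p) by split=> //; have [[_ -> _] _] := vals p Vp.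
  rewrite /Z' /scalef (J_scale _ acJ hZ) (fr_Z1_type10 F Vp).
  by apply/funext => f; rewrite /scalev; ring.
Qed.

Local Notation A := (oring oV).
Local Notation DZ := (sder (oU := oV) sZ).
Local Notation DZb := (sder (oU := oV) sZb).
Local Notation II := (scst oV 'i%C : A).
Let gA : A := mks oV scg.
Let eA : A := mks oV se.

(** The vanishing of the Q-curvature is tested on the frame of
    [conformal_frame], where [conformal_Q] applies. *)
Lemma conformal_Qcurv (k : R) : k != 0 -> Qcurv_vanishes k th' J ->
  ndb DZb (cf_wb cf) (R1c II DZ DZb (cf_wb cf) (cf_a cf) (cf_W cf)
     - 6%:R * P1c II DZ DZb (cf_w1 cf) (cf_a cf) gA) = 0.
Proof.
move=> k0 hQ; have [F' [FT FZ]] := conformal_frame.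
have st' : smooth_form1 setT th'.
  split=> [p _ x v w tv tw|W X oW WV sX].
    by rewrite (form_lin _ sth I tv tw); ring.
  apply: csmoothM => //; last exact: (form_smooth sth oW WV sX).
  apply: csmooth_real; apply: smooth_exp => //; apply: smoothM => //; first exact: smooth_cst.
  exact: smooth_sub sg.
have rt' : real_form1 setT th'.
  move=> p v Vp tv; rewrite /conj1 conjcM conjc_real; congr (_ * _).
  exact: rth.
pose cf' := frame_coframe F' st' rt' ac oV VV Vc.
pose sZ2 := cf_Z cf'; pose sZb2 := cf_Zb cf'; pose sT2 := cf_T cf'.
have Z'E f : sder (oU := oV) sZ2 f = eA * DZ f.
  by apply: sfun_ext => p Vp; rewrite !(sE oV Vp) !mksE// /vderiv FZ.
have Zb'E f : sder (oU := oV) sZb2 f = eA * DZb f.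
  apply: sfun_ext => p Vp; rewrite !(sE oV Vp) !mksE// /vderiv FZ /conjvf /Z' /scalef conjv_scale.
  by rewrite conjc_real.
have T'E f : sder (oU := oV) sT2 f = eA * eA * (sder (oU := oV) sT f
    - 2%:R * II * DZb gA * DZ f + 2%:R * II * DZ gA * DZb f).
  apply: sfun_ext => p Vp; rewrite !(sE oV Vp).
  have -> : DZb gA p = vderiv Zb cg p by rewrite (rep_der sZb (rep_mks oV scg) Vp).
  have -> : DZ gA p = vderiv Z cg p by rewrite (rep_der sZ (rep_mks oV scg) Vp).
  rewrite !mksE// {1}/vderiv FT /T' /scalef /linf /lincombv /scalev /b /b' /vderiv.
  by ring.
have de X (sX : smooth_vfield V X) : sder (oU := oV) sX eA = - eA * sder (oU := oV) sX gA.
  apply: sfun_ext => p Vp; rewrite !(sE oV Vp).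
  rewrite (rep_der sX (rep_mks oV se) Vp) (rep_der sX (rep_mks oV scg) Vp) (mksE _ se Vp).
  by rewrite /vderiv (der_e Vp (vf_tangent sX Vp)).
have H := conformal_Q (cf_II oV) (is_der_sder oV sT) (is_der_sder oV sZ) (is_der_sder oV sZb)
  (cf_frame_eqs cf) (cf_frame_eqs cf') (@cf_indep _ _ _ _ _ _ _ _ _ cf') (de _ sZ) (de _ sZb) (de _ sT) Z'E Zb'E T'E.
have Q0 : ndb (sder (oU := oV) sZb2) (cf_wb cf') (R1c II (sder (oU := oV) sZ2) (sder (oU := oV) sZb2)
    (cf_wb cf') (cf_a cf') (cf_W cf')) = 0.
  have rw := frame_wb F' st' rt' ac oV VV Vc.
  have ra := frame_a F' st' rt' ac oV VV Vc.
  have rW := frame_W F' st' rt' ac oV VV Vc.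
  have rR : rep (R1c II (sder (oU := oV) sZ2) (sder (oU := oV) sZb2) (cf_wb cf') (cf_a cf') (cf_W cf'))
    (R1 F').
    rewrite /R1c /a_b; apply: rep_sub; first exact: (rep_der sZ2 rW).
    apply: rep_mul; first exact: rep_cst.
    move=> p Vp; rewrite (rep_sub (rep_der sZb2 ra) (rep_mul (@rep_nat _ _ _ _ 2) (rep_mul rw ra)) Vp).
    by rewrite /A11_b /covderiv /contract mulr0n addr0 mulrA; congr (_ - _ * _); exact: mulr_natl.
  apply: sfun_ext => p Vp; apply: etrans (rep_sub (rep_der sZb2 rR) (rep_mul rw rR) Vp) _.
  have := hQ _ F' p Vp; rewrite /Qcurv => /eqP.
  rewrite mulNr oppr_eq0 mulf_eq0 (fmorph_eq0 (real_complex R)) (negbTE k0) /= => /eqP.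
  by rewrite cutoff_in// /covderiv /contract mulr1n mulr0n addr0.
rewrite Q0 in H; apply: sfun_ext => p Vp; have := congr1 (fun f : A => f p) H.
rewrite !(sE oV Vp) (mksE _ se Vp) => H'.
have e0 : e p != 0.
  by apply/eqP => z; have := Eee p; rewrite z mulr0 mulr0 => /esym/eqP; rewrite oner_eq0.
by move/esym/eqP: H'; rewrite !mulf_eq0 !(negbTE e0) /= => /eqP.
Qed.

End Conf.
End ConformalFrame.

(** * The volume form of a contact form *)

Section TripleProduct.
Variable A : comPzRingType.

Definition det3 (x0 x1 x2 y0 y1 y2 z0 z1 z2 : A) : A :=
  x0 * (y1 * z2 - y2 * z1) - x1 * (y0 * z2 - y2 * z0) + x2 * (y0 * z1 - y1 * z0).

Variables (x0 x1 x2 y0 y1 y2 z0 z1 z2 : A).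
Local Notation D := (det3 x0 x1 x2 y0 y1 y2 z0 z1 z2).

(** The trace is the derivative of the determinant at the identity matrix. *)
Lemma det3_trace d00 d01 d02 d10 d11 d12 d20 d21 d22 :
  det3 (x0 * d00 + x1 * d10 + x2 * d20) (x0 * d01 + x1 * d11 + x2 * d21)
       (x0 * d02 + x1 * d12 + x2 * d22) y0 y1 y2 z0 z1 z2
  + det3 x0 x1 x2 (y0 * d00 + y1 * d10 + y2 * d20) (y0 * d01 + y1 * d11 + y2 * d21)
       (y0 * d02 + y1 * d12 + y2 * d22) z0 z1 z2
  + det3 x0 x1 x2 y0 y1 y2 (z0 * d00 + z1 * d10 + z2 * d20) (z0 * d01 + z1 * d11 + z2 * d21)
       (z0 * d02 + z1 * d12 + z2 * d22)
  = D * (d00 + d11 + d22).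
Proof. rewrite /det3; ring. Qed.

Lemma det3_der I (d : A -> A) : is_der I d ->
  d D = det3 (d x0) (d x1) (d x2) y0 y1 y2 z0 z1 z2
      + det3 x0 x1 x2 (d y0) (d y1) (d y2) z0 z1 z2
      + det3 x0 x1 x2 y0 y1 y2 (d z0) (d z1) (d z2).
Proof. by move=> dd; rewrite /det3 !(derD dd, derN _ dd, derM dd); ring. Qed.
End TripleProduct.

Section VolumeAlgebra.
Variables (A : comPzRingType) (I : A) (D0 D1 D2 X Y Z : A -> A).
Hypotheses (II : I * I = -1) (d0 : is_der I D0) (d1 : is_der I D1) (d2 : is_der I D2)
  (dX : is_der I X).
Variables (x0 x1 x2 y0 y1 y2 z0 z1 z2 v k : A).
Hypotheses (XE : forall f, X f = x0 * D0 f + x1 * D1 f + x2 * D2 f)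
  (YE : forall f, Y f = y0 * D0 f + y1 * D1 f + y2 * D2 f)
  (ZE : forall f, Z f = z0 * D0 f + z1 * D1 f + z2 * D2 f).
Hypothesis vdet : v * det3 x0 x1 x2 y0 y1 y2 z0 z1 z2 = I.
(** The bracket with [X] is a derivation of triple products, up to its trace. *)
Hypothesis brackets :
  det3 x0 x1 x2 (X y0 - Y x0) (X y1 - Y x1) (X y2 - Y x2) z0 z1 z2
  + det3 x0 x1 x2 y0 y1 y2 (X z0 - Z x0) (X z1 - Z x1) (X z2 - Z x2)
  = - k * det3 x0 x1 x2 y0 y1 y2 z0 z1 z2.

(** Jacobi's formula for the derivative of the determinant of the components,
    which is [I / v]. *)
Lemma coord_div : D0 (v * x0) + D1 (v * x1) + D2 (v * x2) = k * v.
Proof.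
have T := det3_trace x0 x1 x2 y0 y1 y2 z0 z1 z2
  (D0 x0) (D0 x1) (D0 x2) (D1 x0) (D1 x1) (D1 x2) (D2 x0) (D2 x1) (D2 x2).
have Xd := det3_der x0 x1 x2 y0 y1 y2 z0 z1 z2 dX.
rewrite -!XE -!YE -!ZE in T.
move: Xd T vdet brackets; set D := det3 x0 x1 x2 y0 y1 y2 z0 z1 z2 => Xd T vd br.
have XD : X D = D * (D0 x0 + D1 x1 + D2 x2) - k * D.
  by rewrite Xd; apply: (lc 1 T); apply: (lc 1 br); rewrite /det3; ring.
have Xv : X v * D + v * X D = 0 by rewrite -(derM dX) vd (derI dX).
have DX := XE v; rewrite XD in Xv.
rewrite !(derM d0) !(derM d1) !(derM d2).
apply: (lc (-1) DX).
apply: (lc (- I * v) Xv).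
by apply: (lc (I * (X v + v * (D0 x0 + D1 x1 + D2 x2) - v * k)) vd); ring: II.
Qed.
End VolumeAlgebra.

Section Volume.
Variables (R : realType) (M : manifold3 R).
Local Notation C := R[i].
Implicit Types (c : chart R M) (U V W : set M) (p q : M) (v x : cvector M).
Implicit Types (X Y Z T : vfield M) (al th : form1 M).

(** The coefficient of the volume form [th /\ d th] in a chart. *)
Definition volc c th : M -> C := wedge_extd th (pd c i0) (pd c i1) (pd c i2).

Lemma volc_smooth c th : atlas c -> smooth_form1 setT th -> csmooth_on (chart_dom c) (volc c th).
Proof.
move=> ac sth; have oc := chart_dom_open c.
have s := form_sub (@subsetT _ (chart_dom c)) sth; have sp i := vf_pd i ac.
have h i j k : csmooth_on (chart_dom c) (fun p => th p (pd c i p) * extd th (pd c j) (pd c k) p).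
  apply: csmoothM => //; first exact: (form_smooth s oc (@subset_refl _ _) (sp i)).
  exact: extd_smooth.
by do 2?[apply: csmoothD => //].
Qed.

Lemma conjv_pd c i p : atlas c -> chart_dom c p -> conjv (pd c i p) = pd c i p.
Proof.
move=> ac cp; apply/funext => f; have [sf|nsf] := pselect (csmooth_near p f); last first.
  by rewrite /conjv /pd !asboolF ?conjc0// => /csmooth_nearJP.
rewrite /conjv !pdE//; last by apply/csmooth_nearJP.
have [U [oU Up [s1 s2]]] := sf.
apply: complex_eq.
  by rewrite ReJ /dC /=; congr (dM c i _ p); apply/funext => q; rewrite ReJ.
rewrite ImJ /dC /= -(@dM_opp _ _ c i U)//; last by have [] := csmoothJ oU (conj s1 s2).
by congr (dM c i _ p); apply/funext => q; rewrite ImJ opprK.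
Qed.

Lemma volc_real c th p : atlas c -> chart_dom c p -> smooth_form1 setT th -> real_form1 setT th ->
  (volc c th p)^c = volc c th p.
Proof.
move=> ac cp sth rth; have oc := chart_dom_open c.
have s := form_sub (@subsetT _ (chart_dom c)) sth; have sp i := vf_pd i ac.
have r : real_form1 (chart_dom c) th by move=> q v _; exact: rth.
have e i j : (extd th (pd c i) (pd c j) p)^c = extd th (pd c i) (pd c j) p.
  rewrite -(extd_real oc cp (sp i) (sp j) r); symmetry.
  by apply: (@extd_local _ _ th _ _ _ _ (chart_dom c) p oc cp (sp i) (sp j)) => q cq;
    rewrite /conjvf conjv_pd.
have t i : (th p (pd c i p))^c = th p (pd c i p).
  by rewrite -{1}(conjv_pd i ac cp) -[RHS](rth p _ I (tangent_pd i ac cp)).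
by rewrite /volc /wedge_extd !conjcD !conjcM !e !t.
Qed.

Lemma wedge_extd_coord c U th X Y Z p : atlas c -> chart_dom c p -> open U -> U p ->
  smooth_form1 U th -> smooth_vfield U X -> smooth_vfield U Y -> smooth_vfield U Z ->
  let x i := X p (ccoord c i) in let y i := Y p (ccoord c i) in let z i := Z p (ccoord c i) in
  wedge_extd th X Y Z p =
  volc c th p * det3 (x i0) (x i1) (x i2) (y i0) (y i1) (y i2) (z i0) (z i1) (z i2).
Proof.
move=> ac cp oU Up sth sX sY sZ x y z.
have e P Q : smooth_vfield U P -> smooth_vfield U Q -> extd th P Q p = dd c th p (P p) (Q p).
  by move=> sP sQ; rewrite (extd_tensor ac cp oU Up sth sP sQ).
have t P : smooth_vfield U P -> th p (P p) = \sum_i P p (ccoord c i) * th p (pd c i p).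
  by move=> sP; exact: (linear_coord ac cp (vf_tangent sP Up) (linear_form sth Up)).
pose W := U `&` chart_dom c.
have oW : open W by apply: openI => //; exact: chart_dom_open.
have Wp : W p by [].
have sW : smooth_form1 W th by apply: form_sub sth => q [].
have sp i : smooth_vfield W (pd c i) by apply: vf_sub (vf_pd i ac) => q [].
rewrite /volc /wedge_extd (e _ _ sY sZ) (e _ _ sZ sX) (e _ _ sX sY) (t _ sX) (t _ sY) (t _ sZ) /dd !sum3 -/(x i0) -/(x i1) -/(x i2).
rewrite -/(y i0) -/(y i1) -/(y i2) -/(z i0) -/(z i1) -/(z i2).
rewrite !(extdXX oW Wp sW (sp _)) (extdC oW Wp sW (sp i1) (sp i0)).
rewrite (extdC oW Wp sW (sp i2) (sp i1)) (extdC oW Wp sW (sp i0) (sp i2)).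
move: (extd th _ _ p) (extd th _ _ p) (extd th _ _ p) (th p _) (th p _) (th p _).
by move: (x _) (x _) (x _) (y _) (y _) (y _) (z _) (z _) (z _) => *; rewrite /det3; ring.
Qed.

Section CoframeVolume.
Variables (c : chart R M) (V : set M) (oV : open V) (T Z : vfield M) (th th1 : form1 M).
Hypothesis cf : coframe c oV T Z th th1.
Local Notation Zb := (conjvf Z).
Local Notation A := (oring oV).
Let sT := cf_T cf.
Let sZ := cf_Z cf.
Let sZb := cf_Zb cf.
Let Vc := cf_dom cf.
Let ac := cf_atlas cf.
Local Notation DT := (sder (oU := oV) sT).
Local Notation DZ := (sder (oU := oV) sZ).
Local Notation DZb := (sder (oU := oV) sZb).
Local Notation II := (scst oV 'i%C : A).

Let sp i : smooth_vfield V (pd c i). Proof. exact: vf_sub Vc (vf_pd i ac). Qed.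
Let D i : A -> A := sder (oU := oV) (sp i).
Let sx i : csmooth_on V (ccoord c i).
Proof. by apply: csmooth_sub (csmooth_ccoord i ac). Qed.
Let xA i : A := mks oV (sx i).

Lemma sder_coord X (sX : smooth_vfield V X) (f : A) : sder (oU := oV) sX f =
  sder (oU := oV) sX (xA i0) * D i0 f + sder (oU := oV) sX (xA i1) * D i1 f + sder (oU := oV) sX (xA i2) * D i2 f.
Proof.
apply: sfun_ext => p Vp; rewrite !(sE oV Vp).
have x i : sder (oU := oV) sX (xA i) p = X p (ccoord c i).
  by rewrite (rep_der sX (rep_mks oV (sx i)) Vp).
have nf : csmooth_near p f by exact: sfun_near.
have d i : D i f p = dC c i f p by rewrite mksE// /vderiv pdE.
rewrite !x !d mksE// /vderiv (tangent_coord ac (Vc Vp) (vf_tangent sX Vp) nf).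
by rewrite sum3.
Qed.

Hypothesis sthT : smooth_form1 setT th.
Let svol : csmooth_on V (volc c th).
Proof. by apply: csmooth_sub (volc_smooth ac sthT). Qed.
Let vA : A := mks oV svol.

Local Notation "X ^^ i" := (sder (oU := oV) X (xA i)) (at level 2, i at level 1).

(** The volume form takes the value [i] on the frame. *)
Lemma vol_det : vA * det3 (sT^^i0) (sT^^i1) (sT^^i2) (sZ^^i0) (sZ^^i1) (sZ^^i2)
  (sZb^^i0) (sZb^^i1) (sZb^^i2) = II.
Proof.
apply: sfun_ext => p Vp; have [[a1 a2 a3] _] := cf_vals cf Vp.
have := wedge_extd_coord ac (Vc Vp) oV Vp (cf_th cf) sT sZ sZb.
rewrite /wedge_extd a1 a2 a3 (cf_dZZb cf Vp) !mul0r mul1r !addr0 => E.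
rewrite [RHS](sE oV Vp) E [LHS](sE oV Vp) (mksE _ svol Vp); congr (_ * _).
by rewrite /det3 !(sE oV Vp) !(rep_der _ (rep_mks oV (sx _)) Vp).
Qed.

Lemma div_frame_fields :
  [/\ D i0 (vA * sT^^i0) + D i1 (vA * sT^^i1) + D i2 (vA * sT^^i2) = 0,
   D i0 (vA * sZ^^i0) + D i1 (vA * sZ^^i1) + D i2 (vA * sZ^^i2) = cf_w1 cf * vA &
   D i0 (vA * sZb^^i0) + D i1 (vA * sZb^^i1) + D i2 (vA * sZb^^i2) = - cf_wb cf * vA].
Proof.
have fe := cf_frame_eqs cf; have cj := cf_conj cf.
have dd i := is_der_sder oV (sp i).
have [dT dZ dZb] := And3 (is_der_sder oV sT) (is_der_sder oV sZ) (is_der_sder oV sZb).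
have vd := vol_det.
have br1 i : DZ (sT^^i) - DT (sZ^^i) = - cf_w0 cf * sZ^^i + cf_a cf * sZb^^i.
  by have E := comZT fe (xA i); apply: (lc 1 E); ring.
have br2 i : DZ (sZb^^i) - DZb (sZ^^i) = - II * sT^^i - cf_wb cf * sZ^^i - cf_w1 cf * sZb^^i.
  by have E := comZZb fe (xA i); apply: (lc 1 E); ring.
have br3 i : DZb (sT^^i) - DT (sZb^^i) = cf_w0 cf * sZb^^i + sconj (cf_a cf) * sZ^^i.
  by have E := comZbT cj fe (xA i); apply: (lc 1 E); ring.
have n1 i : DT (sZ^^i) - DZ (sT^^i) = - (- cf_w0 cf * sZ^^i + cf_a cf * sZb^^i).
  by rewrite -br1 opprB.
have n2 i : DZb (sZ^^i) - DZ (sZb^^i) = - (- II * sT^^i - cf_wb cf * sZ^^i - cf_w1 cf * sZb^^i).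
  by rewrite -br2 opprB.
have n3 i : DT (sZb^^i) - DZb (sT^^i) = - (cf_w0 cf * sZb^^i + sconj (cf_a cf) * sZ^^i).
  by rewrite -br3 opprB.
move: (cf_w0 cf) (cf_w1 cf) (cf_wb cf) (cf_a cf) br1 br2 br3 n1 n2 n3 => w0 w1 wb a br1 br2 br3 n1 n2 n3.
split.
- rewrite (@coord_div _ II (D i0) (D i1) (D i2) DT DZ DZb (cf_II oV) (dd i0) (dd i1) (dd i2) dT
    _ _ _ (sZ^^i0) (sZ^^i1) (sZ^^i2) (sZb^^i0) (sZb^^i1) (sZb^^i2) vA 0 (sder_coord sT) (sder_coord sZ) (sder_coord sZb) vd) ?mul0r//.
  rewrite !n1 !n3 /det3; ring.
- apply: (@coord_div _ II (D i0) (D i1) (D i2) DZ DZb DT (cf_II oV) (dd i0) (dd i1) (dd i2) dZ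
    _ _ _ (sZb^^i0) (sZb^^i1) (sZb^^i2) (sT^^i0) (sT^^i1) (sT^^i2) vA w1 (sder_coord sZ) (sder_coord sZb) (sder_coord sT)).
    by rewrite -[RHS]vd /det3; ring.
  rewrite !br1 !br2 /det3; ring.
- apply: (@coord_div _ II (D i0) (D i1) (D i2) DZb DT DZ (cf_II oV) (dd i0) (dd i1) (dd i2) dZb
    _ _ _ (sT^^i0) (sT^^i1) (sT^^i2) (sZ^^i0) (sZ^^i1) (sZ^^i2) vA (- wb) (sder_coord sZb) (sder_coord sT) (sder_coord sZ)).
    by rewrite -[RHS]vd /det3; ring.
  rewrite !br3 !n2 /det3; ring.
Qed.

(** The frame divergence is the coordinate divergence with respect to the
    contact volume, so its integral vanishes. *)
Lemma frame_div_coord (x0 x1 xb : A) :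
  D i0 (vA * (x0 * sT^^i0 + x1 * sZ^^i0 + xb * sZb^^i0))
  + D i1 (vA * (x0 * sT^^i1 + x1 * sZ^^i1 + xb * sZb^^i1))
  + D i2 (vA * (x0 * sT^^i2 + x1 * sZ^^i2 + xb * sZb^^i2)) =
  vA * frame_div DT DZ DZb (cf_w1 cf) (cf_wb cf) x0 x1 xb.
Proof.
have [E0 E1 Eb] := div_frame_fields.
have dd i := is_der_sder oV (sp i).
rewrite /frame_div /nd1 /ndb (sder_coord sT x0) (sder_coord sZ x1) (sder_coord sZb xb).
have dM' i (f g : A) : D i (f * g) = D i f * g + f * D i g := derM (dd i) f g.
have dD' i (f g : A) : D i (f + g) = D i f + D i g := derD (dd i) f g.
rewrite !dM' in E0 E1 Eb; rewrite !(dM', dD').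
by apply: (lc x0 E0); apply: (lc x1 E1); apply: (lc xb Eb); ring.
Qed.

End CoframeVolume.
End Volume.

(** * The two divergence identities *)

Section DivAlgebra.
Variables (A : comPzRingType) (I : A) (conj T Z Zb : A -> A).
Hypotheses (II : I * I = -1) (dT : is_der I T) (dZ : is_der I Z) (dZb : is_der I Zb).
Hypothesis cj : is_conj I conj T Z Zb.
Variables (w0 w1 wb a ac W : A).
Hypothesis fe : frame_eqs I conj T Z Zb w0 w1 wb a ac W.

(** Multiply [6 (P_1 g)_b = (R_1)_b] by [x]: the left side is [6 g (P_1 x)_b] and
    the right side is [|A|^2 x], both up to divergences. *)
Lemma torsion_divergence x g : conj x = x -> Z (Z x) - w1 * Z x + I * a * x = 0 -> Z W = 0 ->
  ndb Zb wb (R1c I Z Zb wb a W - 6%:R * P1c I Z Zb w1 a g) = 0 ->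
  a * ac * x = 6%:R * (g * ndb Zb wb (P1c I Z Zb w1 a x)) + frame_div T Z Zb w1 wb 0
    (6%:R * (Zb g * nd1 Z w1 (Zb x) - Zb x * nd1 Z w1 (Zb g)))
    (6%:R * (x * P1c I Z Zb w1 a g - g * P1c I Z Zb w1 a x)
     - I * (Zb x * a - x * a_b Zb wb a)).
Proof.
move=> cx sol ZW Q; have E1 := curvature_pairing II dZb cj fe cx sol ZW.
have E2 := paneitz_symmetric dT dZ dZb w1 wb a x g.
move: Q E1 E2; rewrite /frame_div (der0 dT).
move: (R1c _ _ _ _ _ _) (P1c _ _ _ _ _ g) (P1c _ _ _ _ _ x) (I * _) => r pg px k.
set y := _ - _ * nd1 _ _ (Zb g); set z := x * pg - g * px => Q E1 E2.
have n6 (D : A -> A) (d : is_der I D) t : D (6%:R * t) = 6%:R * D t.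
  by rewrite (derM d) (der_nat _ d) mul0r add0r.
have Zz : Zb z = Zb (x * pg) - Zb (g * px) by rewrite (derD dZb) (derN _ dZb).
rewrite /nd1 /ndb !(derD dZb) !(derN _ dZb) !(n6 _ dZ) !(n6 _ dZb) in Q E1 E2 *.
rewrite ?Zz in E2 *.
by apply: (lc (-1) E1); apply: (lc 6%:R E2); apply: (lc (x) Q); ring.
Qed.
End DivAlgebra.

Section Fields.
Variables (R : realType) (M : manifold3 R) (th : form1 M) (J : bundle_endo M).
Local Notation C := R[i].
Implicit Types (c : chart R M) (U V W : set M) (p q : M).
Hypothesis ps : pseudohermitian th J.
Let sth : smooth_form1 setT th. Proof. by have [[]] := ps. Qed.
Let rth : real_form1 setT th. Proof. by have [[]] := ps. Qed.
Let acJ : almost_complex th J. Proof. by have [] := ps. Qed.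

Section Defs.
Variables (U : set M) (F : local_frame th J U).
Local Notation T := (fr_T F).
Local Notation Z := (fr_Z1 F).
Local Notation Zb := (conjvf (fr_Z1 F)).

Definition nd (s : M -> C) : M -> C := covderiv (fr_om F) Z 0 1 s.

(** Its divergence is the square of [f_0]; the scalar curvature of
    [soliton_divergence] is replaced by its value in the soliton equation. *)
Definition field1 (mu : R) (f : M -> R) : vfield M := fun q =>
  let u := cfun_of f in
  let w := mu%:C - 2%:R^-1 * d_0 F u q in
  lincombv (u q * d_0 F u q) (T q)
    (lincombv (- 2%:R * 'i%C * w * vderiv Zb u q - 4%:R * vderiv Zb (d_0 F u) q) (Z q)
      (scalev (2%:R * 'i%C * w * vderiv Z u q - 4%:R * vderiv Z (d_0 F u) q) (Zb q))).

(** Its components are those of the divergence in [torsion_divergence]. *)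
Definition field2 (g x : M -> R) : vfield M := fun q =>
  let u := cfun_of x in let k := cfun_of g in
  lincombv (6%:R * (vderiv Zb k q * nd (vderiv Zb u) q - vderiv Zb u q * nd (vderiv Zb k) q)) (Z q)
   (scalev (6%:R * (u q * P1 F k q - k q * P1 F u q)
      - 'i%C * (vderiv Zb u q * A11 F q - u q * A11_b F q)) (Zb q)).
End Defs.

Section Reps.
Variables (U : set M) (F : local_frame th J U) (c : chart R M) (V : set M).
Hypotheses (ac : atlas c) (oV : open V) (VU : V `<=` U) (Vc : V `<=` chart_dom c).
Let cf := frame_coframe F sth rth ac oV VU Vc.
Local Notation T := (fr_T F).
Local Notation Z := (fr_Z1 F).
Local Notation Zb := (conjvf (fr_Z1 F)).
Local Notation A := (oring oV).
Local Notation DT := (sder (oU := oV) (cf_T cf)).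
Local Notation DZ := (sder (oU := oV) (cf_Z cf)).
Local Notation DZb := (sder (oU := oV) (cf_Zb cf)).
Local Notation II := (scst oV 'i%C : A).

Lemma rep_nd (s : A) u : rep s u -> rep (nd1 DZ (cf_w1 cf) s) (nd F u).
Proof.
move=> su p Vp; apply: etrans (rep_add (rep_der (cf_Z cf) su) (rep_mul (frame_w1 F sth rth ac oV VU Vc) su) Vp) _.
rewrite /nd /covderiv mulr0n mulr1n add0r /contract.
by rewrite (fr_om_imaginary F (VU Vp) (vf_tangent (cf_Z cf) Vp)) mulNr opprK.
Qed.

Lemma rep_P1 (s : A) u : rep s u -> rep (P1c II DZ DZb (cf_w1 cf) (cf_a cf) s) (P1 F u).
Proof.
move=> su p Vp; have ra := frame_a F sth rth ac oV VU Vc.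
have rb := rep_der (cf_Zb cf) su.
apply: etrans (rep_add (rep_der (cf_Z cf) (rep_nd rb)) (rep_mul (rep_mul (rep_cst oV 'i%C) ra) rb) Vp) _.
rewrite /P1 /d_b11; congr (_ + _); rewrite /covderiv !mulr1n.
by rewrite (fr_om_imaginary F (VU Vp) (vf_tangent (cf_Z cf) Vp)) subrr mul0r subr0.
Qed.

Lemma rep_ab : rep (a_b DZb (cf_wb cf) (cf_a cf)) (A11_b F).
Proof.
move=> p Vp; have ra := frame_a F sth rth ac oV VU Vc; have rw := frame_wb F sth rth ac oV VU Vc.
apply: etrans (rep_sub (rep_der (cf_Zb cf) ra) (rep_mul (@rep_nat _ _ _ oV 2) (rep_mul rw ra)) Vp) _.
by rewrite /A11_b /covderiv /contract mulr0n addr0 mulrA; congr (_ - _ * _); exact: mulr_natl.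
Qed.

Lemma rep_ndb (s : A) u : rep s u ->
  rep (ndb DZb (cf_wb cf) s) (covderiv (fr_om F) Zb 1 0 u).
Proof.
move=> su p Vp; have rw := frame_wb F sth rth ac oV VU Vc.
apply: etrans (rep_sub (rep_der (cf_Zb cf) su) (rep_mul rw su) Vp) _.
by rewrite /covderiv /contract mulr1n mulr0n addr0.
Qed.

Lemma field_div (x0 x1 xb : A) u0 u1 ub p : V p -> rep x0 u0 -> rep x1 u1 -> rep xb ub ->
  \sum_i dC c i (fun q => volc c th q *
     lincombv (u0 q) (T q) (lincombv (u1 q) (Z q) (scalev (ub q) (Zb q))) (ccoord c i)) p =
  volc c th p * frame_div DT DZ DZb (cf_w1 cf) (cf_wb cf) x0 x1 xb p.
Proof.
move=> Vp r0 r1 rb; have E := frame_div_coord cf sth x0 x1 xb.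
have := congr1 (fun h : A => h p) E; rewrite [in RHS](sE oV Vp) (mksE _ _ Vp) => <-.
rewrite sum3.
have e i (sp : smooth_vfield V (pd c i)) (sv : csmooth_on V (volc c th)) (si : csmooth_on V (ccoord c i)) :
   dC c i (fun q => volc c th q *
     lincombv (u0 q) (T q) (lincombv (u1 q) (Z q) (scalev (ub q) (Zb q))) (ccoord c i)) p =
   sder (oU := oV) sp ((mks oV sv : A) * (x0 * sder (oU := oV) (cf_T cf) (mks oV si)
     + x1 * sder (oU := oV) (cf_Z cf) (mks oV si) + xb * sder (oU := oV) (cf_Zb cf) (mks oV si))) p.
  have rxx X (sX : smooth_vfield V X) := rep_der sX (rep_mks oV si).
  have r := rep_mul (rep_mks oV sv) (rep_add (rep_add (rep_mul r0 (rxx _ (cf_T cf)))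
     (rep_mul r1 (rxx _ (cf_Z cf)))) (rep_mul rb (rxx _ (cf_Zb cf)))).
  rewrite mksE// /vderiv pdE; last exact: sfun_near.
  apply: dC_near; first exact: Vc.
  apply: (@near_open _ V) => // q Vq; rewrite r// /lincombv /scalev /vderiv; ring.
have ev (s t r : A) : (s + t + r) p = s p + t p + r p by rewrite !(sE oV Vp).
by rewrite ev -!e.
Qed.

End Reps.

Section FrameRelation.
Variables (U U' : set M) (F : local_frame th J U) (F' : local_frame th J U').

Lemma frame_rel p : U p -> U' p -> let u := fr_th1 F p (fr_Z1 F' p) in
  [/\ fr_T F' p = fr_T F p, u * u^c = 1 & fr_Z1 F' p = scalev u (fr_Z1 F p)].
Proof.
move=> Up U'p u; have [c ac cp] := atlas_cover p.
pose V := (U `&` U') `&` chart_dom c.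
have oV : open V by apply: openI; [apply: openI; [exact: (fr_open F)|exact: (fr_open F')]|exact: chart_dom_open].
have VU : V `<=` U by move=> q [[]].
have VU' : V `<=` U' by move=> q [[]].
have Vc : V `<=` chart_dom c by move=> q [].
have Vp : V p by [].
pose cf := frame_coframe F sth rth ac oV VU Vc.
pose cf' := frame_coframe F' sth rth ac oV VU' Vc.
have [sT sZ sZb] := And3 (cf_T cf) (cf_Z cf) (cf_Zb cf).
have [sT' sZ' sZb'] := And3 (cf_T cf') (cf_Z cf') (cf_Zb cf').
have [tT tZ tZb] := And3 (vf_tangent sT Vp) (vf_tangent sZ Vp) (vf_tangent sZb Vp).
have [tT' tZ' tZb'] := And3 (vf_tangent sT' Vp) (vf_tangent sZ' Vp) (vf_tangent sZb' Vp).
have [[a1 a2 a3] [[b1 b2 b3] [c1 c2 c3]]] := cf_vals cf Vp.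
have [[a1' a2' a3'] _] := cf_vals cf' Vp.
have sV := form_sub (@subsetT _ V) sth.
have E X Y : smooth_vfield V X -> smooth_vfield V Y -> extd th X Y p =
    'i%C * (fr_th1 F p (X p) * conj1 (fr_th1 F) p (Y p) - fr_th1 F p (Y p) * conj1 (fr_th1 F) p (X p)).
  by move=> sX sY; rewrite (extd_eq_on (@fr_normalized _ _ _ _ _ F) oV VU sX sY Vp) imE.
have [_ _ _ dT'] := fr_reeb F'.
have i0 : ('i%C : C) != 0 by apply/eqP => z; have := mulCii R; rewrite z mul0r => /eqP; rewrite eq_sym oppr_eq0 oner_eq0.
have e1 : fr_T F' p = fr_T F p.
  have h1 : fr_th1 F p (fr_T F' p) = 0.
    have := dT' V _ oV VU' sZb p Vp; rewrite E// b3 c3 mul0r subr0 mulr1 => /eqP.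
    by rewrite mulf_eq0 (negbTE i0) => /eqP.
  have h2 : conj1 (fr_th1 F) p (fr_T F' p) = 0.
    have := dT' V _ oV VU' sZ p Vp; rewrite E// b2 c2 mulr0 sub0r mul1r mulrN => /eqP.
    by rewrite oppr_eq0 mulf_eq0 (negbTE i0) => /eqP.
  rewrite (cf_expand cf Vp tT') h1 h2 a1'.
  by apply/funext => f; rewrite /lincombv /scalev !mul0r mul1r !addr0.
have e2 : conj1 (fr_th1 F) p (fr_Z1 F' p) = 0.
  set y := conj1 _ _ _.
  have hZ : horizontal th p (fr_Z1 F p) by [].
  have hZb : horizontal th p (conjvf (fr_Z1 F) p) by [].
  have Zx : fr_Z1 F' p = lincombv u (fr_Z1 F p) (lincombv y (conjvf (fr_Z1 F) p) (fun=> 0)).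
    rewrite (cf_expand cf Vp tZ') a2' -/u -/y.
    by apply/funext => f; rewrite /lincombv /scalev mul0r add0r addr0.
  have [_ Jl Jc _ _] := acJ.
  have h0 : horizontal th p (fun=> 0) by split; [exact: tangent_zero|exact: (form_zero sV Vp)].
  have hy : horizontal th p (lincombv y (conjvf (fr_Z1 F) p) (fun=> 0)).
    by split; [apply: tangent_lin => //; exact: tangent_zero|
      rewrite (form_lin _ sV Vp tZb (tangent_zero p)) a3 (form_zero sV Vp) mulr0 addr0].
  have J0 : J p (fun=> 0) = (fun=> 0).
    have -> : (fun=> 0) = scalev 0 (fr_Z1 F p) :> cvector M by apply/funext => f; rewrite /scalev mul0r.
    by rewrite (J_scale 0 acJ hZ); apply/funext => f; rewrite /scalev !mul0r.
  have JZb : J p (conjvf (fr_Z1 F) p) = scalev (- 'i%C) (conjvf (fr_Z1 F) p).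
    by rewrite /conjvf Jc// (fr_Z1_type10 F Up) conjv_scale -imE conjci imE.
  have := fr_Z1_type10 F' U'p; rewrite {1}Zx Jl// Jl// J0 (fr_Z1_type10 F Up) JZb => JE.
  have := congr1 (conj1 (fr_th1 F) p) JE.
  have s1b := cf_th1b cf.
  have tc := tangent_scale.
  rewrite (form_lin _ s1b Vp (tc _ _ _ _ _ tZ) (tangent_lin _ (tc _ _ _ _ _ tZb) (tangent_zero p))).
  rewrite (form_lin _ s1b Vp (tc _ _ _ _ _ tZb) (tangent_zero p)) !(form_scale _ s1b Vp)//.
  rewrite (form_zero s1b Vp) c2 c3 -/y => JJ.
  have : ('i%C * y) *+ 2 = 0 by rewrite mulr2n; apply: (lc (-1) JJ); ring.
  by move/eqP; rewrite mulrn_eq0 mulf_eq0 (negbTE i0) => /eqP.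
have e3 : fr_Z1 F' p = scalev u (fr_Z1 F p).
  rewrite (cf_expand cf Vp tZ') a2' e2 -/u.
  by apply/funext => f; rewrite /lincombv /scalev !mul0r addr0 add0r.
split=> //.
have := cf_dZZb cf' Vp; rewrite E//.
have -> : conj1 (fr_th1 F) p (conjvf (fr_Z1 F') p) = u^c by rewrite /conj1 /conjvf conjvK.
have -> : fr_th1 F p (conjvf (fr_Z1 F') p) = 0.
  rewrite /conjvf e3 conjv_scale (form_scale _ (cf_th1 cf) Vp); last exact: tZb.
  by rewrite -/(conjvf (fr_Z1 F) p) b3 mulr0.
by rewrite mul0r subr0 -[RHS]mulr1 => /(mulfI i0).
Qed.

(** Frames rotate by a factor of modulus one, which cancels between each
    component and its frame field; so the local fields fit together on the manifold. *)
Lemma field1_frame mu (f : M -> R) p : smooth_on setT f -> U p -> U' p ->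
  field1 F' mu f p = field1 F mu f p.
Proof.
move=> sf Up U'p; have [eT uu eZ] := frame_rel Up U'p.
set u := fr_th1 F p _ in uu eZ.
pose W := U `&` U'; have oW : open W by apply: openI; [exact: (fr_open F)|exact: (fr_open F')].
have Wp : W p by [].
have eD q : W q -> d_0 F' (cfun_of f) q = d_0 F (cfun_of f) q.
  by move=> [Uq U'q]; rewrite /d_0 /vderiv; have [-> _ _] := frame_rel Uq U'q.
have nD (X : vfield M) : is_tangent p (X p) ->
    vderiv X (d_0 F' (cfun_of f)) p = vderiv X (d_0 F (cfun_of f)) p.
  by move=> tX; apply: (tangent_near tX); apply: (@near_open _ W).
have tZ : is_tangent p (fr_Z1 F p) by exact: vf_tangent (fr_Z1_smooth F) Up.
have tZ' : is_tangent p (fr_Z1 F' p) by exact: vf_tangent (fr_Z1_smooth F') U'p.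
have eZb : conjvf (fr_Z1 F') p = scalev u^c (conjvf (fr_Z1 F) p) by rewrite /conjvf eZ conjv_scale.
rewrite /field1 !nD//; last by apply: tangent_conj.
rewrite !eD// eT /vderiv eZb eZ; apply/funext => h; rewrite /lincombv /scalev.
set x1 := - 2%:R * _ * _ * (_ * _) - _; set xb := 2%:R * _ * _ * _ - _.
set y1 := - 2%:R * _ * _ * conjvf _ _ _ - _; set yb := 2%:R * _ * _ * fr_Z1 _ _ _ - _.
have -> : x1 = u^c * y1 by rewrite /x1 /y1; ring.
have -> : xb = u * yb by rewrite /xb /yb; ring.
apply: (lc (y1 * fr_Z1 F p h + yb * conjvf (fr_Z1 F) p h) uu); ring.
Qed.

Lemma field2_frame (g x : M -> R) p : smooth_on setT g -> smooth_on setT x -> U p -> U' p ->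
  field2 F' g x p = field2 F g x p.
Proof.
move=> sg sx Up U'p; have [c ac cp] := atlas_cover p.
pose V := (U `&` U') `&` chart_dom c.
have oV : open V by apply: openI; [apply: openI; [exact: (fr_open F)|exact: (fr_open F')]|exact: chart_dom_open].
have VU : V `<=` U by move=> q [[]].
have VU' : V `<=` U' by move=> q [[]].
have Vc : V `<=` chart_dom c by move=> q [].
have Vp : V p by [].
pose cf := frame_coframe F sth rth ac oV VU Vc.
pose cf' := frame_coframe F' sth rth ac oV VU' Vc.
pose uf : M -> C := contract (fr_th1 F) (fr_Z1 F').
have su : csmooth_on V uf.
  exact: (form_smooth (cf_th1 cf) oV (@subset_refl _ V) (cf_Z cf')).
have suc : csmooth_on V (fun q => (uf q)^c) by exact: csmoothJ.
pose u : oring oV := mks oV su; pose uc : oring oV := mks oV suc.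
have rel q : V q -> [/\ fr_T F' q = fr_T F q, uf q * (uf q)^c = 1 & fr_Z1 F' q = scalev (uf q) (fr_Z1 F q)].
  by move=> Vq; exact: frame_rel (VU q Vq) (VU' q Vq).
have uu : u * uc = 1.
  by apply: sfun_ext => q Vq; rewrite !(sE oV Vq) !mksE//; have [] := rel q Vq.
have Z'E s : sder (oU := oV) (cf_Z cf') s = u * sder (oU := oV) (cf_Z cf) s.
  by apply: sfun_ext => q Vq; rewrite !(sE oV Vq) !mksE// /vderiv; have [_ _ ->] := rel q Vq.
have Zb'E s : sder (oU := oV) (cf_Zb cf') s = uc * sder (oU := oV) (cf_Zb cf) s.
  apply: sfun_ext => q Vq; rewrite !(sE oV Vq) !mksE// /vderiv /conjvf.
  by have [_ _ ->] := rel q Vq; rewrite conjv_scale.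
have T'E s : sder (oU := oV) (cf_T cf') s = sder (oU := oV) (cf_T cf) s.
  by apply: sfun_ext => q Vq; rewrite !mksE// /vderiv; have [-> _ _] := rel q Vq.
have [rn ra rP rb] := rotation (is_der_sder oV (cf_T cf)) (is_der_sder oV (cf_Z cf))
  (is_der_sder oV (cf_Zb cf)) (cf_frame_eqs cf) (cf_frame_eqs cf') (@cf_indep _ _ _ _ _ _ _ _ _ cf')
  uu T'E Z'E Zb'E.
have ss (h : M -> R) : smooth_on setT h -> csmooth_on V (cfun_of h).
  by move=> sh; apply: csmooth_real; exact: smooth_sub sh.
pose gA : oring oV := mks oV (ss g sg); pose xA : oring oV := mks oV (ss x sx).
have rg : rep gA (cfun_of g) := rep_mks oV (ss g sg).
have rx : rep xA (cfun_of x) := rep_mks oV (ss x sx).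
have ev (s t : oring oV) : s = t -> s p = t p by move=> ->.
have eb (h : oring oV) k : rep h k -> vderiv (conjvf (fr_Z1 F')) k p = (uf p)^c * vderiv (conjvf (fr_Z1 F)) k p.
  move=> rh; have := ev _ _ (Zb'E h); rewrite (rep_der (cf_Zb cf') rh Vp) => ->.
  by rewrite (sE oV Vp) (rep_der (cf_Zb cf) rh Vp) mksE.
have en (h : oring oV) k : rep h k -> nd F' (vderiv (conjvf (fr_Z1 F')) k) p = nd F (vderiv (conjvf (fr_Z1 F)) k) p.
  move=> rh; have := ev _ _ (rn h).
  by rewrite (rep_nd F' ac VU' Vc (rep_der (cf_Zb cf') rh) Vp) (rep_nd F ac VU Vc (rep_der (cf_Zb cf) rh) Vp).
have eP (h : oring oV) k : rep h k -> P1 F' k p = uf p * P1 F k p.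
  move=> rh; have := ev _ _ (rP h); rewrite (rep_P1 F' ac VU' Vc rh Vp) => ->.
  by rewrite (sE oV Vp) (rep_P1 F ac VU Vc rh Vp) mksE.
have ea : A11 F' p = uf p * uf p * A11 F p.
  have := ev _ _ ra; rewrite (frame_a F' sth rth ac oV VU' Vc Vp) => ->.
  by rewrite (rep_mul (rep_mul (rep_mks oV su) (rep_mks oV su)) (frame_a F sth rth ac oV VU Vc) Vp).
have eab : A11_b F' p = uf p * A11_b F p.
  have := ev _ _ rb; rewrite (rep_ab F' ac oV VU' Vc Vp) => ->.
  by rewrite (rep_mul (rep_mks oV su) (rep_ab F ac oV VU Vc) Vp).
have [_ u1 eZ] := rel p Vp.
rewrite /field2 (en _ _ rg) (en _ _ rx) (eP _ _ rg) (eP _ _ rx) ea eab (eb _ _ rg) (eb _ _ rx).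
have -> : conjvf (fr_Z1 F') p = scalev (uf p)^c (conjvf (fr_Z1 F) p) by rewrite /conjvf eZ conjv_scale.
rewrite eZ; apply/funext => h; rewrite /lincombv /scalev.
move: (nd F _ p) (nd F _ p) (P1 F _ p) (P1 F _ p) (A11 F p) (A11_b F p) u1 => n1 n2 P1 P2 a b.
move: (vderiv _ _ p) (vderiv _ _ p) (uf p) ((uf p)^c) (fr_Z1 F p h) (conjvf _ p h) => d1 d2 v vc z zb u1.
pose X := 6%:R * (d2 * n2 - d1 * n1) * z
  + (6%:R * (cfun_of x p * P2 - cfun_of g p * P1) + 'i%C * (cfun_of x p * b)) * zb
  - 'i%C * d1 * a * zb * (1 + v * vc).
apply: (lc X u1); rewrite /X; ring.
Qed.

End FrameRelation.

Section Identities.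
Variables (U : set M) (F : local_frame th J U) (c : chart R M) (V : set M).
Hypotheses (ac : atlas c) (oV : open V) (VU : V `<=` U) (Vc : V `<=` chart_dom c).
Let cf := frame_coframe F sth rth ac oV VU Vc.
Local Notation T := (fr_T F).
Local Notation Z := (fr_Z1 F).
Local Notation Zb := (conjvf (fr_Z1 F)).
Local Notation A := (oring oV).
Local Notation DT := (sder (oU := oV) (cf_T cf)).
Local Notation DZ := (sder (oU := oV) (cf_Z cf)).
Local Notation DZb := (sder (oU := oV) (cf_Zb cf)).
Local Notation II := (scst oV 'i%C : A).

Lemma rep_sol (s : A) (f : M -> R) : rep s (cfun_of f) ->
  (forall q, V q -> d_11 F (cfun_of f) q + 'i * A11 F q * (f q)%:C = 0) ->
  DZ (DZ s) - cf_w1 cf * DZ s + II * cf_a cf * s = 0.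
Proof.
move=> sf H; apply: sfun_ext => q Vq; have rZ := rep_der (cf_Z cf) sf.
apply: etrans (rep_add (rep_sub (rep_der (cf_Z cf) rZ) (rep_mul (frame_w1 F sth rth ac oV VU Vc) rZ))
   (rep_mul (rep_mul (rep_cst oV 'i%C) (frame_a F sth rth ac oV VU Vc)) sf) Vq) _.
by rewrite (sE oV Vq) -(H q Vq) /d_11 /covderiv mulr1n mulr0n addr0.
Qed.

Lemma sconj_real (s : A) (f : M -> R) : rep s (cfun_of f) -> sconj s = s.
Proof.
by move=> sf; apply: sfun_ext => q Vq; rewrite sconjE// sf// /cfun_of; exact: conjc_real.
Qed.

Lemma field1_div (mu : R) (f : M -> R) p : smooth_on setT f -> V p ->
  (forall q, V q -> (fr_W F q)%:C + 2%:R^-1 * d_0 F (cfun_of f) q = mu%:C /\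
     d_11 F (cfun_of f) q + 'i * A11 F q * (f q)%:C = 0) ->
  \sum_i dC c i (fun q => volc c th q * field1 F mu f q (ccoord c i)) p =
  volc c th p * (d_0 F (cfun_of f) p * d_0 F (cfun_of f) p).
Proof.
move=> sf Vp H.
have ss : csmooth_on V (cfun_of f) by apply: csmooth_real; exact: smooth_sub sf.
pose fA : A := mks oV ss; have rf : rep fA (cfun_of f) := rep_mks oV ss.
have rT : rep (DT fA) (d_0 F (cfun_of f)) := rep_der (cf_T cf) rf.
pose wA : A := scst oV mu%:C - scst oV (2%:R^-1) * DT fA.
have rw : rep wA (fun q => mu%:C - 2%:R^-1 * d_0 F (cfun_of f) q).
  exact: rep_sub (rep_cst _ _) (rep_mul (rep_cst _ _) rT).
have Ww : cf_W cf = wA.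
  apply: sfun_ext => q Vq; rewrite (frame_W F sth rth ac oV VU Vc Vq) rw//.
  by have [E _] := H q Vq; apply: (lc 1 E); rewrite /cfun_of; ring.
have h2 : 2%:R * scst oV (2%:R^-1) = 1 :> A.
  by apply: sfun_ext => q Vq; rewrite !(sE oV Vq) mulfV// pnatr_eq0.
have dc X (sX : smooth_vfield V X) (k : C) : sder (oU := oV) sX (scst oV k) = 0.
  apply: sfun_ext => q Vq; rewrite (rep_der sX (rep_cst oV k) Vq) (sE oV Vq).
  exact: (tangent_cst _ (vf_tangent sX Vq)).
have dW X (sX : smooth_vfield V X) : sder (oU := oV) sX (DT fA) = - 2%:R * sder (oU := oV) sX (cf_W cf).
  have d := is_der_sder oV sX; rewrite Ww /wA (derD d) (derN _ d) (derM d) !dc.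
  by apply: (lc (- sder (oU := oV) sX (DT fA)) h2); ring.
have sol : DZ (DZ fA) - cf_w1 cf * DZ fA + II * cf_a cf * fA = 0.
  by apply: rep_sol rf _ => q Vq; have [] := H q Vq.
have := soliton_divergence (cf_II oV) (is_der_sder oV (cf_T cf)) (is_der_sder oV (cf_Z cf))
  (is_der_sder oV (cf_Zb cf)) (cf_conj cf) (cf_frame_eqs cf) (sconj_real rf) sol (dW _ (cf_Z cf)) (dW _ (cf_T cf)).
rewrite Ww => E.
have rZ := rep_der (cf_Z cf) rf; have rZb := rep_der (cf_Zb cf) rf.
have rI := rep_cst oV ('i%C : C).
have rn n := @rep_nat _ _ _ oV n.
have r0 := rep_mul rf rT.
have r1 := rep_sub (rep_mul (rep_mul (rep_mul (rep_opp (rn 2)) rI) rw) rZb)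
   (rep_mul (rn 4) (rep_der (cf_Zb cf) rT)).
have rb := rep_sub (rep_mul (rep_mul (rep_mul (rn 2) rI) rw) rZ)
   (rep_mul (rn 4) (rep_der (cf_Z cf) rT)).
have D := field_div F ac VU Vc Vp r0 r1 rb.
rewrite -E in D; rewrite -(rep_mul rT rT Vp) -D.
by [].
Qed.

Lemma field2_div (mu : R) (g x : M -> R) p : smooth_on setT g -> smooth_on setT x -> V p ->
  (forall q, V q -> d_11 F (cfun_of x) q + 'i * A11 F q * (x q)%:C = 0) ->
  (forall q, V q -> fr_W F q = mu) -> (forall q, V q -> P0 F x q = 0) ->
  (forall sg' : csmooth_on V (cfun_of g), ndb DZb (cf_wb cf)
    (R1c II DZ DZb (cf_wb cf) (cf_a cf) (cf_W cf)
     - 6%:R * P1c II DZ DZb (cf_w1 cf) (cf_a cf) (mks oV sg')) = 0) ->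
  exists2 d : C, \sum_i dC c i (fun q => volc c th q * field2 F g x q (ccoord c i)) p =
    volc c th p * d & complex.Re d = complex.Re (A11 F p * (A11 F p)^c * (x p)%:C).
Proof.
move=> sg sx Vp sol Wmu Px Q.
have ss (h : M -> R) : smooth_on setT h -> csmooth_on V (cfun_of h).
  by move=> sh; apply: csmooth_real; exact: smooth_sub sh.
pose gA : A := mks oV (ss g sg); pose xA : A := mks oV (ss x sx).
have rg : rep gA (cfun_of g) := rep_mks oV (ss g sg).
have rx : rep xA (cfun_of x) := rep_mks oV (ss x sx).
have ra := frame_a F sth rth ac oV VU Vc.
have ZW : DZ (cf_W cf) = 0.
  apply: sfun_ext => q Vq; rewrite (rep_der (cf_Z cf) (frame_W F sth rth ac oV VU Vc) Vq) (sE oV Vq).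
  have tZ := vf_tangent (cf_Z cf) Vq; rewrite /vderiv -(tangent_cst mu%:C tZ).
  by apply: (tangent_near tZ); apply: (@near_open _ V) => // q' Vq'; rewrite /cfun_of Wmu.
have E := torsion_divergence (cf_II oV) (is_der_sder oV (cf_T cf)) (is_der_sder oV (cf_Z cf))
  (is_der_sder oV (cf_Zb cf)) (cf_conj cf) (cf_frame_eqs cf) (sconj_real rx) (rep_sol rx sol) ZW (Q (ss g sg)).
have rZbx := rep_der (cf_Zb cf) rx; have rZbg := rep_der (cf_Zb cf) rg.
have rI := rep_cst oV ('i%C : C); have r6 := @rep_nat _ _ _ oV 6.
have r0 : rep (0 : A) (fun=> 0) by move=> q Vq; rewrite (sE oV Vq).
have r1 := rep_mul r6 (rep_sub (rep_mul rZbg (rep_nd F ac VU Vc rZbx)) (rep_mul rZbx (rep_nd F ac VU Vc rZbg))).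
have rb := rep_sub (rep_mul r6 (rep_sub (rep_mul rx (rep_P1 F ac VU Vc rg)) (rep_mul rg (rep_P1 F ac VU Vc rx))))
  (rep_mul rI (rep_sub (rep_mul rZbx ra) (rep_mul rx (rep_ab F ac oV VU Vc)))).
have D := field_div F ac VU Vc Vp r0 r1 rb.
move: D; set d := (X in _ = _ * X) => D.
exists d.
  rewrite -D; apply: eq_bigr => i _; congr (dC c i _ p); apply/funext => q.
  by rewrite /field2 /lincombv mul0r add0r.
have ev (a a' x' s g' n t : A) : a * a' * x' = s * (g' * n) + t ->
    a p * a' p * x' p = s p * (g' p * n p) + t p.
  by move=> e; have := congr1 (fun h : A => h p) e; rewrite !(sE oV Vp).
have := ev _ _ _ _ _ _ _ E; rewrite -/d (r6 p Vp) (rg p Vp) (rx p Vp) sconjE// (ra p Vp).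
rewrite (rep_ndb F ac VU Vc (rep_P1 F ac VU Vc rx) Vp) => Ep.
have := Px p Vp; rewrite /P0; move: Ep; set n := covderiv _ _ _ _ _ p => Ep n0.
have n1 : complex.Re n = 0 by have := congr1 (@complex.Re R) n0; rewrite ReD ReJ /=; lra.
rewrite /cfun_of in Ep; rewrite Ep ReD.
have -> : 6%:R * ((g p)%:C * n) = (6%:R * g p)%:C * n by rewrite rmorphM rmorph_nat mulrA.
by rewrite ReM /= n1 mulr0 mul0r subr0 add0r.
Qed.

End Identities.
End Fields.

(** * Riemann sums over grids in space *)

Lemma count_between m lo hi :
  (\sum_(0 <= j < m) ((lo <= j) && (j <= hi)) <= hi.+1 - lo)%N.
Proof.
suff : (\sum_(0 <= j < m) ((lo <= j) && (j <= hi)) <= minn m hi.+1 - lo)%N by lia.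
elim: m => [|m IH]; first by rewrite big_nil.
by rewrite big_nat_recr//=; case: (leqP lo m) => h1; case: (leqP m hi) => h2 /=; lia.
Qed.

Section Grid.
Variable R : realType.
Local Notation V := 'rV[R]_3.
Implicit Types (h g k : V -> R) (n B : nat) (x y v : V).

Definition supp B h := forall x, B%:R < `|x| -> h x = 0.

(** The cubes grow while the mesh shrinks, so that a fixed compact set is inside
    the grid for large [n]. *)
Definition gN n : R := n.+1%:R.
Definition gM n := ((n.+1 * n.+1).*2).+1.
Definition coordpt n (j : nat) : R := (j%:R - (n.+1 * n.+1)%:R) / gN n.
Definition gridpt n (a : {ffun 'I_3 -> 'I_(gM n)}) : V := \row_i coordpt n (a i).
Definition S n h : R := (gN n)^-1 ^+ 3 * \sum_a h (@gridpt n a).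

Lemma gN0 n : 0 < gN n. Proof. by rewrite ltr0n. Qed.
Lemma gNV0 n : 0 < (gN n)^-1. Proof. by rewrite invr_gt0 gN0. Qed.

Lemma S_ext n h g : (forall x, h x = g x) -> S n h = S n g.
Proof. by move=> E; congr (_ * _); apply: eq_bigr. Qed.

Lemma S_add n h g : S n (fun x => h x + g x) = S n h + S n g.
Proof. by rewrite /S big_split mulrDr. Qed.

Lemma S_scale n c h : S n (fun x => c * h x) = c * S n h.
Proof. by rewrite /S -mulr_sumr mulrCA. Qed.

Lemma S_opp n h : S n (fun x => - h x) = - S n h.
Proof. by rewrite -mulN1r -S_scale; apply: S_ext => x; rewrite mulN1r. Qed.

Lemma S_sub n h g : S n (fun x => h x - g x) = S n h - S n g.
Proof. by rewrite S_add S_opp. Qed.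

Lemma S0 n : S n (fun=> 0) = 0.
Proof. by rewrite /S big1 ?mulr0. Qed.

Lemma S_sum n (I : Type) (r : seq I) (F : I -> V -> R) :
  S n (fun x => \sum_(i <- r) F i x) = \sum_(i <- r) S n (F i).
Proof.
elim: r => [|i r IH]; first by rewrite big_nil -[RHS](S0 n); apply: S_ext => x; rewrite big_nil.
by rewrite big_cons -IH -S_add; apply: S_ext => x; rewrite big_cons.
Qed.

Lemma S_ge0 n h : (forall x, 0 <= h x) -> 0 <= S n h.
Proof.
by move=> h0; rewrite mulr_ge0//; [rewrite exprn_ge0// ltW// gNV0|exact: sumr_ge0].
Qed.

Lemma norm_S n h : `|S n h| <= S n (fun x => `|h x|).
Proof.
have n0 : 0 <= (gN n)^-1 ^+ 3 by rewrite exprn_ge0// ltW// gNV0.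
by rewrite normrM (ger0_norm n0) ler_wpM2l// ler_norm_sum.
Qed.

Lemma coordptE n j : coordpt n j * gN n = j%:R - (n.+1 * n.+1)%:R.
Proof. by rewrite /coordpt divfK// gt_eqF// gN0. Qed.

Lemma coord_count n B : \sum_(j < gM n) (if `|coordpt n j| <= B%:R then 1 else 0) <=
   (B.*2).+1%:R * gN n.
Proof.
set N := n.+1; have hj (j : nat) : `|coordpt n j| <= B%:R -> (j + B * N >= N * N)%N /\ (j <= N * N + B * N)%N.
  move=> H; have H2 : `|coordpt n j * gN n| <= B%:R * gN n.
    by rewrite normrM (gtr0_norm (gN0 n)) ler_pM2r ?gN0.
  move: H2; rewrite coordptE ler_norml /gN -natrM -/N => /andP[h1 h2].
  have h1' : (N * N)%:R <= (j + B * N)%:R :> R by rewrite natrD; lra.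
  have h2' : j%:R <= (N * N + B * N)%:R :> R by rewrite natrD; lra.
  by rewrite !ler_nat in h1' h2'.
apply: (@le_trans _ _ ((\sum_(0 <= j < gM n) ((N * N - B * N <= j) && (j <= N * N + B * N)))%N)%:R).
  rewrite big_mkord natr_sum; apply: ler_sum => j _; case: ifP => // /hj [a b].
  by rewrite leq_subLR addnC a b.
rewrite /gN -natrM ler_nat; apply: leq_trans (count_between _ _ _) _.
rewrite -/N; have : (0 < N)%N by []. nia.
Qed.

Lemma gridptE n a i : @gridpt n a ord0 i = coordpt n (a i).
Proof. by rewrite mxE. Qed.

Lemma S_bound n B h K : supp B h -> (forall x, `|h x| <= K) ->
  `|S n h| <= (B.*2).+1%:R ^+ 3 * K.
Proof.
move=> sh hK; have K0 : 0 <= K by apply: le_trans (hK 0).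
apply: le_trans (norm_S _ _) _.
pose c (j : 'I_(gM n)) : R := if `|coordpt n j| <= B%:R then 1 else 0.
apply: (@le_trans _ _ ((gN n)^-1 ^+ 3 * (K * \prod_(i < 3) \sum_j c j))).
  rewrite ler_wpM2l ?exprn_ge0 ?(ltW (gNV0 n))// (bigA_distr_bigA (fun _ => c)) mulr_sumr.
  apply: ler_sum => a _.
  have [big|small] := ltP B%:R `|gridpt a|.
    by rewrite sh// normr0 mulr_ge0// prodr_ge0// => i _; rewrite /c; case: ifP.
  rewrite big1 ?mulr1 ?hK// => i _; rewrite /c -(gridptE a i).
  by rewrite (le_trans (coord_le_norm _ _) small).
rewrite prodr_const card_ord mulrC -mulrA (mulrC K) ler_wpM2r//.
rewrite -exprMn lerXn2r ?nnegrE ?mulr_ge0 ?sumr_ge0 ?(ltW (gNV0 n))//.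
- by move=> j _; rewrite /c; case: ifP.
- by rewrite ler_pdivrMr ?gN0// coord_count.
Qed.

(** The grid is invariant under a translation by its mesh, up to points where
    a compactly supported function vanishes. *)
Lemma S_shift n B h i : supp B h -> (B.+1 < n.+1)%N ->
  S n (fun x => h (x + (gN n)^-1 *: bvec R i)) = S n h.
Proof.
move=> sh Bn; congr (_ * _).
pose s (a : {ffun 'I_3 -> 'I_(gM n)}) : {ffun 'I_3 -> 'I_(gM n)} :=
  [ffun j => if j == i then ordS (a j) else a j].
have s_inj : injective s.
  move=> a b E; apply/ffunP => j; have := congr1 (fun f : {ffun _ -> _} => f j) E.
  by rewrite !ffunE; case: ifP => // _ /ordS_inj.
rewrite [RHS](reindex_inj s_inj) /=; apply: eq_bigr => a _.
have [wrap|inner] := ltnP (a i).+1 (gM n).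
  congr h; apply/rowP => j; rewrite !mxE eqxx /= ffunE.
  have [->|ji] := eqVneq j i; last by rewrite mulr0 addr0.
  rewrite mulr1 /coordpt /= modn_small// -[in RHS]natr1 addrAC [in RHS]mulrDl.
  by congr (_ + _); rewrite mul1r.
have aE : (a i : nat) = (n.+1 * n.+1).*2.
  by apply/eqP; rewrite eqn_leq -ltnS ltn_ord -ltnS.
rewrite !sh//; apply: lt_le_trans (coord_le_norm _ i).
  rewrite mxE ffunE eqxx /= aE modnn /coordpt sub0r mulNr normrN natrM /gN mulfK ?pnatr_eq0//.
  by rewrite ger0_norm// ltr_nat ltnW.
rewrite !mxE !eqxx /= mulr1 aE /coordpt -addnn natrD addrK natrM /gN mulfK ?pnatr_eq0//.
rewrite ger0_norm ?addr_ge0 ?invr_ge0// (@lt_le_trans _ _ n.+1%:R) ?ltr_nat ?(ltnW Bn)//.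
by rewrite lerDl invr_ge0.
Qed.

Lemma supp_shift B h i (t : R) : supp B h -> `|t| <= 1 -> supp B.+1 (fun x => h (x + t *: bvec R i)).
Proof.
move=> sh t1 x hx; apply: sh; rewrite -natr1 in hx.
have : `|x| <= `|x + t *: bvec R i| + `|t|.
  rewrite -[in leLHS](addrK (t *: bvec R i) x) (le_trans (ler_normB _ _))// lerD2l.
  by rewrite mx_normZ norm_bvec mulr1.
by lra.
Qed.

Lemma bounded_cont B (h : V -> R) : continuous h -> exists2 K : R, 0 <= K & forall x, `|x| <= B%:R -> `|h x| <= K.
Proof.
move=> ch; pose A : set V := [set x | `|x| <= B%:R].
have cA : compact A.
  apply: bounded_closed_compact.
    exists B%:R; split; first exact: num_real.
    by move=> M BM x Ax; exact: le_trans Ax (ltW BM).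
  have -> : A = (fun x : V => `|x|) @^-1` [set t | t <= B%:R] by [].
  by apply: closed_comp => [x _|]; [exact: norm_continuous|exact: closed_le].
have A0 : A !=set0 by exists 0; rewrite /A /= normr0.
have [|y yA hy] := @compact_EVT_max V R (fun x => `|h x|) A A0 cA.
  apply: continuous_subspaceT => x.
  by apply: (@continuous_comp _ _ _ h (fun t : R => `|t|)); [exact: ch|exact: norm_continuous].
by exists `|h y| => // x Ax; apply: hy; exact: mem_set.
Qed.

Lemma bounded_supp B (h : V -> R) : continuous h -> supp B h -> exists2 K : R, 0 <= K & forall x, `|h x| <= K.
Proof.
move=> ch sh; have [K K0 hK] := bounded_cont B ch; exists K => // x.
by have [/sh->|/hK//] := ltP B%:R `|x|; rewrite normr0.
Qed.

Definition null (u : nat -> R) := u @ \oo --> (0 : R).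

Lemma null_le (u : nat -> R) : (forall e : R, 0 < e -> exists N, forall n, (N <= n)%N -> `|u n| <= e) -> null u.
Proof.
move=> H; apply/cvgrPdist_le => e /H[N hN].
by exists N => // n /= Nn; rewrite sub0r normrN; exact: hN.
Qed.

Lemma null_ge (u : nat -> R) e : null u -> 0 < e -> exists N, forall n, (N <= n)%N -> `|u n| <= e.
Proof.
move=> /cvgrPdist_le H e0; have [N _ hN] := H e e0.
by exists N => n Nn; have := hN n Nn; rewrite sub0r normrN.
Qed.

Lemma null_add u w : null u -> null w -> null (fun n => u n + w n).
Proof. by move=> hu hw; rewrite /null -[X in _ --> X](addr0 0); exact: cvgD. Qed.

Lemma null_scale c u : null u -> null (fun n => c * u n).
Proof. by move=> hu; rewrite /null -[X in _ --> X](mulr0 c); exact: cvgMr. Qed.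

Lemma null_eq u w : (forall n, u n = w n) -> null u -> null w.
Proof. by move=> /funext ->. Qed.

Lemma null_sum (I : Type) (r : seq I) (u : I -> nat -> R) : (forall i, null (u i)) ->
  null (fun n => \sum_(i <- r) u i n).
Proof.
move=> H; elim: r => [|i r IH].
  by apply: (@null_eq (fun=> 0)); [move=> n; rewrite big_nil|exact: cvg_cst].
by apply: null_eq (null_add (H i) IH) => n; rewrite big_cons.
Qed.

(** The difference quotient of [h] at the mesh has sum zero, by invariance under
    a shift, and differs from the derivative by a multiple of the mesh. *)
Lemma S_der B h i : Ck_on 2 setT h -> supp B h -> null (fun n => S n (pder i h)).
Proof.
move=> h2 sh; have c2 : continuous (pder i (pder i h)).
  by move=> x; exact: (Ck_cont (Ck_pder i (Ck_pder i h2)) I).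
have d1 x : derivable h x (bvec R i) by exact: (Ck_der h2).
have d2 x : derivable (pder i h) x (bvec R i) by exact: (Ck_der (Ck_pder i h2)).
have near0 (k : V -> R) : supp B k -> supp B (pder i k).
  move=> sk x hx; rewrite (@pder_near_eq _ _ (fun=> 0)) ?pder_cst//.
  have oW : open [set y : V | B%:R < `|y|].
    have -> : [set y : V | B%:R < `|y|] = (fun y : V => `|y|) @^-1` [set t | B%:R < t] by [].
    by apply: open_comp => [y _|]; [exact: norm_continuous|exact: open_gt].
  by apply: (@near_open _ [set y : V | B%:R < `|y|]) => //.
have [K K0 hK] := bounded_supp c2 (near0 _ (near0 _ sh)).
apply: null_le => e e0.
pose C := (B.+2.*2).+1%:R ^+ 3 * K.
have C0 : 0 <= C by rewrite mulr_ge0// exprn_ge0.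
have [N hN] : exists N : nat, C / e <= N.+1%:R.
  by exists (Num.truncn (C / e)); apply: ltW; exact: truncnS_gt.
exists (N + B.+2)%N => n nN.
have Bn : (B.+1 < n.+1)%N by lia.
pose q x := pder i h x - gN n * (h (x + (gN n)^-1 *: bvec R i) - h x).
have -> : S n (pder i h) = S n q.
  rewrite S_sub -[LHS]subr0; congr (_ - _).
  by rewrite S_scale S_sub (S_shift i sh Bn) subrr mulr0.
have g1 : `|(gN n)^-1| <= 1.
  by rewrite ger0_norm ?invr_ge0 ?(ltW (gN0 n))// invf_le1 ?gN0// /gN ler1n.
have sq : supp B.+2 q.
  move=> x hx; rewrite /q (near0 h sh); last by apply: le_lt_trans hx; rewrite ler_nat; lia.
  rewrite (supp_shift i sh g1); last by apply: lt_trans hx; rewrite ltr_nat.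
  by rewrite sh ?subrr ?mulr0 ?subr0//; apply: lt_trans hx; rewrite ltr_nat; lia.
have qb x : `|q x| <= (gN n)^-1 * K.
  have [t ht E] := @line_MVT _ h x (bvec R i) (gN n)^-1 (fun t _ => d1 _).
  rewrite /q E mulrA divff ?gt_eqF ?gN0// mul1r -pderE.
  have [t' ht' E'] := @line_MVT _ (pder i h) x (bvec R i) t (fun t _ => d2 _).
  rewrite distrC E' -pderE normrM.
  apply: ler_pM => //; apply: le_trans ht _.
  by rewrite ger0_norm// invr_ge0 ltW// gN0.
apply: le_trans (S_bound n sq qb) _.
rewrite mulrCA -/C mulrC ler_pdivrMr ?gN0//.
rewrite ler_pdivrMr// in hN; apply: le_trans hN _.
by rewrite mulrC ler_wpM2l ?(ltW e0)// /gN ler_nat; lia.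
Qed.

(** These linear maps send the grid to itself, so they serve as the end point
    to which other linear maps are deformed. *)
Definition sperm (s : {perm 'I_3}) (b : 'I_3 -> bool) (x : V) : V :=
  \row_i ((-1) ^+ b i * x ord0 (s i)).

Lemma S_sperm n s b h : S n (fun x => h (sperm s b x)) = S n h.
Proof.
congr (_ * _).
pose f (a : {ffun 'I_3 -> 'I_(gM n)}) : {ffun 'I_3 -> 'I_(gM n)} :=
  [ffun i => if b i then rev_ord (a (s i)) else a (s i)].
have f_inj : injective f.
  move=> a a' E; apply/ffunP => j; have := congr1 (fun g : {ffun _ -> _} => g ((s^-1)%g j)) E.
  by rewrite !ffunE permKV; case: ifP => // _ /rev_ord_inj.
rewrite [RHS](reindex_inj f_inj) /=; apply: eq_bigr => a _; congr h.
apply/rowP => i; rewrite !mxE ffunE; case: (b i); last by rewrite expr0 mul1r.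
rewrite expr1 mulN1r /coordpt -mulNr opprB; congr (_ / _) => /=.
have lt := ltn_ord (a (s i)); rewrite subSS natrB; last by rewrite -ltnS.
by rewrite -addnn natrD; ring.
Qed.

End Grid.

(** * Smooth bump functions *)

Section Bump.
Variable R : realType.
Local Notation V := 'rV[R]_3.

(** The functions [p (1/t) e^(-1/t)] are closed under differentiation, so they
    are smooth as soon as each is differentiable at [0]. *)
Definition flat (p : {poly R}) (t : R) : R := if 0 < t then p.[t^-1] * expR (- t^-1) else 0.

Lemma flat_quadratic p : exists2 C : R, 0 <= C & forall t, `|flat p t| <= C * t ^+ 2.
Proof.
exists (\sum_(i < size p) `|p`_i| * (i.+2)`!%:R); first by apply: sumr_ge0 => i _; rewrite mulr_ge0.
move=> t; rewrite /flat; case: ltP => t0; last first.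
  by rewrite normr0 mulr_ge0 ?sqr_ge0// sumr_ge0// => i _; rewrite mulr_ge0.
have s0 : 0 < t^-1 by rewrite invr_gt0.
set s := t^-1 in s0 *; have -> : t = s^-1 by rewrite /s invrK.
rewrite exprVn ler_pdivlMr ?exprn_gt0// normrM (gtr0_norm (expR_gt0 _)) mulrAC.
rewrite expRN -ler_pdivlMr ?invr_gt0 ?expR_gt0// invrK.
have -> : `|p.[s]| * s ^+ 2 = `|\sum_(i < size p) p`_i * s ^+ i| * s ^+ 2 by rewrite horner_coef.
apply: (@le_trans _ _ (\sum_(i < size p) `|p`_i| * s ^+ i.+2)).
  apply: (@le_trans _ _ ((\sum_(i < size p) `|p`_i * s ^+ i|) * s ^+ 2)).
    by rewrite ler_wpM2r ?sqr_ge0// ler_norm_sum.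
  rewrite mulr_suml; apply: ler_sum => i _.
  by rewrite normrM normrX (gtr0_norm s0) -mulrA -exprD addn2.
rewrite mulr_suml; apply: ler_sum => i _; rewrite -mulrA ler_wpM2l//.
have := expR_ge1Dxn i.+1 (ltW s0) => h.
have {h} : s ^+ i.+2 / (i.+2)`!%:R <= expR s by rewrite (le_trans _ h)// lerDr.
by rewrite ler_pdivrMr ?ltr0n ?fact_gt0// mulrC.
Qed.

Lemma flat_der p t : is_derive t (1:R) (flat p) (flat ('X^2 * (p - p^`())) t).
Proof.
have [t0|t0] := ltP 0 t.
  have d1 : is_derive t (1:R) (fun t : R => t^-1) (- t ^- 2).
    have tn0 : t != 0 by rewrite gt_eqF.
    split; first by apply: derivableV => //; exact: derivable_id.
    by have := deriveV tn0 (@derivable_id _ _ t (1:R)); rewrite derive_id [_ *: _]mulr1.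
  have dp : is_derive (t^-1) (1:R) (horner p) (p^`()).[t^-1] by exact: is_derive_poly.
  have d2 := @is_derive1_comp _ (horner p) (fun t : R => t^-1) t _ _ dp d1.
  have d3 := @is_deriveN _ _ _ (fun t : R => t^-1) t (1:R) _ d1.
  have d4 := @is_derive1_comp _ (@expR R) (fun t : R => - t^-1) t _ _ (is_derive_expR _) d3.
  have d5 := @is_deriveM _ _ _ _ t (1:R) _ _ d2 d4.
  have E : {near t, (horner p \o (fun t : R => t^-1)) * (expR \o (fun t : R => - t^-1)) =1 flat p}.
    near=> s; rewrite /flat /= ifT//; near: s; exact: lt_nbhsr.
  apply: (near_eq_is_derive E); apply: (is_derive_eq d5).
  rewrite /flat t0 !hornerE /= /GRing.scale /= -!exprVn; ring.
have -> : flat ('X^2 * (p - p^`())) t = 0 by rewrite /flat ltNge t0.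
have [C C0 hC] := flat_quadratic p.
have fb (s : R) : `|flat p (s + t)| <= C * s ^+ 2.
  have [st|st] := ltP 0 (s + t); last by rewrite {1}/flat ltNge st normr0 mulr_ge0 ?sqr_ge0.
  apply: le_trans (hC _) _; rewrite ler_wpM2l// lerXn2r ?nnegrE//; lra.
have L : (fun h : R => h^-1 *: ((flat p \o shift t) (h *: (1:R)) - flat p t)) @ 0^' --> (0:R).
  apply/cvgrPdist_le => e e0; near=> h.
  have ft : flat p t = 0 by rewrite /flat ltNge t0.
  rewrite ft subr0 sub0r normrN /= normrZ normfV [h *: _]mulr1.
  have h0 : h != 0 by near: h; exact: nbhs_dnbhs_neq.
  rewrite mulrC ler_pdivrMr ?normr_gt0//; apply: le_trans (fb h) _.
  rewrite -real_normK ?num_real// expr2 mulrA ler_wpM2r//.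
  have : `|h| < e / (C + 1).
    by near: h; apply: dnbhs0_lt; rewrite divr_gt0// ltr_wpDl.
  have C1 : 0 < C + 1 by rewrite ltr_wpDl.
  rewrite ltr_pdivlMr// => /ltW; apply: le_trans.
  by rewrite mulrC ler_wpM2l// lerDl.
by split; [apply/cvg_ex; exists 0|exact/cvg_lim].
Unshelve. all: end_near. Qed.

Lemma flat_der_closed : der_closed setT (fun g => exists p, g = flat p).
Proof.
move=> _ [p ->]; exists (flat ('X^2 * (p - p^`()))); first by eexists.
by move=> t _; exact: flat_der.
Qed.

Lemma Ck_flat k W p h : open W -> Ck_on k W h -> Ck_on k W (fun x => flat p (h x)).
Proof. by move=> oW Hh; apply: (Ck_comp1 oW flat_der_closed _ _ Hh) => //; exists p. Qed.

Lemma flat1_gt0 t : 0 < t -> 0 < flat 1 t.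
Proof. by move=> t0; rewrite /flat t0 hornerE mul1r expR_gt0. Qed.

Lemma flat_le0 p t : t <= 0 -> flat p t = 0.
Proof. by move=> t0; rewrite /flat ltNge t0. Qed.

Lemma flat1_ge0 t : 0 <= flat 1 t.
Proof. by have [t0|t0] := ltP 0 t; [exact/ltW/flat1_gt0|rewrite flat_le0]. Qed.

(** The squared Euclidean distance is smooth, unlike the supremum norm. *)
Definition sqdist (c x : V) : R := \sum_i (x ord0 i - c ord0 i) ^+ 2.

Lemma sqdist_Ck k W c : open W -> Ck_on k W (sqdist c).
Proof.
move=> oW; apply: Ck_sum => // i.
apply: (@Ck_eq _ _ _ (fun x => (x ord0 i - c ord0 i) * (x ord0 i - c ord0 i))) => //.
have h : Ck_on k W (fun x => x ord0 i - c ord0 i).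
  by apply: Ck_add => //; [exact: Ck_coord|exact: Ck_cst].
exact: Ck_mul.
Qed.

Lemma sqdist_ge c x : `|x - c| ^+ 2 <= sqdist c x.
Proof.
have s0 : 0 <= sqdist c x by apply: sumr_ge0 => i _; exact: sqr_ge0.
rewrite -[leRHS]sqr_sqrtr// lerXn2r ?nnegrE ?sqrtr_ge0//.
apply: normrV_le; first exact: sqrtr_ge0.
move=> i; rewrite -sqrtr_sqr ler_wsqrtr// !mxE /sqdist (bigD1 i)//= lerDl.
by apply: sumr_ge0 => j _; exact: sqr_ge0.
Qed.

Lemma sqdist_le c x : sqdist c x <= 3%:R * `|x - c| ^+ 2.
Proof.
rewrite /sqdist (_ : 3%:R * _ = \sum_(i < 3) `|x - c| ^+ 2); last first.
  by rewrite sumr_const card_ord mulr_natl.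
apply: ler_sum => i _; rewrite -real_normK ?num_real// lerXn2r ?nnegrE//.
by have := coord_le_norm (x - c) i; rewrite !mxE.
Qed.

(** The denominator never vanishes, as one of its terms is positive on each side
    of the sphere of radius [r / sqrt 2]. *)
Definition bump c (r : R) (x : V) : R :=
  let a := flat 1 (r ^+ 2 - sqdist c x) in
  let b := flat 1 (sqdist c x - r ^+ 2 / 2) in a / (a + b).

Lemma bump_den c r x : 0 < r -> 0 < flat 1 (r ^+ 2 - sqdist c x) + flat 1 (sqdist c x - r ^+ 2 / 2).
Proof.
move=> r0; have r2 : 0 < r ^+ 2 by rewrite exprn_gt0.
have [h|h] := ltP (sqdist c x) (r ^+ 2).
  by rewrite ltr_wpDr ?flat1_ge0// flat1_gt0// subr_gt0.
by rewrite ltr_wpDl ?flat1_ge0// flat1_gt0//; lra.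
Qed.

Lemma bump_Ck k W c r : open W -> 0 < r -> Ck_on k W (bump c r).
Proof.
move=> oW r0; have s := @sqdist_Ck k W c oW.
have s1 : Ck_on k W (fun x => flat 1 (r ^+ 2 - sqdist c x)).
  by apply: Ck_flat => //; apply: Ck_add => //; [exact: Ck_cst|exact: Ck_opp].
have s2 : Ck_on k W (fun x => flat 1 (sqdist c x - r ^+ 2 / 2)).
  by apply: Ck_flat => //; apply: Ck_add => //; exact: Ck_cst.
apply: Ck_mul => //; apply: Ck_inv => //; last exact: Ck_add.
by move=> x _; rewrite gt_eqF// bump_den.
Qed.

Lemma bump_ge0 c r x : 0 < r -> 0 <= bump c r x.
Proof. by move=> r0; rewrite divr_ge0 ?flat1_ge0// ltW// bump_den. Qed.

Lemma bump_le1 c r x : 0 < r -> bump c r x <= 1.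
Proof. by move=> r0; rewrite ler_pdivrMr ?bump_den// mul1r lerDl flat1_ge0. Qed.

Lemma bump_in c r x : 0 < r -> `|x - c| <= r / 3%:R -> bump c r x = 1.
Proof.
move=> r0 h; have := sqdist_le c x; have n0 : 0 <= `|x - c| by [].
have h2 : `|x - c| ^+ 2 <= (r / 3%:R) ^+ 2 by rewrite lerXn2r ?nnegrE ?divr_ge0 ?(ltW r0).
move=> h3; have h4 : sqdist c x <= r ^+ 2 / 3.
  apply: le_trans h3 _; apply: le_trans (ler_wpM2l _ h2) _ => //.
  by rewrite expr_div_n; lra.
have r2 : 0 < r ^+ 2 by rewrite exprn_gt0.
have := @bump_den c r x r0; rewrite /bump (@flat_le0 _ (_ - r ^+ 2 / 2)); last by lra.
by rewrite addr0 => d; rewrite divff// gt_eqF.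
Qed.

Lemma bump_out c r x : 0 < r -> r <= `|x - c| -> bump c r x = 0.
Proof.
move=> r0 h; rewrite /bump (@flat_le0 _ (r ^+ 2 - _)) ?mul0r// subr_le0.
by apply: le_trans (sqdist_ge c x); rewrite lerXn2r ?nnegrE ?(ltW r0).
Qed.

Lemma bump_center_gt0 c r x : 0 < r -> `|x - c| <= r / 3%:R -> 0 < bump c r x.
Proof. by move=> r0 h; rewrite bump_in. Qed.

Lemma Ck_cutoff k W c r h : open W -> 0 < r -> (forall x, `|x - c| <= r -> W x) ->
  Ck_on k W h -> Ck_on k setT (fun x => bump c r x * h x).
Proof.
move=> oW r0 sub Hh; apply: Ck_local => x _.
have [xr|xr] := leP `|x - c| r.
  exists W; first by split=> //; exact: sub.
  by apply: Ck_mul => //; exact: bump_Ck.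
pose O : set V := [set y | r < `|y - c|].
have oO : open O.
  have -> : O = (fun y : V => `|y - c|) @^-1` [set t | r < t] by [].
  apply: open_comp => [y _|]; last exact: open_gt.
  apply: (@continuous_comp _ _ _ (fun y : V => y - c) (fun y : V => `|y|)); last exact: norm_continuous.
  by apply: continuousB; [exact: id|exact: cst_continuous].
exists O => //; apply: (@Ck_eq _ _ _ (fun=> 0)) => //; last exact: Ck_cst.
by move=> y Oy; rewrite bump_out ?mul0r// ltW.
Qed.

End Bump.

(** * Change of variables in grid sums *)

Section Lax.
Variable R : realType.
Local Notation V := 'rV[R]_3.
Implicit Types (h g k u : V -> R) (n B : nat) (x y v : V) (psi phi : V -> V).

(** Cut the interval into [m] steps of length [d = L / m]: the first order terms
    give finitely many null sequences, and the second order terms add up to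
    [O (m d^2) = O (1 / m)]. *)
Lemma null_path B (G H : R -> V -> R) (L C : R) : 0 <= L -> 0 <= C ->
  (forall s, 0 <= s <= L -> supp B (G s)) -> (forall s, 0 <= s <= L -> supp B (H s)) ->
  (forall s d x, 0 <= d -> `|G (s + d) x - G s x - d * H s x| <= C * d ^+ 2) ->
  (forall s, 0 <= s <= L -> null (fun n => S n (H s))) ->
  null (fun n => S n (G L) - S n (G 0)).
Proof.
move=> L0 C0 sG sH GH nH; apply: null_le => e e0.
have e2 : 0 < e / 2 by rewrite divr_gt0.
pose K : R := (B.*2).+1%:R ^+ 3.
have K0 : 0 <= K by rewrite exprn_ge0.
have [m hm] : exists m : nat, K * C * L ^+ 2 / (e / 2) <= m.+1%:R.
  by exists (Num.truncn (K * C * L ^+ 2 / (e / 2))); apply: ltW; exact: truncnS_gt.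
pose d := L / m.+1%:R.
have m0 : (0 : R) < m.+1%:R by rewrite ltr0n.
have d0 : 0 <= d by rewrite divr_ge0// ltW.
have dL : m.+1%:R * d = L by rewrite /d mulrC divfK// gt_eqF.
have inL (i : nat) : (i <= m.+1)%N -> 0 <= i%:R * d <= L.
  by move=> im; rewrite mulr_ge0//= -dL ler_wpM2r// ler_nat.
have nS : null (fun n => \sum_(i < m.+1) d * S n (H (i%:R * d))).
  by apply: null_sum => i; apply: null_scale; apply: nH; apply: inL; exact: ltnW.
have [N hN] := null_ge nS e2; exists N => n Nn.
have tel : S n (G L) - S n (G 0) = \sum_(i < m.+1) (S n (G (i%:R * d + d)) - S n (G (i%:R * d))).
  rewrite -(big_mkord predT (fun i => S n (G (i%:R * d + d)) - S n (G (i%:R * d)))).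
  rewrite (eq_bigr (fun i => S n (G (i.+1%:R * d)) - S n (G (i%:R * d)))); last first.
    by move=> i _; rewrite -natr1 mulrDl mul1r.
  by rewrite telescope_sumr// mul0r dL.
have split (i : 'I_m.+1) : S n (G (i%:R * d + d)) - S n (G (i%:R * d)) = d * S n (H (i%:R * d)) +
   S n (fun x => G (i%:R * d + d) x - G (i%:R * d) x - d * H (i%:R * d) x).
  by rewrite !S_sub S_scale; ring.
rewrite tel (eq_bigr _ (fun i _ => split i)) big_split /=.
apply: le_trans (ler_normD _ _) _; rewrite (splitr e); apply: lerD; first exact: hN.
apply: le_trans (ler_norm_sum _ _ _) _.
apply: (@le_trans _ _ (\sum_(i < m.+1) K * (C * d ^+ 2))).
  apply: ler_sum => i _; apply: (S_bound n (B := B)) => x; last exact: GH.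
  have i1 := inL i (ltnW (ltn_ord i)); have := inL i.+1 (ltn_ord i).
  by rewrite -natr1 mulrDl mul1r => i2 hx; rewrite sG// sG// sH// mulr0 !subr0.
rewrite sumr_const card_ord -[X in X <= _]mulr_natl /d expr_div_n.
have -> : m.+1%:R * (K * (C * (L ^+ 2 / m.+1%:R ^+ 2))) = K * C * L ^+ 2 / m.+1%:R.
  by field; rewrite gt_eqF.
rewrite ler_pdivrMr// [e / 2 * _]mulrC -ler_pdivrMr//; exact: hm.
Qed.

Lemma taylor2 k K i x d : Ck_on 2 setT k -> (forall y, `|pder i (pder i k) y| <= K) -> 0 <= d ->
  `|k (x + d *: bvec R i) - k x - d * pder i k x| <= K * d ^+ 2.
Proof.
move=> k2 hK d0.
have [t ht ->] := @line_MVT _ k x (bvec R i) d (fun t _ => Ck_der k2 I).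
rewrite -pderE -mulrBr.
have [t' ht' ->] := @line_MVT _ (pder i k) x (bvec R i) t (fun t _ => Ck_der (Ck_pder i k2) I).
rewrite -pderE !normrM (ger0_norm d0); rewrite (ger0_norm d0) in ht.
have h : `|t| * `|pder i (pder i k) (x + t' *: bvec R i)| <= d * K by exact: ler_pM.
by apply: le_trans (ler_wpM2l d0 h) _; rewrite expr2; lra.
Qed.

Lemma Ck_translate m k v : Ck_on m setT k -> Ck_on m setT (fun x => k (x + v)).
Proof.
move=> hk; apply: (@Ck_comp _ m setT setT k (fun x => x + v)); [exact: openT|exact: openT|by []|exact: hk|].
move=> j; apply: (@Ck_eq _ _ _ (fun x => x ord0 j + v ord0 j)); first exact: openT.
  by move=> x _; rewrite mxE.
by apply: Ck_add; [exact: openT|exact: Ck_coord|exact: Ck_cst].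
Qed.

Lemma supp_pder B k i : supp B k -> supp B (pder i k).
Proof.
move=> sk x hx; rewrite (@pder_near_eq _ _ (fun=> 0)) ?pder_cst//.
have oW : open [set y : V | B%:R < `|y|].
  have -> : [set y : V | B%:R < `|y|] = (fun y : V => `|y|) @^-1` [set t | B%:R < t] by [].
  by apply: open_comp => [y _|]; [exact: norm_continuous|exact: open_gt].
exact: (@near_open _ [set y : V | B%:R < `|y|]).
Qed.

Lemma nat_above (r : R) : exists n : nat, r <= n%:R.
Proof. by exists (Num.truncn r).+1; apply: ltW; exact: truncnS_gt. Qed.

Lemma supp_translate B k v D : `|v| <= D%:R -> supp B k -> supp (B + D) (fun x => k (x + v)).
Proof.
move=> vD sk x; rewrite natrD => hx; apply: sk.
have : `|x| <= `|x + v| + `|v| by rewrite -[in leLHS](addrK v x) ler_normB.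
by lra.
Qed.

(** The derivative in [t] of a translate is a partial derivative, whose sums
    are null. *)
Lemma S_translate_axis B k i (t : R) : 0 <= t -> Ck_on 2 setT k -> supp B k ->
  null (fun n => S n (fun x => k (x + t *: bvec R i)) - S n k).
Proof.
move=> t0 k2 sk.
have cont2 : continuous (pder i (pder i k)).
  by move=> x; exact: (Ck_cont (Ck_pder i (Ck_pder i k2)) I).
have [K K0 hK] := bounded_supp cont2 (supp_pder i (supp_pder i sk)).
have [D hD] := nat_above t.
have tr s := Ck_translate (s *: bvec R i) k2.
pose H s x := pder i (fun x => k (x + s *: bvec R i)) x.
pose G s x := k (x + s *: bvec R i).
have nb s : 0 <= s <= t -> `|s *: bvec R i| <= D%:R.
  move=> /andP[s0 st]; rewrite mx_normZ norm_bvec mulr1 ger0_norm//.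
  exact: le_trans st hD.
have sG s : 0 <= s <= t -> supp (B + D) (G s).
  by move=> st; apply: supp_translate => //; exact: nb.
have := @null_path (B + D) G H t K t0 K0 sG (fun s st => supp_pder i (sG s st)).
move=> P; have {}P := P _ _; apply: (null_eq _ (P _ _)).
- by move=> n; congr (_ - _); apply: S_ext => x; rewrite /G scale0r addr0.
- move=> s d x d0; rewrite /H pder_shift /G scalerDl addrA.
  exact: taylor2.
- by move=> s st; apply: (S_der i (tr s) (sG s st)).
Qed.

Lemma null_sub (u w : nat -> R) : null (fun n => u n - w n) -> null (fun n => w n - u n).
Proof. by move=> h; apply: null_eq (null_scale (-1) h) => n; ring. Qed.

Lemma null_trans (u v w : nat -> R) : null (fun n => u n - v n) -> null (fun n => v n - w n) ->
  null (fun n => u n - w n).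
Proof. by move=> h1 h2; apply: null_eq (null_add h1 h2) => n; ring. Qed.

Lemma S_translate1 B k i (t : R) : Ck_on 2 setT k -> supp B k ->
  null (fun n => S n (fun x => k (x + t *: bvec R i)) - S n k).
Proof.
move=> k2 sk; have [t0|t0] := leP 0 t; first exact: (S_translate_axis i t0 k2 sk).
have [D hD] := nat_above (- t).
have sk' : supp (B + D) (fun x => k (x + t *: bvec R i)).
  by apply: supp_translate => //; rewrite mx_normZ norm_bvec mulr1 ltr0_norm.
have nt : 0 <= - t by lra.
have := S_translate_axis i nt (Ck_translate _ k2) sk'.
move=> h; apply: null_sub; apply: null_eq h => n; congr (_ - _).
by apply: S_ext => x; rewrite scaleNr subrK.
Qed.

Lemma S_translate B k v : Ck_on 2 setT k -> supp B k ->
  null (fun n => S n (fun x => k (x + v)) - S n k).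
Proof.
move=> k2 sk.
have step (w : V) i (t : R) : null (fun n => S n (fun x => k (x + w)) - S n k) ->
    null (fun n => S n (fun x => k (x + (t *: bvec R i + w))) - S n k).
  move=> h; apply: null_trans h; have [D hD] := nat_above `|w|.
  have := S_translate1 i t (Ck_translate w k2) (supp_translate hD sk).
  apply: null_eq => n; congr (_ - _); apply: S_ext => x; congr k; rewrite addrA.
  by [].
have -> : v = v ord0 i0 *: bvec R i0 + (v ord0 i1 *: bvec R i1 + (v ord0 i2 *: bvec R i2 + 0)).
  by rewrite addr0 addrA -(sum3 (fun i => v ord0 i *: bvec R i)) -rV_expand.
do 3 apply: (step).
have e n : S n (fun x => k (x + 0)) = S n k by apply: S_ext => x; rewrite addr0.
by apply: (@null_eq _ (fun=> 0)); [move=> n; rewrite e subrr|exact: cvg_cst].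
Qed.

(** ** Jacobians *)

Definition grad3 (a b c : V -> R) x : R :=
  det3 (pder i0 a x) (pder i1 a x) (pder i2 a x) (pder i0 b x) (pder i1 b x) (pder i2 b x)
       (pder i0 c x) (pder i1 c x) (pder i2 c x).

Definition comp psi i : V -> R := fun x => psi x ord0 i.
Definition Jac psi : V -> R := grad3 (comp psi i0) (comp psi i1) (comp psi i2).

Definition cross (b c : V -> R) (i : 'I_3) x : R :=
  let d f j := pder j f x in
  if i == i0 then d b i1 * d c i2 - d b i2 * d c i1
  else if i == i1 then d b i2 * d c i0 - d b i0 * d c i2
  else d b i0 * d c i1 - d b i1 * d c i0.

Lemma cross_Ck m b c i : Ck_on m.+1 setT b -> Ck_on m.+1 setT c -> Ck_on m setT (cross b c i).
Proof.
move=> hb hc; have oT : open (setT : set V) by exact: openT.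
have P j l : Ck_on m setT (fun x => pder j b x * pder l c x).
  by apply: Ck_mul => //; exact: Ck_pder.
have D j l j' l' : Ck_on m setT (fun x => pder j b x * pder l c x - pder j' b x * pder l' c x).
  by apply: Ck_add => //; exact: Ck_opp.
by have [->|->|->] := ord3P i; rewrite /cross !eqE /=.
Qed.

(** The cross product of two gradients is divergence free, because mixed second
    derivatives commute; only the derivatives of [u] remain. *)
Lemma div_cross u b c x : Ck_on 1 setT u -> Ck_on 2 setT b -> Ck_on 2 setT c ->
  \sum_i pder i (fun y => u y * cross b c i y) x = grad3 u b c x.
Proof.
move=> hu hb hc; have oT : open (setT : set V) by exact: openT.
have du i : derivable u x (bvec R i) by exact: (Ck_der hu).
have db i j : derivable (pder j b) x (bvec R i) by exact: (Ck_der (Ck_pder j hb)).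
have dc i j : derivable (pder j c) x (bvec R i) by exact: (Ck_der (Ck_pder j hc)).
have dx i : derivable (cross b c i) x (bvec R i) by exact: (Ck_der (cross_Ck i hb hc)).
have P i j l : derivable (fun x => pder j b x * pder l c x) x (bvec R i) by exact: derivableM.
have D i j l j' l' : pder i (fun x => pder j b x * pder l c x - pder j' b x * pder l' c x) x =
   (pder j b x * pder i (pder l c) x + pder l c x * pder i (pder j b) x)
   - (pder j' b x * pder i (pder l' c) x + pder l' c x * pder i (pder j' b) x).
  by rewrite pderB// !pderM.
rewrite sum3 !pderM//.
have -> : pder i0 (cross b c i0) x = _ := D i0 i1 i2 i2 i1.
have -> : pder i1 (cross b c i1) x = _ := D i1 i2 i0 i0 i2.
have -> : pder i2 (cross b c i2) x = _ := D i2 i0 i1 i1 i0.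
rewrite (@schwarz _ setT b x i1 i0)// (@schwarz _ setT b x i2 i0)// (@schwarz _ setT b x i2 i1)//.
rewrite (@schwarz _ setT c x i1 i0)// (@schwarz _ setT c x i2 i0)// (@schwarz _ setT c x i2 i1)//.
by rewrite /grad3 /det3 /cross !eqE /=; ring.
Qed.

Lemma grad3_comp u psi x : Ck_on 1 setT u -> (forall i, Ck_on 1 setT (comp psi i)) ->
  grad3 (u \o psi) (comp psi i1) (comp psi i2) x = pder i0 u (psi x) * Jac psi x.
Proof.
move=> hu hp; have oT : open (setT : set V) by exact: openT.
have E i : pder i (u \o psi) x = \sum_j pder j u (psi x) * pder i (comp psi j) x.
  by apply: (pder_comp oT _ hu) => // j; exact: (Ck_der (hp j)).
by rewrite /grad3 !E !sum3 /Jac /grad3 /det3; ring.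
Qed.

Lemma near_out B x : B%:R < `|x| -> \forall y \near x, B%:R < `|y|.
Proof.
move=> hx.
have oW : open [set y : V | B%:R < `|y|].
  have -> : [set y : V | B%:R < `|y|] = (fun y : V => `|y|) @^-1` [set t | B%:R < t] by [].
  by apply: open_comp => [y _|]; [exact: norm_continuous|exact: open_gt].
exact: (@near_open _ [set y : V | B%:R < `|y|]).
Qed.

Section LaxMaps.
Variables (psi phi : V -> V) (B : nat).
Hypotheses (hpsi : forall i, Ck_on 3 setT (comp psi i)) (hphi : forall i, Ck_on 3 setT (comp phi i)).
Hypothesis out : forall x, B%:R < `|x| -> psi x = phi x.

Let oT : open (setT : set V). Proof. exact: openT. Qed.

Lemma pder_out i j x : B%:R < `|x| -> pder i (comp psi j) x = pder i (comp phi j) x.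
Proof.
move=> hx; apply: pder_near_eq; apply: filterS (near_out hx) => y hy.
by rewrite /comp out.
Qed.

Lemma Jac_out x : B%:R < `|x| -> Jac psi x = Jac phi x.
Proof. by move=> hx; rewrite /Jac /grad3 !pder_out. Qed.

(** Both terms are divergences, by [div_cross], of fields that agree outside a
    cube; so their difference is the divergence of a field with compact support. *)
Lemma lax_der u : Ck_on 2 setT u ->
  null (fun n => S n (fun x => pder i0 u (psi x) * Jac psi x - pder i0 u (phi x) * Jac phi x)).
Proof.
move=> hu.
have cu (f : V -> V) : (forall i, Ck_on 3 setT (comp f i)) -> Ck_on 2 setT (u \o f).
  by move=> hf; apply: (@Ck_comp _ 2 setT setT u f oT oT (fun _ _ => I) hu) => j; exact: Ck_pred (hf j).
pose F i x := (u (psi x) * cross (comp psi i1) (comp psi i2) i x)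
            - (u (phi x) * cross (comp phi i1) (comp phi i2) i x).
have hF1 (f : V -> V) i : (forall i, Ck_on 3 setT (comp f i)) ->
    Ck_on 2 setT (fun x => u (f x) * cross (comp f i1) (comp f i2) i x).
  by move=> hf; exact: (Ck_mul oT (cu _ hf) (cross_Ck i (hf i1) (hf i2))).
have hF i : Ck_on 2 setT (F i) by exact: (Ck_add oT (hF1 _ i hpsi) (Ck_opp oT (hF1 _ i hphi))).
have sF i : supp B (F i).
  by move=> x hx; rewrite /F out// /cross !pder_out// subrr.
have := null_sum (index_enum 'I_3) (fun i => S_der i (hF i) (sF i)).
apply: null_eq => n; rewrite -S_sum; apply: S_ext => x.
have dF (f : V -> V) i : (forall i, Ck_on 3 setT (comp f i)) ->
    derivable (fun x => u (f x) * cross (comp f i1) (comp f i2) i x) x (bvec R i).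
  by move=> hf; exact: (Ck_der (hF1 f i hf)).
rewrite (eq_bigr _ (fun i _ => pderB (dF psi i hpsi) (dF phi i hphi))) sumrB.
have c1 (f : V -> V) : (forall i, Ck_on 3 setT (comp f i)) ->
    \sum_i pder i (fun x => u (f x) * cross (comp f i1) (comp f i2) i x) x = pder i0 u (f x) * Jac f x.
  move=> hf; have h1 i : Ck_on 1 setT (comp f i) by exact: Ck_le (hf i).
  have h2 i : Ck_on 2 setT (comp f i) by exact: Ck_le (hf i).
  rewrite -(grad3_comp x (Ck_pred hu) h1) -(div_cross x _ (h2 i1) (h2 i2)) //.
  exact: Ck_pred (cu f hf).
by rewrite !c1.
Qed.

Lemma Jac_Ck (f : V -> V) : (forall i, Ck_on 3 setT (comp f i)) -> Ck_on 2 setT (Jac f).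
Proof.
move=> hf; have p i j : Ck_on 2 setT (pder i (comp f j)) by exact: Ck_pder.
have m (a b : V -> R) : Ck_on 2 setT a -> Ck_on 2 setT b -> Ck_on 2 setT (fun x => a x * b x) by exact: Ck_mul.
have s (a b : V -> R) : Ck_on 2 setT a -> Ck_on 2 setT b -> Ck_on 2 setT (fun x => a x - b x).
  by move=> ha hb; exact: (Ck_add oT ha (Ck_opp oT hb)).
have d j l j' l' a b := s _ _ (m _ _ (p j a) (p l b)) (m _ _ (p j' a) (p l' b)).
exact: (Ck_add oT (s _ _ (m _ _ (p i0 i0) (d i1 i2 i2 i1 i1 i2)) (m _ _ (p i1 i0) (d i0 i2 i2 i0 i1 i2)))
  (m _ _ (p i2 i0) (d i0 i1 i1 i0 i1 i2))).
Qed.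

(** Lax's change of variables formula: translating [k] far away in small steps
    reduces it to derivatives. *)
Lemma lax k Bk : Ck_on 2 setT k -> supp Bk k ->
  null (fun n => S n (fun x => k (psi x) * Jac psi x - k (phi x) * Jac phi x)).
Proof.
move=> hk sk.
have cont2 : continuous (pder i0 (pder i0 k)).
  by move=> x; exact: (Ck_cont (Ck_pder i0 (Ck_pder i0 hk)) I).
have [K K0 hK] := bounded_supp cont2 (supp_pder i0 (supp_pder i0 sk)).
have [J1 J10 hJ1] := bounded_cont B (fun x => Ck_cont (Jac_Ck hpsi) (I : setT x)).
have [J2 J20 hJ2] := bounded_cont B (fun x => Ck_cont (Jac_Ck hphi) (I : setT x)).
have [P1 P10 hP1] := bounded_cont B (fun x => Ck_cont (hpsi i0) (I : setT x)).
have [P2 P20 hP2] := bounded_cont B (fun x => Ck_cont (hphi i0) (I : setT x)).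
pose L : R := P1 + P2 + Bk%:R + 1.
have L0 : 0 <= L by rewrite !addr_ge0.
pose e s : V := s *: bvec R i0.
pose D f x s := k (f x + e s) * Jac f x.
pose G s x := D psi x s - D phi x s.
pose H s x := pder i0 k (psi x + e s) * Jac psi x - pder i0 k (phi x + e s) * Jac phi x.
have sG s : 0 <= s <= L -> supp B (G s).
  by move=> _ x hx; rewrite /G /D out// Jac_out// subrr.
have sH s : 0 <= s <= L -> supp B (H s).
  by move=> _ x hx; rewrite /H out// Jac_out// subrr.
have far (f : V -> V) P x : `|comp f i0 x| <= P -> P + Bk%:R < L -> k (f x + e L) = 0.
  move=> fP PL; apply: sk; apply: lt_le_trans (coord_le_norm _ i0).
  rewrite !mxE !eqxx /= mulr1; move: fP; rewrite /comp ler_norml => /andP[h1 h2].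
  by rewrite ltr_normr; apply/orP; left; lra.
have GL x : G L x = 0.
  have [hx|hx] := ltP B%:R `|x|; first by rewrite sG// L0 lexx.
  rewrite /G /D (@far psi P1)//; last by rewrite /L; lra.
    by rewrite (@far phi P2) ?mul0r ?subrr//; [exact: hP2|rewrite /L; lra].
  exact: hP1.
have inc s d x : 0 <= d -> `|G (s + d) x - G s x - d * H s x| <= K * (J1 + J2) * d ^+ 2.
  move=> d0; have [hx|hx] := ltP B%:R `|x|.
    rewrite /G /D /H out// Jac_out// !subrr mulr0 !subr0 normr0.
    by rewrite !mulr_ge0 ?sqr_ge0// addr_ge0.
  pose t f := k (f x + e s + d *: bvec R i0) - k (f x + e s) - d * pder i0 k (f x + e s).
  have -> : G (s + d) x - G s x - d * H s x = t psi * Jac psi x - t phi * Jac phi x.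
    by rewrite /G /D /H /t /e scalerDl !addrA; ring.
  apply: le_trans (ler_normB _ _) _; rewrite !normrM.
  have tb f : `|t f| <= K * d ^+ 2 by exact: taylor2.
  rewrite (_ : K * (J1 + J2) * d ^+ 2 = K * d ^+ 2 * J1 + K * d ^+ 2 * J2); last by ring.
  by apply: lerD; apply: ler_pM => //; [exact: hJ1|exact: hJ2].
have nH s : 0 <= s <= L -> null (fun n => S n (H s)).
  move=> _; have := lax_der (Ck_translate (e s) hk); apply: null_eq => n.
  by apply: S_ext => x; rewrite /H !pder_shift.
have C0 : 0 <= K * (J1 + J2) by rewrite mulr_ge0// addr_ge0.
have := null_scale (-1) (null_path L0 C0 sG sH inc nH); apply: null_eq => n.
rewrite (_ : S n (G L) = 0); last by rewrite -(S0 R n); apply: S_ext.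
rewrite sub0r mulN1r opprK; apply: S_ext => x.
by rewrite /G /D /e scale0r !addr0.
Qed.

End LaxMaps.
End Lax.

(** ** Local changes of variables *)

Section LinearPath.
Variable R : realType.
Local Notation V := 'rV[R]_3.
Implicit Types (A : 'M[R]_3).

Lemma det33 A : \det A = det3 (A i0 i0) (A i1 i0) (A i2 i0) (A i0 i1) (A i1 i1) (A i2 i1)
  (A i0 i2) (A i1 i2) (A i2 i2).
Proof.
rewrite (expand_det_col _ i0) sum3 /cofactor !(expand_det_col _ ord0) !big_ord_recr !big_ord0 /=.
rewrite /cofactor !det_mx11 !mxE /=.
pose w : 'I_2 := widen_ord (leqnSn 1) ord_max; rewrite -/w.
have c1 : lift i0 (ord0 : 'I_2) = i1 by exact: val_inj.
have a1 : lift i0 w = i1 by exact: val_inj.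
have a2 : lift i0 (ord_max : 'I_2) = i2 by exact: val_inj.
have a3 : lift i0 (lift w (0 : 'I_1)) = i2 by exact: val_inj.
have a4 : lift i0 (lift (ord_max : 'I_2) (0 : 'I_1)) = i1 by exact: val_inj.
have b1 : lift i1 w = i0 by exact: val_inj.
have b2 : lift i1 (ord_max : 'I_2) = i2 by exact: val_inj.
have b3 : lift i1 (lift w (0 : 'I_1)) = i2 by exact: val_inj.
have b4 : lift i1 (lift (ord_max : 'I_2) (0 : 'I_1)) = i0 by exact: val_inj.
have d1 : lift i2 w = i0 by exact: val_inj.
have d2 : lift i2 (ord_max : 'I_2) = i1 by exact: val_inj.
have d3 : lift i2 (lift w (0 : 'I_1)) = i1 by exact: val_inj.
have d4 : lift i2 (lift (ord_max : 'I_2) (0 : 'I_1)) = i0 by exact: val_inj.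
rewrite a1 a2 a3 a4 b1 b2 b3 b4 d1 d2 d3 d4 c1 /det3.
by rewrite !addn0 expr0 expr1; ring.
Qed.

Lemma lower_det_neq0 (L : 'M[R]_3) (s : R) : (forall i j : 'I_3, (i <= j)%N -> L i j = (i == j)%:R) ->
  \det ((1 - s) *: 1%:M + s *: L) = 1.
Proof.
move=> hL; rewrite det_trig.
  by apply: big1 => i _; rewrite !mxE hL// eqxx !mulr1 subrK.
apply/is_trig_mxP => i j ij; rewrite !mxE hL; last exact: ltnW.
by rewrite -[i == j]/(val i == val j) ltn_eqF// !mulr0 addr0.
Qed.

Lemma upper_det (U D : 'M[R]_3) (s : R) : (forall i j : 'I_3, (j < i)%N -> U i j = 0) ->
  (forall i j : 'I_3, i != j -> D i j = 0) ->
  \det ((1 - s) *: D + s *: U) = \prod_i ((1 - s) * D i i + s * U i i).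
Proof.
move=> hU hD; rewrite -det_tr det_trig; first by apply: eq_bigr => i _; rewrite !mxE.
apply/is_trig_mxP => i j ij; rewrite !mxE hU// hD ?mulr0 ?addr0//.
by rewrite -[_ == _]/(val j == val i) gtn_eqF.
Qed.

Lemma sgr_path (u s : R) : u != 0 -> 0 <= s <= 1 -> (1 - s) * Num.sg u + s * u != 0.
Proof.
move=> u0 /andP[s0 s1]; have [u1|u1] := ltP u 0; last have {}u1 : 0 < u by rewrite lt_def u0.
  by rewrite ltr0_sg// lt_eqF//; nra.
by rewrite gtr0_sg// gt_eqF//; nra.
Qed.

Lemma lup_proj A (t : 'M[R]_3 * 'M[R]_3 * 'M[R]_3) : (let: (P, L, U) := t in P * A = L * U) ->
  t.1.1 * A = t.1.2 * t.2.
Proof. by case: t => [[]]. Qed.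

(** In an LU decomposition the triangular factors are deformed linearly, the unit
    one to the identity and the other one to the diagonal matrix of its signs;
    the diagonals never vanish on the way. *)
Lemma lin_path A : \det A != 0 -> exists (N : R -> 'M[R]_3) s b,
  [/\ N 1 = A, forall v : V, v *m N 0 = sperm s b v,
   forall t (v : V), 0 <= t <= 1 -> v *m N t = 0 -> v = 0,
   \det (N 0) = Num.sg (\det A) &
   forall i j k (f : V -> R), Ck_on k setT f -> Ck_on k setT (fun x => N (f x) i j)].
Proof.
move=> dA.
have [P [L [U [hU hL /is_perm_mxP[p ->] PA]]]] : exists P L U : 'M[R]_3,
   [/\ forall i j : 'I_3, (j < i)%N -> U i j = 0, forall i j : 'I_3, (i <= j)%N -> L i j = (i == j)%:R,
    is_perm_mx P & P * A = L * U].
  exists (cormen_lup A).1.1, (cormen_lup A).1.2, (cormen_lup A).2; split.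
  - by move=> i j; exact: cormen_lup_upper.
  - by move=> i j; exact: cormen_lup_lower.
  - exact: cormen_lup_perm.
  - exact: (@lup_proj A (cormen_lup A) (cormen_lup_correct A)).
pose D : 'M[R]_3 := diag_mx (\row_i Num.sg (U i i)).
have hD i j : i != j -> D i j = 0 by move=> ij; rewrite !mxE (negbTE ij) mulr0n.
have Dii i : D i i = Num.sg (U i i) by rewrite !mxE eqxx mulr1n.
pose N (t : R) : 'M[R]_3 := perm_mx (p^-1)%g *m (((1 - t) *: 1%:M + t *: L) *m ((1 - t) *: D + t *: U)).
have pp : perm_mx (p^-1)%g *m (perm_mx p : 'M[R]_3) = 1%:M by rewrite -perm_mxM mulVg perm_mx1.
have N1 : N 1 = A.
  rewrite /N subrr !scale0r !scale1r !add0r -[L *m U]/(L * U) -PA -[_ * A]/(_ *m A).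
  by rewrite mulmxA pp mul1mx.
have dL t := lower_det_neq0 t hL.
have dU t := upper_det t hU hD.
have dN t : \det (N t) = \det (perm_mx (p^-1)%g : 'M[R]_3) * \prod_i ((1 - t) * D i i + t * U i i).
  by rewrite /N !det_mulmx dL mul1r dU.
have dNA : \det A = \det (perm_mx (p^-1)%g : 'M[R]_3) * \prod_i U i i.
  rewrite -N1 dN; congr (_ * _); apply: eq_bigr => i _.
  by rewrite subrr mul0r add0r mul1r.
have u0 i : U i i != 0.
  have : \prod_i U i i != 0 by apply: contra dA => /eqP z; rewrite dNA z mulr0.
  by move=> /prodf_neq0; apply.
have dp : \det (perm_mx (p^-1)%g : 'M[R]_3) != 0 by rewrite det_perm signr_eq0.
exists N, (p : {perm 'I_3}), (fun i => U i i < 0); split=> //.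
- move=> v; apply/rowP => i.
  rewrite /N subr0 !scale0r !scale1r !addr0 mul1mx mulmxA.
  have -> : v *m perm_mx (p^-1)%g = \row_j v ord0 (p j).
    apply/rowP => j; rewrite mxE [RHS]mxE (bigD1 (p j))//= big1 ?addr0.
      by rewrite !mxE permK eqxx mulr1.
    move=> l lj; rewrite !mxE; case: eqP => [E|_]; last by rewrite mulr0.
    by move: lj; rewrite -E permKV eqxx.
  rewrite mul_mx_diag !mxE mulrC; congr (_ * _).
  have [h|h] := ltP (U i i) 0; first by rewrite ltr0_sg// expr1.
  by rewrite gtr0_sg ?expr0// lt_def u0.
- move=> t v t01 vN.
  have Nu : N t \in unitmx.
    rewrite unitmxE unitfE dN mulf_neq0//; apply/prodf_neq0 => i _.
    by rewrite Dii sgr_path.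
  by rewrite -(mulmxK Nu v) vN mul0mx.
- rewrite dN dNA sgrM; congr (_ * _).
    by rewrite det_perm -signr_odd; case: odd; rewrite ?expr0 ?expr1 ?sgrN ?sgr1.
  rewrite (eq_bigr (fun i => Num.sg (U i i))); last by move=> i _; rewrite subr0 mul1r mul0r addr0 Dii.
  by rewrite !big_ord_recr !big_ord0 /= !mul1r !sgrM.
- move=> i j k f hf; have oT : open (setT : set V) by exact: openT.
  have aff (a b : R) : Ck_on k setT (fun x => (1 - f x) * a + f x * b).
    have h1 : Ck_on k setT (fun x => 1 - f x) := Ck_add oT (Ck_cst _ _ _) (Ck_opp oT hf).
    exact: (Ck_add oT (Ck_mul oT h1 (Ck_cst _ _ _)) (Ck_mul oT hf (Ck_cst _ _ _))).
  pose q x := \sum_a (perm_mx (p^-1)%g : 'M[R]_3) i a * (\sum_l ((1 - f x) * (1%:M : 'M[R]_3) a l + f x * L a l) *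
     ((1 - f x) * D l j + f x * U l j)).
  apply: (@Ck_eq _ _ _ q) => //.
    move=> x _; rewrite /q /N [RHS]mxE; apply: eq_bigr => a _; congr (_ * _); rewrite [RHS]mxE.
    have cE (a1 b1 : R) (X Y : 'M[R]_3) i1 j1 : (a1 *: X + b1 *: Y) i1 j1 = a1 * X i1 j1 + b1 * Y i1 j1 by rewrite !mxE.
    by apply: eq_bigr => l _; rewrite !cE.
  apply: Ck_sum => // a; apply: (Ck_mul oT (Ck_cst _ _ _)); apply: Ck_sum => // l.
  exact: (Ck_mul oT (aff _ _) (aff _ _)).
Qed.

End LinearPath.

Section LocalChange.
Variable R : realType.
Local Notation V := 'rV[R]_3.

Lemma Ck_lincoord k (N : V -> 'M[R]_3) (x0 : V) j : (forall i l, Ck_on k setT (fun x => N x i l)) ->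
  Ck_on k setT (fun x => ((x - x0) *m N x) ord0 j).
Proof.
move=> hN; have oT : open (setT : set V) by exact: openT.
apply: (@Ck_eq _ _ _ (fun x => \sum_i (x ord0 i - x0 ord0 i) * N x i j)) => //.
  by move=> x _; rewrite mxE; apply: eq_bigr => i _; rewrite !mxE.
apply: Ck_sum => // i; apply: (Ck_mul oT _ (hN i j)).
exact: (Ck_add oT (Ck_coord _ _ _) (Ck_cst _ _ _)).
Qed.

Lemma row_lower_bound (A : 'M[R]_3) : (forall v : V, v *m A = 0 -> v = 0) ->
  exists2 m : R, 0 < m & forall v : V, m * `|v| <= `|v *m A|.
Proof.
move=> inj.
have uA : A \in unitmx.
  rewrite -row_free_unit -kermx_eq0; apply/eqP/row_matrixP => i.
  by rewrite row0; apply: inj; rewrite -row_mul mulmx_ker row0.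
pose K : R := \sum_i \sum_j `|invmx A i j|.
have K0 : 0 <= K by rewrite sumr_ge0// => i _; rewrite sumr_ge0.
have hK (w : V) : `|w *m invmx A| <= K * `|w|.
  apply: normrV_le; first by rewrite mulr_ge0.
  move=> j; rewrite mxE; apply: le_trans (ler_norm_sum _ _ _) _.
  rewrite mulr_suml; apply: ler_sum => i _; rewrite normrM mulrC ler_pM ?coord_le_norm//.
  by rewrite (bigD1 j)//= lerDl sumr_ge0.
exists (K + 1)^-1; first by rewrite invr_gt0 ltr_wpDl.
move=> v; rewrite mulrC ler_pdivrMr ?ltr_wpDl//.
rewrite -{1}(mulmxK uA v); apply: le_trans (hK _) _.
by rewrite mulrC ler_wpM2l// lerDl.
Qed.

Lemma open_far (c : V) r : open [set y : V | r < `|y - c|].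
Proof.
have -> : [set y : V | r < `|y - c|] = (fun y : V => `|y - c|) @^-1` [set t | r < t] by [].
apply: open_comp => [y _|]; last exact: open_gt.
apply: (@continuous_comp _ _ _ (fun y : V => y - c) (fun y : V => `|y|)); last exact: norm_continuous.
by apply: continuousB; [exact: id|exact: cst_continuous].
Qed.

(** A map that is a local diffeomorphism at [x0] is interpolated, away from
    [x0], with its derivative and then with a signed permutation; the resulting
    map takes values near [psi x0] only near [x0]. *)
Lemma local_change (W : set V) (psi : V -> V) (x0 : V) : open W -> W x0 ->
  (forall i, Ck_on 3 W (comp psi i)) -> Jac psi x0 != 0 ->
  exists r r' : R, [/\ 0 < r, 0 < r', forall x, `|x - x0| < r -> W x &
   forall (k : V -> R) B, Ck_on 2 setT k -> supp B k -> (forall y, r' <= `|y - psi x0| -> k y = 0) ->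
   exists q : V -> R, [/\ forall x, `|x - x0| < r -> q x = k (psi x) * Jac psi x,
     forall x, r <= `|x - x0| -> q x = 0 &
     null (fun n => S n q - Num.sg (Jac psi x0) * S n k)]].
Proof.
move=> oW Wx0 hpsi J0; have oT : open (setT : set V) by exact: openT.
pose A : 'M[R]_3 := \matrix_(i, j) pder i (comp psi j) x0.
have dA : \det A = Jac psi x0 by rewrite det33 !mxE.
have dA0 : \det A != 0 by rewrite dA.
have [N [s [b [N1 N0 Ninj Ndet NCk]]]] := lin_path dA0.
pose y0 := psi x0.
(* The cut-off makes the derivative at [x0] take over near [x0] and the signed
   permutation take over at distance [1]. *)
pose chi := bump x0 1.
have hchi k : Ck_on k setT chi by exact: bump_Ck.
pose lin (x : V) : V := (x - x0) *m N (chi x).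
have linCk k j : Ck_on k setT (comp lin j).
  by apply: Ck_lincoord => i l; exact: NCk.
have chi01 x : 0 <= chi x <= 1 by rewrite bump_ge0// bump_le1.
have lin0 x : lin x = 0 -> x = x0.
  by move=> /(Ninj _ _ (chi01 x)) /eqP; rewrite subr_eq0 => /eqP.
have [mA mA0 hmA] : exists2 m : R, 0 < m & forall v : V, m * `|v| <= `|v *m A|.
  by apply: row_lower_bound => v; rewrite -N1; apply: Ninj; rewrite ler01 lexx.
have lin_in x : `|x - x0| <= 1 / 3%:R -> lin x = (x - x0) *m A.
  by move=> hx; rewrite /lin /chi bump_in// N1.
have lin_out x : 1 <= `|x - x0| -> lin x = sperm s b (x - x0).
  by move=> hx; rewrite /lin /chi bump_out.
have norm_sperm (v : V) : `|v| <= `|sperm s b v|.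
  apply: normrV_le => // i.
  have := coord_le_norm (sperm s b v) ((s^-1)%g i); rewrite mxE permKV normrM normrX normrN1 expr1n mul1r.
  by [].
(* The interpolated linear maps are injective, so by compactness [lin] stays away
   from [0] off a neighbourhood of [x0]. *)
have [m1 m10 hm1] : exists2 m : R, 0 < m & forall x, 1 / 3%:R <= `|x - x0| -> m <= `|lin x|.
  pose K : set V := [set x | `|x - x0| <= 1] `&` [set x | 1 / 3%:R <= `|x - x0|].
  have cn : continuous (fun x : V => `|x - x0|).
    move=> x; apply: (@continuous_comp _ _ _ (fun y : V => y - x0) (fun y : V => `|y|)); last exact: norm_continuous.
    by apply: continuousB; [exact: id|exact: cst_continuous].
  have cK : compact K.
    apply: bounded_closed_compact.
      exists (1 + `|x0|); split; first exact: num_real.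
      move=> M hM x [/= hx _]; apply: le_trans (ltW hM).
      by rewrite -(subrK x0 x) (le_trans (ler_normD _ _))// lerD2r.
    apply: closedI; first by apply: (@closed_comp _ _ (fun x : V => `|x - x0|) [set t | t <= 1]) => [x _|]; [exact: cn|exact: closed_le].
    by apply: (@closed_comp _ _ (fun x : V => `|x - x0|) [set t | 1 / 3%:R <= t]) => [x _|]; [exact: cn|exact: closed_ge].
  have K0 : K !=set0.
    by exists (x0 + bvec R i0); rewrite /K /= addxK norm_bvec; split; lra.
  have cl : continuous (fun x => `|lin x|).
    move=> x; apply: (@continuous_comp _ _ _ lin (fun y : V => `|y|)); last exact: norm_continuous.
    by apply: cont_rV => j; exact: (Ck_cont (linCk 0 j) I).
  have [|z zK hz] := @compact_EVT_min V R (fun x => `|lin x|) K K0 cK.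
    exact: continuous_subspaceT.
  have z0 : 0 < `|lin z|.
    rewrite normr_gt0; apply/eqP => /lin0 zx; have [_ /=] := set_mem zK.
    by rewrite zx subrr normr0; lra.
  exists (Num.min 1 `|lin z|); first by rewrite lt_min ltr01.
  move=> x hx; have [x1|x1] := leP `|x - x0| 1; last first.
    rewrite ge_min; apply/orP; left; rewrite lin_out ?(ltW x1)//.
    exact: le_trans (ltW x1) (norm_sperm _).
  by rewrite ge_min; apply/orP; right; apply: hz; apply: mem_set.
(* Half of the lower bound of the derivative is left after adding the remainder
   of first order. *)
have rem j : exists2 d : R, 0 < d & forall x, `|x - x0| < d -> W x /\
    `|comp psi j x - comp psi j x0 - ((x - x0) *m A) ord0 j| <= mA / 2 * `|x - x0|.
  have m2 : 0 < mA / 2 by rewrite divr_gt0.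
  have [D DE] := C1_differentiable oW Wx0 (Ck_le (isT : (1 <= 3)%N) (hpsi j)).
  have [_ E] := (diff_locallyP _ _).1 D.
  have near1 := (eqaddoP _ _ _ _).1 E _ m2.
  have [a a0 ha] : exists2 a : R, 0 < a & forall v : V, `|v| < a ->
      `|comp psi j (v + x0) - (comp psi j x0 + lin3 (fun i => pder i (comp psi j) x0) v)| <= mA / 2 * `|v|.
    have /nbhs_ballP[a /= a0 ha] := near1; exists a => // v va; rewrite -DE.
    by apply: ha; rewrite mx_norm_ball /ball_ /= sub0r normrN.
  have [a' a'0 ha'] := open_dist oW Wx0.
  exists (Num.min a a'); first by rewrite lt_min a0.
  move=> x; rewrite lt_min => /andP[xa xa']; split; first exact: ha'.
  have := ha (x - x0) xa; rewrite subrK opprD addrA; congr (`|_ - _| <= _).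
  by rewrite mxE; apply: eq_bigr => i _; rewrite !mxE.
have [d d0 hd] : exists2 d : R, 0 < d & forall x, `|x - x0| < d -> W x /\
    `|psi x - y0 - (x - x0) *m A| <= mA / 2 * `|x - x0|.
  have [[a a0 ha] [a' a'0 ha'] [a'' a''0 ha'']] := And3 (rem i0) (rem i1) (rem i2).
  exists (Num.min a (Num.min a' a'')); first by rewrite !lt_min a0 a'0.
  move=> x; rewrite !lt_min => /and3P[h h' h'']; split; first by have [] := ha x h.
  apply: normrV_le; first by rewrite mulr_ge0// divr_ge0// ltW.
  move=> i; rewrite !mxE; have := And3 (ha x h) (ha' x h') (ha'' x h''); rewrite !mxE.
  by move=> [[_ e] [_ e'] [_ e'']]; have [->|->|->] := ord3P i.
pose rho := Num.min (d / 2) (1 / 3%:R).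
have rho0 : 0 < rho by rewrite lt_min !divr_gt0.
have rhod : rho < d by rewrite gt_min; apply/orP; left; lra.
have rho3 : rho <= 1 / 3%:R by rewrite ge_min lexx orbT.
pose chi1 := bump x0 rho.
pose psit (x : V) : V := y0 + lin x + chi1 x *: (psi x - y0 - (x - x0) *m A).
pose phit (x : V) : V := y0 + sperm s b (x - x0).
pose r := rho / 3%:R.
have r0 : 0 < r by rewrite divr_gt0.
pose r' := Num.min m1 (mA / 2 * r).
have r'0 : 0 < r' by rewrite lt_min m10 mulr_gt0// divr_gt0.
have rrho : r < rho by rewrite /r; lra.
have psitE x : `|x - x0| < r -> psit x = psi x.
  move=> hx; rewrite /psit /chi1 bump_in ?(ltW hx)// scale1r lin_in; last by lra.
  by rewrite -[psi x - y0 - _]addrA -opprD addrCA subrr addr0.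
have far x : r <= `|x - x0| -> r' <= `|psit x - y0|.
  move=> hx; have -> : psit x - y0 = lin x + chi1 x *: (psi x - y0 - (x - x0) *m A).
    by rewrite /psit -[y0 + lin x + _]addrA addrAC subrr add0r.
  have [x3|x3] := leP (1 / 3%:R) `|x - x0|.
    rewrite /chi1 bump_out ?scale0r ?addr0//; last exact: le_trans x3.
    by rewrite ge_min hm1.
  rewrite lin_in ?(ltW x3)//; rewrite ge_min; apply/orP; right.
  have lb := hmA (x - x0).
  have [xd|xd] := ltP `|x - x0| d; last first.
    rewrite /chi1 bump_out ?scale0r ?addr0//; last exact: le_trans (ltW rhod) xd.
    by apply: le_trans lb; nra.
  have [_ rm] := hd x xd; set w := psi x - y0 - _ in rm *.
  have cw : `|chi1 x *: w| <= mA / 2 * `|x - x0|.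
    rewrite normrZ; apply: le_trans rm; rewrite ger0_norm ?bump_ge0// ler_piMl// bump_le1//.
  have : `|(x - x0) *m A| <= `|(x - x0) *m A + chi1 x *: w| + `|chi1 x *: w|.
    by rewrite -[in leLHS](addrK (chi1 x *: w) ((x - x0) *m A)) ler_normB.
  nra.
have hpsit j : Ck_on 3 setT (comp psit j).
  have hrem : Ck_on 3 W (fun x => comp psi j x - y0 ord0 j - ((x - x0) *m A) ord0 j).
    apply: (Ck_add oW (Ck_add oW (hpsi j) (Ck_cst _ _ _)) (Ck_opp oW _)).
    by apply: (Ck_sub (@subsetT _ W)); apply: (@Ck_lincoord 3 (fun=> A)) => i l; exact: Ck_cst.
  have sub x : `|x - x0| <= rho -> W x by move=> hx; have [] := hd x (le_lt_trans hx rhod).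
  have hc := Ck_cutoff oW rho0 sub hrem.
  have -> : comp psit j = fun x => y0 ord0 j + comp lin j x +
      bump x0 rho x * (comp psi j x - y0 ord0 j - ((x - x0) *m A) ord0 j).
    apply/funext => x; rewrite /psit /comp /chi1.
    by move: (bump x0 rho x) (_ *m A) (lin x) => t v w; rewrite !mxE.
  exact: (Ck_add oT (Ck_add oT (Ck_cst _ _ _) (linCk 3 j)) hc).
have phitE : phit = (fun x => y0 + (x - x0) *m N 0) by apply/funext => x; rewrite N0.
have hphit j : Ck_on 3 setT (comp phit j).
  rewrite phitE; have -> : comp (fun x => y0 + (x - x0) *m N 0) j = fun x => y0 ord0 j + ((x - x0) *m N 0) ord0 j.
    by apply/funext => x; rewrite /comp [in LHS]mxE.
  apply: (Ck_add oT (Ck_cst _ _ _)); apply: (@Ck_lincoord 3 (fun=> N 0)) => i l; exact: Ck_cst.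
have [B0 hB0] := nat_above (`|x0| + 1).
have out x : B0%:R < `|x| -> psit x = phit x.
  move=> hx; have x1 : 1 <= `|x - x0|.
    have : `|x| <= `|x - x0| + `|x0| by rewrite -[in leLHS](subrK x0 x) ler_normD.
    by lra.
  rewrite /psit /phit lin_out// /chi1 bump_out ?scale0r ?addr0//.
  by apply: le_trans rho3 _; apply: le_trans x1; lra.
have pphit i j x : pder i (comp phit j) x = N 0 i j.
  rewrite phitE (_ : comp _ j = fun x => \sum_l (x ord0 l - x0 ord0 l) * N 0 l j + y0 ord0 j); last first.
    apply/funext => y; rewrite /comp !mxE addrC; congr (_ + _); apply: eq_bigr => l _.
    by rewrite !mxE.
  have c l : Ck_on 1 setT (fun x : V => (x ord0 l - x0 ord0 l) * N 0 l j).
    exact: (Ck_mul oT (Ck_add oT (Ck_coord _ _ _) (Ck_cst _ _ _)) (Ck_cst _ _ _)).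
  have c' l : Ck_on 1 setT (fun x : V => x ord0 l - x0 ord0 l).
    exact: (Ck_add oT (Ck_coord _ _ _) (Ck_cst _ _ _)).
  have dl l : pder i (fun x : V => (x ord0 l - x0 ord0 l) * N 0 l j) x = (i == l)%:R * N 0 l j.
    rewrite pderM; [|exact: (Ck_der (c' l))|exact: derivable_cst].
    rewrite pder_cst mulr0 add0r mulrC; congr (_ * _).
    rewrite pderD; [|exact: (Ck_der (Ck_coord 1 _ _))|exact: derivable_cst].
    by rewrite pder_cst addr0 pder_coord.
  rewrite pderD; [|exact: (Ck_der (Ck_sum _ oT c))|exact: derivable_cst].
  rewrite pder_cst addr0; under eq_fun do rewrite sum3.
  have D3 (f g : V -> R) : Ck_on 1 setT f -> Ck_on 1 setT g -> pder i (fun x => f x + g x) x = pder i f x + pder i g x.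
    by move=> hf hg; rewrite pderD//; [exact: (Ck_der hf)|exact: (Ck_der hg)].
  rewrite (D3 _ _ (Ck_add oT (c i0) (c i1)) (c i2)) (D3 _ _ (c i0) (c i1)) !dl.
  by have [->|->|->] := ord3P i; rewrite !eqE /= !(mul0r, mul1r, addr0, add0r).
have Jphit x : Jac phit x = Num.sg (Jac psi x0).
  by rewrite -dA -Ndet det33 /Jac /grad3 !pphit.
have Jpsit x : `|x - x0| < r -> Jac psit x = Jac psi x.
  move=> hx; have n : \forall y \near x, psit y = psi y.
    have o : open [set y : V | `|y - x0| < r] by exact: open_cball.
    by apply: filterS (open_nbhs_nbhs (conj o hx)) => y; exact: psitE.
  have p i j : pder i (comp psit j) x = pder i (comp psi j) x.
    by apply: pder_near_eq; apply: filterS n => y; rewrite /comp => ->.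
  by rewrite /Jac /grad3 !p.
exists r, r'; split=> //.
  by move=> x hx; have [] := hd x (lt_trans (lt_trans hx rrho) rhod).
move=> k B hk sk hk0.
exists (fun x => k (psit x) * Jac psit x); split.
- by move=> x hx; rewrite psitE// Jpsit.
- by move=> x hx; rewrite hk0 ?mul0r//; exact: far.
have L := lax hpsit hphit out hk sk.
apply: (null_trans (v := fun n => S n (fun x => k (phit x) * Jac phit x))).
  by apply: null_eq L => n; rewrite S_sub.
pose k' z := k (z + (y0 - sperm s b x0)).
have e n : S n (fun x => k (phit x) * Jac phit x) = Num.sg (Jac psi x0) * S n k'.
  rewrite -(S_sperm n s b k') -S_scale; apply: S_ext => x; rewrite Jphit mulrC; congr (_ * k _).
  by apply/rowP => i; rewrite !mxE; ring.
apply: null_eq (null_scale (Num.sg (Jac psi x0)) (S_translate (y0 - sperm s b x0) hk sk)) => n.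
by rewrite e mulrBr.
Qed.

End LocalChange.

(** * Partitions of unity *)

Section PositiveSums.
Variable R : realType.
Local Notation V := 'rV[R]_3.

Lemma count_interval m lo hi :
  (\sum_(0 <= j < m) ((lo <= j) && (j < hi)) = minn m hi - lo)%N.
Proof.
elim: m => [|m IH]; first by rewrite big_nil min0n.
by rewrite big_nat_recr//= IH; case: (leqP lo m) => h1; case: (ltnP m hi) => h2 /=; lia.
Qed.

Lemma coord_count_ge (a s : R) : 0 < s -> exists N0, forall n, (N0 <= n)%N ->
  s / 2 * gN R n <= \sum_(j < gM n) (if `|coordpt R n j - a| <= s then 1 else 0).
Proof.
move=> s0; have [N0 hN0] := nat_above (2 / s + `|a| + s).
exists N0 => n Nn; set N := gN R n.
have N1 : 0 < N by exact: gN0.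
have Nb : 2 / s + `|a| + s <= N.
  by apply: le_trans hN0 _; rewrite /N /gN ler_nat; lia.
have s2 : 0 < 2 / s by rewrite divr_gt0.
have [a1 a2] : a <= `|a| /\ - a <= `|a| by rewrite ler_norm -normrN ler_norm.
have sN : 2 <= s * N.
  have : 2 / s <= N by have := normr_ge0 a; lra.
  by rewrite ler_pdivrMr// mulrC.
pose m := Num.truncn (s * N).
pose lo := (Num.truncn (N * N + (a - s) * N)).+1.
have /andP[m1 m2] : m%:R <= s * N < m.+1%:R by apply: truncn_itv; nra.
have /andP[l1 l2] : lo.-1%:R <= N * N + (a - s) * N < lo%:R by apply: truncn_itv; nra.
have lS : lo%:R = lo.-1%:R + 1 :> R by rewrite -natr1.
have mS : m.+1%:R = m%:R + 1 :> R by rewrite -natr1.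
have lm : (lo + m <= gM n)%N.
  have : (lo + m)%:R <= (gM n)%:R :> R; last by rewrite ler_nat.
  rewrite natrD /gM -addnn -natr1 natrD natrM -/N -/(gN R n) -/N; nra.
apply: (@le_trans _ _ (m%:R)); first by nra.
have -> : m = (\sum_(0 <= j < gM n) ((lo <= j) && (j < lo + m)))%N.
  by rewrite count_interval (minn_idPr lm) addnC addnK.
rewrite big_mkord natr_sum; apply: ler_sum => j _.
case: (leqP lo j) => lj; last by case: ifP.
case: (ltnP j (lo + m)) => jm; last by case: ifP.
suff -> : `|coordpt R n j - a| <= s by [].
rewrite -(ler_pM2r N1) -[X in _ * X <= _](gtr0_norm N1) -normrM mulrBl.
rewrite (coordptE R n j) natrM -/(gN R n) -/N.
have jl : lo%:R <= j%:R :> R by rewrite ler_nat.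
have jm' : j%:R + 1 <= lo%:R + m%:R :> R by rewrite natr1 -natrD ler_nat.
by rewrite ler_norml; apply/andP; split; nra.
Qed.

(** The cube around [x] contains a number of grid points proportional to its
    volume divided by the volume of a mesh cell. *)
Lemma S_pos (g : V -> R) (x : V) (s d : R) : 0 < s -> 0 < d -> (forall y, 0 <= g y) ->
  (forall y, `|y - x| <= s -> d <= g y) -> ~ null (fun n => S n g).
Proof.
move=> s0 d0 g0 gd; have s2 : 0 < s / 2 by rewrite divr_gt0.
pose e := (s / 2) ^+ 3 * d / 2.
have e0 : 0 < e by rewrite /e !(mulr_gt0, divr_gt0, exprn_gt0).
move=> /null_ge /(_ e0) [N1 hN1].
have [N2 h2] := coord_count_ge (x ord0 i0) s0.
have [N3 h3] := coord_count_ge (x ord0 i1) s0.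
have [N4 h4] := coord_count_ge (x ord0 i2) s0.
pose n := (N1 + N2 + N3 + N4)%N.
pose c i (j : 'I_(gM n)) : R := if `|coordpt R n j - x ord0 i| <= s then 1 else 0.
have hc i : s / 2 * gN R n <= \sum_j c i j.
  by have [->|->|->] := ord3P i; [apply: h2|apply: h3|apply: h4]; rewrite /n; lia.
have := hN1 n; rewrite ger0_norm ?S_ge0//; have -> : (N1 <= n)%N by rewrite /n; lia.
move=> /(_ isT); apply/negP; rewrite -ltNge.
apply: (@lt_le_trans _ _ ((s / 2) ^+ 3 * d)).
  by rewrite /e ltr_pdivrMr// ltr_pMr ?mulr_gt0 ?exprn_gt0//; lra.
apply: (@le_trans _ _ ((gN R n)^-1 ^+ 3 * (d * \prod_(i < 3) \sum_j c i j))).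
  have -> : (s / 2) ^+ 3 * d = (gN R n)^-1 ^+ 3 * (d * \prod_(i < 3) (s / 2 * gN R n)).
    have /gt_eqF/negbT := gN0 R n; move: (gN R n) => N N0.
    by rewrite prodr_const card_ord; field.
  rewrite ler_wpM2l ?exprn_ge0 ?(ltW (gNV0 R n))// ler_wpM2l ?(ltW d0)//.
  apply: ler_prod => i _; rewrite hc andbT.
  by rewrite mulr_ge0 ?(ltW s2) ?(ltW (gN0 R n)).
rewrite /S ler_wpM2l ?exprn_ge0 ?(ltW (gNV0 R n))// (bigA_distr_bigA c) mulr_sumr.
apply: ler_sum => f _.
have [near|far] := leP `|gridpt R f - x| s.
  apply: le_trans (gd _ near); rewrite ger_pMr//.
  by apply: prodr_ile1 => i _; rewrite /c; case: ifP; rewrite ?lexx ?ler01.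
rewrite (_ : \prod_i _ = 0) ?mulr0//.
have [i hi] : exists i, s < `|(gridpt R f - x) ord0 i|.
  apply/existsP; rewrite -[X in is_true X]negbK negb_exists; apply/negP => /forallP h.
  move: far; apply/negP; rewrite -leNgt; apply: normrV_le (ltW s0) _ => i.
  by rewrite leNgt h.
apply/eqP; rewrite prodf_seq_eq0; apply/hasP; exists i; rewrite ?mem_index_enum//.
by rewrite /= /c; move: hi; rewrite 2!mxE => hi; rewrite leNgt mxE in hi *; rewrite hi /= eqxx.
Qed.

Lemma closed_ball_compact (x0 : V) r : compact [set x : V | `|x - x0| <= r].
Proof.
apply: bounded_closed_compact.
  exists (r + `|x0|); split; first exact: num_real.
  move=> B hB x /= hx; apply: le_trans (ltW hB).
  by rewrite -(subrK x0 x) (le_trans (ler_normD _ _))// lerD2r.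
apply: (@closed_comp _ _ (fun x : V => `|x - x0|) [set t | t <= r]) => [x _|]; last exact: closed_le.
apply: (@continuous_comp _ _ _ (fun y : V => y - x0) (fun y : V => `|y|)); last exact: norm_continuous.
by apply: continuousB; [exact: id|exact: cst_continuous].
Qed.

End PositiveSums.

Section Extension.
Variables (R : realType) (M : manifold3 R).
Local Notation V := 'rV[R]_3.
Implicit Types (c : chart R M) (p q : M) (v : M -> R) (r : R).

Definition full c : set V := chart_map c @` chart_dom c.
Definition kball c q r : set M :=
  [set p | chart_dom c p /\ `|chart_map c p - chart_map c q| <= r].
Definition inside c q r := forall x, `|x - chart_map c q| <= r -> full c x.

Lemma full_inv c x : full c x -> chart_dom c (chart_inv c x) /\ chart_map c (chart_inv c x) = x.
Proof. by move=> [p cp <-]; rewrite invK. Qed.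

(** It is the image of a compact ball, and the manifold is a Hausdorff space. *)
Lemma kball_closed c q r : inside c q r -> closed (kball c q r).
Proof.
move=> ins; have -> : kball c q r = chart_inv c @` [set x : V | `|x - chart_map c q| <= r].
  apply/seteqP; split=> [p [cp pr]|_ [x xr <-]].
    by exists (chart_map c p) => //; rewrite invK.
  by have [h1 h2] := full_inv (ins x xr); split; rewrite ?h2.
apply: compact_closed; first exact: mhausdorff.
apply: continuous_compact; last exact: closed_ball_compact.
apply: continuous_in_subspaceT => x /set_mem /= xr.
exact: (@chart_inv_cont _ _ c x (mem_set (ins x xr))).
Qed.

Definition ext c v (x : V) : R := if `[< full c x >] then v (chart_inv c x) else 0.

Lemma extE c v p : chart_dom c p -> ext c v (chart_map c p) = v p.
Proof. by move=> cp; rewrite /ext asboolT ?invK//; exists p. Qed.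

Lemma ext_out c v x : ~ full c x -> ext c v x = 0.
Proof. by move=> h; rewrite /ext asboolF. Qed.

Lemma ext_in c v x : full c x -> ext c v x = v (chart_inv c x).
Proof. by move=> h; rewrite /ext asboolT. Qed.

Lemma ext_far c q r v x : (forall p, chart_dom c p -> ~ kball c q r p -> v p = 0) ->
  r < `|x - chart_map c q| -> ext c v x = 0.
Proof.
move=> v0 xr; have [fx|] := pselect (full c x); last exact: ext_out.
have [h1 h2] := full_inv fx; rewrite ext_in// v0// => -[_]; rewrite h2.
by rewrite leNgt xr.
Qed.

Lemma ext_supp c q r : exists B, forall v,
  (forall p, chart_dom c p -> ~ kball c q r p -> v p = 0) -> supp B (ext c v).
Proof.
have [B hB] := nat_above (`|chart_map c q| + r); exists B => v v0 x hx.
apply: (ext_far v0); have : `|x| <= `|x - chart_map c q| + `|chart_map c q|.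
  by rewrite -[in leLHS](subrK (chart_map c q) x) ler_normD.
lra.
Qed.

Lemma ext_Ck k c q r v : atlas c -> inside c q r -> smooth_on (chart_dom c) v ->
  (forall p, chart_dom c p -> ~ kball c q r p -> v p = 0) -> Ck_on k setT (ext c v).
Proof.
move=> ac ins sv v0; apply: Ck_local => x _.
have [xr|xr] := leP `|x - chart_map c q| r.
  exists (full c); first by split; [exact: chart_img_open|exact: ins].
  apply: (@Ck_eq _ _ _ (v \o chart_inv c)); first exact: chart_img_open.
    by move=> y fy /=; rewrite ext_in.
  by have := sv c ac k; rewrite setIid.
exists [set y : V | r < `|y - chart_map c q|]; first by split => //; exact: open_far.
apply: (@Ck_eq _ _ _ (fun=> 0)); [exact: open_far| |exact: Ck_cst].
by move=> y yr; rewrite (ext_far v0).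
Qed.

Definition bumpM c q r (p : M) : R :=
  if `[< chart_dom c p >] then bump (chart_map c q) r (chart_map c p) else 0.

Lemma bumpM_ge0 c q r p : 0 < r -> 0 <= bumpM c q r p.
Proof. by move=> r0; rewrite /bumpM; case: ifP => // _; exact: bump_ge0. Qed.

Lemma bumpM_out c q r p : 0 < r -> ~ kball c q r p -> bumpM c q r p = 0.
Proof.
move=> r0 h; rewrite /bumpM; case: asboolP => // cp; apply: bump_out => //.
by rewrite leNgt; apply/negP => /ltW pr; apply: h.
Qed.

Lemma bumpM_smooth c q r : atlas c -> 0 < r -> inside c q r -> smooth_on setT (bumpM c q r).
Proof.
move=> ac r0 ins; apply: smooth_local => p _.
have [cp|cp] := pselect (chart_dom c p).
  exists (chart_dom c); first by split=> //; exact: chart_dom_open.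
  apply: (@smooth_chart _ _ c) => //; first exact: chart_dom_open.
  move=> k; have oI := @open_img _ _ c _ (chart_dom_open c).
  apply: (@Ck_eq _ _ _ (bump (chart_map c q) r)) => //; last exact: bump_Ck.
  by move=> x /imgP[h _ E] /=; rewrite /bumpM asboolT// E.
exists (~` kball c q r); first by split; [exact/closed_openC/kball_closed|move=> []].
apply: (@smooth_eq _ _ _ (fun=> 0)); [exact/closed_openC/kball_closed| |exact: smooth_cst].
by move=> y yk; rewrite bumpM_out.
Qed.

Lemma smooth_sum U (I : Type) (s : seq I) (F : I -> M -> R) : open U ->
  (forall i, smooth_on U (F i)) -> smooth_on U (fun p => \sum_(i <- s) F i p).
Proof.
move=> oU hF; elim: s => [|i s IH].
  by apply: (smooth_eq oU _ (smooth_cst U 0)) => p _; rewrite big_nil.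
by apply: (smooth_eq oU _ (smoothD oU (hF i) IH)) => p _; rewrite big_cons.
Qed.

(** The bump functions of finitely many charts have a positive sum, by which
    they are divided. The supports are closed balls in the given charts. *)
Lemma partition_of_unity (e : M -> chart R M) (N : M -> set M) : compact [set: M] ->
  (forall q, atlas (e q) /\ chart_dom (e q) q) -> (forall q, open (N q) /\ N q q) ->
  exists (s : seq M) (r : M -> R) (z : M -> M -> R),
  [/\ forall q, inside (e q) q (r q), forall q, kball (e q) q (r q) `<=` N q,
      forall q, smooth_on setT (z q) /\ (forall p, 0 <= z q p),
      forall q p, ~ kball (e q) q (r q) p -> z q p = 0 & forall p, \sum_(q <- s) z q p = 1].
Proof.
move=> cM ae oN.
have /choice[r hr] q : exists r, [/\ 0 < r, inside (e q) q r & kball (e q) q r `<=` N q].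
  have [[aq dq] [oq Nq]] := (ae q, oN q).
  have [d d0 hd] := open_dist (@open_img _ _ (e q) _ oq) (img_mem dq Nq).
  have dd : d / 2 < d by lra.
  exists (d / 2); split; first by rewrite divr_gt0.
    move=> x xd; have /imgP[h _ E] := hd x (le_lt_trans xd dd).
    by exists (chart_inv (e q) x).
  by move=> p [cp pd]; have /imgP[_ h _] := hd _ (le_lt_trans pd dd); rewrite invK in h.
pose b q := bumpM (e q) q (r q).
have bs q : smooth_on setT (b q).
  by have [r0 ins _] := hr q; apply: bumpM_smooth => //; have [] := ae q.
have b0 q p : 0 <= b q p by have [r0 _ _] := hr q; exact: bumpM_ge0.
have bq q : 0 < b q q.
  have [[_ dq] [r0 _ _]] := (ae q, hr q).
  by rewrite /b /bumpM asboolT// bump_center_gt0// subrr normr0 divr_ge0// ltW.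
pose O q := [set p | 0 < b q p].
have oO q : open (O q).
  rewrite (_ : O q = b q @^-1` [set t | 0 < t])//.
  apply: open_comp => [p _|]; last exact: open_gt.
  exact: (smooth_cont openT I (bs q)).
have [s cov] : exists s : seq M, forall p, exists2 q, q \in s & O q p.
  pose F : set_system (seq M) := [set A | exists s0 : seq M, forall s : seq M, {subset s0 <= s} -> A s].
  have fF : Filter F.
    split; first by exists [::].
      move=> A A' [s1 h1] [s2 h2]; exists (s1 ++ s2) => s hs; split.
        by apply: h1 => x xs; apply: hs; rewrite mem_cat xs.
      by apply: h2 => x xs; apply: hs; rewrite mem_cat xs orbT.
    by move=> A A' AA [s1 h1]; exists s1 => s /h1; exact: AA.
  have /compact_near_coveringP cov := cM.
  have [|s0 hs0] := cov (seq M) F (fun (s : seq M) p => exists2 q, q \in s & O q p) fF.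
    move=> p _; exists (O p, [set s : seq M | p \in s]) => /=.
      split; first by apply: open_nbhs_nbhs; split=> //; exact: bq.
      by exists [:: p] => s; apply; rewrite mem_head.
    by move=> [p' s] /= [Op ps]; exists p.
  by exists s0 => p; apply: hs0.
pose B p := \sum_(q <- s) b q p.
have B0 p : 0 < B p.
  have [q qD /= qp] := cov p.
  rewrite /B (big_rem q)//=; apply: ltr_wpDr => //; exact: sumr_ge0.
have sB : smooth_on setT B by exact: (smooth_sum _ openT).
have Bn p : B p != 0 by rewrite gt_eqF.
exists s, r, (fun q p => b q p / B p); split.
- by move=> q; have [] := hr q.
- by move=> q; have [] := hr q.
- move=> q; split; last by move=> p; rewrite divr_ge0// ltW.
  exact: (smoothM openT (bs q) (smoothV openT (fun p _ => Bn p) sB)).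
- by move=> q p h; have [r0 _ _] := hr q; rewrite /b bumpM_out ?mul0r.
- by move=> p; rewrite -mulr_suml -/(B p) divff.
Qed.

End Extension.

(** * The divergence theorem on a closed contact manifold *)

Section Divergence.
Variables (R : realType) (M : manifold3 R) (th : form1 M).
Hypotheses (sth : smooth_form1 setT th) (rth : real_form1 setT th).
Hypothesis nondeg : forall p, exists U X Y Z, [/\ open U, U p,
  [/\ smooth_vfield U X, smooth_vfield U Y & smooth_vfield U Z] & wedge_extd th X Y Z p != 0].
Local Notation V := 'rV[R]_3.
Local Notation C := R[i].
Implicit Types (c d : chart R M) (p q : M) (v : M -> R).

Lemma smooth_abs U v : open U -> smooth_on U v -> (forall p, U p -> v p != 0) ->
  smooth_on U (fun p => `|v p|).
Proof.
move=> oU sv v0.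
have half (s : bool) W : W = U `&` [set p | 0 < (-1) ^+ s * v p] -> open W /\ smooth_on W (fun p => `|v p|).
  move=> ->; set Q := _ `&` _; have oW : open Q.
    rewrite openE => p [Up vp].
    have cv : {for p, continuous (fun p => (-1) ^+ s * v p)}.
      exact: (smooth_cont oU Up (smoothM oU (smooth_cst _ _) sv)).
    have o : nbhs p [set q | 0 < (-1) ^+ s * v q].
      by apply: (cv [set t | 0 < t]); apply: open_nbhs_nbhs; split=> //; exact: open_gt.
    apply: filterI => //; exact: open_nbhs_nbhs.
  split=> //; apply: (@smooth_eq _ _ _ (fun p => (-1) ^+ s * v p)) => //.
    move=> p [_ /= h]; rewrite -(gtr0_norm h) normrM normrX normrN1 expr1n mul1r.
    by [].
  by apply: (smoothM oW (smooth_cst _ _)); apply: smooth_sub sv; exact: subIsetl.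
apply: smooth_local => p Up; have [oW sW] := half (v p < 0) _ erefl.
eexists; last exact: sW; split=> //; split=> //=; have := v0 p Up.
have [h _|h h'] := ltP (v p) 0; first by rewrite expr1; lra.
by rewrite expr0 mul1r lt_def h' h.
Qed.

Lemma volc_neq0 c p : atlas c -> chart_dom c p -> volc c th p != 0.
Proof.
move=> ac cp; have [U [X [Y [Z [oU Up [sX sY sZ]]]]]] := nondeg p.
apply: contra => /eqP v0; apply/eqP.
by rewrite (wedge_extd_coord ac cp oU Up (form_sub (@subsetT _ U) sth) sX sY sZ) v0 mul0r.
Qed.

Definition dens c p : R := complex.Re (volc c th p).

Lemma densE c p : atlas c -> chart_dom c p -> volc c th p = (dens c p)%:C.
Proof.
move=> ac cp; have := volc_real ac cp sth rth; rewrite /dens; case: (volc c th p) => a b.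
by case=> /esym/eqP; rewrite -addr_eq0 -mulr2n mulrn_eq0 => /eqP ->.
Qed.

Lemma dens_neq0 c p : atlas c -> chart_dom c p -> dens c p != 0.
Proof.
move=> ac cp; have := volc_neq0 ac cp; rewrite (densE ac cp); apply: contra => /eqP ->.
by rewrite eqxx.
Qed.

Lemma dens_smooth c : atlas c -> smooth_on (chart_dom c) (dens c).
Proof. by move=> ac; have [] := volc_smooth ac sth. Qed.

Definition trans c d (x : V) : V := chart_map d (chart_inv c x).

Lemma dens_trans c d p : atlas c -> atlas d -> chart_dom c p -> chart_dom d p ->
  dens c p = dens d p * Jac (trans c d) (chart_map c p).
Proof.
move=> ac ad cp dp; pose U := chart_dom c `&` chart_dom d.
have oU : open U by apply: openI; exact: chart_dom_open.
have s i : smooth_vfield U (pd c i) by apply: vf_sub (vf_pd i ac); exact: subIsetl.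
have := wedge_extd_coord ad dp oU (conj cp dp) (form_sub (@subsetT _ U) sth) (s i0) (s i1) (s i2).
have E i j : pd c i p (ccoord d j) = (pder i (comp (trans c d) j) (chart_map c p))%:C.
  rewrite pdE; last by apply: csmooth_nearW (csmooth_ccoord j ad); [exact: chart_dom_open|].
  by apply: complex_eq => //=; rewrite /dM (_ : _ \o _ = fun=> 0) ?pder_cst.
rewrite /= -/(volc c th) !E (densE ac cp) (densE ad dp).
rewrite /det3 -!(rmorphM, rmorphB, rmorphD) /= => /complexI ->; congr (_ * _).
by rewrite /Jac /grad3 /det3; ring.
Qed.

Definition vol c p : R := `|dens c p|.

Lemma vol_gt0 c p : atlas c -> chart_dom c p -> 0 < vol c p.
Proof. by move=> ac cp; rewrite normr_gt0 dens_neq0. Qed.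

Lemma vol_smooth c : atlas c -> smooth_on (chart_dom c) (vol c).
Proof.
move=> ac; apply: smooth_abs; [exact: chart_dom_open|exact: dens_smooth|].
by move=> p; exact: dens_neq0.
Qed.

(** For [v] with small support the limiting behaviour of these sums does not
    depend on the chart, by [chart_change]; this makes them a substitute for the
    integral of [v] against the contact volume. *)
Definition csum c v n : R := S n (ext c (fun p => v p * vol c p)).

(** The transition map has a Jacobian of constant sign near [q], and the
    densities are taken in absolute value; so [local_change] applies to a cut-off
    function read in the chart [d]. *)
Lemma chart_change c d q : atlas c -> atlas d -> chart_dom c q -> chart_dom d q ->
  exists2 N : set M, open N /\ N q & forall v B, (forall p, ~ N p -> v p = 0) ->
    Ck_on 2 setT (ext d (fun p => v p * vol d p)) -> supp B (ext d (fun p => v p * vol d p)) ->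
    null (fun n => csum d v n - csum c v n).
Proof.
move=> ac ad cq dq; set x0 := chart_map c q.
set psi := trans c d; set J0 := Jac psi x0.
pose D := chart_dom c `&` chart_dom d.
have oD : open D by apply: openI; exact: chart_dom_open.
have hpsi k i : Ck_on k (img c D) (comp psi i).
  apply: Ck_sub (atlas_compat ac ad i k) => x /imgP[a [_ b] E]; rewrite -E; exact: img_mem.
have oI : open (img c D) by exact: open_img.
have hJ : Ck_on 0 (img c D) (Jac psi).
  have g i j : Ck_on 0 (img c D) (pder i (comp psi j)) by apply: Ck_pder; exact: hpsi.
  have m f h : Ck_on 0 (img c D) f -> Ck_on 0 (img c D) h -> Ck_on 0 (img c D) (fun x => f x * h x).
    by move=> *; exact: Ck_mul.
  have s f h : Ck_on 0 (img c D) f -> Ck_on 0 (img c D) h -> Ck_on 0 (img c D) (fun x => f x - h x).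
    by move=> h1 h2; exact: (Ck_add oI h1 (Ck_opp oI h2)).
  have a f h : Ck_on 0 (img c D) f -> Ck_on 0 (img c D) h -> Ck_on 0 (img c D) (fun x => f x + h x).
    by move=> *; exact: Ck_add.
  by apply: (a); [apply: (s)|]; apply: (m) => //; apply: (s); exact: m.
have J0n : J0 != 0.
  have := dens_neq0 ac cq; rewrite (dens_trans ac ad cq dq) -/J0.
  by apply: contra => /eqP ->; rewrite mulr0.
pose s := Num.sg J0.
have ss : s * s = 1.
  by rewrite /s; have [h|h|h] := sgrP J0; rewrite ?mulr1 ?mulrNN ?mulr1//; move: J0n; rewrite h eqxx.
pose W := img c D `&` [set x | 0 < s * Jac psi x].
have oW : open W.
  rewrite openE => x [Ix sx]; apply: filterI; first exact: open_nbhs_nbhs.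
  have cJ : {for x, continuous (fun x => s * Jac psi x)}.
    by apply: (Ck_cont (Ck_mul oI (Ck_cst _ _ s) hJ)).
  by apply: (cJ [set t | 0 < t]); apply: open_nbhs_nbhs; split=> //; exact: open_gt.
have Wx0 : W x0.
  by split; [exact: img_mem|rewrite /= -/J0 /s -normrEsg normr_gt0].
have [r [r' [r0 r'0 rW ch]]] := local_change oW Wx0 (fun i => Ck_sub (@subIsetl _ _ _) (hpsi 3 i)) J0n.
have psi0 : psi x0 = chart_map d q by rewrite /psi /trans /x0 invK.
pose N := D `&` [set p | chart_dom c p /\ `|chart_map c p - x0| < r]
            `&` [set p | chart_dom d p /\ `|chart_map d p - psi x0| < r'].
have onb (e : chart R M) (y : V) (t : R) : open [set p | chart_dom e p /\ `|chart_map e p - y| < t].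
  rewrite openE => p [ep et]; apply: filterI.
    by apply: open_nbhs_nbhs; split=> //; exact: chart_dom_open.
  have cm : {for p, continuous (chart_map e)} by exact: map_cont.
  apply: (cm [set z | `|z - y| < t]); apply: open_nbhs_nbhs; split=> //.
  exact: open_cball.
exists N.
  split; first by do 2!apply: openI => //.
  by split; [split|]; split=> //; rewrite ?psi0 ?subrr ?normr0.
move=> v B v0 hk sk; set k := ext d _ in hk sk.
have kout y : r' <= `|y - psi x0| -> k y = 0.
  move=> hy; have [fy|] := pselect (full d y); last exact: ext_out.
  have [h1 h2] := full_inv fy; rewrite /k ext_in// v0 ?mul0r// => -[_ [_]] /=.
  by rewrite h2 ltNge hy.
have [qf [q1 q2 q3]] := ch k B hk sk kout.
have qE x : qf x = s * ext c (fun p => v p * vol c p) x.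
  have [xr|xr] := leP r `|x - x0|.
    rewrite q2// [ext _ _ _](_ : _ = 0) ?mulr0//.
    have [fx|] := pselect (full c x); last exact: ext_out.
    have [h1 h2] := full_inv fx; rewrite ext_in// v0 ?mul0r// => -[[_ [_ /=]]].
    by rewrite h2 ltNge xr.
  have [/imgP[a [_ b] E] /= sJ] := rW x xr.
  have -> : ext c (fun p => v p * vol c p) x = v (chart_inv c x) * vol c (chart_inv c x).
    by rewrite -[in LHS]E extE.
  have -> : qf x = v (chart_inv c x) * vol d (chart_inv c x) * Jac psi x.
    by rewrite q1// /k /psi /trans extE.
  rewrite /vol (dens_trans ac ad a b) normrM E -/psi -mulrA.
  have ns : `|s| = 1 by rewrite /s normr_sg J0n.
  have -> : `|Jac psi x| = s * Jac psi x by rewrite -(gtr0_norm sJ) normrM ns mul1r.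
  by rewrite [RHS]mulrCA; congr (_ * _); rewrite [RHS]mulrCA [s * (s * _)]mulrA ss mul1r.
apply: null_eq (null_scale (- s) q3) => n.
rewrite (S_ext n qE) S_scale -/J0 -/s.
rewrite /csum -/k; move: (S n k) (S n _) => a b.
by transitivity (s * s * a - s * s * b); [ring|rewrite ss !mul1r].
Qed.


Lemma null_dom (u w : nat -> R) : (forall n, 0 <= u n <= w n) -> null w -> null u.
Proof.
move=> h hw; apply: null_le => e e0; have [N hN] := null_ge hw e0.
exists N => n /hN; have /andP[u0 uw] := h n; rewrite !ger0_norm// ?(le_trans u0 uw)//.
exact: le_trans.
Qed.

Lemma csum_ext c u v n : (forall p, u p = v p) -> csum c u n = csum c v n.
Proof. by move=> E; rewrite (_ : u = v)//; apply/funext. Qed.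

Lemma csum_sum c (K : Type) (s : seq K) (F : K -> M -> R) n :
  csum c (fun p => \sum_(k <- s) F k p) n = \sum_(k <- s) csum c (F k) n.
Proof.
rewrite -S_sum; apply: S_ext => x; have [fx|fx] := pselect (full c x); last first.
  by rewrite ext_out// big1// => k _; rewrite ext_out.
by rewrite ext_in// mulr_suml; apply: eq_bigr => k _; rewrite ext_in.
Qed.

Lemma csum_zero c v n : (forall p, v p = 0) -> csum c v n = 0.
Proof.
move=> v0; rewrite -(S0 R n); apply: S_ext => x.
have [fx|fx] := pselect (full c x); last by rewrite ext_out.
by rewrite ext_in// v0 mul0r.
Qed.

Lemma finite_nbhs (q : M) (K : eqType) (P : K -> set M -> Prop) (s : seq K) :
  (forall k N N', N' `<=` N -> P k N -> P k N') ->
  (forall k, exists2 N, open N /\ N q & P k N) ->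
  exists2 N, open N /\ N q & forall k, k \in s -> P k N.
Proof.
move=> mono H; elim: s => [|k s [N [oN Nq] hN]]; first by exists setT => //; split=> //; exact: openT.
have [N' [oN' Nq'] hN'] := H k; exists (N `&` N'); first by split=> //; exact: openI.
move=> l; rewrite inE => /orP[/eqP ->|/hN]; apply: mono; by [exact: subIsetr|exact: subIsetl].
Qed.

Section Field.
Variables (X : vfield M) (h : M -> R).
Hypotheses (cM : compact [set: M]) (sX : smooth_vfield setT X) (h0 : forall p, 0 <= h p).
Hypothesis hdiv : forall c p, atlas c -> chart_dom c p ->
  complex.Re (\sum_i dC c i (fun q => volc c th q * X q (ccoord c i)) p) = dens c p * h p.

Definition rcomp c i p : R := complex.Re (X p (ccoord c i)).
Definition rder (z : M -> R) p : R := complex.Re (X p (cfun_of z)).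

Lemma rcomp_smooth c i : atlas c -> smooth_on (chart_dom c) (rcomp c i).
Proof.
move=> ac; have [] // := vf_smooth sX (chart_dom_open c) (@subsetT _ _) (csmooth_ccoord i ac).
Qed.

Lemma rder_smooth z : smooth_on setT z -> smooth_on setT (rder z).
Proof.
by move=> sz; have [] := vf_smooth sX openT (@subset_refl _ _) (csmooth_real sz).
Qed.

Lemma rder_coord c z p : atlas c -> chart_dom c p -> smooth_on setT z ->
  rder z p = \sum_i rcomp c i p * dM c i z p.
Proof.
move=> ac cp sz; have tX : is_tangent p (X p) := vf_tangent sX I.
rewrite /rder (tangent_coord ac cp tX); last exact: csmooth_nearW openT _ (csmooth_real sz).
have E i : dC c i (cfun_of z) p = (dM c i z p)%:C.
  by apply: complex_eq => //=; rewrite /dM (_ : _ \o _ = fun=> 0) ?pder_cst.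
rewrite !sum3 !ReD !E /rcomp.
have r (w : C) (a : R) : complex.Re (w * a%:C) = complex.Re w * a by rewrite ReM /= mulr0 subr0.
by rewrite !r.
Qed.

Lemma hdiv_real c p : atlas c -> chart_dom c p ->
  \sum_i dM c i (fun q => dens c q * rcomp c i q) p = dens c p * h p.
Proof.
move=> ac cp; rewrite -(hdiv ac cp) !sum3 !ReD.
have E i : dM c i (fun q => dens c q * rcomp c i q) p =
    complex.Re (dC c i (fun q => volc c th q * X q (ccoord c i)) p).
  apply: dM_near => //; apply: (@near_open _ (chart_dom c)) => //; first exact: chart_dom_open.
  by move=> q cq; rewrite (densE ac cq) ReM /= mul0r subr0.
by rewrite !E.
Qed.

Lemma h_smooth : smooth_on setT h.
Proof.
apply: smooth_local => p _; have [c ac cp] := atlas_cover p.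
have od := chart_dom_open c.
exists (chart_dom c) => //.
have si i : smooth_on (chart_dom c) (dM c i (fun q => dens c q * rcomp c i q)).
  apply: smooth_dM => //; exact: smoothM od (dens_smooth ac) (rcomp_smooth i ac).
have dn q : chart_dom c q -> dens c q != 0 by exact: dens_neq0.
apply: (smooth_eq od _ (smoothM od (smoothV od dn (dens_smooth ac)) (smooth_sum (index_enum 'I_3) od si))) => q cq.
by rewrite hdiv_real// mulKf// dn.
Qed.

Lemma div_cut c z p : atlas c -> chart_dom c p -> smooth_on setT z ->
  \sum_i dM c i (fun q => z q * rcomp c i q * vol c q) p = (z p * h p + rder z p) * vol c p.
Proof.
move=> ac cp sz; have od := chart_dom_open c.
pose s := Num.sg (dens c p).
have sd : 0 < s * dens c p by rewrite /s -normrEsg normr_gt0 dens_neq0.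
have near : \forall q \near p, chart_dom c q /\ vol c q = s * dens c q.
  have cd : {for p, continuous (fun q => s * dens c q)}.
    exact: (smooth_cont od cp (smoothM od (smooth_cst _ _) (dens_smooth ac))).
  have n1 : \forall q \near p, chart_dom c q by apply: open_nbhs_nbhs.
  have n2 : \forall q \near p, 0 < s * dens c q.
    by apply: (cd [set t | 0 < t]); apply: open_nbhs_nbhs; split=> //; exact: open_gt.
  apply: filterS2 n1 n2 => q cq q0; split=> //.
  by rewrite -(gtr0_norm q0) normrM normr_sg (dens_neq0 ac cp) mul1r.
have sz' : smooth_on (chart_dom c) z by exact: smooth_sub sz.
have si i : smooth_on (chart_dom c) (fun q => dens c q * rcomp c i q).
  exact: smoothM od (dens_smooth ac) (rcomp_smooth i ac).
have cst i : dM c i (fun=> s) p = 0 by rewrite /dM (_ : _ \o _ = fun=> s) ?pder_cst.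
have E i : dM c i (fun q => z q * rcomp c i q * vol c q) p =
    s * (dM c i z p * (dens c p * rcomp c i p) + z p * dM c i (fun q => dens c q * rcomp c i q) p).
  rewrite (dM_near i cp (g := fun q => s * (z q * (dens c q * rcomp c i q)))); last first.
    by apply: filterS near => q [_ ->]; ring.
  rewrite (dM_mul _ ac cp cp (smooth_cst _ s) (smoothM od sz' (si i))) cst mul0r add0r.
  by rewrite (dM_mul _ ac cp cp sz' (si i)).
have [_ ->] := nbhs_singleton near.
have H := hdiv_real ac cp; rewrite (rder_coord ac cp sz).
rewrite (eq_bigr _ (fun i _ => E i)); move: H; rewrite !sum3 => H.
transitivity (s * ((dM c i0 z p * rcomp c i0 p + dM c i1 z p * rcomp c i1 p + dM c i2 z p * rcomp c i2 p) * dens c p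
   + z p * (dens c p * h p))); first by rewrite -H; ring.
ring.
Qed.

(** In the chart the sums are those of a sum of partial derivatives of functions
    with compact support. *)
Lemma null_cut c q r z : atlas c -> inside c q r -> smooth_on setT z ->
  (forall p, ~ kball c q r p -> z p = 0) ->
  null (csum c (fun p => z p * h p + rder z p)).
Proof.
move=> ac ins sz z0; have od := chart_dom_open c.
pose F i p := z p * rcomp c i p * vol c p.
have sF i : smooth_on (chart_dom c) (F i).
  apply: smoothM (vol_smooth ac) => //; apply: smoothM (rcomp_smooth i ac) => //.
  exact: smooth_sub sz.
have F0 i p : chart_dom c p -> ~ kball c q r p -> F i p = 0 by move=> _ /z0 e; rewrite /F e !mul0r.
have [B hB] := ext_supp c q r.
have dF i := S_der i (ext_Ck 2 ac ins (sF i) (F0 i)) (hB _ (F0 i)).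
apply: null_eq (null_sum (index_enum 'I_3) dF) => n; rewrite -S_sum; apply: S_ext => x.
have [fx|fx] := pselect (full c x).
  have [h1 h2] := full_inv fx; rewrite ext_in// -(div_cut ac h1 sz); apply: eq_bigr => i _.
  rewrite /dM h2; apply: pder_near_eq.
  apply: (@near_open _ (full c)) => //; first exact: chart_img_open.
  by move=> y fy; rewrite ext_in.
have xr : r < `|x - chart_map c q| by rewrite ltNge; apply/negP => /ins.
rewrite ext_out// big1// => i _.
rewrite -[RHS](congr1 (@^~ x) (pder_cst (0 : R) i)); apply: pder_near_eq.
apply: (@near_open _ [set y : V | r < `|y - chart_map c q|]) => //; first exact: open_far.
by move=> y yr; exact: (ext_far (F0 i)).
Qed.

Lemma rder_out c q r z p : inside c q r -> smooth_on setT z ->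
  (forall p, ~ kball c q r p -> z p = 0) -> ~ kball c q r p -> rder z p = 0.
Proof.
move=> ins sz z0 kp; have tX : is_tangent p (X p) := vf_tangent sX I.
rewrite /rder (tangent_near tX (w := fun=> 0)) ?(tangent_cst _ tX)//.
apply: (@near_open _ (~` kball c q r)) => //; first exact/closed_openC/kball_closed.
by move=> y /z0 e; rewrite /cfun_of e.
Qed.

Lemma rder_sum (s : seq M) (z : M -> M -> R) p : (forall q, smooth_on setT (z q)) ->
  (forall p, \sum_(q <- s) z q p = 1) -> \sum_(q <- s) rder (z q) p = 0.
Proof.
move=> sz z1; have [c ac cp] := atlas_cover p.
have tX : is_tangent p (X p) := vf_tangent sX I.
have E : rder (fun p => \sum_(q <- s) z q p) p = 0.
  by rewrite /rder (_ : cfun_of _ = fun=> 1) ?(tangent_cst _ tX)//; apply/funext => q; rewrite /cfun_of z1.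
rewrite -[RHS]E {E z1}; elim: s => [|q s IH].
  rewrite big_nil /rder (_ : cfun_of _ = fun=> 0) ?(tangent_cst _ tX)//.
  by apply/funext => q; rewrite /cfun_of big_nil.
have ss := smooth_sum s openT sz.
rewrite big_cons IH (_ : (fun p => \sum_(q <- q :: s) z q p) = fun p => z q p + \sum_(q <- s) z q p).
  rewrite (rder_coord ac cp (sz q)) (rder_coord ac cp ss).
  rewrite (rder_coord ac cp (smoothD openT (sz q) ss)) -big_split /=; apply: eq_bigr => i _.
  by rewrite -mulrDr -(dM_sum i ac cp I (sz q) ss).
by apply/funext => y; rewrite big_cons.
Qed.

(** The divergence theorem: the integral of [h] is [0], so [h] is zero because it
    is nonnegative. The integral is replaced by sums in finitely many charts, weighted
    by a partition of unity [chi]. A second partition [z], fine enough for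
    [chart_change] to compare all charts on each of its supports, cuts [X] into
    fields supported in one chart, whose divergences have null sums. *)
Lemma nonneg_div_eq0 p : h p = 0.
Proof.
have /choice[e he] q : exists c : chart R M, atlas c /\ chart_dom c q.
  by have [c ac cq] := atlas_cover q; exists c.
have [s [r [chi [ins1 _ sc c0 c1]]]] :=
  partition_of_unity cM he (N := fun=> setT) (fun q => conj openT I).
pose P q (k : M) (N : set M) := forall v, smooth_on setT v -> (forall p, ~ N p -> v p = 0) ->
  null (fun n => csum (e k) (fun p => chi k p * v p) n - csum (e q) (fun p => chi k p * v p) n).
have /choice[N hN] q : exists N, (open N /\ N q) /\ forall k, k \in s -> P q k N.
  have [||N oN hN] := @finite_nbhs q _ (P q) s; last by exists N.
    by move=> k N N' NN hk v sv v0; apply: hk => // x nx; apply: v0 => /NN.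
  move=> k; have [kq|kq] := pselect (kball (e k) k (r k) q).
    have [[ak _] [aq dq]] := (he k, he q).
    have [N oN hN] := chart_change aq ak dq kq.1.
    have [B hB] := ext_supp (e k) k (r k).
    exists N => // v sv v0.
    have out x : chart_dom (e k) x -> ~ kball (e k) k (r k) x -> chi k x * v x * vol (e k) x = 0.
      by move=> _ /c0 ->; rewrite !mul0r.
    apply: (hN _ B); first by move=> x /v0 ->; rewrite mulr0.
      apply: ext_Ck (ins1 k) _ out => //; have od := chart_dom_open (e k).
      apply: smoothM (vol_smooth ak) => //; apply: smooth_sub (@subsetT _ _) _.
      exact: smoothM openT (sc k).1 sv.
    exact: hB.
  exists (~` kball (e k) k (r k)); first by split=> //; exact/closed_openC/kball_closed.
  move=> v sv v0; have z x : chi k x * v x = 0.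
    have [kx|kx] := pselect (kball (e k) k (r k) x); last by rewrite c0 ?mul0r.
    by rewrite v0 ?mulr0//; apply.
  apply: null_le => t t0; exists 0%N => n _; rewrite !csum_zero// subrr normr0; exact: ltW.
have [s' [r' [z [ins2 sub2 sz z0 z1]]]] := partition_of_unity cM he (fun q => (hN q).1).
pose v l x := z l x * h x + rder (z l) x.
have sv l : smooth_on setT (v l).
  exact: (smoothD openT (smoothM openT (sz l).1 h_smooth) (rder_smooth (sz l).1)).
have v0 l x : ~ N l x -> v l x = 0.
  move=> nx; have kx : ~ kball (e l) l (r' l) x by move=> /sub2.
  by rewrite /v z0// mul0r add0r (rder_out (ins2 l) (sz l).1 (z0 l) kx).
have vh x : \sum_(l <- s') v l x = h x.
  by rewrite big_split /= -mulr_suml z1 mul1r (rder_sum _ (fun q => (sz q).1) z1) addr0.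
have nl l : null (fun n => \sum_(k <- s) csum (e k) (fun x => chi k x * v l x) n).
  (* The divergence of [z l * X] is computed in the chart of [l] and then
     distributed over the charts of the first partition. *)
  have h1 : null (csum (e l) (v l)) := null_cut (he l).1 (ins2 l) (sz l).1 (z0 l).
  have h2 : null (fun n => \sum_(k <- s) (csum (e k) (fun x => chi k x * v l x) n - csum (e l) (fun x => chi k x * v l x) n)).
    have : forall k, k \in s -> P l k (N l) := (hN l).2.
    elim: (s) => [|k t IH] ht.
      by apply: null_le => a a0; exists 0%N => n _; rewrite big_nil normr0 ltW.
    apply: null_eq (null_add (ht k (mem_head _ _) (v l) (sv l) (v0 l)) (IH _)) => [n|j jt].
      by rewrite big_cons.
    by apply: ht; rewrite inE jt orbT.
  apply: null_eq (null_add h2 h1) => n.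
  rewrite sumrB -csum_sum (_ : csum (e l) (v l) n = csum (e l) (fun x => \sum_(k <- s) chi k x * v l x) n) ?subrK//.
  by apply: csum_ext => x; rewrite -mulr_suml c1 mul1r.
have nh : null (fun n => \sum_(k <- s) csum (e k) (fun x => chi k x * h x) n).
  apply: null_eq (null_sum s' nl) => n; rewrite exchange_big; apply: eq_bigr => k _.
  rewrite -csum_sum; apply: csum_ext => x; rewrite -vh mulr_sumr.
  by [].
have pos k x : 0 <= ext (e k) (fun p => chi k p * h p * vol (e k) p) x.
  have [fx|fx] := pselect (full (e k) x); last by rewrite ext_out.
  by rewrite ext_in// !mulr_ge0// ?normr_ge0//; exact: (sc k).2.
have nk k : k \in s -> null (csum (e k) (fun x => chi k x * h x)).
  move=> ks; apply: null_dom nh => n; rewrite S_ge0//= (big_rem k)//= lerDl.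
  by apply: sumr_ge0 => j _; exact: S_ge0.
(* At a point where [h] is positive, one of the terms of a null sum is positive. *)
apply/eqP; rewrite eq_le h0 andbT leNgt; apply/negP => hp.
have [k ks kp] : exists2 k, k \in s & 0 < chi k p.
  apply/hasP; rewrite -[X in is_true X]negbK -all_predC; apply/negP => /allP hs.
  have := c1 p; rewrite big_seq big1; first by move/eqP; rewrite eq_sym oner_eq0.
  by move=> k /hs /=; rewrite -leNgt => h1; apply/eqP; rewrite eq_le h1 (sc k).2.
have dp : chart_dom (e k) p.
  by have [[]|/c0 e0] // := pselect (kball (e k) k (r k) p); rewrite e0 ltxx in kp.
pose G := ext (e k) (fun p => chi k p * h p * vol (e k) p).
have Gp : 0 < G (chart_map (e k) p) by rewrite /G extE// !mulr_gt0// vol_gt0//; exact: (he k).1.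
have cG : {for chart_map (e k) p, continuous G}.
  have od := chart_dom_open (e k).
  have G0 : Ck_on 0 setT G.
    apply: ext_Ck (ins1 k) _ _; [exact: (he k).1| |by move=> x _ /c0 ->; rewrite !mul0r].
    apply: smoothM (vol_smooth (he k).1) => //; apply: smooth_sub (@subsetT _ _) _.
    exact: smoothM openT (sc k).1 h_smooth.
  exact: (Ck_cont G0 I).
have G2 : 0 < G (chart_map (e k) p) / 2 by rewrite divr_gt0.
have [d d0 hd] := cvg_dist cG G2.
apply: (S_pos (g := G) (x := chart_map (e k) p) (s := d / 2) _ G2 _ _ (nk k ks)).
- by rewrite divr_gt0.
- exact: pos.
- move=> y yd; have := hd y; have -> : `|y - chart_map (e k) p| < d by lra.
  by move=> /(_ isT); rewrite ler_norml => /andP[]; lra.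
Qed.

End Field.

End Divergence.

(** * Torsion of closed solitons *)

Section Gluing.
Variables (R : realType) (M : manifold3 R) (th : form1 M) (J : bundle_endo M).
Local Notation C := R[i].
Implicit Types (c : chart R M) (U V W : set M) (p q : M).
Hypothesis ps : pseudohermitian th J.
Let sth : smooth_form1 setT th. Proof. by have [[]] := ps. Qed.
Let rth : real_form1 setT th. Proof. by have [[]] := ps. Qed.
Let nondeg : forall p, exists U X Y Z, [/\ open U, U p,
  [/\ smooth_vfield U X, smooth_vfield U Y & smooth_vfield U Z] & wedge_extd th X Y Z p != 0].
Proof. by have [[]] := ps. Qed.

Lemma vf_local U X : (forall p, U p -> exists2 W, open W /\ W p & smooth_vfield W X) ->
  smooth_vfield U X.
Proof.
move=> H; split; first by move=> p /H[W [oW Wp] sX]; exact: vf_tangent sX Wp.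
move=> V u oV VU su; apply: csmooth_local => p Vp.
have [W [oW Wp] sX] := H p (VU p Vp).
exists (V `&` W); first by split=> //; exact: openI.
apply: (vf_smooth sX); [exact: openI|exact: subIsetr|].
by apply: csmooth_sub su; exact: subIsetl.
Qed.

Lemma extd_eq_sub U V al be : V `<=` U -> extd_eq U al be -> @extd_eq R M V al be.
Proof. by move=> VU H W X Y oW WV; apply: H => //; exact: subset_trans WV VU. Qed.

Lemma reeb_sub U V T : V `<=` U -> reeb_on U th T -> reeb_on V th T.
Proof.
move=> VU [h1 h2 h3 h4]; split; first exact: vf_sub VU h1.
- by move=> p /VU; exact: h2.
- by move=> p /VU; exact: h3.
- by move=> W X oW WV; apply: h4 => //; exact: subset_trans WV VU.
Qed.

Definition frame_restrict U V (F : local_frame th J U) (oV : open V) (VU : V `<=` U) :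
  local_frame th J V :=
  @LocalFrame R M th J V oV (fr_T F) (fr_Z1 F) (fr_th1 F) (fr_om F) (fr_tors F) (fr_W F)
    (reeb_sub VU (fr_reeb F)) (vf_sub VU (fr_Z1_smooth F))
    (fun p Vp => fr_Z1_horizontal F (VU p Vp)) (fun p Vp => fr_Z1_type10 F (VU p Vp))
    (form_sub VU (fr_th1_smooth F)) (fun p Vp => fr_th1_dual F (VU p Vp))
    (extd_eq_sub VU (fr_normalized F)) (form_sub VU (fr_om_smooth F))
    (fun p v Vp => fr_om_imaginary F (VU p Vp)) (extd_eq_sub VU (fr_structure F))
    (extd_eq_sub VU (fr_curvature F)).

Section Field.
Variable fld : forall U, local_frame th J U -> vfield M.
Variable val : forall U, local_frame th J U -> M -> R.
Hypothesis cM : compact [set: M].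
Hypothesis fld_indep : forall U U' (F : local_frame th J U) (F' : local_frame th J U') p,
  U p -> U' p -> fld F' p = fld F p.
Hypothesis fld_smooth : forall U (F : local_frame th J U) c, atlas c -> U `<=` chart_dom c ->
  smooth_vfield U (fld F).
Hypothesis val_ge0 : forall U (F : local_frame th J U) p, 0 <= val F p.
Hypothesis val_div : forall U (F : local_frame th J U) c p, atlas c -> U `<=` chart_dom c -> U p ->
  complex.Re (\sum_i dC c i (fun q => volc c th q * fld F q (ccoord c i)) p) = dens th c p * val F p.

(** Local fields given in every frame, independent of the frame, define one
    vector field on the manifold, to which [nonneg_div_eq0] applies. The value of the
    divergence is then independent of the frame as well. *)
Lemma glued_div_eq0 U (F : local_frame th J U) c p : atlas c -> U `<=` chart_dom c -> U p ->
  val F p = 0.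
Proof.
have /choice[t ht] q : exists t : {V : set M & local_frame th J V},
    exists c, [/\ atlas c, projT1 t q & projT1 t `<=` chart_dom c].
  have [d [V [G [ad Vq Vd]]]] := exists_frame ps q.
  by exists (existT _ V G), d.
pose Fr q := projT2 (t q); pose X : vfield M := fun q => fld (Fr q) q.
have tq q : projT1 (t q) q by have [d []] := ht q.
have XE V (G : local_frame th J V) q : V q -> X q = fld G q.
  by move=> Vq; exact: fld_indep.
have sX : smooth_vfield setT X.
  apply: vf_local => q _; exists (projT1 (t q)); first by split=> //; exact: fr_open (Fr q).
  have [d [ad _ sd]] := ht q.
  by apply: vf_eq (fld_smooth (Fr q) ad sd) => y yt; rewrite (XE _ (Fr q)).
have div V (G : local_frame th J V) d q : atlas d -> V `<=` chart_dom d -> V q ->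
    complex.Re (\sum_i dC d i (fun y => volc d th y * X y (ccoord d i)) q) = dens th d q * val G q.
  move=> ad Vd Vq; rewrite -(val_div G ad Vd Vq); congr complex.Re; apply: eq_bigr => i _.
  apply: dC_near; first exact: Vd.
  apply: (@near_open _ V) => //; first exact: fr_open G.
  by move=> y Vy; rewrite (XE _ G).
have same V V' (G : local_frame th J V) (G' : local_frame th J V') d q : atlas d ->
    V `<=` chart_dom d -> V' `<=` chart_dom d -> V q -> V' q -> val G q = val G' q.
  move=> ad Vd Vd' Vq Vq'; apply: (mulfI (dens_neq0 sth rth nondeg ad (Vd q Vq))).
  by rewrite -(div _ G)// (div _ G').
pose h q := val (Fr q) q.
have hdiv d q : atlas d -> chart_dom d q ->
    complex.Re (\sum_i dC d i (fun y => volc d th y * X y (ccoord d i)) q) = dens th d q * h q.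
  move=> ad dq; have [e [ae _ te]] := ht q.
  pose W := projT1 (t q) `&` chart_dom d.
  have oW : open W by apply: openI; [exact: fr_open (Fr q)|exact: chart_dom_open].
  have Wd : W `<=` chart_dom d by exact: subIsetr.
  rewrite (div _ (frame_restrict (Fr q) oW (@subIsetl _ _ _)) d q ad Wd (conj (tq q) dq)).
  congr (_ * _); apply: (same _ _ _ _ e q ae _ te (conj (tq q) dq) (tq q)).
  by move=> y [/te].
have h_0 := nonneg_div_eq0 sth rth nondeg cM sX (fun q => val_ge0 _ q) hdiv.
move=> ac Uc Up; apply: (mulfI (dens_neq0 sth rth nondeg ac (Uc p Up))).
by rewrite -(div _ F _ _ ac Uc Up) (hdiv _ _ ac (Uc p Up)) /h h_0.
Qed.

End Field.
End Gluing.

Section Torsion.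
Variables (R : realType) (M : manifold3 R) (th : form1 M) (J : bundle_endo M) (f : M -> R) (mu : R).
Local Notation C := R[i].
Implicit Types (c : chart R M) (U V W : set M) (p q : M).
Hypotheses (cM : compact [set: M]) (sol : cr_yamabe_soliton th J f mu).
Let ps : pseudohermitian th J. Proof. by have [] := sol. Qed.
Let sf : smooth_on setT f. Proof. by have [] := sol. Qed.
Let sth : smooth_form1 setT th. Proof. by have [[]] := ps. Qed.
Let rth : real_form1 setT th. Proof. by have [[]] := ps. Qed.

Lemma rep_smooth V (oV : open V) (s : oring oV) u : rep s u -> csmooth_on V u.
Proof. by move=> r; apply: csmooth_eq (sfun_smooth s). Qed.

Lemma combo_smooth V X Y Z (u0 u1 u2 : M -> C) : open V -> csmooth_on V u0 -> csmooth_on V u1 ->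
  csmooth_on V u2 -> smooth_vfield V X -> smooth_vfield V Y -> smooth_vfield V Z ->
  smooth_vfield V (fun q => lincombv (u0 q) (X q) (lincombv (u1 q) (Y q) (scalev (u2 q) (Z q)))).
Proof.
move=> oV s0 s1 s2 sX sY sZ.
exact: (vf_lin oV s0 sX (vf_lin oV s1 sY (vf_scale oV s2 sZ))).
Qed.

Section Frame.
Variables (U : set M) (F : local_frame th J U) (c : chart R M).
Hypotheses (ac : atlas c) (Uc : U `<=` chart_dom c).
Let oU := fr_open F.
Let UU := @subset_refl _ U.
Let cf := frame_coframe F sth rth ac oU UU Uc.

Let sreal (h : M -> R) : smooth_on setT h -> csmooth_on U (cfun_of h).
Proof. by move=> sh; apply: csmooth_real; exact: smooth_sub sh. Qed.

Lemma field1_smooth (h : M -> R) : smooth_on setT h -> smooth_vfield U (field1 F mu h).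
Proof.
move=> sh; have rf := rep_mks oU (sreal sh); have rT := rep_der (cf_T cf) rf.
have rw := rep_sub (rep_cst oU mu%:C) (rep_mul (rep_cst oU (2%:R^-1)) rT).
have rZ := rep_der (cf_Z cf) rf; have rZb := rep_der (cf_Zb cf) rf.
have rI := rep_cst oU ('i%C : C); have rn n := @rep_nat _ _ _ oU n.
have r1 := rep_sub (rep_mul (rep_mul (rep_mul (rep_opp (rn 2)) rI) rw) rZb)
   (rep_mul (rn 4) (rep_der (cf_Zb cf) rT)).
have rb := rep_sub (rep_mul (rep_mul (rep_mul (rn 2) rI) rw) rZ)
   (rep_mul (rn 4) (rep_der (cf_Z cf) rT)).
exact: (combo_smooth oU (rep_smooth (rep_mul rf rT)) (rep_smooth r1) (rep_smooth rb)
  (cf_T cf) (cf_Z cf) (cf_Zb cf)).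
Qed.

Lemma field2_smooth (g x : M -> R) : smooth_on setT g -> smooth_on setT x ->
  smooth_vfield U (field2 F g x).
Proof.
move=> sg sx; have rg := rep_mks oU (sreal sg); have rx := rep_mks oU (sreal sx).
have ra := frame_a F sth rth ac oU UU Uc.
have rZbx := rep_der (cf_Zb cf) rx; have rZbg := rep_der (cf_Zb cf) rg.
have rI := rep_cst oU ('i%C : C); have r6 := @rep_nat _ _ _ oU 6.
have r1 := rep_mul r6 (rep_sub (rep_mul rZbg (rep_nd ps F ac UU Uc rZbx)) (rep_mul rZbx (rep_nd ps F ac UU Uc rZbg))).
have rb := rep_sub (rep_mul r6 (rep_sub (rep_mul rx (rep_P1 ps F ac UU Uc rg)) (rep_mul rg (rep_P1 ps F ac UU Uc rx))))
  (rep_mul rI (rep_sub (rep_mul rZbx ra) (rep_mul rx (rep_ab ps F ac oU UU Uc)))).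
exact: (vf_lin oU (rep_smooth r1) (cf_Z cf) (vf_scale oU (rep_smooth rb) (cf_Zb cf))).
Qed.

End Frame.

Lemma T_real U (F : local_frame th J U) (h : M -> R) p : U p ->
  (d_0 F (cfun_of h) p)^c = d_0 F (cfun_of h) p.
Proof.
move=> Up; have [_ rT _ _] := fr_reeb F; rewrite /d_0 /vderiv -{2}(rT p Up) /conjv.
congr (fr_T F p _)^c; apply/funext => q.
by rewrite /cfun_of /= oppr0.
Qed.

(** The field [field1] has divergence [f_0 ^ 2], so [f_0 = 0] and the first
    soliton equation reads [W = mu]. *)
Lemma soliton_constant_curvature U (F : local_frame th J U) p : U p -> fr_W F p = mu.
Proof.
move=> Up; have [_ _ E] := sol.
pose val V (G : local_frame th J V) q := complex.Re (d_0 G (cfun_of f) q) ^+ 2.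
have [c ac cp] := atlas_cover p.
pose W := U `&` chart_dom c.
have oW : open W by apply: openI; [exact: fr_open F|exact: chart_dom_open].
pose G := frame_restrict F oW (@subIsetl _ _ _).
have v0 : val W G p = 0.
  apply: (glued_div_eq0 ps (fld := fun V (G : local_frame th J V) => field1 G mu f) (val := val) cM _ _ _ _ G ac).
  - by move=> V V' K K' q Vq Vq'; exact: field1_frame.
  - by move=> V K d ad Vd; exact: field1_smooth ad Vd _ sf.
  - by move=> V K q; exact: sqr_ge0.
  - move=> V K d q ad Vd Vq.
    rewrite (field1_div ps ad (fr_open K) (@subset_refl _ V) Vd sf Vq); last by move=> y Vy; exact: E.
    have := T_real K f Vq; rewrite /val; case: (d_0 K (cfun_of f) q) => a b [/eqP].
    rewrite eq_sym -addr_eq0 -mulr2n mulrn_eq0 => /eqP ->.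
    by rewrite (densE sth rth ad (Vd q Vq)) /= !(mul0r, mulr0, subr0).
  - exact: subIsetr.
  - by split.
have d0 : d_0 F (cfun_of f) p = 0.
  have v1 : complex.Re (d_0 F (cfun_of f) p) ^+ 2 = 0 := v0.
  have := T_real F f Up; move: v1; case: (d_0 F (cfun_of f) p) => a b /eqP.
  rewrite expf_eq0 /= => /eqP -> [/eqP]; rewrite eq_sym -addr_eq0 -mulr2n mulrn_eq0 => /eqP ->.
  by [].
have [Wp _] := E U F p Up; move: Wp; rewrite d0 mulr0 addr0.
by move=> /complexI.
Qed.

(** As [f] has a locally constant sign [s], the field [s * field2] has a
    divergence whose real part is [|A|^2 |f|]. *)
Lemma soliton_torsion_free (k : R) (g : M -> R) : smooth_on setT g -> paneitz_null th J f ->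
  k != 0 -> Qcurv_vanishes k (fun p v => (expR (2 * g p))%:C * th p v) J ->
  (forall p, f p != 0) -> torsion_vanishes th J.
Proof.
move=> sg P0f k0 Q f0 U F p Up; have [_ _ E] := sol.
have sa : smooth_on setT (fun q => `|f q|) by apply: smooth_abs; [exact: openT|exact: sf|].
pose s q := f q * `|f q|^-1.
have ss : smooth_on setT s.
  apply: (smoothM openT sf (smoothV openT _ sa)) => q _; by rewrite normr_eq0.
have sE q : s q * f q = `|f q|.
  rewrite /s mulrAC -expr2 -real_normK ?num_real// expr2 mulfK// normr_eq0.
  exact: f0.
have s_loc q : \forall y \near q, s y = s q.
  have cf : {for q, continuous (fun y => f y * f q)}.
    exact: (smooth_cont openT I (smoothM openT sf (smooth_cst _ _))).
  have n : \forall y \near q, 0 < f y * f q.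
    apply: (cf [set t | 0 < t]); apply: open_nbhs_nbhs; split; first exact: open_gt.
    by rewrite /= -expr2 lt_def sqrf_eq0 f0 sqr_ge0.
  apply: filterS n => y h; rewrite /s.
  have [y0|y0|y0] := ltrgtP (f y) 0; last by move: (f0 y); rewrite y0 eqxx.
    have q0 : f q < 0 by nra.
    by rewrite !ltr0_norm// !invrN !mulrN !divff// lt_eqF.
  have q0 : 0 < f q by nra.
  by rewrite !gtr0_norm// !divff// gt_eqF.
pose fld V (G : local_frame th J V) : vfield M := fun q => scalev (s q)%:C (field2 G g f q).
pose val V (G : local_frame th J V) q := complex.Re (A11 G q * (A11 G q)^c * `|f q|%:C).
have valE V (G : local_frame th J V) q : val V G q =
    (complex.Re (A11 G q) ^+ 2 + complex.Im (A11 G q) ^+ 2) * `|f q|.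
  by rewrite /val; case: (A11 G q) => a b /=; ring.
have [c ac cp] := atlas_cover p.
pose W := U `&` chart_dom c.
have oW : open W by apply: openI; [exact: fr_open F|exact: chart_dom_open].
pose G := frame_restrict F oW (@subIsetl _ _ _).
have v0 : val W G p = 0.
  apply: (glued_div_eq0 ps (fld := fld) (val := val) cM _ _ _ _ G ac).
  - by move=> V V' K K' q Vq Vq'; rewrite /fld (field2_frame ps K K' sg sf Vq Vq').
  - move=> V K d ad Vd; have sX := field2_smooth K ad Vd sg sf.
    by apply: (vf_scale (fr_open K) _ sX); apply: csmooth_real; exact: smooth_sub ss.
  - by move=> V K q; rewrite valE mulr_ge0// addr_ge0// sqr_ge0.
  - move=> V K d q ad Vd Vq; have oV := fr_open K.
    have sX := field2_smooth K ad Vd sg sf.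
    have UU := @subset_refl _ V.
    have [e e1 e2] : exists2 e : C, \sum_i dC d i (fun y => volc d th y * field2 K g f y (ccoord d i)) q =
        volc d th q * e & complex.Re e = complex.Re (A11 K q * (A11 K q)^c * (f q)%:C).
      apply: (field2_div (ps := ps) (ac := ad) (oV := oV) (VU := UU) (Vc := Vd) (mu := mu) sg sf Vq).
      + by move=> y Vy; have [] := E V K y Vy.
      + by move=> y Vy; exact: soliton_constant_curvature.
      + by move=> y Vy; exact: P0f.
      + move=> sg'; have := conformal_Qcurv ps sg oV K ad Vd k0 Q.
        have cfE a b v : frame_coframe K a b ad oV v Vd = frame_coframe K sth rth ad oV UU Vd.
          by rewrite (Prop_irrelevance a sth) (Prop_irrelevance b rth) (Prop_irrelevance v UU).
        by rewrite !cfE; set s0 := (X in mks oV X); rewrite (Prop_irrelevance s0 sg').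
    have E2 i : dC d i (fun y => volc d th y * fld V K y (ccoord d i)) q =
        (s q)%:C * dC d i (fun y => volc d th y * field2 K g f y (ccoord d i)) q.
      have sv : csmooth_on V (volc d th) by apply: csmooth_sub Vd _; exact: volc_smooth.
      have sw := vf_smooth sX oV (@subset_refl _ V) (csmooth_sub Vd (csmooth_ccoord i ad)).
      rewrite (dC_near i (Vd q Vq) (w := fun y => (s q)%:C * (volc d th y * field2 K g f y (ccoord d i)))).
        rewrite (dC_mul _ ad (Vd q Vq) (csmooth_near_cst _ _) (csmooth_nearW oV Vq (csmoothM oV sv sw))).
        by rewrite dC_cst mul0r add0r.
      by apply: filterS (s_loc q) => y sy; rewrite /fld /scalev sy mulrCA.
    rewrite (eq_bigr _ (fun i _ => E2 i)) -mulr_sumr e1 (densE sth rth ad (Vd q Vq)).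
    have r1 (a : R) (w : C) : complex.Re (a%:C * w) = a * complex.Re w by rewrite ReM /= mul0r subr0.
    have r2 (a : R) (w : C) : complex.Re (w * a%:C) = complex.Re w * a by rewrite ReM /= mulr0 subr0.
    by rewrite !r1 e2 /val !r2 -sE; ring.
  - exact: subIsetr.
  - by split.
move: v0; rewrite valE => /eqP; rewrite mulf_eq0 normr_eq0 (negbTE (f0 p)) orbF.
rewrite paddr_eq0 ?sqr_ge0// !sqrf_eq0 => /andP[/eqP a /eqP b].
by apply: complex_eq.
Qed.

End Torsion.

Theorem theorem1p2 (R : realType) (M : manifold3 R) (theta : form1 M)
    (J : bundle_endo M) (f : M -> R) (mu c : R)
    (hcompact : compact [set: M])
    (hsoliton : cr_yamabe_soliton theta J f mu)
    (hP0 : paneitz_null theta J f)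
    (hc : c != 0)
    (hQ : exists2 theta' : form1 M,
            in_contact_class theta theta' & Qcurv_vanishes c theta' J)
    (hf : forall p : M, f p != 0) :
  torsion_vanishes theta J.
Proof.
have [theta' [g sg ->] Q] := hQ.
exact: (soliton_torsion_free hcompact hsoliton sg hP0 hc Q hf).
Qed.
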